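(* The function $\rho_\infty$ is quasi-inner relative to $\mathbb{C}_-=\{z\in\mathbb{C}\mid\Re(z)\le\frac12\}$. Moreover the operator $(1-\mathcal{P})\rho_\infty\mathcal{P}$ is an infinitesimal of infinite order.
   Context: $\rho_\infty(z):=\dfrac{\pi^{-z/2}\Gamma(z/2)}{\pi^{-(1-z)/2}\Gamma((1-z)/2)}$, which has modulus $1$ on the critical line $\partial\mathbb{C}_-=\{\Re(z)=\frac12\}$. $L^2(\partial\mathbb{C}_-)$ is taken with respect to Lebesgue measure; $H^2(\mathbb{C}_-)\subset L^2(\partial\mathbb{C}_-)$ is the closed subspace of boundary values of holomorphic functions $f$ on $\{\Re(z)<\frac12\}$ with $\sup_{x<1/2}\int_{\mathbb{R}}|f(x+iy)|^2dy<\infty$; $\mathcal{P}$ is the orthogonal projection of $L^2(\partial\mathbb{C}_-)$ onto $H^2(\mathbb{C}_-)$. Functions in $L^\infty(\partial\mathbb{C}_-)$ act by multiplication. A function $u\in L^\infty(\partial\mathbb{C}_-)$ of modulus $1$ is quasi-inner relative to $\mathbb{C}_-$ if $(1-\mathcal{P})u\mathcal{P}$ is compact. A compact operator $T$ with characteristic values (singular values in decreasing order) $\mu_n(T)$ is an infinitesimal of infinite order if $\mu_n(T)=O(n^{-N})$ for every $N>0$. *)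

(* Defs.v *)
From HB Require Import structures.
From mathcomp Require Import all_boot all_order all_algebra.
From mathcomp Require Import generic_quotient complex.
From mathcomp Require Import all_classical all_reals all_analysis.
From mathcomp Require Import measurable_realfun.

Set Implicit Arguments.
Unset Strict Implicit.
Unset Printing Implicit Defensive.

Import Order.TTheory GRing.Theory Num.Theory.
Import numFieldNormedType.Exports.
Import Normc.

Local Open Scope classical_set_scope.
Local Open Scope ring_scope.
Local Open Scope complex_scope.

Arguments normc {R} x.

Section ComplexIntegration.
Context d (T : measurableType d) (R : realType).
Variable mu : {measure set T -> \bar R}.
Implicit Types f g : T -> R[i].

Definition cmeasurable f :=
  measurable_fun setT (fun x => complex.Re (f x)) /\
  measurable_fun setT (fun x => complex.Im (f x)).

Definition cintegral (D : set T) f : R[i] :=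
  Rintegral mu D (fun x => complex.Re (f x)) +i*
  Rintegral mu D (fun x => complex.Im (f x)).

Definition cLnorm2 f : \bar R := 'N[mu]_2%:E[EFin \o (normc \o f)].

Definition square_integrable f := cmeasurable f /\ (cLnorm2 f < +oo)%E.

Lemma measurable_normc f : cmeasurable f ->
  measurable_fun setT (fun x => normc (f x)).
Proof.
move=> [mr mi].
rewrite [X in measurable_fun _ X](_ : _ = fun x =>
  Num.sqrt (complex.Re (f x) ^+ 2 + complex.Im (f x) ^+ 2)); last first.
  by apply/funext => x; case: (f x).
have ms : measurable_fun setT (@Num.sqrt R).
  by apply: continuous_measurable_fun; exact: sqrt_continuous.
apply: (measurableT_comp ms); apply: measurable_funD;
exact: measurable_funX.
Qed.

Lemma measurable_normc2 f : cmeasurable f ->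
  measurable_fun setT (fun x => `|(normc (f x))%:E| `^ 2)%E.
Proof.
move=> mf; apply: (measurableT_comp (measurable_poweR _)) => //.
by apply: measurableT_comp => //; exact/measurable_EFinP/measurable_normc.
Qed.

Lemma cLnorm2_ge0 f : (0 <= cLnorm2 f)%E.
Proof. exact: Lnorm_ge0. Qed.

Lemma cmeasurableD f g : cmeasurable f -> cmeasurable g ->
  cmeasurable (fun x => f x + g x).
Proof.
move=> [fr fi] [gr gi]; split.
- rewrite (_ : (fun x => _) = (fun x => complex.Re (f x) + complex.Re (g x))).
    exact: measurable_funD.
  by apply/funext => x; case: (f x) (g x) => [? ?] [? ?].
- rewrite (_ : (fun x => _) = (fun x => complex.Im (f x) + complex.Im (g x))).
    exact: measurable_funD.
  by apply/funext => x; case: (f x) (g x) => [? ?] [? ?].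
Qed.

Lemma cmeasurableZ (a : R[i]) f : cmeasurable f ->
  cmeasurable (fun x => a * f x).
Proof.
case: a => a b [fr fi]; split.
- rewrite (_ : (fun x => _) = (fun x => a * complex.Re (f x) - b * complex.Im (f x))).
    by apply: measurable_funB; exact: measurable_funM.
  by apply/funext => x; case: (f x) => [? ?].
- rewrite (_ : (fun x => _) = (fun x => a * complex.Im (f x) + b * complex.Re (f x))).
    by apply: measurable_funD; exact: measurable_funM.
  by apply/funext => x; case: (f x) => [? ?].
Qed.

Lemma cLnorm2D f g : cmeasurable f -> cmeasurable g ->
  (cLnorm2 (fun x => f x + g x)%R <= cLnorm2 f + cLnorm2 g)%E.
Proof.
move=> mf mg; rewrite /cLnorm2.
have nf := measurable_normc mf; have ng := measurable_normc mg.
have nfg := measurable_normc (cmeasurableD mf mg).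
have p1 : 1 <= 2 :> R by rewrite ler1n.
apply: le_trans (minkowski_EFin mu nf ng p1).
rewrite unlock; apply: gt0_ler_poweR.
- by rewrite invr_ge0.
- by rewrite in_itv/= leey andbT; apply: integral_ge0 => x _; rewrite /= lee_fin powR_ge0.
- by rewrite in_itv/= leey andbT; apply: integral_ge0 => x _; rewrite /= lee_fin powR_ge0.
apply: ge0_le_integral => //=.
- exact: measurable_normc2 (cmeasurableD mf mg).
- apply/measurable_EFinP; apply: (measurableT_comp (measurable_powR _)) => //.
  by apply: measurableT_comp => //; exact: measurable_funD.
- move=> x _; rewrite lee_fin; apply: ge0_ler_powR => //=.
  have n0 (z : R[i]) : 0 <= normc z by case: z => a b; exact: sqrtr_ge0.
  rewrite !ger0_norm ?addr_ge0 ?n0//; exact: le_normcD.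
Qed.

Lemma cLnorm2Z (a : R[i]) f : cmeasurable f ->
  cLnorm2 (fun x => a * f x) = ((normc a)%:E * cLnorm2 f)%E.
Proof.
move=> mf; rewrite /cLnorm2 unlock.
have a0 : 0 <= normc a by case: (a) => ? ?; exact: sqrtr_ge0.
have nf := measurable_normc mf.
rewrite (_ : (fun x => _) =
    (fun x => (normc a `^ 2)%:E * (`|(normc (f x))%:E| `^ 2))%E); last first.
  apply/funext => x /=.
  by rewrite normcM normrM powRM// ger0_norm// EFinM.
rewrite ge0_integralZl//; last 3 first.
- exact: measurable_normc2.
- by move=> x _; rewrite /= lee_fin powR_ge0.
- by rewrite lee_fin powR_ge0.
rewrite poweRM ?lee_fin ?powR_ge0//; last first.
  by apply: integral_ge0 => x _; rewrite /= lee_fin powR_ge0.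
by rewrite poweR_EFin -powRrM mulfV// powRr1.
Qed.

Lemma cLnorm2_eq0 f : cmeasurable f -> cLnorm2 f = 0%E ->
  {ae mu, forall x, f x = 0}.
Proof.
move=> /measurable_normc mf /Lnorm_eq0_eq0 h.
have /h : measurable_fun setT (EFin \o (normc \o f)).
  exact/measurable_EFinP.
move=> /(_ ltac:(by rewrite lte_fin)); apply: filterS => x /= /(_ I).
by case=> /eq0_normc.
Qed.

Lemma ae_cLnorm2 f g : cmeasurable f -> cmeasurable g ->
  {ae mu, forall x, f x = g x} -> cLnorm2 f = cLnorm2 g.
Proof.
move=> mf mg fg; rewrite /cLnorm2 unlock; congr (_ `^ _)%E.
apply: ge0_ae_eq_integral => //=.
- exact: measurable_normc2.
- exact: measurable_normc2.
- by move: fg; apply: filterS => x /= ->.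
Qed.

Lemma square_integrableD f g : square_integrable f -> square_integrable g ->
  square_integrable (fun x => f x + g x).
Proof.
move=> [mf lf] [mg lg]; split; first exact: cmeasurableD.
by apply: le_lt_trans (cLnorm2D mf mg) _; rewrite lte_add_pinfty.
Qed.

Lemma square_integrableZ (a : R[i]) f : square_integrable f ->
  square_integrable (fun x => a * f x).
Proof.
move=> [mf lf]; split; first exact: cmeasurableZ.
rewrite cLnorm2Z// lte_mul_pinfty// lee_fin.
by case: (a) => ? ?; exact: sqrtr_ge0.
Qed.

Lemma square_integrable0 : square_integrable (fun _ => 0).
Proof.
split; first by split; exact: measurable_cst.
rewrite /cLnorm2 (_ : EFin \o _ = cst 0%E) ?Lnorm0// ?ltry//.
by apply/funext => x /=; congr (_%:E); exact: normc0.
Qed.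

End ComplexIntegration.

Section L2space.
Context d (T : measurableType d) (R : realType).
Variable mu : {measure set T -> \bar R}.

Record L2fun := MkL2fun {
  L2fun_val :> T -> R[i];
  L2fun_prop : square_integrable mu L2fun_val }.

HB.instance Definition _ := gen_eqMixin L2fun.
HB.instance Definition _ := gen_choiceMixin L2fun.

Definition ae_eq_L2 (f g : L2fun) := `[< {ae mu, forall x, f x = g x} >].

Lemma ae_eq_L2_refl : reflexive ae_eq_L2.
Proof. by move=> f; apply/asboolP; exact: aeW. Qed.

Lemma ae_eq_L2_sym : symmetric ae_eq_L2.
Proof.
by move=> f g; apply/asboolP/asboolP; apply: filterS => x ->.
Qed.

Lemma ae_eq_L2_trans : transitive ae_eq_L2.
Proof.
move=> f g h /asboolP gf /asboolP fh; apply/asboolP.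
by move: gf fh; apply: filterS2 => x -> ->.
Qed.

Canonical ae_eq_L2_canonical :=
  EquivRel ae_eq_L2 ae_eq_L2_refl ae_eq_L2_sym ae_eq_L2_trans.

Local Open Scope quotient_scope.

Definition L2 : Type := {eq_quot ae_eq_L2}.
HB.instance Definition _ := Choice.on L2.
HB.instance Definition _ := EqQuotient.on L2.

Definition L2_repr (f : L2) : T -> R[i] := repr f.
Coercion L2_repr : L2 >-> Funclass.

Lemma L2_reprP (f : L2) : square_integrable mu f.
Proof. exact: L2fun_prop. Qed.

(* The class of f, and the class of 0 when f is not square-integrable. *)
Definition L2_class (f : T -> R[i]) : L2 :=
  match pselect (square_integrable mu f) with
  | left sf => \pi_L2 (MkL2fun sf)
  | right _ => \pi_L2 (MkL2fun (square_integrable0 mu))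
  end.

Lemma L2_classK f : square_integrable mu f ->
  {ae mu, forall x, L2_class f x = f x}.
Proof.
move=> sf; rewrite /L2_class; case: pselect => // sf'.
have : \pi_L2 (repr (\pi_L2 (MkL2fun sf'))) = \pi_L2 (MkL2fun sf').
  by rewrite reprK.
by move=> /eqmodP /asboolP.
Qed.

Lemma L2_eqP (f g : L2) : {ae mu, forall x, f x = g x} -> f = g.
Proof.
move=> fg; rewrite -[f]reprK -[g]reprK.
by apply/eqmodP/asboolP.
Qed.

Definition L2_add (f g : L2) : L2 := L2_class (fun x => f x + g x).
Definition L2_scale (a : R[i]) (f : L2) : L2 := L2_class (fun x => a * f x).
Definition L2_zero : L2 := L2_class (fun _ => 0).
Definition L2_opp (f : L2) : L2 := L2_scale (-1) f.

Lemma L2_addE f g : {ae mu, forall x, L2_add f g x = f x + g x}.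
Proof. by apply: L2_classK; apply: square_integrableD; exact: L2_reprP. Qed.

Lemma L2_scaleE a f : {ae mu, forall x, L2_scale a f x = a * f x}.
Proof. by apply: L2_classK; apply: square_integrableZ; exact: L2_reprP. Qed.

Lemma L2_zeroE : {ae mu, forall x, L2_zero x = 0}.
Proof. by apply: L2_classK; exact: square_integrable0. Qed.

Lemma ae_and (P Q : T -> Prop) : {ae mu, forall x, P x} ->
  {ae mu, forall x, Q x} -> {ae mu, forall x, P x /\ Q x}.
Proof. by apply: filterS2 => x. Qed.

Lemma L2_addA : associative L2_add.
Proof.
move=> f g h; apply: L2_eqP.
have := ae_and (ae_and (L2_addE f (L2_add g h)) (L2_addE g h))
  (ae_and (L2_addE (L2_add f g) h) (L2_addE f g)).
by apply: filterS => x /= [[-> ->] [-> ->]]; exact: addrA.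
Qed.

Lemma L2_addC : commutative L2_add.
Proof.
move=> f g; apply: L2_eqP; move: (L2_addE f g) (L2_addE g f).
by apply: filterS2 => x -> ->; exact: addrC.
Qed.

Lemma L2_add0 : left_id L2_zero L2_add.
Proof.
move=> f; apply: L2_eqP; move: (L2_addE L2_zero f) L2_zeroE.
by apply: filterS2 => x -> ->; exact: add0r.
Qed.

Lemma L2_addN : left_inverse L2_zero L2_opp L2_add.
Proof.
move=> f; apply: L2_eqP.
move: (L2_addE (L2_opp f) f) (L2_scaleE (-1) f) L2_zeroE.
by apply: filterS3 => x -> -> ->; rewrite mulN1r addNr.
Qed.

HB.instance Definition _ :=
  GRing.isZmodule.Build L2 L2_addA L2_addC L2_add0 L2_addN.

Lemma L2_scaleA a b f : L2_scale a (L2_scale b f) = L2_scale (a * b) f.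
Proof.
apply: L2_eqP.
move: (L2_scaleE a (L2_scale b f)) (L2_scaleE b f) (L2_scaleE (a * b) f).
by apply: filterS3 => x -> -> ->; rewrite mulrA.
Qed.

Lemma L2_scale1 : left_id 1 L2_scale.
Proof.
move=> f; apply: L2_eqP; move: (L2_scaleE 1 f).
by apply: filterS => x ->; rewrite mul1r.
Qed.

Lemma L2_scaleDr : right_distributive L2_scale L2_add.
Proof.
move=> a f g; apply: L2_eqP.
have := ae_and (ae_and (L2_scaleE a (L2_add f g)) (L2_addE f g))
  (ae_and (L2_addE (L2_scale a f) (L2_scale a g))
    (ae_and (L2_scaleE a f) (L2_scaleE a g))).
by apply: filterS => x /= [[-> ->] [-> [-> ->]]]; rewrite mulrDr.
Qed.

Lemma L2_scaleDl f : {morph L2_scale^~ f : a b / a + b >-> L2_add a b}.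
Proof.
move=> a b; apply: L2_eqP.
have := ae_and (ae_and (L2_scaleE (a + b) f)
    (L2_addE (L2_scale a f) (L2_scale b f)))
  (ae_and (L2_scaleE a f) (L2_scaleE b f)).
by apply: filterS => x /= [[-> ->] [-> ->]]; rewrite mulrDl.
Qed.

HB.instance Definition _ :=
  GRing.Zmodule_isLmodule.Build R[i] L2
    L2_scaleA L2_scale1 L2_scaleDr L2_scaleDl.

Definition L2_norm (f : L2) : R[i] := (fine (cLnorm2 mu f))%:C.

Lemma L2_norm_fin (f : L2) : (fine (cLnorm2 mu f))%:E = cLnorm2 mu f.
Proof.
by rewrite fineK// ge0_fin_numE ?cLnorm2_ge0//; exact: (L2_reprP f).2.
Qed.

Lemma L2_normD (f g : L2) : L2_norm (f + g) <= L2_norm f + L2_norm g.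
Proof.
rewrite /L2_norm -rmorphD lecR -lee_fin EFinD !L2_norm_fin.
have [mf _] := L2_reprP f; have [mg _] := L2_reprP g.
apply: le_trans (cLnorm2D mu mf mg).
rewrite (@ae_cLnorm2 _ _ _ mu (f + g : L2) (fun x => f x + g x)) //.
- exact: (L2_reprP _).1.
- exact: cmeasurableD.
- exact: L2_addE.
Qed.

Lemma L2_normZ a (f : L2) : L2_norm (a *: f) = `|a| * L2_norm f.
Proof.
have [mf _] := L2_reprP f.
rewrite /L2_norm (_ : `|a| = (normc a)%:C); last by case: a.
rewrite -rmorphM; congr (_ %:C); apply: EFin_inj.
rewrite EFinM !L2_norm_fin -(cLnorm2Z mu a mf); apply: ae_cLnorm2.
- exact: (L2_reprP _).1.
- exact: cmeasurableZ.
- exact: L2_scaleE.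
Qed.

Lemma L2_norm_eq0 f : L2_norm f = 0 -> f = 0.
Proof.
move=> [nf0]; apply: L2_eqP.
have [mf _] := L2_reprP f.
have : cLnorm2 mu f = 0%E by rewrite -L2_norm_fin nf0.
move=> /(cLnorm2_eq0 mf) f0; move: f0 L2_zeroE.
by apply: filterS2 => x -> <-.
Qed.

HB.instance Definition _ :=
  @Lmodule_isNormed.Build R[i] L2 L2_norm L2_normD L2_normZ L2_norm_eq0.

Definition L2_inner (f g : L2) : R[i] :=
  cintegral mu setT (fun x => f x * conjc (g x)).

Implicit Types (A : set L2) (K : L2 -> L2).

Definition mult_op (u : T -> R[i]) (f : L2) : L2 :=
  L2_class (fun x => u x * f x).

(* Unique when it exists, which it does for a closed subspace A. *)
Definition orth_proj A (f : L2) : L2 :=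
  xget 0 [set g | A g /\ forall h, A h -> L2_inner (f - g) h = 0].

Definition compact_op K :=
  linear K /\ precompact (K @` [set f : L2 | `|f| <= 1]).

(* The Hilbert space adjoint, unique when it exists, which it does for a
   bounded operator. *)
Definition adjoint K (g : L2) : L2 :=
  xget 0 [set h : L2 | forall f, L2_inner (K f) g = L2_inner f h].

Definition orthonormal_family n (e : 'I_n -> L2) :=
  forall i j, L2_inner (e i) (e j) = (i == j)%:R.

(* n-th term, counting from 0, of the nonincreasing list of the eigenvalues of
   |K| = (K^* K)^(1/2) repeated according to multiplicity: the largest s such
   that the eigenvalues >= s, counted with multiplicity, are at least n + 1.
   As sup set0 = 0, the list is padded with zeros. *)
Definition singular_value K (n : nat) : R :=
  sup [set s : R | 0 <= s /\
    exists (e : 'I_n.+1 -> L2) (l : 'I_n.+1 -> R),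
      orthonormal_family e /\
      forall i, s <= l i /\ adjoint K (K (e i)) = ((l i) ^+ 2)%:C *: e i].

Definition infinitesimal_infinite_order K :=
  compact_op K /\
  forall N : R, 0 < N ->
    (singular_value K : nat -> R^o) =O_\oo (fun n => (n%:R : R) `^ (- N) : R^o).

End L2space.

Section ComplexFunctions.
Variable R : realType.
Implicit Types z s : R[i].

Definition cexp z : R[i] :=
  (expR (complex.Re z))%:C * (cos (complex.Im z) +i* sin (complex.Im z)).

(* t ^ s for t > 0 *)
Definition cpow (t : R) s : R[i] := cexp (s * (ln t)%:C).

Definition Gamma_integral s : R[i] :=
  cintegral lebesgue_measure `]0, +oo[
    (fun t : R => cpow t (s - 1) * (expR (- t))%:C).

Definition Gamma_shift s : nat :=
  if 0 < complex.Re s then 0%N else (Num.truncn (- complex.Re s)).+1.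

(* Euler's integral converges for Re s > 0, and is continued to Re s <= 0 by
   Gamma (s + 1) = s Gamma s; the poles get an irrelevant value. *)
Definition Gamma s : R[i] :=
  Gamma_integral (s + (Gamma_shift s)%:R) /
  \prod_(k < Gamma_shift s) (s + k%:R).

Definition rho_infty z : R[i] :=
  (cpow pi (- z / 2) * Gamma (z / 2)) /
  (cpow pi (- (1 - z) / 2) * Gamma ((1 - z) / 2)).

End ComplexFunctions.

Section Hardy.
Variable R : realType.

Definition vertical_line (x y : R) : R[i] := x +i* y.

Definition critical_line : measurableTypeR R -> R[i] := vertical_line 2^-1.

(* The critical line is parametrised by y |-> 1/2 + iy. *)
Local Notation L2_line := (L2 (@lebesgue_measure R)).

Definition holomorphic_left_half_plane (F : R[i] -> R[i]) :=
  forall z, complex.Re z < 2^-1 -> derivable (F : R[i]^o -> R[i]^o) z 1.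

Definition Hardy_norm_bounded (F : R[i] -> R[i]) :=
  (ereal_sup [set \int[lebesgue_measure]_y ((normc (F (vertical_line x y))) ^+ 2)%:E
             | x in [set x : R | (x < 2^-1)%R]] < +oo)%E.

Definition boundary_value (F : R[i] -> R[i]) (f : R -> R[i]) :=
  cLnorm2 lebesgue_measure (fun y => F (vertical_line x y) - f y)
    @[x --> (2^-1 : R)^'-] --> 0%E.

Definition H2 : set L2_line :=
  [set f : L2_line | exists F : R[i] -> R[i],
    [/\ holomorphic_left_half_plane F, Hardy_norm_bounded F &
        boundary_value F f]].

Definition Hardy_proj : L2_line -> L2_line := orth_proj H2.

(* (1 - P) u P *)
Definition Hankel_op (u : R[i] -> R[i]) (f : L2_line) : L2_line :=
  let g : L2_line := mult_op (fun y => u (critical_line y)) (Hardy_proj f) in g - Hardy_proj g.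

Definition unimodular (u : R[i] -> R[i]) :=
  cmeasurable (fun y : measurableTypeR R => u (critical_line y)) /\
  {ae lebesgue_measure, forall y, normc (u (critical_line y)) = 1}.

Definition quasi_inner (u : R[i] -> R[i]) :=
  unimodular u /\ compact_op (Hankel_op u).

End Hardy.

(* Main.v *)
Require Import Defs.
From HB Require Import structures.
From mathcomp Require Import all_boot all_order all_algebra.
From mathcomp Require Import complex.
From mathcomp Require Import all_classical all_reals all_analysis.
From mathcomp Require Import measurable_realfun.
From mathcomp Require Import ring lra.

(** On the critical line, u = rho_infty has for every n an expansion

      u (z) = h (z) + sum_(k < n) r_k / (z + 2 k) + E_n (z)

    in which multiplication by h preserves the Hardy space, the other terms of
    the sum have their poles in the left half plane, and |E_n| is bounded by a
    constant times 4^-n.  Let K be the Hankel operator f |-> (1 - P) (u P f).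
    The term h contributes nothing to K.  The symbol 1 / (z - a) contributes a
    multiple of a rank one operator: if F is the holomorphic extension of P f
    and F a = 0, then F / (z - a) is again in the Hardy space
    ([hardy_fun_division], [hankel_kap_eq0]).  Hence K is within norm
    C 4^-n of an operator of rank n, so that it is compact
    ([compact_op_approx]), and its n-th singular value is at most C 4^-n
    because n + 1 orthonormal eigenvectors of K^* K span a space meeting the
    kernel of n linear forms ([singular_value_le]); this is rapid decay.

    The expansion comes from an integral formula.  For 0 < Re s, pi^(-s/2)
    Gamma (s/2) is twice the Mellin transform M (s) of exp (- pi t^2), so that
    u (z) = M (z) / M (1 - z).  The Gaussian is its own Fourier transform; the
    derivative of this identity says that t exp (- pi t^2) is its own sine
    transform, and in the variables t = e^u a sine transform is a convolution.
    Exchanging two integrals therefore gives, on the critical line,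

      u (z) = (1 - z) / pi * int_R sin (2 pi e^u) e^((z - 1) u) du

    ([rho_sine]).  The integral over u >= 0 is holomorphic and bounded in the
    left half plane and yields h.  In the integral over u <= 0 an integration
    by parts absorbs the factor 1 - z and turns the sine into
    2 cos (2 pi e^u) ([rho_decomposition]); the Taylor polynomial of the cosine
    contributes the integrals of e^(2 k u) e^(z u), that is the simple
    fractions 1 / (z + 2 k), and its remainder is at most C 4^-n for u <= 0.
    Although the factor 1 - z is unbounded, h is bounded on the line, as the
    difference of two bounded functions; it preserves the Hardy space since
    the products of h f by r / (c - z), c = r + 1/2, are in it and tend to h f
    as r tends to infinity ([holo_line_hardy]).  That |u| = 1 on the line is
    the identity 1 - z = conj z, together with the absence of zeros of Gamma:
    Gamma (s + 1) = s Gamma (s) moves a zero arbitrarily far to the right,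
    where the integrand of Euler's integral is too concentrated for a
    cancellation ([euler_neq0]).

    The Hardy space is handled through Cauchy integrals over the critical line.
    A square-integrable f is the boundary value of a Hardy function if and only
    if its integrals against 1 / (z - c) vanish for Re c > 1/2 and its Cauchy
    transform tends to it in mean square ([H2_hardy]).  One direction is
    Cauchy's formula, from Goursat's theorem on rectangles whose horizontal
    sides recede to infinity; the other one holds because under the
    first condition the Cauchy transform is the Poisson integral of f,
    which is a contraction on every vertical line ([poisson_contraction]).
    This contraction also makes the Hardy space closed ([H2_closed]), so that
    its orthogonal projection exists ([L2_projection]). *)

Set Implicit Arguments.
Unset Strict Implicit.
Unset Printing Implicit Defensive.

Import Order.TTheory GRing.Theory Num.Theory.
Import numFieldNormedType.Exports.
Import Normc.

Local Open Scope classical_set_scope.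
Local Open Scope ring_scope.
Local Open Scope complex_scope.

(** * Complex numbers *)

Section ComplexNumbers.
Variable R : realType.
Implicit Types (z w : R[i]) (a b x y : R).

Lemma normc_ge0 z : 0 <= normc z.
Proof. by case: z => a b; exact: sqrtr_ge0. Qed.

Lemma normc_re z : `|complex.Re z| <= normc z.
Proof.
case: z => a b /=; rewrite -(ler_pXn2r (_ : 0 < 2)%N) ?nnegrE ?sqrtr_ge0//.
by rewrite sqr_sqrtr ?addr_ge0 ?sqr_ge0// real_normK ?num_real// lerDl sqr_ge0.
Qed.

Lemma normc_im z : `|complex.Im z| <= normc z.
Proof.
case: z => a b /=; rewrite -(ler_pXn2r (_ : 0 < 2)%N) ?nnegrE ?sqrtr_ge0//.
by rewrite sqr_sqrtr ?addr_ge0 ?sqr_ge0// real_normK ?num_real// lerDr sqr_ge0.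
Qed.

Lemma normc_sqr z : normc z ^+ 2 = complex.Re z ^+ 2 + complex.Im z ^+ 2.
Proof. by case: z => a b /=; rewrite sqr_sqrtr// addr_ge0 ?sqr_ge0. Qed.

Lemma normc_le_reim z : normc z <= `|complex.Re z| + `|complex.Im z|.
Proof.
rewrite -(ler_pXn2r (_ : 0 < 2)%N) ?nnegrE ?addr_ge0 ?normc_ge0// normc_sqr.
have := normr_ge0 (complex.Re z); have := normr_ge0 (complex.Im z).
rewrite -(real_normK (num_real (complex.Re z))).
by rewrite -(real_normK (num_real (complex.Im z))); nra.
Qed.

Lemma normc_real x : normc x%:C = `|x|.
Proof. by rewrite /= expr0n/= addr0 sqrtr_sqr. Qed.

Lemma normc_i : normc 'i%C = 1 :> R.
Proof. by rewrite /= expr0n/= expr1n add0r sqrtr1. Qed.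

Lemma normc_conj z : normc (conjc z) = normc z.
Proof. by case: z => a b /=; rewrite sqrrN. Qed.

Lemma normc_nat n : normc (n%:R : R[i]) = n%:R.
Proof. by rewrite -(rmorph_nat (real_complex R)) normc_real ger0_norm. Qed.

Lemma normc_normrE z : `|z| = (normc z)%:C.
Proof. by case: z. Qed.

Lemma normc_eq0 z : (normc z == 0) = (z == 0).
Proof. by apply/eqP/eqP => [/eq0_normc//|->]; exact: normc0. Qed.

Lemma normc_gt0 z : (0 < normc z) = (z != 0).
Proof. by rewrite lt_def normc_ge0 andbT normc_eq0. Qed.

Lemma normcB z w : normc (z - w) = normc (w - z).
Proof. by rewrite -normcN opprB. Qed.

Lemma ler_normcB z w : normc z - normc w <= normc (z - w).
Proof. by rewrite lerBlDr -{1}(subrK w z) le_normcD. Qed.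

Lemma normc_div z w : normc (z / w) = normc z / normc w.
Proof. by rewrite normcM normcV. Qed.

Lemma mulc_conj z : z * conjc z = (normc z ^+ 2)%:C.
Proof.
rewrite normc_sqr; case: z => a b.
by apply/eqP; rewrite eq_complex/=; apply/andP; split; apply/eqP; ring.
Qed.

Lemma ReD z w : complex.Re (z + w) = complex.Re z + complex.Re w.
Proof. by case: z w => ? ? []. Qed.
Lemma ImD z w : complex.Im (z + w) = complex.Im z + complex.Im w.
Proof. by case: z w => ? ? []. Qed.
Lemma ReN z : complex.Re (- z) = - complex.Re z.
Proof. by case: z. Qed.
Lemma ImN z : complex.Im (- z) = - complex.Im z.
Proof. by case: z. Qed.
Lemma ReM z w : complex.Re (z * w) =
  complex.Re z * complex.Re w - complex.Im z * complex.Im w.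
Proof. by case: z w => ? ? []. Qed.
Lemma ImM z w : complex.Im (z * w) =
  complex.Re z * complex.Im w + complex.Im z * complex.Re w.
Proof. by case: z w => ? ? []. Qed.
Lemma Re_conj z : complex.Re (conjc z) = complex.Re z.
Proof. by case: z. Qed.
Lemma Im_conj z : complex.Im (conjc z) = - complex.Im z.
Proof. by case: z. Qed.

Definition ReImE := (ReD, ImD, ReN, ImN, ReM, ImM, Re_conj, Im_conj).

Lemma complex_ext z w : complex.Re z = complex.Re w ->
  complex.Im z = complex.Im w -> z = w.
Proof. by case: z w => ? ? [? ?] /= -> ->. Qed.

Lemma conjcD z w : conjc (z + w) = conjc z + conjc w.
Proof. exact: rmorphD. Qed.
Lemma conjcM z w : conjc (z * w) = conjc z * conjc w.
Proof. exact: rmorphM. Qed.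
Lemma conjcN z : conjc (- z) = - conjc z.
Proof. exact: rmorphN. Qed.

Lemma complex_RI a b : a +i* b = a%:C + 'i%C * b%:C :> R[i].
Proof. by apply: complex_ext => /=; ring. Qed.

End ComplexNumbers.

(** * Integrals of complex-valued functions *)

Section ComplexIntegral.
Context d (T : measurableType d) (R : realType).
Variable mu : {measure set T -> \bar R}.
Implicit Types (f g : T -> R[i]) (D : set T).

Definition cmeas D f :=
  measurable_fun D (fun x => complex.Re (f x)) /\
  measurable_fun D (fun x => complex.Im (f x)).

Definition cintegrable D f :=
  mu.-integrable D (EFin \o (fun x => complex.Re (f x))) /\
  mu.-integrable D (EFin \o (fun x => complex.Im (f x))).

Lemma cmeasS D E f : measurable E -> D `<=` E -> cmeas E f -> cmeas D f.
Proof. by move=> mE DE [? ?]; split; exact: measurable_funS mE DE _. Qed.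

Lemma cmeas_cst D (c : R[i]) : cmeas D (fun=> c).
Proof. by split; exact: measurable_cst. Qed.

Lemma cmeasD D f g : cmeas D f -> cmeas D g -> cmeas D (fun x => f x + g x).
Proof.
move=> [fr fi] [gr gi]; split.
- by under eq_fun do rewrite ReD; exact: measurable_funD.
- by under eq_fun do rewrite ImD; exact: measurable_funD.
Qed.

Lemma cmeasN D f : cmeas D f -> cmeas D (fun x => - f x).
Proof.
move=> [fr fi]; split.
- by under eq_fun do rewrite ReN; exact: measurableT_comp.
- by under eq_fun do rewrite ImN; exact: measurableT_comp.
Qed.

Lemma cmeasB D f g : cmeas D f -> cmeas D g -> cmeas D (fun x => f x - g x).
Proof. by move=> mf mg; exact/cmeasD/cmeasN. Qed.

Lemma cmeasM D f g : cmeas D f -> cmeas D g -> cmeas D (fun x => f x * g x).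
Proof.
move=> [fr fi] [gr gi]; split.
- under eq_fun do rewrite ReM.
  by apply: measurable_funB; exact: measurable_funM.
- under eq_fun do rewrite ImM.
  by apply: measurable_funD; exact: measurable_funM.
Qed.

Lemma cmeas_conj D f : cmeas D f -> cmeas D (fun x => conjc (f x)).
Proof.
move=> [fr fi]; split.
- by under eq_fun do rewrite Re_conj.
- by under eq_fun do rewrite Im_conj; exact: measurableT_comp.
Qed.

Lemma cmeas_real D (h : T -> R) : measurable_fun D h -> cmeas D (fun x => (h x)%:C).
Proof. by move=> mh; split => //=; exact: measurable_cst. Qed.

Lemma cmeas_normc D f : cmeas D f -> measurable_fun D (fun x => normc (f x)).
Proof.
move=> [mr mi].
rewrite [X in measurable_fun _ X](_ : _ = fun x =>
  Num.sqrt (complex.Re (f x) ^+ 2 + complex.Im (f x) ^+ 2)); last first.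
  by apply/funext => x; case: (f x).
have ms : measurable_fun setT (@Num.sqrt R).
  by apply: continuous_measurable_fun; exact: sqrt_continuous.
apply: (measurableT_comp ms); apply: measurable_funD;
exact: measurable_funX.
Qed.

Lemma cintegrable_cmeas D f : cintegrable D f -> cmeas D f.
Proof. by move=> [/measurable_int/measurable_EFinP ? /measurable_int/measurable_EFinP ?]. Qed.

Lemma dom_cintegrable D f (g : T -> R) : measurable D -> cmeas D f ->
  mu.-integrable D (EFin \o g) -> (forall x, D x -> normc (f x) <= g x) ->
  cintegrable D f.
Proof.
move=> mD [mr mi] ig fg; split; apply: (le_integrable mD _ _ ig).
- exact/measurable_EFinP.
- move=> x Dx /=; rewrite lee_fin.
  apply: le_trans (normc_re _) _; apply: le_trans (fg _ Dx) _; exact: ler_norm.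
- exact/measurable_EFinP.
- move=> x Dx /=; rewrite lee_fin.
  apply: le_trans (normc_im _) _; apply: le_trans (fg _ Dx) _; exact: ler_norm.
Qed.

Lemma cintegrable_normc D f : measurable D -> cintegrable D f ->
  mu.-integrable D (EFin \o (fun x => normc (f x))).
Proof.
move=> mD fi; have [ri ii] := fi.
apply: (le_integrable mD _ _ (integrableD mD (integrable_norm ri) (integrable_norm ii))).
  exact/measurable_EFinP/cmeas_normc/cintegrable_cmeas.
move=> x Dx /=; rewrite lee_fin ger0_norm ?normc_ge0// ger0_norm ?addr_ge0//.
exact: normc_le_reim.
Qed.

Lemma cintegrableP D f : measurable D -> cmeas D f ->
  cintegrable D f <-> mu.-integrable D (EFin \o (fun x => normc (f x))).
Proof.
move=> mD mf; split; first exact: cintegrable_normc.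
by move=> nf; exact: (dom_cintegrable mD mf nf).
Qed.

Lemma cintegrableS D E f : measurable D -> measurable E -> E `<=` D ->
  cintegrable D f -> cintegrable E f.
Proof. by move=> mD mE ED [? ?]; split; exact: integrableS mD mE ED _. Qed.

Lemma cintegrableD D f g : measurable D -> cintegrable D f -> cintegrable D g ->
  cintegrable D (fun x => f x + g x).
Proof.
move=> mD [fr fi] [gr gi]; split.
- have := integrableD mD fr gr; apply: eq_integrable => // x _.
  by rewrite /= ReD.
- have := integrableD mD fi gi; apply: eq_integrable => // x _.
  by rewrite /= ImD.
Qed.

Lemma cintegrableZ D (c : R[i]) f : measurable D -> cintegrable D f ->
  cintegrable D (fun x => c * f x).
Proof.
move=> mD fi; apply/cintegrableP => //.
  by apply: cmeasM; [exact: cmeas_cst|exact: cintegrable_cmeas].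
have := integrableZl mD (normc c) (cintegrable_normc mD fi).
by apply: eq_integrable => // x _; rewrite /= normcM.
Qed.

Lemma cintegrableN D f : measurable D -> cintegrable D f ->
  cintegrable D (fun x => - f x).
Proof.
move=> mD fi; have := cintegrableZ (-1) mD fi.
by under eq_fun do rewrite mulN1r.
Qed.

Lemma cintegrableB D f g : measurable D -> cintegrable D f -> cintegrable D g ->
  cintegrable D (fun x => f x - g x).
Proof. by move=> mD fi gi; exact/cintegrableD/cintegrableN. Qed.

Lemma cintegrable_real D (h : T -> R) : mu.-integrable D (EFin \o h) ->
  measurable D -> cintegrable D (fun x => (h x)%:C).
Proof. by move=> hi mD; split => //=; exact: integrable0. Qed.

Lemma eq_cintegral D f g : {in D, f =1 g} -> cintegral mu D f = cintegral mu D g.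
Proof.
by move=> fg; rewrite /cintegral; congr (_ +i* _);
  apply: eq_Rintegral => x Dx; rewrite fg.
Qed.

Lemma eq_cintegrable D f g : measurable D -> {in D, f =1 g} ->
  cintegrable D f -> cintegrable D g.
Proof.
move=> mD fg [? ?]; split.
- apply: (eq_integrable mD (EFin \o (fun x => complex.Re (f x)))) => // x Dx /=.
  by rewrite fg.
- apply: (eq_integrable mD (EFin \o (fun x => complex.Im (f x)))) => // x Dx /=.
  by rewrite fg.
Qed.

Lemma ae_eq_Rintegral D (f g : T -> R) : measurable D ->
  measurable_fun D f -> measurable_fun D g ->
  {ae mu, forall x, D x -> f x = g x} ->
  Rintegral mu D f = Rintegral mu D g.
Proof.
move=> mD mf mg fg; rewrite /Rintegral; congr fine; apply: ae_eq_integral => //.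
- exact/measurable_EFinP.
- exact/measurable_EFinP.
- by move: fg; apply: filterS => x h Dx; rewrite h.
Qed.

Lemma ae_eq_cintegral D f g : measurable D -> cmeas D f -> cmeas D g ->
  {ae mu, forall x, D x -> f x = g x} -> cintegral mu D f = cintegral mu D g.
Proof.
move=> mD [fr fi] [gr gi] fg; rewrite /cintegral; congr (_ +i* _).
- by apply: ae_eq_Rintegral => //; move: fg; apply: filterS => x h Dx; rewrite h.
- by apply: ae_eq_Rintegral => //; move: fg; apply: filterS => x h Dx; rewrite h.
Qed.

Lemma cintegralD D f g : measurable D -> cintegrable D f -> cintegrable D g ->
  cintegral mu D (fun x => f x + g x) = cintegral mu D f + cintegral mu D g.
Proof.
move=> mD [fr fi] [gr gi]; rewrite /cintegral.
apply: complex_ext => /=.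
- rewrite -RintegralD//; apply: eq_Rintegral => x _; exact: ReD.
- rewrite -RintegralD//; apply: eq_Rintegral => x _; exact: ImD.
Qed.

Lemma cintegralZ D (c : R[i]) f : measurable D -> cintegrable D f ->
  cintegral mu D (fun x => c * f x) = c * cintegral mu D f.
Proof.
move=> mD [fr fi]; rewrite /cintegral.
have Z r h : mu.-integrable D (EFin \o h) ->
    mu.-integrable D (EFin \o (fun x => r * h x)) by exact: integrableZl.
apply: complex_ext => /=; rewrite !ReImE/=.
- rewrite -!RintegralZl// -RintegralB//; [|exact: Z..].
  by apply: eq_Rintegral => x _; rewrite ReM.
- rewrite -!RintegralZl// -RintegralD//; [|exact: Z..].
  by apply: eq_Rintegral => x _; rewrite ImM.
Qed.

Lemma cintegralZr D (c : R[i]) f : measurable D -> cintegrable D f ->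
  cintegral mu D (fun x => f x * c) = cintegral mu D f * c.
Proof.
move=> mD fi; rewrite mulrC -cintegralZ//.
by apply: eq_cintegral => x _; rewrite mulrC.
Qed.

Lemma cintegralN D f : measurable D -> cintegrable D f ->
  cintegral mu D (fun x => - f x) = - cintegral mu D f.
Proof.
move=> mD fi; rewrite -mulN1r -cintegralZ//.
by apply: eq_cintegral => x _; rewrite mulN1r.
Qed.

Lemma cintegralB D f g : measurable D -> cintegrable D f -> cintegrable D g ->
  cintegral mu D (fun x => f x - g x) = cintegral mu D f - cintegral mu D g.
Proof.
by move=> mD fi gi; rewrite cintegralD ?cintegralN//; exact: cintegrableN.
Qed.

Lemma cintegral_conj D f : measurable D -> cintegrable D f ->
  cintegral mu D (fun x => conjc (f x)) = conjc (cintegral mu D f).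
Proof.
move=> mD [fr fi]; rewrite /cintegral; apply: complex_ext => /=.
- by apply: eq_Rintegral => x _; rewrite Re_conj.
- rewrite -mulN1r -RintegralZl//; apply: eq_Rintegral => x _.
  by rewrite Im_conj mulN1r.
Qed.

Lemma cintegral_real D (h : T -> R) :
  cintegral mu D (fun x => (h x)%:C) = (Rintegral mu D h)%:C.
Proof.
rewrite /cintegral; apply: complex_ext => //=.
by rewrite /Rintegral integral0.
Qed.

Lemma cintegral0 D : cintegral mu D (fun=> 0) = 0.
Proof. by rewrite /cintegral /= /Rintegral integral0. Qed.

(** The bound follows by rotating the value of the integral onto the positive
    real axis, where only the real part of the rotated integrand counts. *)
Lemma le_normc_cintegral D f : measurable D -> cintegrable D f ->
  normc (cintegral mu D f) <= Rintegral mu D (fun x => normc (f x)).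
Proof.
move=> mD fi; set I := cintegral mu D f.
have nfi := cintegrable_normc mD fi.
have n0 : 0 <= Rintegral mu D (fun x => normc (f x)).
  by apply: Rintegral_ge0 => x _; exact: normc_ge0.
have [I0|I0] := eqVneq I 0; first by rewrite I0 normc0.
have e : complex.Re (cintegral mu D (fun x => conjc I * f x)) = normc I ^+ 2.
  by rewrite cintegralZ// mulrC mulc_conj.
have : normc I ^+ 2 <= normc I * Rintegral mu D (fun x => normc (f x)).
  rewrite -e -RintegralZl//; apply: le_Rintegral => //.
  - exact: (cintegrableZ _ mD fi).1.
  - exact: (integrableZl mD (normc I) nfi).
  - move=> x Dx; apply: le_trans (ler_norm _) _.
    by apply: le_trans (normc_re _) _; rewrite normcM normc_conj.
by rewrite expr2 ler_pM2l// normc_gt0.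
Qed.

Lemma le_normc_cintegral_dom D f (g : T -> R) : measurable D -> cmeas D f ->
  mu.-integrable D (EFin \o g) -> (forall x, D x -> normc (f x) <= g x) ->
  normc (cintegral mu D f) <= Rintegral mu D g.
Proof.
move=> mD mf ig fg; have fi := dom_cintegrable mD mf ig fg.
apply: le_trans (le_normc_cintegral mD fi) _.
by apply: le_Rintegral => //; exact: cintegrable_normc.
Qed.

End ComplexIntegral.

Arguments cintegral : simpl never.
Arguments normc : simpl never.

(** * Square-integrable functions *)

Section L2norm.
Context d (T : measurableType d) (R : realType).
Variable mu : {measure set T -> \bar R}.
Implicit Types (f g : T -> R[i]).

Definition sqnorm f : R := Rintegral mu setT (fun x => normc (f x) ^+ 2).

Lemma sqnorm_ge0 f : 0 <= sqnorm f.
Proof. by apply: Rintegral_ge0 => x _; rewrite exprn_ge0// normc_ge0. Qed.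

Lemma cLnorm2E f : cLnorm2 mu f =
  ((\int[mu]_x (normc (f x) ^+ 2)%:E) `^ 2^-1)%E.
Proof.
rewrite /cLnorm2 unlock; congr (_ `^ _)%E; apply: eq_integral => x _ /=.
by rewrite powR_mulrn// ?real_normK// ?num_real.
Qed.

Lemma sqnorm_EFin f : square_integrable mu f ->
  (\int[mu]_x (normc (f x) ^+ 2)%:E = (sqnorm f)%:E)%E.
Proof.
move=> [mf]; rewrite cLnorm2E => h; rewrite /sqnorm /Rintegral fineK//.
rewrite ge0_fin_numE; last by apply: integral_ge0 => x _; rewrite lee_fin exprn_ge0// normc_ge0.
by apply: (@lty_poweRy _ _ 2^-1) => //; rewrite invr_eq0.
Qed.

Lemma square_integrableP f : square_integrable mu f <->
  cmeas setT f /\ mu.-integrable setT (EFin \o (fun x => normc (f x) ^+ 2)).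
Proof.
have n0 x : (0 <= (normc (f x) ^+ 2)%:E)%E by rewrite lee_fin exprn_ge0// normc_ge0.
split=> [sf|[mf /integrableP[_ nf]]].
  split; first exact: sf.1.
  apply/integrableP; split.
    by apply/measurable_EFinP/measurable_funX/cmeas_normc; exact: sf.1.
  under eq_integral do rewrite gee0_abs//=.
  by rewrite sqnorm_EFin// ltry.
split=> //; rewrite cLnorm2E.
move: nf; under eq_integral do rewrite gee0_abs//=.
move=> nf; set I := integral _ _ _ in nf *.
have I0 : (0 <= I)%E by exact: integral_ge0.
have Ifin : I \is a fin_num by rewrite ge0_fin_numE.
by rewrite -(fineK Ifin) poweR_EFin ltry.
Qed.

Lemma square_integrable_sqr f : square_integrable mu f ->
  mu.-integrable setT (EFin \o (fun x => normc (f x) ^+ 2)).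
Proof. by move/square_integrableP => []. Qed.

Lemma cLnorm2_sqrt f : square_integrable mu f ->
  cLnorm2 mu f = (Num.sqrt (sqnorm f))%:E.
Proof.
move=> sf; rewrite cLnorm2E sqnorm_EFin// poweR_EFin powR12_sqrt//.
exact: sqnorm_ge0.
Qed.

Lemma square_integrable_dom f (g : T -> R) : cmeas setT f ->
  mu.-integrable setT (EFin \o g) -> (forall x, normc (f x) ^+ 2 <= g x) ->
  square_integrable mu f.
Proof.
move=> mf ig fg; apply/square_integrableP; split => //.
apply: (le_integrable _ _ _ ig) => //.
  exact/measurable_EFinP/measurable_funX/cmeas_normc.
move=> x _ /=; rewrite lee_fin ger0_norm ?exprn_ge0 ?normc_ge0//.
by apply: le_trans (fg _) _; exact: ler_norm.
Qed.

Lemma square_integrableN f : square_integrable mu f ->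
  square_integrable mu (fun x => - f x).
Proof.
move=> sf; have := square_integrableZ (-1) sf.
by under eq_fun do rewrite mulN1r.
Qed.

Lemma square_integrableB f g : square_integrable mu f -> square_integrable mu g ->
  square_integrable mu (fun x => f x - g x).
Proof. by move=> sf sg; exact/square_integrableD/square_integrableN. Qed.

Lemma square_integrable_conj f : square_integrable mu f ->
  square_integrable mu (fun x => conjc (f x)).
Proof.
move=> /square_integrableP[mf sf]; apply/square_integrableP; split.
  exact: cmeas_conj.
by under eq_fun do rewrite normc_conj.
Qed.

Lemma square_integrableM_bounded f g M : cmeas setT f ->
  (forall x, normc (f x) <= M) -> square_integrable mu g ->
  square_integrable mu (fun x => f x * g x).
Proof.
move=> mf fM sg; have /square_integrableP[mg ig] := sg.
apply: (@square_integrable_dom _ (fun x => M ^+ 2 * normc (g x) ^+ 2)).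
- exact: cmeasM.
- exact: (integrableZl _ (M ^+ 2) ig).
- move=> x; rewrite normcM exprMn ler_wpM2r ?exprn_ge0 ?normc_ge0//.
  by rewrite ler_pXn2r ?nnegrE ?normc_ge0//; apply: le_trans (normc_ge0 _) (fM x).
Qed.

Lemma le_sqnorm f g M : square_integrable mu f -> square_integrable mu g ->
  (forall x, normc (f x) <= M * normc (g x)) -> sqnorm f <= M ^+ 2 * sqnorm g.
Proof.
move=> /square_integrableP[mf ifi] /square_integrableP[mg ig] fg.
rewrite /sqnorm -RintegralZl//; apply: le_Rintegral => //.
  exact: (integrableZl _ (M ^+ 2) ig).
by move=> x _; rewrite -exprMn ler_sqr ?fg// ?nnegrE ?normc_ge0// (le_trans (normc_ge0 _) (fg x)).
Qed.

Lemma integrable_normcM f g : square_integrable mu f -> square_integrable mu g ->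
  mu.-integrable setT (EFin \o (fun x => normc (f x) * normc (g x))).
Proof.
move=> /square_integrableP[mf ifi] /square_integrableP[mg ig].
apply: (le_integrable _ _ _ (integrableD _ ifi ig)) => //.
  by apply/measurable_EFinP/measurable_funM; exact: cmeas_normc.
move=> x _ /=; rewrite lee_fin ger0_norm ?mulr_ge0 ?normc_ge0//.
rewrite ger0_norm ?addr_ge0 ?exprn_ge0 ?normc_ge0//.
have := sqr_ge0 (normc (f x) - normc (g x)).
have := normc_ge0 (f x); have := normc_ge0 (g x); nra.
Qed.

Lemma cintegrableM2 f g : square_integrable mu f -> square_integrable mu g ->
  cintegrable mu setT (fun x => f x * g x).
Proof.
move=> sf sg; apply: (dom_cintegrable _ _ (integrable_normcM sf sg)) => //.
  by apply: cmeasM; [exact: sf.1|exact: sg.1].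
by move=> x _; rewrite normcM.
Qed.

(** A real quadratic polynomial without sign change has nonpositive
    discriminant; the degenerate case a = 0 forces x = 0. *)
Lemma discriminant_le (a b x : R) : 0 <= a -> 0 <= b -> 0 <= x ->
  (forall t, 0 <= t ^+ 2 * a - 2 * t * x + b) -> x <= Num.sqrt a * Num.sqrt b.
Proof.
move=> a0 b0 x0 h; rewrite -sqrtrM// -(ger0_norm x0) -sqrtr_sqr ler_sqrt ?mulr_ge0//.
have [az|an0] := eqVneq a 0.
  have [->|xn0] := eqVneq x 0; first by rewrite az mul0r expr0n.
  (* a value of t at which the affine function b - 2 t x equals -1 *)
  have := h ((b + 1) / (2 * x)); rewrite az mulr0 add0r.
  have -> : 2 * ((b + 1) / (2 * x)) * x = b + 1 by field.
  by lra.
have ap : 0 < a by rewrite lt_def an0.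
have := h (x / a).
have -> : (x / a) ^+ 2 * a - 2 * (x / a) * x + b = b - x ^+ 2 / a by field.
by rewrite subr_ge0 ler_pdivrMr// mulrC.
Qed.

Lemma cauchy_schwarz f g : square_integrable mu f -> square_integrable mu g ->
  Rintegral mu setT (fun x => normc (f x) * normc (g x)) <=
  Num.sqrt (sqnorm f) * Num.sqrt (sqnorm g).
Proof.
move=> sf sg; have ifg := integrable_normcM sf sg.
have [_ ifi] := (square_integrableP _).1 sf.
have [_ ig] := (square_integrableP _).1 sg.
apply: discriminant_le; rewrite ?sqnorm_ge0//.
  by apply: Rintegral_ge0 => x _; rewrite mulr_ge0 ?normc_ge0.
move=> t; rewrite /sqnorm -!RintegralZl// -RintegralB//; last 2 first.
- exact: (integrableZl _ (t ^+ 2) ifi).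
- exact: (integrableZl _ (2 * t) ifg).
rewrite -RintegralD//; last first.
  have := integrableB measurableT (integrableZl measurableT (t ^+ 2) ifi)
    (integrableZl measurableT (2 * t) ifg).
  by apply: eq_integrable.
apply: Rintegral_ge0 => x _.
have -> : t ^+ 2 * normc (f x) ^+ 2 - 2 * t * (normc (f x) * normc (g x)) +
  normc (g x) ^+ 2 = (t * normc (f x) - normc (g x)) ^+ 2 by ring.
exact: sqr_ge0.
Qed.

Lemma normc_cintegralM f g : square_integrable mu f -> square_integrable mu g ->
  normc (cintegral mu setT (fun x => f x * g x)) <=
  Num.sqrt (sqnorm f) * Num.sqrt (sqnorm g).
Proof.
move=> sf sg; apply: le_trans (cauchy_schwarz sf sg).
apply: le_normc_cintegral_dom => //.
- by apply: cmeasM; [exact: sf.1|exact: sg.1].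
- exact: integrable_normcM.
- by move=> x _; rewrite normcM.
Qed.

Lemma sqrt_sqnormD f g : square_integrable mu f -> square_integrable mu g ->
  Num.sqrt (sqnorm (fun x => f x + g x)) <=
  Num.sqrt (sqnorm f) + Num.sqrt (sqnorm g).
Proof.
move=> sf sg; rewrite -lee_fin EFinD -!cLnorm2_sqrt//.
  by apply: cLnorm2D; [exact: sf.1|exact: sg.1].
exact: square_integrableD.
Qed.

Lemma sqnormN f : sqnorm (fun x => - f x) = sqnorm f.
Proof. by rewrite /sqnorm; under eq_Rintegral do rewrite normcN. Qed.

Lemma sqnormZ (c : R[i]) f : square_integrable mu f ->
  sqnorm (fun x => c * f x) = normc c ^+ 2 * sqnorm f.
Proof.
move=> /square_integrableP[mf ifi]; rewrite /sqnorm -RintegralZl//.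
by apply: eq_Rintegral => x _; rewrite normcM exprMn.
Qed.

Lemma ae_eq_sqnorm f g : cmeas setT f -> cmeas setT g ->
  {ae mu, forall x, f x = g x} -> sqnorm f = sqnorm g.
Proof.
move=> mf mg fg; apply: ae_eq_Rintegral => //.
- exact/measurable_funX/cmeas_normc.
- exact/measurable_funX/cmeas_normc.
- by move: fg; apply: filterS => x -> _.
Qed.

End L2norm.

Arguments L2_inner : simpl never.

Section L2inner.
Context d (T : measurableType d) (R : realType).
Variable mu : {measure set T -> \bar R}.
Implicit Types (f g h : L2 mu).
Local Notation "<[ f , g ]>" := (L2_inner f g).

Definition nrm f : R := fine (cLnorm2 mu f).

Lemma nrmE f : nrm f = Num.sqrt (sqnorm mu f).
Proof. by rewrite /nrm cLnorm2_sqrt//; exact: L2_reprP. Qed.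

Lemma nrm_normE f : `|f| = (nrm f)%:C.
Proof. by []. Qed.

Lemma nrm_ge0 f : 0 <= nrm f.
Proof. by rewrite nrmE sqrtr_ge0. Qed.

Lemma nrm_sqr f : nrm f ^+ 2 = sqnorm mu f.
Proof. by rewrite nrmE sqr_sqrtr// sqnorm_ge0. Qed.

Lemma nrmD f g : nrm (f + g) <= nrm f + nrm g.
Proof. by rewrite -lecR rmorphD/= -!nrm_normE; exact: ler_normD. Qed.

Lemma nrmZ (c : R[i]) f : nrm (c *: f) = normc c * nrm f.
Proof. by apply: complexI; rewrite rmorphM/= -!nrm_normE -normc_normrE; exact: normrZ. Qed.

Lemma nrmN f : nrm (- f) = nrm f.
Proof. by apply: complexI; rewrite -!nrm_normE; exact: normrN. Qed.

Lemma nrmB f g : nrm (f - g) = nrm (g - f).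
Proof. by rewrite -nrmN opprB. Qed.

Lemma nrm0 : nrm 0 = 0.
Proof. by apply: complexI; rewrite -!nrm_normE; exact: normr0. Qed.

Lemma nrm_eq0 f : nrm f = 0 -> f = 0.
Proof. by move=> f0; apply/eqP; rewrite -normr_eq0 nrm_normE f0. Qed.

Lemma inner_integrable f g : cintegrable mu setT (fun x => f x * conjc (g x)).
Proof.
apply: cintegrableM2; first exact: L2_reprP.
by apply: square_integrable_conj; exact: L2_reprP.
Qed.

Lemma inner_ae f g (u v : T -> R[i]) : square_integrable mu u ->
  square_integrable mu v -> {ae mu, forall x, f x = u x} ->
  {ae mu, forall x, g x = v x} ->
  <[f, g]> = cintegral mu setT (fun x => u x * conjc (v x)).
Proof.
move=> su sv fu gv; apply: ae_eq_cintegral => //.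
- exact/cintegrable_cmeas/inner_integrable.
- apply: cmeasM; first exact: su.1.
  by apply: cmeas_conj; exact: sv.1.
- by move: fu gv; apply: filterS2 => x -> ->.
Qed.

Lemma innerDl f g h : <[f + g, h]> = <[f, h]> + <[g, h]>.
Proof.
rewrite (@inner_ae (f + g) h (fun x => f x + g x) h).
- rewrite /L2_inner -cintegralD//; [|exact: inner_integrable..].
  by apply: eq_cintegral => x _; rewrite mulrDl.
- by apply: square_integrableD; exact: L2_reprP.
- exact: L2_reprP.
- exact: L2_addE.
- exact: aeW.
Qed.

Lemma innerZl (c : R[i]) f h : <[c *: f, h]> = c * <[f, h]>.
Proof.
rewrite (@inner_ae (c *: f) h (fun x => c * f x) h).
- rewrite /L2_inner -cintegralZ//; last exact: inner_integrable.
  by apply: eq_cintegral => x _; rewrite mulrA.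
- by apply: square_integrableZ; exact: L2_reprP.
- exact: L2_reprP.
- exact: L2_scaleE.
- exact: aeW.
Qed.

Lemma inner_conj f g : <[g, f]> = conjc <[f, g]>.
Proof.
rewrite /L2_inner -cintegral_conj//; last exact: inner_integrable.
by apply: eq_cintegral => x _; rewrite conjcM conjcK mulrC.
Qed.

Lemma innerNl f h : <[- f, h]> = - <[f, h]>.
Proof. by rewrite -scaleN1r innerZl mulN1r. Qed.

Lemma innerBl f g h : <[f - g, h]> = <[f, h]> - <[g, h]>.
Proof. by rewrite innerDl innerNl. Qed.

Lemma innerDr f g h : <[h, f + g]> = <[h, f]> + <[h, g]>.
Proof. by rewrite inner_conj innerDl conjcD -!inner_conj. Qed.

Lemma innerZr (c : R[i]) f h : <[h, c *: f]> = conjc c * <[h, f]>.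
Proof.
by rewrite inner_conj innerZl conjcM -inner_conj.
Qed.

Lemma innerNr f h : <[h, - f]> = - <[h, f]>.
Proof. by rewrite inner_conj innerNl conjcN -inner_conj. Qed.

Lemma inner0l h : <[0, h]> = 0.
Proof. by rewrite -(scale0r 0) innerZl mul0r. Qed.

Lemma inner_suml I (s : seq I) (F : I -> L2 mu) h :
  <[\sum_(i <- s) F i, h]> = \sum_(i <- s) <[F i, h]>.
Proof.
elim: s => [|i s IH]; first by rewrite !big_nil inner0l.
by rewrite !big_cons innerDl IH.
Qed.

Lemma inner_self f : <[f, f]> = (nrm f ^+ 2)%:C.
Proof.
rewrite nrm_sqr /sqnorm -cintegral_real; apply: eq_cintegral => x _.
exact: mulc_conj.
Qed.

Lemma nrmD_sqr f g :
  nrm (f + g) ^+ 2 = nrm f ^+ 2 + 2 * complex.Re <[f, g]> + nrm g ^+ 2.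
Proof.
apply: complexI; rewrite -inner_self innerDl !innerDr !rmorphD/= -!inner_self.
rewrite (inner_conj f g) -!addrA; congr (_ + _); rewrite !addrA; congr (_ + _).
by apply: complex_ext; rewrite !ReImE/=; ring.
Qed.

Lemma parallelogram f g :
  nrm (f - g) ^+ 2 = 2 * nrm f ^+ 2 + 2 * nrm g ^+ 2 - nrm (f + g) ^+ 2.
Proof. by rewrite !nrmD_sqr nrmN innerNr ReN; ring. Qed.

End L2inner.

(** * Completeness of the space of square-integrable functions *)

Section VectorIdentities.
Variables (K : numFieldType) (V : lmodType K).
Implicit Types (f g h l u v : V).

Lemma subr_subl f u v : (f - v) - (f - u) = u - v.
Proof. by rewrite opprB [RHS]addrC -[u - f]addrC addrACA subrr add0r addrC. Qed.

Lemma addr_midpoint f u v :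
  (f - v) + (f - u) = (2 : K) *: (f - (2^-1 *: u + 2^-1 *: v)).
Proof.
rewrite scalerBr scalerDr !scalerA mulfV ?pnatr_eq0// !scale1r.
by rewrite scaler_nat mulr2n addrACA -opprD [v + u]addrC.
Qed.

Lemma subr_comb f h l (c : K) : f - (c *: h + l) = (f - l) + (- c) *: h.
Proof. by rewrite opprD scaleNr addrCA addrC. Qed.

End VectorIdentities.

Section Completeness.
Context d (T : measurableType d) (R : realType).
Variable mu : {measure set T -> \bar R}.

Lemma L2_subE (f g : L2 mu) : {ae mu, forall x, (f - g : L2 mu) x = f x - g x}.
Proof.
move: (L2_addE f (- g)) (L2_scaleE (-1) g).
by apply: filterS2 => x -> e; rewrite [X in _ + X]e mulN1r.
Qed.

Lemma nrmB_sqr (f g : L2 mu) :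
  nrm (f - g) ^+ 2 = sqnorm mu (fun x => f x - g x).
Proof.
rewrite nrm_sqr; apply: ae_eq_sqnorm.
- exact: (L2_reprP _).1.
- by apply: cmeasB; exact: (L2_reprP _).1.
- exact: L2_subE.
Qed.

Lemma geometric_increments_cvg (a : nat -> R) (C : R) :
  (forall n, `|a n.+1 - a n| <= C * 2^-1 ^+ n) -> cvgn a.
Proof.
move=> h; have C0 : 0 <= C.
  by have := h 0%N; rewrite expr0 mulr1; apply: le_trans; exact: normr_ge0.
have : cvgn (series (telescope a)).
  apply: normed_cvg.
  apply: (@series_le_cvg _ _ (geometric C 2^-1)) => [n|n|n|].
  - exact: normr_ge0.
  - by rewrite /geometric/= mulr_ge0// exprn_ge0// invr_ge0.
  - exact: h.
  - by apply: is_cvg_geometric_series; rewrite ger0_norm ?invr_ge0// invf_lt1// ltr1n.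
move=> cs; have -> : a = (fun n => a 0%N + series (telescope a) n).
  by apply/funext => n; exact: eq_sum_telescope.
exact: is_cvgD (is_cvg_cst _) cs.
Qed.

Lemma cmeas_cvg (w : nat -> T -> R[i]) (f : T -> R[i]) :
  (forall n, cmeas setT (w n)) ->
  (forall x, (fun n => complex.Re (w n x)) @ \oo --> complex.Re (f x)) ->
  (forall x, (fun n => complex.Im (w n x)) @ \oo --> complex.Im (f x)) ->
  cmeas setT f.
Proof.
move=> mw fr fi; split.
- by apply: (@measurable_fun_cvg _ _ _ _ (fun n x => complex.Re (w n x))) => // n; exact: (mw n).1.
- by apply: (@measurable_fun_cvg _ _ _ _ (fun n x => complex.Im (w n x))) => // n; exact: (mw n).2.
Qed.

Lemma cvg_normc_sqr (w : nat -> R[i]) (z : R[i]) :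
  (fun n => complex.Re (w n)) @ \oo --> complex.Re z ->
  (fun n => complex.Im (w n)) @ \oo --> complex.Im z ->
  (fun n => normc (w n) ^+ 2) @ \oo --> normc z ^+ 2.
Proof.
move=> cr ci; under eq_fun do rewrite normc_sqr.
by rewrite normc_sqr !expr2; apply: cvgD; [exact: (cvgM cr cr)|exact: (cvgM ci ci)].
Qed.

(** Fatou for the squared norms: a bound in mean square survives pointwise
    limits. *)
Lemma fatou_sqnorm (w : nat -> T -> R[i]) (f : T -> R[i]) (M : R) :
  (forall n, square_integrable mu (w n)) ->
  (forall x, (fun n => complex.Re (w n x)) @ \oo --> complex.Re (f x)) ->
  (forall x, (fun n => complex.Im (w n x)) @ \oo --> complex.Im (f x)) ->
  (forall n, sqnorm mu (w n) <= M) ->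
  square_integrable mu f /\ sqnorm mu f <= M.
Proof.
move=> sw fr fi wM.
have mf : cmeas setT f by apply: cmeas_cvg fr fi => n; exact: (sw n).1.
have mn n : measurable_fun setT (fun x => (normc (w n x) ^+ 2)%:E).
  by apply/measurable_EFinP/measurable_funX/cmeas_normc; exact: (sw n).1.
have := @fatou _ _ _ mu setT measurableT (fun n x => (normc (w n x) ^+ 2)%:E) mn.
move=> /(_ ltac:(by move=> n x _; rewrite lee_fin exprn_ge0// normc_ge0)).
have -> : (fun x => limn_einf ((fun n x => (normc (w n x) ^+ 2)%:E) ^~ x)) =
    (fun x => (normc (f x) ^+ 2)%:E).
  apply/funext => x.
  have c : (fun n => (normc (w n x) ^+ 2)%:E) @ \oo --> (normc (f x) ^+ 2)%:E.
    by apply: cvg_EFin; [exact: nearW|exact: cvg_normc_sqr].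
  rewrite is_cvg_limn_einfE; last by apply/cvg_ex; exists (normc (f x) ^+ 2)%:E.
  exact/cvg_lim.
move=> le1.
have le2 : (\int[mu]_x (normc (f x) ^+ 2)%:E <= M%:E)%E.
  apply: le_trans le1 _; rewrite limn_einf_lim.
  apply: lime_le; first exact: is_cvg_einfs.
  apply: nearW => n; rewrite /einfs.
  apply: ge_ereal_inf; exists (\int[mu]_x (normc (w n x) ^+ 2)%:E)%E.
    by exists n => //=.
  by rewrite sqnorm_EFin// lee_fin.
have sf : square_integrable mu f.
  apply/square_integrableP; split => //; apply/integrableP; split.
    exact/measurable_EFinP/measurable_funX/cmeas_normc.
  under eq_integral do rewrite gee0_abs ?lee_fin ?exprn_ge0 ?normc_ge0//.
  by apply: le_lt_trans le2 _; rewrite ltry.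
by split => //; rewrite -lee_fin -sqnorm_EFin.
Qed.

(** Increments of norm at most 4^-n make the sum of the 4^n |u_(n+1) - u_n|^2
    integrable, hence finite almost everywhere, and there the increments are
    pointwise dominated by a geometric sequence. *)
Lemma L2_geometric_cvg (u : nat -> L2 mu) :
  (forall n, nrm (u n.+1 - u n) <= 4^-1 ^+ n) ->
  exists f : L2 mu, forall n, nrm (f - u n) <= 2 * 4^-1 ^+ n.
Proof.
move=> hu.
pose D n x : R[i] := u n.+1 x - u n x.
have su n : square_integrable mu (u n) by exact: L2_reprP.
have sD n : square_integrable mu (D n) by exact: square_integrableB.
have DE n : sqnorm mu (D n) <= 4^-1 ^+ n * 4^-1 ^+ n.
  by rewrite -nrmB_sqr expr2 ler_pM ?nrm_ge0.
pose G x := (\sum_(n <oo) (4 ^+ n * normc (D n x) ^+ 2)%:E)%E.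
have t0 n x : (0 <= (4 ^+ n * normc (D n x) ^+ 2)%:E :> \bar R)%E.
  by rewrite lee_fin mulr_ge0 ?exprn_ge0 ?normc_ge0.
have mt n : measurable_fun setT (fun x => (4 ^+ n * normc (D n x) ^+ 2)%:E).
  apply/measurable_EFinP; apply: measurable_funM => //.
  by apply/measurable_funX/cmeas_normc; exact: (sD n).1.
have mG : measurable_fun setT G.
  by apply: ge0_emeasurable_sum => // k x _ _; exact: t0.
have G0 x : (0 <= G x)%E by apply: nneseries_ge0 => n _ _; exact: t0.
have intG : (\int[mu]_x G x < +oo)%E.
  rewrite integral_nneseries//.
  apply: (@le_lt_trans _ _ (\sum_(n <oo) (4^-1 ^+ n)%:E)%E).
    apply: lee_nneseries => [n _ _|n _]; first by apply: integral_ge0.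
    have mD2 : measurable_fun setT (fun x => (normc (D n x) ^+ 2)%:E).
      by apply/measurable_EFinP/measurable_funX/cmeas_normc; exact: (sD n).1.
    have D20 x : setT x -> (0 <= (normc (D n x) ^+ 2)%:E)%E.
      by move=> _; rewrite lee_fin exprn_ge0 ?normc_ge0.
    have c0 : (0 <= (4 ^+ n : R)%:E)%E by rewrite lee_fin exprn_ge0.
    under eq_integral do rewrite EFinM.
    rewrite (ge0_integralZl mu measurableT mD2 D20 c0).
    rewrite sqnorm_EFin// -EFinM lee_fin.
    apply: le_trans (ler_wpM2l _ (DE n)) _; first by rewrite exprn_ge0.
    by rewrite mulrA -exprMn mulfV ?expr1n ?mul1r.
  have := @cvg_geometric_series R 1 4^-1 ltac:(rewrite ger0_norm ?invr_ge0// invf_lt1// ltr1n//).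
  move=> c; rewrite (_ : (\sum_(n <oo) _)%E = (1 * (1 - 4^-1)^-1)%:E) ?ltry//.
  apply/cvg_lim => //; apply: cvg_EFin; first by apply: nearW => n; rewrite sumEFin.
  apply: cvg_trans c; apply: near_eq_cvg; apply: nearW => n /=.
  rewrite sumEFin/= /series/=; apply: eq_bigr => i _; exact: mul1r.
pose A := [set x | (G x < +oo)%E].
have mA : measurable A.
  by rewrite -[A]setTI; exact: emeasurable_fun_infty_o.
have aeA : {ae mu, forall x, A x}.
  have : mu.-integrable setT G.
    apply/integrableP; split => //.
    by under eq_integral do rewrite gee0_abs//.
  move=> /integrable_ae => /(_ measurableT); apply: filterS => x /(_ I).
  by rewrite ge0_fin_numE.
(* truncated to A, the sequence converges at every point *)
pose w n x : R[i] := (\1_A x)%:C * u n x.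
have mw n : cmeas setT (w n).
  by apply: cmeasM; [apply: cmeas_real; exact: measurable_indic|exact: (su n).1].
have wu n : {ae mu, forall x, w n x = u n x}.
  by move: aeA; apply: filterS => x Ax; rewrite /w indicE mem_set// mul1r.
have sw n : square_integrable mu (w n).
  apply: (square_integrableM_bounded (M := 1)) => //.
    by apply: cmeas_real; exact: measurable_indic.
  move=> x; rewrite normc_real indicE; case: (_ \in _) => /=; rewrite ?normr1 ?normr0//.
have dw x : exists C, forall n, normc (w n.+1 x - w n x) <= C * 2^-1 ^+ n.
  rewrite /w indicE; have [Ax|nAx] := boolP (x \in A); last first.
    by exists 0 => n; rewrite /= !mul0r subrr normc0.
  have {}Ax : (G x < +oo)%E by move: Ax; rewrite inE.
  have Gf : G x \is a fin_num by rewrite ge0_fin_numE.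
  exists (Num.sqrt (fine (G x))) => n; rewrite !mul1r -/(D n x).
  have : 4 ^+ n * normc (D n x) ^+ 2 <= fine (G x).
    rewrite -lee_fin fineK// /G (@nneseriesD1 _ _ n)// leeDl//.
    by apply: nneseries_ge0 => k _ _; exact: t0.
  rewrite -(ler_sqrt _ (fine_ge0 (G0 x))) => h.
  have e : Num.sqrt (4 ^+ n * normc (D n x) ^+ 2) = 2 ^+ n * normc (D n x).
    rewrite (_ : 4 = 2 ^+ 2 :> R); last by rewrite -natrX.
    by rewrite exprAC -exprMn sqrtr_sqr ger0_norm// mulr_ge0 ?exprn_ge0 ?normc_ge0.
  by rewrite exprVn ler_pdivlMr ?exprn_gt0// mulrC -e.
have cr x : cvgn (fun n => complex.Re (w n x)).
  have [C hC] := dw x; apply: (@geometric_increments_cvg _ C) => n.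
  by apply: le_trans (hC n); apply: le_trans (normc_re _); rewrite ReD ReN.
have ci x : cvgn (fun n => complex.Im (w n x)).
  have [C hC] := dw x; apply: (@geometric_increments_cvg _ C) => n.
  by apply: le_trans (hC n); apply: le_trans (normc_im _); rewrite ImD ImN.
pose f x : R[i] := limn (fun n => complex.Re (w n x)) +i* limn (fun n => complex.Im (w n x)).
have nle n m : nrm (u (m + n)%N - u n) <= 2 * 4^-1 ^+ n - 2 * 4^-1 ^+ (m + n).
  elim: m => [|m IH].
    have : 0 <= 4^-1 ^+ n :> R by rewrite exprn_ge0// invr_ge0.
    rewrite add0n subrr nrm0; lra.
  rewrite addSn -(subrK (u (m + n)%N) (u (m + n).+1)) -addrA.
  apply: le_trans (nrmD _ _) _; apply: le_trans (lerD (hu _) IH) _.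
  rewrite exprS; have : 0 <= 4^-1 ^+ (m + n) :> R by rewrite exprn_ge0// invr_ge0.
  lra.
have key n : square_integrable mu (fun x => f x - w n x) /\
    sqnorm mu (fun x => f x - w n x) <= (2 * 4^-1 ^+ n) ^+ 2.
  apply: (@fatou_sqnorm (fun m x => w (m + n)%N x - w n x)).
  - by move=> m; exact: square_integrableB.
  - move=> x; rewrite ReD ReN; under eq_fun do rewrite ReD ReN.
    apply: cvgB; last exact: cvg_cst.
    by rewrite (cvg_shiftn n (fun k => complex.Re (w k x))); exact: cr.
  - move=> x; rewrite ImD ImN; under eq_fun do rewrite ImD ImN.
    apply: cvgB; last exact: cvg_cst.
    by rewrite (cvg_shiftn n (fun k => complex.Im (w k x))); exact: ci.
  - move=> m; rewrite (@ae_eq_sqnorm _ _ _ _ _ (fun x => u (m + n)%N x - u n x)).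
    + rewrite -nrmB_sqr ler_sqr ?nnegrE ?nrm_ge0 ?mulr_ge0 ?exprn_ge0 ?invr_ge0//.
      apply: le_trans (nle n m) _; rewrite gerBl mulr_ge0// exprn_ge0// invr_ge0.
    + exact: cmeasB.
    + by apply: cmeasB; [exact: (su _).1|exact: (su n).1].
    + by move: (wu (m + n)%N) (wu n); apply: filterS2 => x -> ->.
have sf : square_integrable mu f.
  have := square_integrableD (key 0%N).1 (sw 0%N).
  by under eq_fun do rewrite subrK.
exists (L2_class mu f) => n.
rewrite -(ler_pXn2r (_ : 0 < 2)%N) ?nnegrE ?nrm_ge0 ?mulr_ge0 ?exprn_ge0 ?invr_ge0//.
apply: le_trans (key n).2; rewrite nrmB_sqr le_eqVlt; apply/orP; left; apply/eqP.
apply: ae_eq_sqnorm.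
- by apply: cmeasB; exact: (L2_reprP _).1.
- exact: (key n).1.1.
- by move: (L2_classK sf) (wu n); apply: filterS2 => x -> ->.
Qed.

(** A Cauchy filter contains balls of radius 4^-(n+1) for all n, and the
    centres of such balls form a sequence with geometric increments. *)
Lemma L2_complete (F : set_system (L2 mu)) : ProperFilter F -> cauchy F -> cvg F.
Proof.
move=> FF /cauchyP cF.
have e0 n : 0 < ((4^-1 ^+ n.+1)%:C : R[i]).
  by rewrite ltcR exprn_gt0// invr_gt0.
have /choice[x xF] : forall n, exists x : L2 mu, F (ball x ((4^-1 ^+ n.+1)%:C : R[i])).
  by move=> n; exact: cF (e0 n).
have ballE (y z : L2 mu) (e : R) : ball y (e%:C : R[i]) z -> nrm (y - z) < e.
  by rewrite -ball_normE /ball_ /= nrm_normE ltcR.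
have [f fx] : exists f : L2 mu, forall n, nrm (f - x n) <= 2 * 4^-1 ^+ n.
  apply: L2_geometric_cvg => n.
  have [y [/ballE h1 /ballE h2]] := filter_ex (filterI (xF n) (xF n.+1)).
  rewrite -(subrK y (x n.+1)) -addrA; apply: le_trans (nrmD _ _) _.
  rewrite (nrmB y); have := ltW h1; have := ltW h2; rewrite !exprS.
  have : 0 <= 4^-1 ^+ n :> R by rewrite exprn_ge0// invr_ge0.
  lra.
apply/cvg_ex; exists f; apply/fcvg_ballP => e e0'.
have [eR eE epos] : exists2 r : R, e = r%:C & 0 < r.
  by move: e0'; rewrite ltcE => /andP[/eqP ei er]; exists (complex.Re e) => //;
    apply: complex_ext.
have [n ne] : exists n, 3 * 4^-1 ^+ n < eR.
  have : (fun n => 3 * 4^-1 ^+ n : R) @ \oo --> (0 : R).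
    rewrite -[X in _ --> X](mulr0 3); apply: cvgM; first exact: cvg_cst.
    by apply: cvg_expr; rewrite ger0_norm ?invr_ge0// invf_lt1// ltr1n.
  move=> /cvgr0_norm_lt/(_ _ epos) [N _ HN]; exists N.
  exact: le_lt_trans (ler_norm _) (HN N (leqnn N)).
apply: filterS (xF n) => y /ballE xy.
rewrite eE -ball_normE /ball_/= nrm_normE ltcR.
rewrite -(subrK (x n) f) -addrA; apply: le_lt_trans (nrmD _ _) _.
apply: le_lt_trans ne; apply: le_trans (lerD (fx n) (ltW xy)) _.
rewrite exprS; have : 0 <= 4^-1 ^+ n :> R by rewrite exprn_ge0// invr_ge0.
lra.
Qed.

HB.instance Definition _ := Uniform_isComplete.Build (L2 mu) L2_complete.

End Completeness.

(** * Orthogonal projections *)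

Section Projection.
Context d (T : measurableType d) (R : realType).
Variable mu : {measure set T -> \bar R}.

(** The minimising sequence of the distance to a closed subspace is Cauchy by
    the parallelogram identity. *)
Lemma L2_projection (S : set (L2 mu)) :
  S 0 -> (forall (c : R[i]) f g, S f -> S g -> S (c *: f + g)) ->
  (forall f, (forall e : R, 0 < e -> exists2 g, S g & nrm (f - g) < e) -> S f) ->
  forall f, exists2 g, S g & forall h, S h -> L2_inner (f - g) h = 0.
Proof.
move=> S0 Slin Scl f.
pose dist := [set nrm (f - g) ^+ 2 | g in S].
have hd : has_inf dist.
  split; first by exists (nrm (f - 0) ^+ 2), 0.
  by exists 0 => _ [g _ <-]; rewrite exprn_ge0 ?nrm_ge0.
pose D := inf dist.
have Dle g : S g -> D <= nrm (f - g) ^+ 2.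
  by move=> Sg; apply: ge_inf; [exact: hd.2|exists g].
(* the errors are such that the increments of g are at most 4^-n *)
have /choice[g gP] : forall n, exists g, S g /\ nrm (f - g) ^+ 2 <= D + 8^-1 * 16^-1 ^+ n.
  move=> n; have e0 : 0 < 8^-1 * 16^-1 ^+ n :> R by rewrite mulr_gt0 ?exprn_gt0 ?invr_gt0.
  have [_ [g Sg <-] lg] := inf_adherent e0 hd.
  by exists g; split => //; exact: ltW.
have SB u v : S u -> S v -> S (2^-1 *: u + 2^-1 *: v).
  move=> Su Sv; rewrite -[2^-1 *: v]addr0; apply: (Slin _ _ _ Su).
  exact: (Slin _ _ _ Sv S0).
have mid u v : nrm (u - v) ^+ 2 = 2 * nrm (f - u) ^+ 2 + 2 * nrm (f - v) ^+ 2
    - 4 * nrm (f - (2^-1 *: u + 2^-1 *: v)) ^+ 2.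
  have e := parallelogram (f - v) (f - u).
  have e1 : f - v - (f - u) = u - v := subr_subl f u v.
  have e2 : f - v + (f - u) = _ := addr_midpoint f u v.
  move: e; rewrite e1 e2 nrmZ exprMn normc_nat => ->.
  by ring.
have [l lP] : exists l : L2 mu, forall n, nrm (l - g n) <= 2 * 4^-1 ^+ n.
  apply: L2_geometric_cvg => n.
  rewrite -(ler_pXn2r (_ : 0 < 2)%N) ?nnegrE ?nrm_ge0 ?exprn_ge0 ?invr_ge0//.
  rewrite mid; have [S1 h1] := gP n; have [S2 h2] := gP n.+1.
  have h3 := Dle _ (SB _ _ S2 S1).
  rewrite -exprM mulnC exprM (_ : 4^-1 ^+ 2 = 16^-1 :> R); last by rewrite exprVn -natrX.
  move: h2; rewrite (exprS 16^-1 n); have : 0 <= 16^-1 ^+ n :> R by rewrite exprn_ge0// invr_ge0.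
  move: h1 h3; lra.
have small (e : R) : 0 < e -> exists n, 2 * 4^-1 ^+ n < e.
  move=> e0; have : (fun n => 2 * 4^-1 ^+ n : R) @ \oo --> (0 : R).
    rewrite -[X in _ --> X](mulr0 2); apply: cvgM; first exact: cvg_cst.
    by apply: cvg_expr; rewrite ger0_norm ?invr_ge0// invf_lt1// ltr1n.
  move=> /cvgr0_norm_lt/(_ _ e0) [N _ HN]; exists N.
  exact: le_lt_trans (ler_norm _) (HN N (leqnn N)).
have Sl : S l.
  apply: Scl => e e0; have [n ne] := small e e0; exists (g n); first exact: (gP n).1.
  exact: le_lt_trans (lP n) ne.
have lD : nrm (f - l) ^+ 2 <= D.
  have D0 : 0 <= D by apply: lb_le_inf; [exact: hd.1|move=> _ [u _ <-]; rewrite exprn_ge0 ?nrm_ge0].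
  rewrite -(sqr_sqrtr D0) ler_sqr ?nnegrE ?nrm_ge0 ?sqrtr_ge0//.
  apply/ler_addgt0Pr => e e0.
  have [n ne] := small (e / 2) ltac:(by rewrite divr_gt0).
  have := nrmD (f - g n) (g n - l); rewrite (subrKA (g n) f (- l)) => /le_trans; apply.
  have h1 : nrm (f - g n) <= Num.sqrt D + 4^-1 ^+ n.
    rewrite -(ler_pXn2r (_ : 0 < 2)%N) ?nnegrE ?nrm_ge0 ?addr_ge0 ?sqrtr_ge0 ?exprn_ge0 ?invr_ge0//.
    apply: le_trans (gP n).2 _; rewrite sqrrD sqr_sqrtr// -addrA lerD2l.
    rewrite -exprM mulnC exprM (_ : 4^-1 ^+ 2 = 16^-1 :> R); last by rewrite exprVn -natrX.
    have := sqrtr_ge0 D; have : 0 <= 16^-1 ^+ n :> R by rewrite exprn_ge0// invr_ge0.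
    have : 0 <= 4^-1 ^+ n :> R by rewrite exprn_ge0// invr_ge0.
    nra.
  have h2 := lP n; rewrite nrmB in h2.
  have : 0 <= 4^-1 ^+ n :> R by rewrite exprn_ge0// invr_ge0.
  move: h1 h2 ne; lra.
exists l => // h Sh.
apply/eqP/negPn/negP => c0; set c := L2_inner (f - l) h in c0.
have cp : 0 < normc c ^+ 2 by rewrite exprn_gt0// normc_gt0.
(* if c were nonzero, the step s c in the direction h would bring l closer to
   f *)
pose s : R := (nrm h ^+ 2 + 1)^-1.
have s0 : 0 < s by rewrite invr_gt0 ltr_wpDl ?exprn_ge0 ?nrm_ge0.
have := Dle _ (Slin (s%:C * c) _ _ Sh Sl).
rewrite subr_comb nrmD_sqr nrmZ innerZr -/c normcN normcM normc_real (gtr0_norm s0).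
have -> : complex.Re (conjc (- (s%:C * c)) * c) = - (s * normc c ^+ 2).
  rewrite conjcN conjcM conjc_real mulNr -mulrA [conjc c * c]mulrC mulc_conj.
  by rewrite -rmorphM ReN.
move=> /le_trans/(_ (lerD (lerD lD (lexx _)) (lexx _))).
rewrite -[X in X <= _]addr0 -addrA lerD2l exprMn exprMn.
apply/negP; rewrite -ltNge.
have -> : 2 * - (s * normc c ^+ 2) + s ^+ 2 * normc c ^+ 2 * nrm h ^+ 2 =
  - (s * normc c ^+ 2) * (2 - s * nrm h ^+ 2) by ring.
have h0 : 0 <= nrm h ^+ 2 by rewrite exprn_ge0 ?nrm_ge0.
have h1 : s * nrm h ^+ 2 < 2 by rewrite /s mulrC ltr_pdivrMr; lra.
by rewrite mulNr oppr_lt0; apply: mulr_gt0; [exact: mulr_gt0|rewrite subr_gt0].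
Qed.

End Projection.

Section LinearMaps.
Context (K : pzRingType) (V W : lmodType K).
Implicit Types (f : V -> W).

Lemma lin0 f : linear f -> f 0 = 0.
Proof. by move=> lf; have := lf (-1) 0 0; rewrite scaler0 addr0 scaleN1r addNr. Qed.

Lemma lin_sum f I (s : seq I) (c : I -> K) (u : I -> V) : linear f ->
  f (\sum_(i <- s) c i *: u i) = \sum_(i <- s) c i *: f (u i).
Proof.
move=> lf; elim: s => [|i s IH]; first by rewrite !big_nil lin0.
by rewrite !big_cons lf IH.
Qed.

End LinearMaps.

Section OrthogonalProjection.
Context d (T : measurableType d) (R : realType).
Variable mu : {measure set T -> \bar R}.
Implicit Types (f g h : L2 mu) (S : set (L2 mu)).

(** Closedness is stated by approximation, the form in which it is both proved
    for the Hardy space and used for the projection. *)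
Definition closed_subspace S := [/\ S 0,
  forall (c : R[i]) f g, S f -> S g -> S (c *: f + g) &
  forall f, (forall e : R, 0 < e -> exists2 g, S g & nrm (f - g) < e) -> S f].

Variables (S : set (L2 mu)) (clS : closed_subspace S).

Lemma orth_projP f : S (orth_proj S f) /\
  forall h, S h -> L2_inner (f - orth_proj S f) h = 0.
Proof.
have [S0 Sl Sc] := clS; have [g Sg gP] := L2_projection S0 Sl Sc f.
rewrite /orth_proj.
by case: xgetP => [y -> []//|/(_ g)]; case; split.
Qed.

Lemma orth_proj_uniq f g : S g -> (forall h, S h -> L2_inner (f - g) h = 0) ->
  orth_proj S f = g.
Proof.
move=> Sg go; have [Sp po] := orth_projP f; set p := orth_proj S f in Sp po *.
have [S0 Sl Sc] := clS.
have Spg : S (p - g).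
  by rewrite -[p - g]/(p + - g) addrC -scaleN1r; exact: Sl.
have : L2_inner (p - g) (p - g) = 0.
  have e : p - g = (f - g) - (f - p) := esym (subr_subl f p g).
  by rewrite {1}e innerBl go// po// subrr.
rewrite inner_self => -[/eqP]; rewrite sqrf_eq0 => /eqP/nrm_eq0 e.
by apply/eqP; rewrite -subr_eq0 e.
Qed.

Lemma orth_proj_id f : S f -> orth_proj S f = f.
Proof. by move=> Sf; apply: orth_proj_uniq => // h _; rewrite subrr inner0l. Qed.

Lemma orth_proj_linear : linear (orth_proj S).
Proof.
move=> c f g; have [Sf fo] := orth_projP f; have [Sg go] := orth_projP g.
apply: orth_proj_uniq; first by have [_ Sl _] := clS; exact: Sl.
move=> h Sh.
have ef : L2_inner f h = L2_inner (orth_proj S f) h.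
  by apply/eqP; rewrite -subr_eq0 -innerBl fo.
have eg : L2_inner g h = L2_inner (orth_proj S g) h.
  by apply/eqP; rewrite -subr_eq0 -innerBl go.
by rewrite innerBl !innerDl !innerZl ef eg subrr.
Qed.

Lemma nrm_proj_sqr f :
  nrm f ^+ 2 = nrm (f - orth_proj S f) ^+ 2 + nrm (orth_proj S f) ^+ 2.
Proof.
have [Sf fo] := orth_projP f; have := nrmD_sqr (f - orth_proj S f) (orth_proj S f).
by rewrite subrK fo// mulr0 addr0.
Qed.

Lemma nrm_proj_le f : nrm (orth_proj S f) <= nrm f.
Proof.
by rewrite -ler_sqr ?nnegrE ?nrm_ge0// (nrm_proj_sqr f) lerDr exprn_ge0// nrm_ge0.
Qed.

Lemma nrm_coproj_le f : nrm (f - orth_proj S f) <= nrm f.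
Proof.
by rewrite -ler_sqr ?nnegrE ?nrm_ge0// (nrm_proj_sqr f) lerDl exprn_ge0// nrm_ge0.
Qed.

End OrthogonalProjection.

(** * Multiplication operators *)

Section MultiplicationOperator.
Context d (T : measurableType d) (R : realType).
Variable mu : {measure set T -> \bar R}.
Variables (u : T -> R[i]) (M : R).
Hypotheses (mu_ : cmeas setT u) (M0 : 0 <= M)
  (uM : forall x, normc (u x) <= M).

Let sq (f : L2 mu) : square_integrable mu (fun x => u x * f x).
Proof. exact: (square_integrableM_bounded mu_ uM (L2_reprP f)). Qed.

Lemma mult_opE (f : L2 mu) : {ae mu, forall x, mult_op u f x = u x * f x}.
Proof. exact: L2_classK. Qed.

Lemma mult_op_linear : linear (@mult_op _ _ _ mu u).
Proof.
move=> c f g; apply: L2_eqP.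
have := ae_and (ae_and (mult_opE (c *: f + g)) (ae_and (L2_addE (c *: f) g) (L2_scaleE c f)))
  (ae_and (ae_and (L2_addE (c *: mult_op u f) (mult_op u g)) (L2_scaleE c (mult_op u f)))
    (ae_and (mult_opE f) (mult_opE g))).
apply: filterS => x /= [[-> [-> ->]] [[-> ->] [-> ->]]].
by rewrite mulrDr mulrCA.
Qed.

Lemma nrm_mult_op (f : L2 mu) : nrm (mult_op u f) <= M * nrm f.
Proof.
rewrite !nrmE -[M](ger0_norm M0) -sqrtr_sqr -sqrtrM ?sqr_ge0// ler_sqrt ?mulr_ge0 ?sqr_ge0 ?sqnorm_ge0//.
have -> : sqnorm mu (mult_op u f) = sqnorm mu (fun x => u x * f x).
  by apply: ae_eq_sqnorm; [exact: (L2_reprP _).1|exact: (sq f).1|exact: mult_opE].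
apply: le_sqnorm => //; first exact: L2_reprP.
by move=> x; rewrite normcM ler_wpM2r ?normc_ge0.
Qed.

End MultiplicationOperator.

(** * Compactness and singular values *)

Section TotallyBounded.
Context d (T : measurableType d) (R : realType).
Variable mu : {measure set T -> \bar R}.
Implicit Types (f g h : L2 mu) (A B : set (L2 mu)).

Definition totally_bounded A := forall e : R, 0 < e ->
  exists (n : nat) (s : nat -> L2 mu),
    forall f, A f -> exists2 i, (i < n)%N & nrm (f - s i) < e.

Lemma totally_bounded_sub A B : A `<=` B -> totally_bounded B -> totally_bounded A.
Proof.
by move=> AB tB e /tB [n [s h]]; exists n, s => f /AB /h.
Qed.

Lemma totally_boundedD A B : totally_bounded A -> totally_bounded B ->
  totally_bounded [set h | exists f g, [/\ A f, B g & h = f + g]].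
Proof.
move=> tA tB e e0; have e2 : 0 < e / 2 by rewrite divr_gt0.
have [n [s hs]] := tA _ e2; have [m [t ht]] := tB _ e2.
(* the index k encodes the pair of its remainder and quotient by n *)
exists (m * n)%N, (fun k => s (k %% n)%N + t (k %/ n)%N) => h [f [g [Af Bg ->]]].
have [i ni fi] := hs _ Af; have [j mj gj] := ht _ Bg.
have n0 : (0 < n)%N by apply: leq_ltn_trans ni.
exists (j * n + i)%N.
  by apply: (@leq_trans (j.+1 * n)%N); rewrite ?leq_mul2r ?mj ?orbT// mulSn addnC ltn_add2r.
rewrite modnMDl modn_small// divnMDl// divn_small// addn0.
have e1 : f + g - (s i + t j) = (f - s i) + (g - t j).
  by rewrite opprD; exact: addrACA.
rewrite e1; apply: le_lt_trans (nrmD _ _) _.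
by rewrite (splitr e) ltrD.
Qed.

Lemma near_grid (M x : R) (N : nat) : 0 <= M -> (0 < N)%N -> `|x| <= M ->
  exists2 k, (k < (Num.truncn (2 * M * N%:R)).+1)%N & `|x - (k%:R / N%:R - M)| <= N%:R^-1.
Proof.
move=> M0 N0 xM; have NR : 0 < N%:R :> R by rewrite ltr0n.
have xM0 : 0 <= (x + M) * N%:R.
  by rewrite mulr_ge0 ?ler0n//; move: xM; rewrite ler_norml => /andP[]; lra.
have /andP[k1 k2] := truncn_itv xM0; set k := Num.truncn _ in k1 k2.
exists k.
  rewrite ltnS; apply: le_truncn; rewrite ler_pM2r//.
  by move: xM; rewrite ler_norml => /andP[]; lra.
have -> : x - (k%:R / N%:R - M) = ((x + M) * N%:R - k%:R) / N%:R by field; rewrite lt0r_neq0.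
rewrite normrM (ger0_norm (_ : 0 <= N%:R^-1)) ?invr_ge0 ?ler0n//.
rewrite -[leRHS]mul1r ler_pM2r ?invr_gt0// ger0_norm ?subr_ge0//.
by move: k2; rewrite -natr1; lra.
Qed.

Lemma totally_bounded_line (t : L2 mu) (M : R) : 0 <= M ->
  totally_bounded [set h | exists2 c : R[i], normc c <= M & h = c *: t].
Proof.
move=> M0 e e0; have t0 := nrm_ge0 t.
pose N := (Num.truncn (2 * (nrm t + 1) / e)).+1.
have N0 : (0 < N)%N by [].
have NR : 0 < N%:R :> R by rewrite ltr0n.
have Ne : 2 * N%:R^-1 * nrm t < e.
  have : 2 * (nrm t + 1) / e < N%:R by apply: truncnS_gt.
  rewrite ltr_pdivrMr// => h.
  rewrite mulrAC ltr_pdivrMr// [e * _]mulrC; lra.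
pose K := (Num.truncn (2 * M * N%:R)).+1.
exists (K * K)%N, (fun k => (((k %% K)%:R / N%:R - M) +i* ((k %/ K)%:R / N%:R - M)) *: t).
move=> h [c cM ->].
have [i iK hi] := near_grid M0 N0 (le_trans (normc_re c) cM).
have [j jK hj] := near_grid M0 N0 (le_trans (normc_im c) cM).
exists (j * K + i)%N.
  by apply: (@leq_trans (j.+1 * K)%N); rewrite ?leq_mul2r ?jK ?orbT// mulSn addnC ltn_add2r.
rewrite modnMDl modn_small// divnMDl// divn_small// addn0.
set z := (_ +i* _).
have e1 : c *: t - z *: t = (c - z) *: t by rewrite scalerBl.
rewrite e1 nrmZ; apply: le_lt_trans Ne; apply: ler_wpM2r => //.
apply: le_trans (normc_le_reim _) _; rewrite ReD ImD ReN ImN /=.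
by rewrite [leRHS](_ : _ = N%:R^-1 + N%:R^-1); [exact: lerD|ring].
Qed.

(** In a complete space it is enough that an ultrafilter containing A be
    Cauchy, and it contains one of finitely many small balls covering A. *)
Lemma totally_bounded_precompact A : totally_bounded A -> precompact A.
Proof.
move=> tA; rewrite precompactE compact_ultra => F UF FA.
have cF : cauchy F.
  apply/cauchyP => e e0.
  have [eR eE epos] : exists2 r : R, e = r%:C & 0 < r.
    move: e0; rewrite ltcE => /andP[/eqP ei er]; exists (complex.Re e) => //.
    exact: complex_ext.
  have [n [s hs]] := tA _ (divr_gt0 epos (ltr0n R 2)).
  have : F (\bigcup_(i in `I_n) (ball (s i) e : set (L2 mu))).
    apply: filterS FA => f Af.
    have eh : 0 < ((eR / 2)%:C : R[i]) by rewrite ltcR divr_gt0.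
    have [g [Ag fg]] := Af _ (nbhsx_ballx f _ eh).
    have [i ni gi] := hs _ Ag; exists i => //.
    move: fg; rewrite eE -!ball_normE /ball_/= !nrm_normE !ltcR => fg.
    rewrite -(subrK g (s i)) -addrA; apply: le_lt_trans (nrmD _ _) _.
    by rewrite (splitr eR) ltrD// nrmB.
  elim: n {hs} => [|n IH]; first by rewrite II0 bigcup_set0 => /filter_ex [].
  rewrite IIS bigcup_setU bigcup_set1 => FU.
  have [Fs|] := pselect (F (ball (s n) e)); first by exists (s n).
  move=> nFs; apply: IH.
  have [//|] := in_ultra_setVsetC (ball (s n) e : set (L2 mu)) UF.
  by move=> FC; apply: filterS2 FU FC => f [].
have /cvg_ex[l Fl] : cvg F by exact: cauchy_cvg.
exists l; split => //.
have := @closed_closure _ A; rewrite closure_id => {1}->.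
by move=> B Bl; have [x []] := filter_ex (filterI FA (Fl _ Bl)); exists x.
Qed.

End TotallyBounded.

Section Approximation.
Context d (T : measurableType d) (R : realType).
Variable mu : {measure set T -> \bar R}.
Implicit Types (f g h : L2 mu) (K : L2 mu -> L2 mu).

Local Notation unit_ball := [set f : L2 mu | nrm f <= 1].

(** A bounded map vanishing where a linear form vanishes has its values on a
    line. *)
Lemma totally_bounded_rank1 (t : L2 mu -> L2 mu) (c : L2 mu -> R[i]) (M : R) :
  0 <= M -> linear t -> (forall (a : R[i]) f g, c (a *: f + g) = a * c f + c g) ->
  (forall f, nrm (t f) <= M * nrm f) -> (forall f, c f = 0 -> t f = 0) ->
  totally_bounded (t @` unit_ball).
Proof.
move=> M0 lt lc tM ct.
have [[f0 tf0]|t0] := pselect (exists f, t f <> 0); last first.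
  apply: (totally_bounded_sub _ (totally_bounded_line (0 : L2 mu) M0)).
  move=> _ [f _ <-]; exists 0; first by rewrite normc0.
  by rewrite scaler0; apply: contrapT => h; apply: t0; exists f.
have cf0 : c f0 != 0 by apply/eqP => /ct.
have nt0 : 0 < nrm (t f0).
  by rewrite lt_def nrm_ge0 andbT; apply/eqP => /nrm_eq0.
apply: (totally_bounded_sub _ (totally_bounded_line (t f0)
  (divr_ge0 M0 (ltW nt0)))).
move=> _ [f /= f1 <-].
have e : t f = (c f / c f0) *: t f0.
  have h : t ((- (c f / c f0)) *: f0 + f) = 0.
    by apply: ct; rewrite lc mulNr divfK// addNr.
  move: h; rewrite lt scaleNr => /eqP; rewrite addrC subr_eq0 => /eqP //.
exists (c f / c f0) => //.
rewrite ler_pdivlMr// -nrmZ -e; apply: le_trans (tM f) _.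
by rewrite -[leRHS]mulr1 ler_wpM2l.
Qed.

Lemma totally_bounded_rank n (t : 'I_n -> L2 mu -> L2 mu)
    (c : 'I_n -> L2 mu -> R[i]) (M : R) : 0 <= M ->
  (forall i, linear (t i)) ->
  (forall i (a : R[i]) f g, c i (a *: f + g) = a * c i f + c i g) ->
  (forall i f, nrm (t i f) <= M * nrm f) ->
  (forall i f, c i f = 0 -> t i f = 0) ->
  totally_bounded ((fun f => \sum_(i < n) t i f) @` unit_ball).
Proof.
move=> M0; elim: n t c => [|n IH] t c lt lc tM ct.
  apply: (totally_bounded_sub _ (totally_bounded_line (0 : L2 mu) M0)).
  move=> _ [f _ <-]; exists 0; first by rewrite normc0.
  by rewrite big_ord0 scaler0.
have t1 := IH (fun i => t (widen_ord (leqnSn n) i)) (fun i => c (widen_ord (leqnSn n) i))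
  (fun i => lt _) (fun i => lc _) (fun i => tM _) (fun i => ct _).
have t2 := totally_bounded_rank1 M0 (lt ord_max) (lc ord_max) (tM ord_max) (ct ord_max).
apply: (totally_bounded_sub _ (totally_boundedD t1 t2)) => _ [f f1 <-].
exists (\sum_(i < n) t (widen_ord (leqnSn n) i) f), (t ord_max f).
split; [by exists f|by exists f|exact: big_ord_recr].
Qed.

(** A norm limit of maps with totally bounded image of the unit ball has the
    same property; the approximating maps need not be linear. *)
Lemma compact_op_approx K : linear K ->
  (forall e : R, 0 < e -> exists t : L2 mu -> L2 mu,
    totally_bounded (t @` unit_ball) /\ forall f, nrm (K f - t f) <= e * nrm f) ->
  compact_op K.
Proof.
move=> lK h; split => //; apply: totally_bounded_precompact => e e0.
have e2 : 0 < e / 2 by rewrite divr_gt0.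
have [t [tb Kt]] := h _ e2; have [n [s hs]] := tb _ e2.
exists n, s => _ [f f1 <-].
have {}f1 : nrm f <= 1 by rewrite -lecR -nrm_normE.
have [i ni fi] := hs (t f) (ex_intro2 _ _ f f1 erefl); exists i => //.
rewrite -(subrK (t f) (K f)) -addrA; apply: le_lt_trans (nrmD _ _) _.
rewrite (splitr e) ler_ltD//; apply: le_trans (Kt f) _.
by rewrite -[leRHS]mulr1 ler_wpM2l// ltW.
Qed.

End Approximation.

Section SingularValues.
Context d (T : measurableType d) (R : realType).
Variable mu : {measure set T -> \bar R}.
Implicit Types (f g h : L2 mu) (K : L2 mu -> L2 mu).

Lemma exists_kernel_vector n (A : 'M[R[i]]_(n.+1, n)) :
  exists2 a : 'rV[R[i]]_n.+1, a != 0 & a *m A = 0.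
Proof.
have /rowV0Pn[a /sub_kermxP aA a0] : kermx A != 0.
  by rewrite kermx_eq0 /row_free neq_ltn ltnS rank_leq_col.
by exists a.
Qed.

Lemma inner_sumr I (s : seq I) (F : I -> L2 mu) h :
  L2_inner h (\sum_(i <- s) F i) = \sum_(i <- s) L2_inner h (F i).
Proof.
elim: s => [|i s IH]; first by rewrite !big_nil inner_conj inner0l conjc0.
by rewrite !big_cons innerDr IH.
Qed.

(** An orthonormal family of n + 1 eigenvectors of K^* K spans a space that
    meets the common kernel of n linear forms in a nonzero vector, on which K
    expands by at least the smallest of the n + 1 singular values. *)
Lemma singular_value_le K (n : nat) (c : 'I_n -> L2 mu -> R[i]) (eps : R) :
  linear K -> (forall i (a : R[i]) f g, c i (a *: f + g) = a * c i f + c i g) ->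
  0 <= eps ->
  (forall f, (forall i, c i f = 0) -> nrm (K f) <= eps * nrm f) ->
  0 <= singular_value K n <= eps.
Proof.
move=> lK lc eps0 Keps; rewrite /singular_value; set S := [set s : R | _].
suff Sle : ubound S eps.
  have [[s Ss]|S0] := pselect (S !=set0); last first.
    have e : S = set0 by apply/seteqP; split => // s Ss; case: S0; exists s.
    by rewrite e sup0 lexx.
  apply/andP; split.
    by apply: le_trans Ss.1 _; apply: ub_le_sup => //; exists eps.
  by apply: ge_sup => //; exists s.
move=> s [s0 [e [l [eo el]]]].
have [->//|sn0] := eqVneq s 0.
have {}s0 : 0 < s by rewrite lt_def sn0.
have lpos i : 0 < l i ^+ 2.
  by rewrite exprn_gt0//; apply: lt_le_trans s0 (el i).1.
have nei i : nrm (e i) = 1.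
  have := eo i i; rewrite inner_self eqxx => -[h].
  by apply/eqP; rewrite -(@eqrXn2 _ 2) ?nrm_ge0// h expr1n.
have adj i f : L2_inner (K f) (K (e i)) = (l i ^+ 2)%:C * L2_inner f (e i).
  have := (el i).2; rewrite /adjoint; case: xgetP => [y -> /= hy e2|_ e2].
    by rewrite hy e2 innerZr conjc_real.
  have := nrmZ ((l i ^+ 2)%:C) (e i); rewrite -e2 nrm0 nei normc_real.
  by rewrite mulr1 => /esym/eqP; rewrite normr_eq0 gt_eqF.
pose A : 'M[R[i]]_(n.+1, n) := \matrix_(i, j) c j (e i).
have [a a0 aA] := exists_kernel_vector A.
pose v : L2 mu := \sum_(i < n.+1) a 0 i *: e i.
have lcsum j (r : seq 'I_n.+1) :
    c j (\sum_(i <- r) a 0 i *: e i) = \sum_(i <- r) a 0 i * c j (e i).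
  elim: r => [|i r IH]; last by rewrite !big_cons lc IH.
  rewrite !big_nil; have := lc j (-1) 0 0.
  by rewrite scaler0 addr0 mulN1r addNr.
have cv j : c j v = 0.
  rewrite lcsum; have := congr1 (fun B : 'rV__ => B 0 j) aA; rewrite !mxE => h.
  by rewrite -[RHS]h; apply: eq_bigr => i _; rewrite mxE.
have ve j : L2_inner v (e j) = a 0 j.
  rewrite inner_suml (bigD1 j)//= innerZl eo eqxx mulr1 big1 ?addr0// => i ij.
  by rewrite innerZl eo (negbTE ij) mulr0.
have nv : nrm v ^+ 2 = \sum_(j < n.+1) normc (a 0 j) ^+ 2.
  apply: complexI; rewrite -inner_self {2}/v inner_sumr rmorph_sum/=.
  by apply: eq_bigr => j _; rewrite innerZr ve mulrC mulc_conj.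
have nKv : nrm (K v) ^+ 2 = \sum_(j < n.+1) l j ^+ 2 * normc (a 0 j) ^+ 2.
  have Kv : K v = \sum_(j < n.+1) a 0 j *: K (e j) by exact: lin_sum.
  apply: complexI; rewrite -inner_self {2}Kv inner_sumr rmorph_sum/=.
  apply: eq_bigr => j _; rewrite innerZr adj ve mulrCA [conjc _ * _]mulrC mulc_conj.
  exact/esym/rmorphM.
have v0 : 0 < nrm v.
  rewrite lt_def nrm_ge0 andbT -sqrf_eq0 nv gt_eqF//.
  have /rV0Pn[j aj] := a0.
  rewrite (bigD1 j)//= ltr_wpDr ?sumr_ge0//; last by rewrite exprn_gt0// normc_gt0.
  by move=> i _; rewrite exprn_ge0 ?normc_ge0.
have : s * nrm v <= nrm (K v).
  rewrite -ler_sqr ?nnegrE ?nrm_ge0 ?mulr_ge0 ?nrm_ge0 ?(ltW s0)//.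
  rewrite exprMn nKv nv mulr_sumr; apply: ler_sum => j _.
  rewrite ler_wpM2r ?exprn_ge0 ?normc_ge0// ler_sqr ?nnegrE ?(ltW s0) ?(el j).1//.
  exact: le_trans (ltW s0) (el j).1.
by move=> /le_trans/(_ (Keps _ cv)); rewrite ler_pM2r.
Qed.

End SingularValues.

(** * Complex differentiability *)

Section ComplexDifferentiability.
Variable R : realType.
Implicit Types (F G : R[i] -> R[i]) (z w p : R[i]).

Definition cderiv F z := derivable (F : R[i]^o -> R[i]^o) z 1.

Definition ccont F z := forall e : R, 0 < e -> exists2 dl : R, 0 < dl &
  forall w, normc (w - z) < dl -> normc (F w - F z) <= e.

(** The weak inequality includes w = z and does away with the quotient of the
    definition of the derivative. *)
Definition cdiff F z := exists L : R[i], forall e : R, 0 < e ->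
  exists2 dl : R, 0 < dl &
  forall w, normc (w - z) < dl -> normc (F w - F z - L * (w - z)) <= e * normc (w - z).

Lemma cpos_real (e : R[i]) : 0 < e -> exists2 r : R, e = r%:C & 0 < r.
Proof.
rewrite ltcE => /andP[/eqP ei er]; exists (complex.Re e) => //.
exact: complex_ext.
Qed.

Lemma cderivP F z : cderiv F z <-> cdiff F z.
Proof.
split=> [/cvg_ex[L /cvgrPdist_le /= FL]|[L FL]].
  exists L => e e0; have eC : 0 < (e%:C : R[i]) by rewrite ltcR.
  have [dC /= /cpos_real[dl -> dl0] Hd] := FL _ eC.
  exists dl => // w wz; have [->|wz0] := eqVneq w z.
    by rewrite !subrr mulr0 subr0 normc0 mulr0.
  have h0 : w - z != 0 by rewrite subr_eq0.
  have := Hd (w - z); rewrite /= sub0r normrN normc_normrE ltcR => /(_ wz h0).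
  rewrite [_%:A]mulr1 subrK normc_normrE lecR => H.
  have -> : F w - F z - L * (w - z) =
    - ((L - (w - z)^-1 * (F w - F z)) * (w - z)) by field.
  by rewrite normcN normcM ler_wpM2r ?normc_ge0.
apply/cvg_ex; exists L; apply/cvgrPdist_le => /= _ /cpos_real[e -> e0].
have [dl dl0 H] := FL _ e0.
exists (dl%:C) => /=; first by rewrite ltcR.
move=> h /=; rewrite sub0r normrN normc_normrE ltcR => hd h0.
rewrite normc_normrE lecR [_%:A]mulr1.
have := H (h + z); rewrite addrK => /(_ hd).
have hn : 0 < normc h by rewrite normc_gt0.
rewrite -ler_pdivrMr//; apply: le_trans.
rewrite -normc_div [X in _ <= normc X](_ : _ = - (L - h^-1 *: (F (h + z) - F z))).
  by rewrite normcN.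
by rewrite /GRing.scale /=; field.
Qed.

Lemma cdiff_cont F z : cdiff F z -> ccont F z.
Proof.
move=> [L FL] e e0; have [dl dl0 H] := FL 1 ltr01.
have q0 : 0 < 1 + normc L by rewrite ltr_pwDl ?normc_ge0.
exists (Num.min dl (e / (1 + normc L))); first by rewrite lt_min dl0 divr_gt0.
move=> w; rewrite lt_min => /andP[w1 w2].
have := H _ w1; rewrite mul1r => H1.
have -> : F w - F z = (F w - F z - L * (w - z)) + L * (w - z) by rewrite subrK.
apply: le_trans (le_normcD _ _) _; rewrite normcM.
move: w2; rewrite ltr_pdivlMr// => /ltW; apply: le_trans.
by rewrite [leRHS]mulrDr mulr1 [normc L * _]mulrC lerD2r.
Qed.

Lemma cderiv_cst c z : cderiv (fun=> c) z.
Proof. exact: (@derivable_cst _ R[i]^o R[i]^o c z 1). Qed.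

Lemma cderiv_id z : cderiv id z.
Proof. exact: (@derivable_id _ R[i]^o z 1). Qed.

Lemma cderivD F G z : cderiv F z -> cderiv G z -> cderiv (fun w => F w + G w) z.
Proof. exact: (@derivableD _ R[i]^o R[i]^o F G z 1). Qed.

Lemma cderivN F z : cderiv F z -> cderiv (fun w => - F w) z.
Proof. exact: (@derivableN _ R[i]^o R[i]^o F z 1). Qed.

Lemma cderivB F G z : cderiv F z -> cderiv G z -> cderiv (fun w => F w - G w) z.
Proof. by move=> dF dG; exact/cderivD/cderivN. Qed.

Lemma cderivM F G z : cderiv F z -> cderiv G z -> cderiv (fun w => F w * G w) z.
Proof. exact: (@derivableM _ R[i]^o F G z 1). Qed.

Lemma cderivV F z : F z != 0 -> cderiv F z -> cderiv (fun w => (F w)^-1) z.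
Proof. exact: (@derivableV _ R[i]^o F z 1). Qed.

Lemma cdiff_inv a z : z != a -> cdiff (fun w => (w - a)^-1) z.
Proof.
move=> za; apply/cderivP; apply: cderivV; first by rewrite subr_eq0.
by apply: cderivB; [exact: cderiv_id|exact: cderiv_cst].
Qed.

Lemma cdiffM F G z : cdiff F z -> cdiff G z -> cdiff (fun w => F w * G w) z.
Proof. by rewrite -!cderivP; exact: cderivM. Qed.

Lemma cdiffD F G z : cdiff F z -> cdiff G z -> cdiff (fun w => F w + G w) z.
Proof. by rewrite -!cderivP; exact: cderivD. Qed.

Lemma cdiffB F G z : cdiff F z -> cdiff G z -> cdiff (fun w => F w - G w) z.
Proof. by rewrite -!cderivP; exact: cderivB. Qed.

Lemma cdiff_cst c z : cdiff (fun=> c) z.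
Proof. by rewrite -cderivP; exact: cderiv_cst. Qed.

Lemma cdiff_near F G z (r : R) : 0 < r ->
  (forall w, normc (w - z) < r -> F w = G w) -> cdiff F z -> cdiff G z.
Proof.
move=> r0 FG [L FL]; exists L => e e0; have [dl dl0 H] := FL _ e0.
exists (Num.min dl r); first by rewrite lt_min dl0.
move=> w; rewrite lt_min => /andP[w1 w2]; rewrite -!FG ?H//.
by rewrite subrr normc0.
Qed.

Definition rcont (f : R -> R[i]) (x : R) := forall e : R, 0 < e ->
  exists2 dl : R, 0 < dl & forall y, `|y - x| < dl -> normc (f y - f x) <= e.

Lemma ccont_horizontal F x y : ccont F (x +i* y) -> rcont (fun s => F (s +i* y)) x.
Proof.
move=> cF e e0; have [dl dl0 H] := cF _ e0; exists dl => // s sx; apply: H.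
have -> : (s +i* y) - (x +i* y) = (s - x)%:C by apply: complex_ext => /=; ring.
by rewrite normc_real.
Qed.

Lemma ccont_vertical F x y : ccont F (x +i* y) -> rcont (fun t => F (x +i* t)) y.
Proof.
move=> cF e e0; have [dl dl0 H] := cF _ e0; exists dl => // s sx; apply: H.
have -> : (x +i* s) - (x +i* y) = 'i%C * (s - y)%:C by apply: complex_ext => /=; ring.
by rewrite normcM normc_i mul1r normc_real.
Qed.

Lemma rcont_re f x : rcont f x -> {for x, continuous (fun y => complex.Re (f y))}.
Proof.
move=> cf; apply/cvgrPdist_le => /= e e0; have [dl dl0 H] := cf _ e0.
exists dl => //= y yx; apply: le_trans (H y _); last by rewrite distrC.
by rewrite distrC -ReN -ReD normc_re.
Qed.

Lemma rcont_im f x : rcont f x -> {for x, continuous (fun y => complex.Im (f y))}.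
Proof.
move=> cf; apply/cvgrPdist_le => /= e e0; have [dl dl0 H] := cf _ e0.
exists dl => //= y yx; apply: le_trans (H y _); last by rewrite distrC.
by rewrite distrC -ImN -ImD normc_im.
Qed.

Lemma rcont_cmeas f : (forall x, rcont f x) -> cmeas (setT : set (measurableTypeR R)) f.
Proof.
move=> cf; split; apply: continuous_measurable_fun => x;
  [exact: rcont_re|exact: rcont_im].
Qed.

Lemma rcont_normc f x : rcont f x -> {for x, continuous (fun y => normc (f y))}.
Proof.
move=> cf; apply/cvgrPdist_le => /= e e0; have [dl dl0 H] := cf _ e0.
exists dl => //= y yx; apply: le_trans (H y _); last by rewrite distrC.
rewrite distrC ler_norml; apply/andP; split.
  by rewrite lerNl opprB normcB ler_normcB.
exact: ler_normcB.
Qed.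

End ComplexDifferentiability.

(** * The theorem of Goursat *)

Section SegmentIntegrals.
Variable R : realType.
Local Notation leb := (@lebesgue_measure R).
Implicit Types (f g : R -> R[i]) (a b m x : R).

Lemma rcont_cintegrable f a b : (forall x, a <= x <= b -> rcont f x) ->
  cintegrable leb `[a, b] f.
Proof.
move=> cf; split; apply: continuous_compact_integrable;
  try exact: segment_compact;
  apply: continuous_in_subspaceT => x; rewrite inE/= in_itv/= => xab.
- exact/rcont_re/cf.
- exact/rcont_im/cf.
Qed.

Lemma Rintegral_split (h : R -> R) a m b : a <= m -> m <= b ->
  leb.-integrable `[a, b] (EFin \o h) ->
  Rintegral leb `[a, b] h = Rintegral leb `[a, m] h + Rintegral leb `[m, b] h.
Proof.
move=> am mb ih; have := @Rintegral_itvB R h (BLeft a) (BRight b) m ih.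
rewrite !bnd_simp => /(_ am mb) e.
rewrite -(Rintegral_itv_obnd_cbnd (r := m)); last first.
  apply: integrableS ih => //; apply: subset_itv; by rewrite bnd_simp.
by rewrite -e addrC subrK.
Qed.

Lemma cintegral_split f a m b : a <= m -> m <= b -> cintegrable leb `[a, b] f ->
  cintegral leb `[a, b] f = cintegral leb `[a, m] f + cintegral leb `[m, b] f.
Proof.
move=> am mb [ir ii]; rewrite /cintegral (Rintegral_split am mb ir).
by rewrite (Rintegral_split am mb ii).
Qed.

Lemma segment_length a b : a <= b -> fine (leb `[a, b]%classic) = b - a.
Proof.
move=> ab; rewrite lebesgue_measure_itv/= lte_fin.
case: ltP => //= ba; have -> : a = b by apply/eqP; rewrite eq_le ab ba.
by rewrite subrr.
Qed.

Lemma cintegral_segment_cst (c : R[i]) a b : a <= b ->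
  cintegral leb `[a, b] (fun=> c) = (b - a)%:C * c.
Proof.
move=> ab; rewrite /cintegral !Rintegral_cst// segment_length//.
by apply: complex_ext; rewrite !ReImE/=; ring.
Qed.

Lemma le_cintegral_segment f a b M : a <= b -> cintegrable leb `[a, b] f ->
  (forall x, a <= x <= b -> normc (f x) <= M) ->
  normc (cintegral leb `[a, b] f) <= (b - a) * M.
Proof.
move=> ab fi fM.
rewrite mulrC -(segment_length ab) -Rintegral_cst//.
apply: le_normc_cintegral_dom => //.
- exact: cintegrable_cmeas fi.
- apply: continuous_compact_integrable; first exact: segment_compact.
  by apply: continuous_subspaceT => x; exact: cst_continuous.
Qed.

Lemma cintegral_segment_near f a b (c : R[i]) M : a <= b ->
  cintegrable leb `[a, b] f ->
  (forall x, a <= x <= b -> normc (f x - c) <= M) ->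
  normc (cintegral leb `[a, b] f - (b - a)%:C * c) <= (b - a) * M.
Proof.
move=> ab fi fM; have ic : cintegrable leb `[a, b] (fun=> c).
  apply: rcont_cintegrable => x _ e e0; exists 1 => // y _.
  by rewrite subrr normc0 ltW.
rewrite -cintegral_segment_cst// -cintegralB//.
by apply: le_cintegral_segment => //; exact: cintegrableB.
Qed.

End SegmentIntegrals.

Section Goursat.
Variable R : realType.
Local Notation leb := (@lebesgue_measure R).
Implicit Types (F : R[i] -> R[i]) (a b c d m : R).

(** The integral of F along the boundary of [a, b] x [c, d], opposite sides
    being grouped so that no integral of a nonconstant function is needed to
    see that affine functions integrate to 0. *)
Definition rect_integral F a b c d : R[i] :=
  cintegral leb `[a, b] (fun s => F (s +i* c) - F (s +i* d)) +
  'i%C * cintegral leb `[c, d] (fun y => F (b +i* y) - F (a +i* y)).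

Definition cont_rect F a b c d := forall x y, a <= x <= b -> c <= y <= d ->
  ccont F (x +i* y).

Definition diff_rect F a b c d := forall x y, a <= x <= b -> c <= y <= d ->
  cdiff F (x +i* y).

Lemma diff_cont_rect F a b c d : diff_rect F a b c d -> cont_rect F a b c d.
Proof. by move=> dF x y hx hy; exact/cdiff_cont/dF. Qed.

Lemma cont_rect_sub F a b c d a' b' c' d' : cont_rect F a b c d ->
  a <= a' -> b' <= b -> c <= c' -> d' <= d -> cont_rect F a' b' c' d'.
Proof.
move=> cF aa bb cc dd x y /andP[x1 x2] /andP[y1 y2].
by apply: cF; apply/andP; split;
  [exact: le_trans x1|exact: le_trans bb|exact: le_trans y1|exact: le_trans dd].
Qed.

Section Rectangle.
Variables (F : R[i] -> R[i]) (a b c d : R).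
Hypotheses (ab : a <= b) (cd : c <= d) (cF : cont_rect F a b c d).

Lemma integrable_hor y : c <= y <= d ->
  cintegrable leb `[a, b] (fun s => F (s +i* y)).
Proof. by move=> hy; apply: rcont_cintegrable => x hx; exact/ccont_horizontal/cF. Qed.

Lemma integrable_ver x : a <= x <= b ->
  cintegrable leb `[c, d] (fun y => F (x +i* y)).
Proof. by move=> hx; apply: rcont_cintegrable => y hy; exact/ccont_vertical/cF. Qed.

Let aI : a <= a <= b. Proof. by rewrite lexx. Qed.
Let bI : a <= b <= b. Proof. by rewrite lexx andbT. Qed.
Let cI : c <= c <= d. Proof. by rewrite lexx. Qed.
Let dI : c <= d <= d. Proof. by rewrite lexx andbT. Qed.

Lemma integrable_horB y y' : c <= y <= d -> c <= y' <= d ->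
  cintegrable leb `[a, b] (fun s => F (s +i* y) - F (s +i* y')).
Proof. by move=> h h'; apply: cintegrableB => //; exact: integrable_hor. Qed.

Lemma integrable_verB x x' : a <= x <= b -> a <= x' <= b ->
  cintegrable leb `[c, d] (fun y => F (x +i* y) - F (x' +i* y)).
Proof. by move=> h h'; apply: cintegrableB => //; exact: integrable_ver. Qed.

Lemma rect_integral_hsplit m : a <= m -> m <= b ->
  rect_integral F a b c d = rect_integral F a m c d + rect_integral F m b c d.
Proof.
move=> am mb; have mI : a <= m <= b by rewrite am.
rewrite /rect_integral (cintegral_split am mb (integrable_horB cI dI)).
have -> : cintegral leb `[c, d] (fun y => F (b +i* y) - F (a +i* y)) =
    cintegral leb `[c, d] (fun y => F (m +i* y) - F (a +i* y)) +
    cintegral leb `[c, d] (fun y => F (b +i* y) - F (m +i* y)).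
  rewrite -cintegralD//; [|exact: integrable_verB..].
  by apply: eq_cintegral => y _; ring.
by rewrite mulrDr addrACA.
Qed.

Lemma rect_integral_vsplit m : c <= m -> m <= d ->
  rect_integral F a b c d = rect_integral F a b c m + rect_integral F a b m d.
Proof.
move=> cm md; have mI : c <= m <= d by rewrite cm.
rewrite /rect_integral (cintegral_split cm md (integrable_verB bI aI)).
have -> : cintegral leb `[a, b] (fun s => F (s +i* c) - F (s +i* d)) =
    cintegral leb `[a, b] (fun s => F (s +i* c) - F (s +i* m)) +
    cintegral leb `[a, b] (fun s => F (s +i* m) - F (s +i* d)).
  rewrite -cintegralD//; [|exact: integrable_horB..].
  by apply: eq_cintegral => y _; ring.
by rewrite mulrDr addrACA.
Qed.

Lemma rect_integral_le M :
  (forall x y, a <= x <= b -> c <= y <= d -> normc (F (x +i* y)) <= M) ->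
  normc (rect_integral F a b c d) <= (b - a + (d - c)) * (2 * M).
Proof.
move=> FM; apply: le_trans (le_normcD _ _) _; rewrite normcM normc_i mul1r mulrDl.
apply: lerD.
- apply: le_cintegral_segment => //; first exact: integrable_horB.
  move=> x hx; apply: le_trans (le_normcD _ _) _; rewrite normcN.
  by rewrite mulr_natl mulr2n lerD ?FM.
- apply: le_cintegral_segment => //; first exact: integrable_verB.
  move=> x hx; apply: le_trans (le_normcD _ _) _; rewrite normcN.
  by rewrite mulr_natl mulr2n lerD ?FM.
Qed.

(** Affine functions integrate to 0, so only the deviation from the tangent
    map counts. *)
Lemma rect_integral_tangent (z0 A L : R[i]) M :
  (forall x y, a <= x <= b -> c <= y <= d ->
    normc (F (x +i* y) - A - L * ((x +i* y) - z0)) <= M) ->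
  normc (rect_integral F a b c d) <= (b - a + (d - c)) * (2 * M).
Proof.
move=> FM; rewrite /rect_integral.
set I1 := cintegral _ _ _; set I2 := cintegral _ _ _.
pose k1 := L * 'i%C * (c - d)%:C; pose k2 := L * (b - a)%:C.
have -> : I1 + 'i%C * I2 =
    (I1 - (b - a)%:C * k1) + 'i%C * (I2 - (d - c)%:C * k2).
  rewrite /k1 /k2 (_ : (c - d)%:C = - (d - c)%:C); last by rewrite -rmorphN opprB.
  by ring.
apply: le_trans (le_normcD _ _) _; rewrite normcM normc_i mul1r mulrDl.
apply: lerD; apply: cintegral_segment_near => //.
- exact: integrable_horB.
- move=> x hx.
  have -> : F (x +i* c) - F (x +i* d) - k1 =
     (F (x +i* c) - A - L * ((x +i* c) - z0)) -
     (F (x +i* d) - A - L * ((x +i* d) - z0)).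
    rewrite /k1 (complex_RI x c) (complex_RI x d) rmorphB/=; ring.
  apply: le_trans (le_normcD _ _) _; rewrite normcN.
  by rewrite mulr_natl mulr2n lerD ?FM.
- exact: integrable_verB.
- move=> y hy.
  have -> : F (b +i* y) - F (a +i* y) - k2 =
     (F (b +i* y) - A - L * ((b +i* y) - z0)) -
     (F (a +i* y) - A - L * ((a +i* y) - z0)).
    rewrite /k2 (complex_RI b y) (complex_RI a y) rmorphB/=; ring.
  apply: le_trans (le_normcD _ _) _; rewrite normcN.
  by rewrite mulr_natl mulr2n lerD ?FM.
Qed.

End Rectangle.
End Goursat.

Section GoursatTheorem.
Variable R : realType.
Implicit Types (F : R[i] -> R[i]) (a b c d m : R).

Lemma nested_intervals_point (x l : nat -> R) :
  (forall n, 0 <= l n) -> (forall n, x n <= x n.+1) ->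
  (forall n, x n.+1 + l n.+1 <= x n + l n) ->
  exists p, forall n, x n <= p <= x n + l n.
Proof.
move=> l0 xS yS.
have xm n k : x n <= x (k + n)%N.
  by elim: k => [|k IH]; rewrite ?add0n// addSn (le_trans IH).
have ym n k : x (k + n)%N + l (k + n)%N <= x n + l n.
  by elim: k => [|k IH]; rewrite ?add0n// addSn (le_trans _ IH).
have xy (n k : nat) : x k <= x n + l n.
  have [mn|/ltnW nm] := leqP k n.
    by have := xm k (n - k)%N; rewrite subnK// => /le_trans; apply; rewrite lerDl.
  have := ym n (k - n)%N; rewrite subnK// => h; apply: le_trans h; by rewrite lerDl.
exists (sup (range x)) => n; apply/andP; split.
  apply: ub_le_sup; last by exists n.
  by exists (x 0%N + l 0%N) => _ [m _ <-].
by apply: ge_sup; [exists (x 0%N), 0%N|move=> _ [m _ <-]].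
Qed.

Lemma halving_sequence (l : R) : 0 <= l -> exists w : nat -> R,
  [/\ w 0%N = l, forall n, 0 <= w n, forall n, w n = w n.+1 + w n.+1 &
    w @ \oo --> (0 : R)].
Proof.
move=> l0; exists (fun n => l * 2^-1 ^+ n); split.
- by rewrite expr0 mulr1.
- by move=> n; rewrite mulr_ge0// exprn_ge0// invr_ge0.
- by move=> n; rewrite exprS; field.
- rewrite -[X in _ --> X](mulr0 l); apply: cvgM; first exact: cvg_cst.
  by apply: cvg_expr; rewrite ger0_norm ?invr_ge0// invf_lt1// ltr1n.
Qed.

(** Bisection: a rectangle whose boundary integral exceeds e times the square
    of its half perimeter contains a quarter with the same defect; the nested
    quarters shrink to a point where F is not complex differentiable. *)
Lemma rect_integral_small F a b c d (e : R) : a <= b -> c <= d ->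
  diff_rect F a b c d -> 0 < e ->
  normc (rect_integral F a b c d) <= e * (b - a + (d - c)) ^+ 2.
Proof.
move=> ab cd dF e0; apply/negPn/negP => bad0.
have ba0 : 0 <= b - a by rewrite subr_ge0.
have dc0 : 0 <= d - c by rewrite subr_ge0.
have [w [w00 w0 wS wcv]] := halving_sequence ba0.
have [h [h00 h0 hS hcv]] := halving_sequence dc0.
pose J n (p : R * R) := rect_integral F p.1 (p.1 + w n) p.2 (p.2 + h n).
pose inside n (p : R * R) := [/\ a <= p.1, p.1 + w n <= b, c <= p.2 & p.2 + h n <= d].
pose bad n p := ~~ (normc (J n p) <= e * (w n + h n) ^+ 2).
have step (np : nat * (R * R)) : exists q : R * R,
    inside np.1 np.2 -> bad np.1 np.2 ->
    [/\ inside np.1.+1 q, bad np.1.+1 q,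
      np.2.1 <= q.1 /\ q.1 + w np.1.+1 <= np.2.1 + w np.1 &
      np.2.2 <= q.2 /\ q.2 + h np.1.+1 <= np.2.2 + h np.1].
  case: np => n [x y] /=.
  have [[q hq]|nq] := pselect (exists q, [/\ inside n.+1 q, bad n.+1 q,
      x <= q.1 /\ q.1 + w n.+1 <= x + w n & y <= q.2 /\ q.2 + h n.+1 <= y + h n]).
    by exists q.
  exists (x, y) => -[/= ax xb cy yd] bn; exfalso; apply: nq.
  have wn := w0 n.+1; have hn := h0 n.+1; have ws := wS n; have hs := hS n.
  have cF : cont_rect F x (x + w n) y (y + h n).
    by apply: cont_rect_sub (diff_cont_rect dF) _ _ _ _.
  have xw : x <= x + w n by lra.
  have yh : y <= y + h n by lra.
  have ym1 : y <= y + h n.+1 by lra.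
  have ym2 : y + h n.+1 <= y + h n by lra.
  have xm1 : x <= x + w n.+1 by lra.
  have xm2 : x + w n.+1 <= x + w n by lra.
  have e1 : y + h n.+1 + h n.+1 = y + h n by lra.
  have e2 : x + w n.+1 + w n.+1 = x + w n by lra.
  have split4 : J n (x, y) = J n.+1 (x, y) + J n.+1 (x + w n.+1, y) +
      (J n.+1 (x, y + h n.+1) + J n.+1 (x + w n.+1, y + h n.+1)).
    rewrite /J /= e1 e2 (rect_integral_vsplit xw yh cF ym1 ym2).
    congr (_ + _); apply: rect_integral_hsplit => //.
    - exact: cont_rect_sub cF _ _ _ _.
    - exact: cont_rect_sub cF _ _ _ _.
  have quarter (x' y' : R) : x <= x' -> x' + w n.+1 <= x + w n ->
      y <= y' -> y' + h n.+1 <= y + h n -> bad n.+1 (x', y') ->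
      exists q, [/\ inside n.+1 q, bad n.+1 q,
        x <= q.1 /\ q.1 + w n.+1 <= x + w n & y <= q.2 /\ q.2 + h n.+1 <= y + h n].
    move=> h1 h2 h3 h4 b'; exists (x', y'); split; [|exact: b'|exact: conj|exact: conj].
    by split; [exact: le_trans h1|exact: le_trans xb|exact: le_trans h3|exact: le_trans yd].
  have e1' : y + h n.+1 + h n.+1 <= y + h n by rewrite e1.
  have e2' : x + w n.+1 + w n.+1 <= x + w n by rewrite e2.
  have [g1|b1] := boolP (normc (J n.+1 (x, y)) <= e * (w n.+1 + h n.+1) ^+ 2); last first.
    exact: (quarter x y).
  have [g2|b2] := boolP (normc (J n.+1 (x + w n.+1, y)) <= e * (w n.+1 + h n.+1) ^+ 2); last first.
    exact: (quarter (x + w n.+1) y).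
  have [g3|b3] := boolP (normc (J n.+1 (x, y + h n.+1)) <= e * (w n.+1 + h n.+1) ^+ 2); last first.
    exact: (quarter x (y + h n.+1)).
  have [g4|b4] := boolP (normc (J n.+1 (x + w n.+1, y + h n.+1)) <= e * (w n.+1 + h n.+1) ^+ 2); last first.
    exact: (quarter (x + w n.+1) (y + h n.+1)).
  move: bn; rewrite /bad split4 => /negP[].
  apply: le_trans (le_normcD _ _) _.
  apply: le_trans (lerD (le_normcD _ _) (le_normcD _ _)) _.
  rewrite ws hs (_ : e * _ = e * (w n.+1 + h n.+1) ^+ 2 + e * (w n.+1 + h n.+1) ^+ 2 +
    (e * (w n.+1 + h n.+1) ^+ 2 + e * (w n.+1 + h n.+1) ^+ 2)); last by ring.
  by rewrite !lerD.
have [g gP] := choice step.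
pose z := fix z n := if n is m.+1 then g (m, z m) else (a, c).
have zP n : inside n (z n) /\ bad n (z n).
  elim: n => [|n [i1 i2]]; last by have [] := gP (n, z n) i1 i2.
  have e1 : a + (b - a) = b by lra.
  have e2 : c + (d - c) = d by lra.
  split; first by split; rewrite /= ?w00 ?h00 ?e1 ?e2 ?lexx.
  by rewrite /bad /J /= w00 h00 e1 e2.
have zS n : ((z n).1 <= (z n.+1).1 /\ (z n.+1).1 + w n.+1 <= (z n).1 + w n) /\
    ((z n).2 <= (z n.+1).2 /\ (z n.+1).2 + h n.+1 <= (z n).2 + h n).
  by have [i1 i2] := zP n; have [] := gP (n, z n) i1 i2.
have [px hpx] := nested_intervals_point w0 (fun n => (zS n).1.1) (fun n => (zS n).1.2).
have [py hpy] := nested_intervals_point h0 (fun n => (zS n).2.1) (fun n => (zS n).2.2).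
have [[ax xb cy yd] _] := zP 0%N.
have pxI : a <= px <= b.
  by have /andP[p1 p2] := hpx 0%N; rewrite (le_trans ax p1) (le_trans p2 xb).
have pyI : c <= py <= d.
  by have /andP[p1 p2] := hpy 0%N; rewrite (le_trans cy p1) (le_trans p2 yd).
have [L FL] := dF _ _ pxI pyI.
have [dl dl0 FD] := FL (e / 2) ltac:(by rewrite divr_gt0).
have [n ndl] : exists n, w n + h n < dl.
  have : (fun n => w n + h n) @ \oo --> (0 + 0 : R) by exact: cvgD.
  rewrite addr0 => /cvgr0_norm_lt/(_ _ dl0) [N _ HN]; exists N.
  exact: le_lt_trans (ler_norm _) (HN N (leqnn N)).
have [[axn xbn cyn ydn] /negP] := zP n; apply.
have /andP[px1 px2] := hpx n; have /andP[py1 py2] := hpy n.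
set l := w n + h n in ndl *.
have l0 : 0 <= l by rewrite addr_ge0.
have -> : e * l ^+ 2 = ((z n).1 + w n - (z n).1 + ((z n).2 + h n - (z n).2)) * (2 * (e / 2 * l)).
  by rewrite ![_ + _ - _]addrAC !subrr !add0r -/l; field.
apply: (rect_integral_tangent _ _ _ (z0 := px +i* py) (A := F (px +i* py)) (L := L)).
- by rewrite lerDl.
- by rewrite lerDl.
- exact: cont_rect_sub (diff_cont_rect dF) _ _ _ _.
move=> x y /andP[x1 x2] /andP[y1 y2].
have near : normc ((x +i* y) - (px +i* py)) <= l.
  apply: le_trans (normc_le_reim _) _ => /=; apply: lerD.
    by rewrite ler_norml; apply/andP; split; lra.
  by rewrite ler_norml; apply/andP; split; lra.
apply: le_trans (FD _ (le_lt_trans near ndl)) _.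
by rewrite ler_wpM2l// divr_ge0// ltW.
Qed.

(** Letting e tend to 0 in the bisection bound. *)
Lemma goursat F a b c d : a <= b -> c <= d -> diff_rect F a b c d ->
  rect_integral F a b c d = 0.
Proof.
move=> ab cd dF; apply: eq0_normc; apply/eqP; rewrite eq_le normc_ge0 andbT.
apply/ler_addgt0Pr => e e0; rewrite add0r.
have q0 : 0 < 1 + (b - a + (d - c)) ^+ 2 by rewrite ltr_pwDl ?sqr_ge0.
have := rect_integral_small ab cd dF (divr_gt0 e0 q0).
move=> /le_trans; apply; rewrite mulrAC ler_pdivrMr// ler_pM2l//.
by rewrite lerDr.
Qed.

(** A point where F is merely continuous is cut out by a small square, along
    whose boundary the integral is small. *)
Lemma goursat_except F a b c d px py : a < px -> px < b -> c < py -> py < d ->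
  cont_rect F a b c d ->
  (forall x y, a <= x <= b -> c <= y <= d -> x +i* y != px +i* py ->
    cdiff F (x +i* y)) ->
  rect_integral F a b c d = 0.
Proof.
move=> apx pxb cpy pyd cF dF.
have pxI : a <= px <= b by rewrite !ltW.
have pyI : c <= py <= d by rewrite !ltW.
apply: eq0_normc; apply/eqP; rewrite eq_le normc_ge0 andbT.
apply/ler_addgt0Pr => e e0; rewrite add0r.
pose M := normc (F (px +i* py)) + 1.
have M0 : 0 < M by rewrite ltr_wpDl ?normc_ge0.
have [dl dl0 Fdl] := cF _ _ pxI pyI 1 ltr01.
pose eta := Num.min (Num.min (Num.min (px - a) (b - px)) (Num.min (py - c) (d - py)))
  (Num.min (dl / 4) (e / (8 * M))).
have eta0 : 0 < eta by rewrite !lt_min !subr_gt0 apx pxb cpy pyd/= !divr_gt0// mulr_gt0.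
have : eta <= eta by [].
rewrite {2}/eta !le_min => /andP[/andP[/andP[e1 e2] /andP[e3 e4]] /andP[e5 e6]].
have rect0 a' b' c' d' : a <= a' -> a' <= b' -> b' <= b -> c <= c' -> c' <= d' -> d' <= d ->
    (b' < px \/ px < a') \/ (d' < py \/ py < c') -> rect_integral F a' b' c' d' = 0.
  move=> h1 h2 h3 h4 h5 h6 out; apply: goursat => // x y /andP[x1 x2] /andP[y1 y2].
  apply: dF; [by apply/andP; split; lra|by apply/andP; split; lra|].
  by apply/eqP => -[xe ye]; move: out; rewrite -xe -ye => -[] []; lra.
have cs a' b' c' d' : a <= a' -> b' <= b -> c <= c' -> d' <= d -> cont_rect F a' b' c' d'.
  exact: cont_rect_sub.
have [x1 x2 x3] : [/\ a <= px - eta, px - eta <= px + eta & px + eta <= b] by split; lra.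
have [y1 y2 y3] : [/\ c <= py - eta, py - eta <= py + eta & py + eta <= d] by split; lra.
have [x4 x5] : px - eta <= b /\ a <= px + eta by split; lra.
have [y4 y5] : py - eta <= d /\ c <= py + eta by split; lra.
have [ab cd] : a <= b /\ c <= d by split; lra.
have -> : rect_integral F a b c d =
    rect_integral F (px - eta) (px + eta) (py - eta) (py + eta).
  rewrite (rect_integral_hsplit ab cd cF x1 x4).
  rewrite (rect0 a (px - eta) c d) ?add0r//; last by left; left; lra.
  rewrite (rect_integral_hsplit x4 cd (cs _ _ _ _ x1 (lexx b) (lexx c) (lexx d)) x2 x3).
  rewrite (rect0 (px + eta) b c d) ?addr0//; last by left; right; lra.
  rewrite (rect_integral_vsplit x2 cd (cs _ _ _ _ x1 x3 (lexx c) (lexx d)) y1 y4).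
  rewrite (rect0 _ _ c (py - eta)) ?add0r//; last by right; left; lra.
  rewrite (rect_integral_vsplit x2 y4 (cs _ _ _ _ x1 x3 y1 (lexx d)) y2 y3).
  by rewrite (rect0 _ _ (py + eta) d) ?addr0//; right; right; lra.
apply: le_trans (rect_integral_le x2 y2 (cs _ _ _ _ x1 x3 y1 y3) (M := M) _) _.
- move=> x y /andP[x6 x7] /andP[y6 y7]; rewrite /M -lerBlDl.
  apply: le_trans (ler_normcB _ _) _; apply: Fdl.
  apply: le_lt_trans (normc_le_reim _) _ => /=.
  apply: (@le_lt_trans _ _ (eta + eta)).
    by apply: lerD; rewrite ler_norml; apply/andP; split; lra.
  lra.
- move: e6; rewrite ler_pdivlMr ?mulr_gt0// => e6.
  by rewrite (_ : _ * _ = eta * (8 * M)); [exact: e6|ring].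
Qed.

End GoursatTheorem.

(** * Integrals over vertical lines *)

Section JointMeasurability.
Variable R : realType.
Local Notation RR := (measurableTypeR R).
Local Notation leb := (@lebesgue_measure R).

(** The nodes are the left neighbours of s on the grids of mesh 1 / (n + 1).
    *)
Lemma grid_cvg (a s : R) : a <= s ->
  (fun n : nat => a + (Num.truncn ((s - a) * n.+1%:R))%:R / n.+1%:R) @ \oo --> s.
Proof.
move=> sa; apply/cvgrPdist_le => /= e e0.
have [N _ HN] := near_infty_natSinv_lt (PosNum e0).
exists N => // n /= Nn; apply: le_trans (ltW (HN n Nn)).
have n0 : 0 < n.+1%:R :> R by [].
have x0 : 0 <= (s - a) * n.+1%:R by rewrite mulr_ge0// subr_ge0.
have /andP[k1 k2] := truncn_itv x0; set k := Num.truncn _ in k1 k2 *.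
have -> : s - (a + k%:R / n.+1%:R) = ((s - a) * n.+1%:R - k%:R) / n.+1%:R.
  by field; rewrite lt0r_neq0.
rewrite normrM (ger0_norm (_ : 0 <= n.+1%:R^-1)) ?invr_ge0 ?ler0n//.
rewrite -[leRHS]mul1r ler_pM2r ?invr_gt0// ger0_norm ?subr_ge0//.
by move: k2; rewrite -natr1; lra.
Qed.

(** Functions that are continuous in one variable and measurable in the other
    are pointwise limits of functions that are piecewise constant in the former
    on a countable grid. *)
Lemma measurable_caratheodory (g : R -> R -> R) (a : R) :
  (forall s, measurable_fun (setT : set RR) (g s)) ->
  (forall y, continuous (g^~ y)) ->
  (forall s y, s <= a -> g s y = g a y) ->
  measurable_fun (setT : set (RR * RR)%type) (fun p : RR * RR => g p.1 p.2).
Proof.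
move=> mg cg ga.
pose k n (s : R) : nat := Num.truncn ((s - a) * n.+1%:R).
have mk n j : measurable ([set s | k n s = j] : set RR).
  have m1 : measurable_fun (setT : set RR) (fun s : RR => (k n s)%:R : R).
    apply: nondecreasing_measurable => // x y xy; rewrite ler_nat; apply: le_truncn.
    by rewrite ler_pM2r// lerB.
  have := m1 measurableT [set j%:R] (measurable_set1 _); rewrite setTI.
  congr measurable; apply/seteqP; split => s /=; last by move=> ->.
  by move/eqP; rewrite eqr_nat => /eqP.
apply: (@measurable_fun_cvg _ _ _ _ (fun n (p : RR * RR) =>
  g (a + (k n p.1)%:R / n.+1%:R) p.2)) => [n|[s y] _ /=].
- move=> _ B mB; rewrite setTI.
  have -> : (fun p : RR * RR => g (a + (k n p.1)%:R / n.+1%:R) p.2) @^-1` B =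
      \bigcup_j ((fst @^-1` [set s | k n s = j]) `&`
        (snd @^-1` [set y | B (g (a + j%:R / n.+1%:R) y)])).
    apply/seteqP; split => [[s y] /= Bsy|[s y] [j _ /= [<-]]//].
    by exists (k n s).
  apply: bigcup_measurable => j _; apply: measurableI.
  + by rewrite -[X in measurable X]setTI; exact: measurable_fst.
  + rewrite -[X in measurable X]setTI; apply: measurable_snd => //.
    by have := mg (a + j%:R / n.+1%:R) measurableT B mB; rewrite setTI.
- have [sa|sa] := leP a s; first exact: continuous_cvg (cg y s) (grid_cvg sa).
  rewrite (ga s y (ltW sa)); apply: cvg_near_cst; apply: nearW => n.
  by rewrite /k (_ : Num.truncn _ = 0%N) ?mul0r ?addr0//; apply/eqP;
    rewrite -leqn0 truncn_le_nat (@le_lt_trans _ _ 0)// nmulr_rle0// ?subr_lt0.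
Qed.

End JointMeasurability.

Section Strip.
Variable R : realType.
Local Notation RR := (measurableTypeR R).
Local Notation leb := (@lebesgue_measure R).

Lemma cintegral_tail (D : R -> R[i]) (e : R) : cintegrable leb setT D -> 0 < e ->
  exists n : nat, forall c d : R, c <= - n%:R -> n%:R <= d ->
    normc (cintegral leb setT D - cintegral leb `[c, d] D) <= e.
Proof.
move=> iD e0; have nD := cintegrable_normc measurableT iD.
have mn : measurable_fun (setT : set RR) (fun x => normc (D x)).
  exact/cmeas_normc/(cintegrable_cmeas iD).
have fin (A : set R) : measurable A -> (\int[leb]_(x in A) (normc (D x))%:E)%E =
    (Rintegral leb A (fun x => normc (D x)))%:E.
  move=> mA; rewrite /Rintegral fineK//.
  by apply: integrable_fin_num => //; exact: integrableS nD.
have := @ge0_nondecreasing_set_cvg_integral _ RR _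
  (fun n => `[- (n%:R), n%:R]%classic : set RR) (fun x => (normc (D x))%:E) leb.
rewrite bigcup_itvT fin// => /(_ _ _ _ _)/fine_cvgP cv.
have [|| | |_] := cv.
- apply/nondecreasing_seqP => n; rewrite subsetEset; apply: subset_itv;
    by rewrite bnd_simp ?lerN2 ler_nat.
- by move=> i.
- by move=> i; apply/measurable_EFinP; exact: measurable_funTS.
- by move=> i x _; rewrite lee_fin normc_ge0.
move=> /cvgrPdist_le/(_ _ e0)[n _ HN].
(* outside [c, d] the integral of |D| is at most what it is outside [-n, n] *)
exists n => c d cn nd; apply: le_trans (HN n (leqnn n)).
pose S : set RR := `[c, d]%classic.
have mS : measurable S by exact: measurable_itv.
have mC : measurable (~` S) by exact: measurableC.
have dSC : [disjoint S & ~` S] by rewrite disj_set2E setICr.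
have splitR (h : R -> R) : leb.-integrable setT (EFin \o h) ->
    Rintegral leb setT h = Rintegral leb S h + Rintegral leb (~` S) h.
  by move=> ih; rewrite -Rintegral_setU ?setUv.
have split : cintegral leb setT D = cintegral leb S D + cintegral leb (~` S) D.
  by rewrite /cintegral (splitR _ iD.1) (splitR _ iD.2).
rewrite [X in normc X](_ : _ = cintegral leb (~` S) D); last first.
  apply/eqP; rewrite subr_eq; apply/eqP; exact: (etrans split (addrC _ _)).
apply: le_trans (le_normc_cintegral mC _) _.
  exact: cintegrableS measurableT mC _ iD.
apply: le_trans (ler_norm _); rewrite [X in X <= _](_ : _ = Rintegral leb setT (fun x => normc (D x)) -
    Rintegral leb S (fun x => normc (D x))); last first.
  by apply/eqP; rewrite eq_sym subr_eq; apply/eqP; exact: (etrans (splitR _ nD) (addrC _ _)).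
rewrite lerD2l lerN2 -lee_fin -!fin//.
apply: ge0_subset_integral => //.
- by apply/measurable_EFinP; exact: measurable_funTS.
- by move=> x _; rewrite lee_fin normc_ge0.
- by apply: subset_itv; rewrite bnd_simp.
Qed.

(** An integrable function cannot stay above e > 0 on a set of infinite
    measure. *)
Lemma small_value_far (f : R -> \bar R) (e : R) (A : set R) :
  measurable (A : set RR) -> leb A = +oo%E -> measurable_fun (setT : set RR) f ->
  (forall x, (0 <= f x)%E) -> (\int[leb]_x f x < +oo)%E -> 0 < e ->
  exists2 x, A x & (f x < e%:E)%E.
Proof.
move=> mA Ay mf f0 fy e0; apply: contrapT => h.
have ef x : A x -> (e%:E <= f x)%E.
  by move=> Ax; rewrite leNgt; apply/negP => fx; apply: h; exists x.
have : (\int[leb]_(x in A) e%:E <= \int[leb]_x f x)%E.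
  apply: (@le_trans _ _ (\int[leb]_(x in A) f x)%E); last exact: ge0_subset_integral.
  apply: ge0_le_integral => //; first by move=> x _; rewrite lee_fin ltW.
  exact: measurable_funTS.
rewrite integral_cst// => h1; have {h1} : (e%:E * leb A <= \int[leb]_x f x)%E := h1.
rewrite Ay gt0_muley ?lte_fin// leye_eq => /eqP e1.
by rewrite e1 in fy.
Qed.

(** The two horizontal sides of a tall rectangle are negligible along suitable
    heights, since the integral of |H| over the strip is finite. *)
Lemma strip_integral_eq (H : R[i] -> R[i]) (x1 x2 T0 B : R) : x1 < x2 ->
  (forall x y, x1 <= x <= x2 -> ccont H (x +i* y)) ->
  (forall c d, c <= - T0 -> T0 <= d -> rect_integral H x1 x2 c d = 0) ->
  (forall x, x1 <= x <= x2 -> (\int[leb]_y (normc (H (x +i* y)))%:E <= B%:E)%E) ->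
  cintegral leb setT (fun y => H (x2 +i* y)) =
  cintegral leb setT (fun y => H (x1 +i* y)).
Proof.
move=> x12 cH J0 HB.
(* extending H constantly across the vertical sides keeps it continuous in x
   *)
pose clamp x := Num.max x1 (Num.min x x2).
have clampI x : x1 <= clamp x <= x2.
  by rewrite /clamp le_max lexx/= ge_max (ltW x12) ge_min lexx orbT.
have clampE x : x1 <= x <= x2 -> clamp x = x.
  by move=> /andP[h1 h2]; rewrite /clamp min_l// max_r.
have clampL x y : `|clamp x - clamp y| <= `|x - y|.
  rewrite /clamp /Num.max /Num.min; do ![case: ifP]; move=> *;
  rewrite ler_norml; have := ler_norm (x - y); have := ler_norm (y - x);
  rewrite distrC => ? ?; apply/andP; split; lra.
pose g s y := normc (H (clamp s +i* y)).
have g0 s y : 0 <= g s y by exact: normc_ge0.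
have cg y : continuous (g^~ y).
  move=> s; apply: (@rcont_normc _ (fun s => H (clamp s +i* y))) => e e0.
  have [dl dl0 Hd] := ccont_horizontal (cH _ y (clampI s)) e0.
  by exists dl => // t ts; apply: Hd; exact: le_lt_trans (clampL _ _) ts.
have cv x : x1 <= x <= x2 -> cmeas (setT : set RR) (fun y => H (x +i* y)).
  by move=> hx; apply: rcont_cmeas => y; exact/ccont_vertical/cH.
have mg s : measurable_fun (setT : set RR) (g s).
  exact/cmeas_normc/cv/clampI.
have mgg : measurable_fun (setT : set (RR * RR)%type) (fun p : RR * RR => g p.1 p.2).
  apply: (measurable_caratheodory (a := x1)) => // s y sx.
  by rewrite /g /clamp !max_l ?ge_min ?lexx// sx.
have iH x : x1 <= x <= x2 -> cintegrable leb setT (fun y => H (x +i* y)).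
  move=> hx; apply/cintegrableP => //; first exact: cv.
  apply/integrableP; split; first exact/measurable_EFinP/cmeas_normc/cv.
  under eq_integral do rewrite gee0_abs ?lee_fin ?normc_ge0//.
  exact: le_lt_trans (HB _ hx) (ltry _).
pose seg : set RR := `[x1, x2]%classic.
pose G (p : RR * RR) : \bar R := ((\1_seg p.1) * g p.1 p.2)%:E.
have mG : measurable_fun setT G.
  apply/measurable_EFinP; apply: measurable_funM => //.
  have m1 : measurable_fun (setT : set RR) (\1_seg : RR -> R).
    by apply: measurable_indic; exact: measurable_itv.
  exact: (measurableT_comp m1 measurable_fst).
have G0 p : (0 <= G p)%E by rewrite lee_fin mulr_ge0.
have ty := @fubini_tonelli _ _ _ _ _ leb leb G mG G0.
have fin1 : (\int[leb]_y \int[leb]_x G (x, y) < +oo)%E.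
  have m1 : measurable_fun (setT : set RR) (\1_seg : RR -> R).
    by apply: measurable_indic; exact: measurable_itv.
  have B0 : 0 <= B.
    rewrite -lee_fin; apply: le_trans (HB x1 _); last by rewrite lexx ltW.
    by apply: integral_ge0 => y _; rewrite lee_fin normc_ge0.
  have le1 x : setT x -> (\int[leb]_y G (x, y) <= B%:E * (\1_seg x)%:E)%E.
    move=> _; rewrite /G /= indicE; case: (x \in seg) => /=.
      under eq_integral do rewrite mul1r.
      by rewrite mule1; exact: HB (clampI x).
    by under eq_integral do rewrite mul0r; rewrite integral0 mule0.
  have mB : measurable_fun (setT : set RR) (fun x => B%:E * (\1_seg x)%:E)%E.
    by apply/measurable_EFinP; exact: (measurable_funM (measurable_cst B) m1).
  have i0 x : setT x -> (0 <= (\1_seg x)%:E :> \bar R)%E by rewrite lee_fin.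
  have F0 x : setT x -> (0 <= \int[leb]_y G (x, y))%E.
    by move=> _; apply: integral_ge0 => y _; exact: G0.
  have mF : measurable_fun (setT : set RR) (fun x => \int[leb]_y G (x, y))%E.
    exact: measurable_fun_fubini_tonelli_F.
  rewrite -ty; apply: le_lt_trans (ge0_le_integral leb measurableT F0 mF mB le1) _.
  rewrite (ge0_integralZl leb measurableT (measurableT_comp (@EFin_measurable _ _) m1) i0 (_ : (0 <= B%:E)%E))//.
  have e1 : (\int[leb]_x (\1_seg x)%:E = (x2 - x1)%:E)%E.
    apply: etrans (integral_indic leb measurableT (measurable_itv _ : measurable seg)) _.
    rewrite setIT; apply: etrans (lebesgue_measure_itv `[x1, x2]) _.
    by rewrite /= lte_fin x12.
  rewrite [X in (_ * X)%E](_ : _ = (x2 - x1)%:E); last exact: e1.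
  by rewrite -EFinM ltry.
clear ty.
pose E y : \bar R := (\int[leb]_x G (x, y))%E.
have mE : measurable_fun (setT : set RR) E by exact: measurable_fun_fubini_tonelli_G.
have E0 y : (0 <= E y)%E by exact: integral_ge0.
have EE y : E y = (Rintegral leb `[x1, x2] (fun x => normc (H (x +i* y))))%:E.
  have ih : cintegrable leb `[x1, x2] (fun x => H (x +i* y)).
    by apply: rcont_cintegrable => x hx; exact/ccont_horizontal/cH.
  have nh : leb.-integrable `[x1, x2] (EFin \o (fun x => normc (H (x +i* y)))).
    by apply: cintegrable_normc ih.
  rewrite /Rintegral fineK; last by apply: integrable_fin_num.
  rewrite [RHS]integral_mkcond /E; apply: eq_integral => x _.
  rewrite patchE /G /= indicE; case: ifPn => [xs|nxs]; last by rewrite mul0r.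
  by rewrite mul1r /g clampE//; move: xs; rewrite inE /seg /= in_itv.
set I1 := cintegral _ _ _; set I2 := cintegral _ _ _.
have x1I : x1 <= x1 <= x2 by rewrite lexx ltW.
have x2I : x1 <= x2 <= x2 by rewrite lexx ltW.
pose D y := H (x2 +i* y) - H (x1 +i* y).
have iD : cintegrable leb setT D := cintegrableB measurableT (iH _ x2I) (iH _ x1I).
have ID : I1 - I2 = cintegral leb setT D.
  exact: esym (cintegralB measurableT (iH _ x2I) (iH _ x1I)).
apply/eqP; rewrite -subr_eq0 ID -normc_eq0 eq_le normc_ge0 andbT.
apply/ler_addgt0Pr => e e0; rewrite add0r.
have e3 : 0 < e / 3 by rewrite divr_gt0.
have [n hn] := cintegral_tail iD e3.
pose m := Num.max n%:R T0.
have Ay1 : leb `[m, +oo[%classic = +oo%E.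
  by apply: etrans (lebesgue_measure_itv `[m, +oo[) _; rewrite /= ltry.
have Ay2 : leb `]-oo, - m]%classic = +oo%E.
  by apply: etrans (lebesgue_measure_itv `]-oo, - m]) _; rewrite /= ltNyr.
have [d md Ed] := small_value_far (measurable_itv _) Ay1 mE E0 fin1 e3.
have [c cm Ec] := small_value_far (measurable_itv _) Ay2 mE E0 fin1 e3.
move: md cm; rewrite /= !in_itv/= andbT => md cm.
have [nm Tm] : n%:R <= m /\ T0 <= m by rewrite /m !le_max !lexx orbT.
have cn : c <= - n%:R by apply: le_trans cm _; rewrite lerN2.
have cT : c <= - T0 by apply: le_trans cm _; rewrite lerN2.
have nd := le_trans nm md; have h1 := hn c d cn nd.
have cd : c <= d.
  by apply: le_trans cn _; apply: le_trans nd; rewrite ge0_cp.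
have J := J0 c d cT (le_trans Tm md).
have ihor y : cintegrable leb `[x1, x2] (fun s => H (s +i* y)).
  by apply: rcont_cintegrable => x hx; exact/ccont_horizontal/cH.
have h2 : normc (cintegral leb `[c, d] D) <= e / 3 + e / 3.
  move: J => /eqP; rewrite /rect_integral addrC addr_eq0 => /eqP J.
  have -> : normc (cintegral leb `[c, d] D) = normc ('i%C * cintegral leb `[c, d] D).
    by rewrite normcM normc_i mul1r.
  rewrite J normcN.
  rewrite cintegralB; [|exact: measurable_itv|exact: ihor|exact: ihor].
  apply: le_trans (le_normcD _ _) _; rewrite normcN.
  move: Ec Ed; rewrite !EE !lte_fin => Ec Ed.
  have hc y : normc (cintegral leb `[x1, x2] (fun s => H (s +i* y))) <=
      Rintegral leb `[x1, x2] (fun s => normc (H (s +i* y))).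
    by apply: le_normc_cintegral; [exact: measurable_itv|exact: ihor].
  by apply: le_trans (lerD (hc c) (hc d)) _; exact: lerD (ltW Ec) (ltW Ed).
rewrite -(subrK (cintegral leb `[c, d] D) (cintegral leb setT D)).
apply: le_trans (le_normcD _ _) _; apply: le_trans (lerD h1 h2) _; clear; lra.
Qed.

End Strip.

(** * The Poisson kernel *)

Section PoissonKernel.
Variable R : realType.
Local Notation RR := (measurableTypeR R).
Local Notation leb := (@lebesgue_measure R).
Implicit Types (t x y : R) (a c z : R[i]).

Lemma integral_oneDsqr : (\int[leb]_x ((1 + x ^+ 2)^-1)%:E = pi%:E)%E.
Proof.
have c : continuous (fun x : R => (1 + x ^+ 2)^-1) by exact: continuous_oneDsqrV.
have p x : 0 <= (1 + x ^+ 2)^-1 :> R by rewrite invr_ge0 addr_ge0 ?sqr_ge0.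
rewrite (ge0_symfun_integralT p c); last by move=> x /=; rewrite sqrrN.
rewrite -set_itvcy (integral0y_oneDsqr R) -EFinM; congr EFin.
by rewrite mulrC divfK.
Qed.

Lemma ge0_integral_affine (al be : R) (G : R -> R) : 0 < al -> continuous G ->
  (forall x, 0 <= G x) ->
  (\int[leb]_x (G x)%:E = \int[leb]_x (G (al * x + be) * al)%:E)%E.
Proof.
move=> al0 cG G0; pose F x : R := al * x + be.
have dF x : is_derive x 1 F al.
  apply: is_derive_eq; rewrite addr0 /GRing.scale /=; exact: mulr1.
have F'E : derive1 F = cst al by apply/funext => x; rewrite derive1E derive_val.
have Finf (l : R) : exists M, forall x, M < x -> l <= F x.
  exists ((l - be) / al) => x; rewrite ltr_pdivrMr// => h; rewrite /F mulrC; lra.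
rewrite (@increasing_ge0_integration_by_substitutionT _ F G) ?F'E//.
- by move=> x y xy; rewrite /F ltrD2r ltr_pM2l.
- by move=> x; exact: cvg_cst.
- exact: is_cvg_cst.
- exact: is_cvg_cst.
- apply/cvgrNyPle => A; exists ((A - be) / al); split; first exact: num_real.
  by move=> x; rewrite ltr_pdivlMr// => h; rewrite /F mulrC; lra.
- apply/cvgryPge => A; exists ((A - be) / al); split; first exact: num_real.
  by move=> x; rewrite ltr_pdivrMr// => h; rewrite /F mulrC; lra.
Qed.

Lemma integral_poisson (dl t : R) : 0 < dl ->
  (\int[leb]_y ((dl ^+ 2 + (y - t) ^+ 2)^-1)%:E = (pi / dl)%:E)%E.
Proof.
move=> dl0; have il : 0 < dl^-1 by rewrite invr_gt0.
have := @ge0_integral_affine dl^-1 (- t / dl) (fun x => (1 + x ^+ 2)^-1) il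
  (@continuous_oneDsqrV R).
move=> /(_ ltac:(by move=> x; rewrite invr_ge0 addr_ge0 ?sqr_ge0)).
rewrite integral_oneDsqr => e.
have mp : measurable_fun (setT : set RR) (fun y => ((1 + (dl^-1 * y + - t / dl) ^+ 2)^-1 * dl^-1)%:E).
  apply/measurable_EFinP; apply: measurable_funM => //.
  apply: (measurableT_comp (f := fun x : R => (1 + x ^+ 2)^-1)).
    by apply: continuous_measurable_fun; exact: continuous_oneDsqrV.
  by apply: measurable_funD => //; exact: measurable_funM.
transitivity (\int[leb]_y (dl^-1%:E * ((1 + (dl^-1 * y + - t / dl) ^+ 2)^-1 * dl^-1)%:E))%E.
  apply: eq_integral => y _; rewrite -EFinM; congr EFin.
  have d0 : dl != 0 by rewrite gt_eqF.
  have -> : 1 + (dl^-1 * y + - t / dl) ^+ 2 = (dl ^+ 2 + (y - t) ^+ 2) / dl ^+ 2 by field.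
  by rewrite invfM invrK; set X := (_ + _)^-1; field.
rewrite ge0_integralZl//.
- by rewrite -e -EFinM mulrC.
- by move=> x _; rewrite lee_fin mulr_ge0// ?ltW// invr_gt0 ltr_pwDl// sqr_ge0.
- by rewrite lee_fin ltW.
Qed.

Definition kap a y : R[i] := ((2^-1 +i* y) - a)^-1.

Lemma normc_vertical_inv a x y : normc (((x +i* y) - a)^-1) ^+ 2 =
  ((x - complex.Re a) ^+ 2 + (y - complex.Im a) ^+ 2)^-1.
Proof.
by rewrite normcV exprVn normc_sqr; case: a => p q /=.
Qed.

Lemma vertical_neq a x y : x != complex.Re a -> (x +i* y) - a != 0.
Proof.
apply: contraNneq => /eqP; rewrite subr_eq0 => /eqP <- //=.
Qed.

Lemma rcont_vertical_inv a x : x != complex.Re a ->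
  forall y, rcont (fun y => ((x +i* y) - a)^-1) y.
Proof.
move=> xa y; apply: (@ccont_vertical _ (fun w => (w - a)^-1)).
apply: cdiff_cont; apply: cdiff_inv.
by rewrite -subr_eq0 vertical_neq.
Qed.

Lemma sqnorm_vertical_inv a x : x != complex.Re a ->
  square_integrable leb (fun y => ((x +i* y) - a)^-1) /\
  sqnorm leb (fun y => ((x +i* y) - a)^-1) = pi / `|x - complex.Re a|.
Proof.
move=> xa; set f := fun y => _.
have mf : cmeas (setT : set RR) f by apply: rcont_cmeas; exact: rcont_vertical_inv.
have d0 : 0 < `|x - complex.Re a| by rewrite normr_gt0 subr_eq0.
have e : (\int[leb]_y (normc (f y) ^+ 2)%:E = (pi / `|x - complex.Re a|)%:E)%E.
  rewrite -(integral_poisson (complex.Im a) d0); apply: eq_integral => y _.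
  by rewrite normc_vertical_inv real_normK// num_real.
split; last by rewrite /sqnorm /Rintegral e.
apply/square_integrableP; split => //; apply/integrableP; split.
  exact/measurable_EFinP/measurable_funX/cmeas_normc.
under eq_integral do rewrite gee0_abs ?lee_fin ?exprn_ge0 ?normc_ge0//.
by rewrite e ltry.
Qed.

End PoissonKernel.

(** * The Cauchy formula in the half plane *)

Section HardyPairs.
Variable R : realType.
Local Notation RR := (measurableTypeR R).
Local Notation leb := (@lebesgue_measure R).
Local Notation N2 f := (Num.sqrt (sqnorm leb f)).
Implicit Types (F G : R[i] -> R[i]) (f g : R -> R[i]) (x y : R) (a c z : R[i]).

Definition on_line F x := fun y : R => F (x +i* y).

(** A function F of the Hardy space, as a function on the half plane, with its
    boundary value f. *)
Definition hardy_pair F f := [/\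
  forall z, complex.Re z < 2^-1 -> cdiff F z,
  exists M, forall x, x < 2^-1 ->
    square_integrable leb (on_line F x) /\ sqnorm leb (on_line F x) <= M,
  square_integrable leb f &
  forall e : R, 0 < e -> exists2 dl : R, 0 < dl & forall x, x < 2^-1 ->
    2^-1 - x < dl -> N2 (fun y => on_line F x y - f y) <= e].

Lemma cmeas_on_line F x : (forall y, ccont F (x +i* y)) ->
  cmeas (setT : set RR) (on_line F x).
Proof. by move=> cF; apply: rcont_cmeas => y; exact: ccont_vertical. Qed.

Lemma sqrt_small (K e : R) : 0 <= K -> 0 < e -> exists2 T : R, 0 < T &
  forall t, T < t -> Num.sqrt (K / t) <= e.
Proof.
move=> K0 e0; have T0 : 0 < (K + 1) / e ^+ 2 by rewrite divr_gt0 ?exprn_gt0// ltr_wpDl.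
exists ((K + 1) / e ^+ 2) => // t Tt; have t0 := lt_trans T0 Tt.
rewrite -[leRHS](ger0_norm (ltW e0)) -sqrtr_sqr ler_sqrt ?sqr_ge0//.
rewrite ler_pdivrMr//; move: Tt; rewrite ltr_pdivrMr ?exprn_gt0// mulrC; lra.
Qed.

(* Q is the quotient F / (z - a), whose possible singularity at a is removable
   *)
Section CauchyZero.
Variables (F Q : R[i] -> R[i]) (f : R -> R[i]) (a : R[i]) (C dl : R).
Hypotheses (Ff : hardy_pair F f) (a2 : complex.Re a != 2^-1)
  (hQ : forall z, z != a -> Q z = F z * (z - a)^-1)
  (cQ : forall z, complex.Re z < 2^-1 -> ccont Q z)
  (dl0 : 0 < dl) (C0 : 0 <= C)
  (nearQ : forall z, complex.Re z < 2^-1 -> normc (z - a) < dl -> normc (Q z) <= C).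

Let cdQ z : complex.Re z < 2^-1 -> z != a -> cdiff Q z.
Proof.
move=> z2 za; have r0 : 0 < normc (z - a) by rewrite normc_gt0 subr_eq0.
apply: (cdiff_near r0) => [w wz|].
  rewrite hQ//; apply: contraTneq wz => ->.
  by rewrite -leNgt normcB.
by apply: cdiffM; [case: Ff => dF _ _ _; exact: dF|exact: cdiff_inv].
Qed.

Let Q_le x y : x < 2^-1 -> normc (Q (x +i* y)) <= normc (F (x +i* y)) ^+ 2 +
  (2 + 2 * C * dl ^+ 2) * (dl ^+ 2 + (y - complex.Im a) ^+ 2)^-1.
Proof.
move=> x2; set z := x +i* y.
have n2 : normc (z - a) ^+ 2 = (x - complex.Re a) ^+ 2 + (y - complex.Im a) ^+ 2.
  by rewrite normc_sqr ReD ImD ReN ImN.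
set D := dl ^+ 2 + _; have D0 : 0 < D by rewrite ltr_pwDl ?exprn_gt0// sqr_ge0.
have [near|far] := ltP (normc (z - a)) dl.
  apply: le_trans (@nearQ z x2 near) _; rewrite -[leLHS]add0r lerD ?sqr_ge0//.
  rewrite ler_pdivlMr// mulrC.
  have : D <= 2 * dl ^+ 2.
    rewrite /D; have : normc (z - a) ^+ 2 <= dl ^+ 2.
      by rewrite ler_sqr ?nnegrE ?normc_ge0 ?(ltW dl0) ?(ltW near)//.
    rewrite n2; have := sqr_ge0 (x - complex.Re a); lra.
  move=> /(ler_wpM2r C0); have := sqr_ge0 dl; lra.
have za : z != a.
  by apply: contraTneq far => ->; rewrite subrr normc0 -ltNge.
have n0 : 0 < normc (z - a) by apply: lt_le_trans far.
rewrite hQ// normcM normcV.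
rewrite mulrDl addrA -[leLHS]addr0 lerD//; last first.
  by apply: mulr_ge0; [exact: mulr_ge0 (mulr_ge0 _ _) (sqr_ge0 _)|rewrite invr_ge0 ltW].
apply: (@le_trans _ _ (normc (F z) ^+ 2 + (normc (z - a))^-1 ^+ 2)).
  have := sqr_ge0 (normc (F z) - (normc (z - a))^-1).
  have p : 0 <= normc (F z) * (normc (z - a))^-1 by rewrite mulr_ge0 ?invr_ge0 ?normc_ge0.
  by move: p; rewrite sqrrB; set u := normc _ * _; lra.
rewrite lerD2l exprVn ler_pdivlMr// mulrC ler_pdivrMr ?exprn_gt0//.
have : dl ^+ 2 <= normc (z - a) ^+ 2.
  by rewrite ler_sqr ?nnegrE ?normc_ge0 ?(ltW dl0).
rewrite /D n2; have := sqr_ge0 (x - complex.Re a); lra.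
Qed.

Let I x := cintegral leb setT (on_line Q x).

(* The integrals of Q over two vertical lines agree when a is between the
   lines or to the right of the boundary: Q is continuous at a, so that
   Goursat applies to rectangles containing a *)
Let I_const x1 x2 : x1 < x2 -> x2 < 2^-1 -> x1 < complex.Re a ->
  complex.Re a < x2 \/ 2^-1 < complex.Re a -> I x2 = I x1.
Proof.
move=> x12 x22 x1a ax2; have [_ [M FM] _ _] := Ff.
pose K := 2 + 2 * C * dl ^+ 2.
have K0 : 0 <= K by apply: addr_ge0 => //; exact: mulr_ge0 (mulr_ge0 _ _) (sqr_ge0 _).
apply: (@strip_integral_eq _ Q x1 x2 (`|complex.Im a| + 1) (M + K * (pi / dl))) => //.
- by move=> x y /andP[_ xx2]; apply: cQ; exact: le_lt_trans x22.
- move=> c d cT Td.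
  have /andP[ia1 ia2] : - `|complex.Im a| <= complex.Im a <= `|complex.Im a|.
    by rewrite -ler_norml.
  have cd : c <= d by lra.
  case: ax2 => ax2; last first.
    apply: goursat => //; first exact: ltW.
    move=> x y /andP[_ xx2] _; have xlt := le_lt_trans xx2 x22; apply: cdQ => //.
    by apply/eqP => e; move: ax2; rewrite -e /= ltNge ltW.
  apply: (@goursat_except _ _ _ _ _ _ (complex.Re a) (complex.Im a)) => //; try lra.
  + by move=> x y /andP[_ xx2] _; apply: cQ; exact: le_lt_trans x22.
  + move=> x y /andP[_ xx2] _ za; apply: cdQ; first exact: le_lt_trans x22.
    by move: za; case: (a).
- move=> x /andP[_ xx2]; have xlt := le_lt_trans xx2 x22.
  have [sF FxM] := FM _ xlt.
  have mq : measurable_fun (setT : set RR) (fun y => normc (Q (x +i* y))).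
    by apply/cmeas_normc/cmeas_on_line => y; exact: cQ.
  have mp : measurable_fun (setT : set RR)
      (fun y => ((dl ^+ 2 + (y - complex.Im a) ^+ 2)^-1)%:E).
    apply/measurable_EFinP.
    under eq_fun do rewrite -powR_inv1 ?addr_ge0 ?sqr_ge0//.
    apply: (measurableT_comp (measurable_powR _)).
    by apply: measurable_funD => //; apply: measurable_funX; exact: measurable_funB.
  have mF : measurable_fun (setT : set RR) (fun y => (normc (F (x +i* y)) ^+ 2)%:E).
    by apply/measurable_EFinP/measurable_funX/cmeas_normc; exact: sF.1.
  have p0 y : (0 <= ((dl ^+ 2 + (y - complex.Im a) ^+ 2)^-1)%:E)%E.
    by rewrite lee_fin invr_ge0 addr_ge0 ?sqr_ge0.
  apply: (@le_trans _ _ (\int[leb]_y ((normc (F (x +i* y)) ^+ 2)%:E +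
     K%:E * ((dl ^+ 2 + (y - complex.Im a) ^+ 2)^-1)%:E))%E).
    apply: (ge0_le_integral leb measurableT).
    + by move=> y _; rewrite lee_fin normc_ge0.
    + exact/measurable_EFinP.
    + by apply: emeasurable_funD => //; exact: measurable_funeM.
    + by move=> y _; rewrite -EFinM -EFinD lee_fin; exact: Q_le.
  rewrite (ge0_integralD leb measurableT)//; first last.
  + exact: measurable_funeM.
  + by move=> y _; rewrite mule_ge0.
  + by move=> y _; rewrite lee_fin exprn_ge0 ?normc_ge0.
  rewrite (ge0_integralZl leb measurableT)//.
  rewrite integral_poisson// (EFinD M) (EFinM K); apply: leeD => //.
  by have := FxM; rewrite -lee_fin -sqnorm_EFin.
Qed.

(* and they are 0 since the norm of 1 / (z - a) on the line of abscissa x1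
   tends to 0 as x1 tends to minus infinity *)
Let I0 x2 : x2 < 2^-1 -> complex.Re a < x2 \/ 2^-1 < complex.Re a -> I x2 = 0.
Proof.
move=> x22 ax2; have [_ [M FM] _ _] := Ff.
have M0 : 0 <= M.
  by have [_] := FM _ x22; apply: le_trans; exact: sqnorm_ge0.
apply: eq0_normc; apply/eqP; rewrite eq_le normc_ge0 andbT.
apply/ler_addgt0Pr => e e0; rewrite add0r.
have K0 : 0 <= M * pi by rewrite mulr_ge0 ?pi_ge0.
have [T T0 HT] := sqrt_small K0 e0.
pose x1 := Num.min (x2 - 1) (complex.Re a - T - 1).
have : x1 <= x1 by [].
rewrite {2}/x1 le_min => /andP[h1 h2].
have x1a : x1 < complex.Re a by lra.
have x12 : x1 < x2 by lra.
rewrite (I_const x12 x22 x1a ax2).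
have x1lt := lt_trans x12 x22.
have [sF FxM] := FM _ x1lt.
have x1na : x1 != complex.Re a by rewrite lt_eqF.
have [sk ke] := sqnorm_vertical_inv x1na.
have -> : I x1 = cintegral leb setT (fun y => on_line F x1 y * ((x1 +i* y) - a)^-1).
  apply: eq_cintegral => y _; rewrite /on_line hQ//.
  by rewrite -subr_eq0 vertical_neq.
apply: le_trans (normc_cintegralM sF sk) _.
rewrite ke -sqrtrM ?sqnorm_ge0//.
have t0 : 0 < `|x1 - complex.Re a| by rewrite normr_gt0 subr_eq0.
apply: le_trans (HT `|x1 - complex.Re a| _).
  rewrite ler_sqrt ?divr_ge0// -mulrA ler_wpM2r// divr_ge0 ?pi_ge0//.
rewrite ltr0_norm ?subr_lt0//; lra.
Qed.

(** By the Cauchy-Schwarz inequality the integral of F / (z - a) over a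
    vertical line close to the boundary is close to that of f / (z - a) over
    the boundary, and the former is 0. *)
Lemma cauchy_zero : cintegral leb setT (fun y => f y * kap a y) = 0.
Proof.
have [dF [M FM] sf Fb] := Ff.
have a2' : 2^-1 != complex.Re a by rewrite eq_sym.
have [sk ke] := sqnorm_vertical_inv a2'.
pose r := `|2^-1 - complex.Re a| / 2.
have r0 : 0 < r by rewrite divr_gt0// normr_gt0 subr_eq0.
pose A := Num.sqrt (pi / r); pose B := N2 f.
have A0 : 0 <= A by exact: sqrtr_ge0.
have B0 : 0 <= B by exact: sqrtr_ge0.
apply: eq0_normc; apply/eqP; rewrite eq_le normc_ge0 andbT.
apply/ler_addgt0Pr => e e0; rewrite add0r.
have q0 : 0 < A * (1 + B / r) + 1 by rewrite ltr_wpDl// mulr_ge0// addr_ge0// divr_ge0// ltW.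
pose e1 := e / (A * (1 + B / r) + 1).
have e10 : 0 < e1 by rewrite divr_gt0.
have [d d0 Hd] := Fb _ e10.
pose x := 2^-1 - Num.min (Num.min (d / 2) r) e1.
have m0 : 0 < Num.min (Num.min (d / 2) r) e1 by rewrite !lt_min divr_gt0// r0.
have x2 : x < 2^-1 by rewrite /x; lra.
have : Num.min (Num.min (d / 2) r) e1 <= Num.min (Num.min (d / 2) r) e1 by [].
rewrite !le_min => /andP[/andP[h1 h2] h3].
have xE : 2^-1 - x = Num.min (Num.min (d / 2) r) e1 by rewrite /x opprB addrC subrK.
have xd : 2^-1 - x < d by rewrite xE; lra.
have xr : 2^-1 - x <= r by rewrite xE.
have xe1 : 2^-1 - x <= e1 by rewrite xE.
have xa : r <= `|x - complex.Re a|.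
  have := ler_normB (2^-1 - x) (complex.Re a - x).
  rewrite (_ : _ - _ = 2^-1 - complex.Re a); last by ring.
  rewrite (distrC (complex.Re a)) (_ : `|2^-1 - complex.Re a| = r + r); last by rewrite /r -splitr.
  by rewrite (gtr0_norm (_ : 0 < 2^-1 - x)) ?subr_gt0//; lra.
have xna : x != complex.Re a.
  by apply: contraTneq xa => ->; rewrite subrr normr0 -ltNge.
have ax : complex.Re a < x \/ 2^-1 < complex.Re a.
  have [ha|ha] := ltP 2^-1 (complex.Re a); [by right|left].
  move: xr; rewrite /r ger0_norm ?subr_ge0// => xr'.
  have : complex.Re a < 2^-1 by rewrite lt_neqAle a2.
  lra.
have [sF _] := FM _ x2.
have [skx kxe] := sqnorm_vertical_inv xna.
have kxA : N2 (fun y => ((x +i* y) - a)^-1) <= A.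
  rewrite kxe; apply: ler_wsqrtr; rewrite ler_wpM2l ?pi_ge0//.
  by rewrite lef_pV2// posrE; apply: lt_le_trans xa.
have iff := cintegrableM2 sf sk.
have IF : cintegral leb setT (fun y => on_line F x y * ((x +i* y) - a)^-1) = 0.
  rewrite -(I0 x2 ax); apply: eq_cintegral => y _; rewrite /on_line hQ//.
  by rewrite -subr_eq0 vertical_neq.
have sD := square_integrableB sF sf.
have sK := square_integrableB sk skx.
have -> : cintegral leb setT (fun y => f y * kap a y) =
    cintegral leb setT (fun y => f y * (kap a y - ((x +i* y) - a)^-1)) -
    cintegral leb setT (fun y => (on_line F x y - f y) * ((x +i* y) - a)^-1).
  have i1 := cintegrableM2 sf sK; have i2 := cintegrableM2 sD skx.
  rewrite -(cintegralB measurableT i1 i2) -[LHS]subr0 -IF.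
  rewrite -(cintegralB measurableT iff (cintegrableM2 sF skx)).
  by apply: eq_cintegral => y _; ring.
apply: le_trans (le_normcD _ _) _; rewrite normcN.
have b1 : normc (cintegral leb setT (fun y => f y * (kap a y - ((x +i* y) - a)^-1))) <=
    B * (e1 / r * A).
  apply: le_trans (normc_cintegralM sf sK) _; rewrite ler_wpM2l//.
  apply: (@le_trans _ _ (e1 / r * N2 (fun y => ((x +i* y) - a)^-1))); last first.
    by rewrite ler_wpM2l// divr_ge0// ltW.
  have er0 : 0 <= e1 / r by rewrite divr_ge0// ltW.
  rewrite -[X in X * _](ger0_norm er0) -sqrtr_sqr -sqrtrM ?sqr_ge0//.
  apply: ler_wsqrtr; apply: le_sqnorm => // y; rewrite /kap.
  have z1 := vertical_neq y a2'; have z2 := vertical_neq y xna.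
  have -> : ((2^-1 +i* y) - a)^-1 - ((x +i* y) - a)^-1 =
      - (((2^-1 - x)%:C * ((2^-1 +i* y) - a)^-1) * ((x +i* y) - a)^-1).
    rewrite (_ : (2^-1 - x)%:C = ((2^-1 +i* y) - a) - ((x +i* y) - a)); last first.
      by apply: complex_ext; rewrite !ReImE/=; ring.
    by move: z1 z2; set u := (_ +i* _) - a; set v := (_ +i* _) - a => z1 z2; field; rewrite z1 z2.
  rewrite normcN normcM ler_wpM2r ?normc_ge0// normcM normc_real gtr0_norm ?subr_gt0//.
  apply: ler_pM => //; rewrite ?normc_ge0 ?subr_ge0 ?(ltW x2)//.
  rewrite normcV lef_pV2 ?posrE ?normc_gt0//.
  apply: le_trans (normc_re _); rewrite ReD ReN /=.
  rewrite (_ : `|2^-1 - complex.Re a| = r + r); last by rewrite /r -splitr.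
  by rewrite lerDl ltW.
have b2 : normc (cintegral leb setT (fun y => (on_line F x y - f y) * ((x +i* y) - a)^-1)) <=
    e1 * A.
  apply: le_trans (normc_cintegralM sD skx) _.
  by apply: ler_pM; rewrite ?sqrtr_ge0// Hd.
apply: le_trans (lerD b1 b2) _.
have -> : B * (e1 / r * A) + e1 * A = e1 * (A * (1 + B / r)) by field; rewrite gt_eqF.
rewrite /e1 mulrAC ler_pdivrMr// (ler_pM2l e0) lerDl//.
Qed.

End CauchyZero.
End HardyPairs.

Section CauchyFormula.
Variable R : realType.
Local Notation RR := (measurableTypeR R).
Local Notation leb := (@lebesgue_measure R).
Local Notation N2 f := (Num.sqrt (sqnorm leb f)).
Implicit Types (F G : R[i] -> R[i]) (f g : R -> R[i]) (x y : R) (a c z : R[i]).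

Lemma cauchy_right F f a : hardy_pair F f -> 2^-1 < complex.Re a ->
  cintegral leb setT (fun y => f y * kap a y) = 0.
Proof.
move=> Ff a2; have [dF _ _ _] := Ff.
have za z : complex.Re z < 2^-1 -> z != a.
  by move=> z2; apply: contraTneq z2 => ->; rewrite -leNgt ltW.
apply: (@cauchy_zero _ F (fun z => F z * (z - a)^-1) f a 0 (complex.Re a - 2^-1)) => //.
- by rewrite gt_eqF.
- move=> z z2; apply: cdiff_cont; apply: cdiffM; first exact: dF.
  by apply: cdiff_inv; exact: za.
- by rewrite subr_gt0.
- move=> z z2; rewrite ltNge => /negP[]; rewrite normcB.
  by apply: le_trans (normc_re _); rewrite ReD ReN ler_normr; apply/orP; left; lra.
Qed.

(** A zero of F at a makes the singularity of F / (z - a) removable. *)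
Lemma cauchy_left_zero F f a : hardy_pair F f -> complex.Re a < 2^-1 -> F a = 0 ->
  cintegral leb setT (fun y => f y * kap a y) = 0.
Proof.
move=> Ff a2 Fa; have [dF _ _ _] := Ff; have [L FL] := dF _ a2.
have [d1 d10 H1] := FL 1 ltr01.
pose Q z := if z == a then L else F z * (z - a)^-1.
have Qa (e d : R) : (forall w, normc (w - a) < d ->
      normc (F w - F a - L * (w - a)) <= e * normc (w - a)) -> 0 <= e ->
    forall w, normc (w - a) < d -> normc (Q w - L) <= e.
  move=> H e0 w wd; rewrite /Q; have [_|wa] := eqVneq w a; first by rewrite subrr normc0.
  have wa0 : w - a != 0 by rewrite subr_eq0.
  have := H _ wd; rewrite Fa subr0 -ler_pdivrMr ?normc_gt0//; apply: le_trans.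
  by rewrite -normc_div mulrBl mulfK.
apply: (@cauchy_zero _ F Q f a (normc L + 1) d1) => //.
- by rewrite lt_eqF.
- by move=> z za; rewrite /Q (negbTE za).
- move=> z z2; have [->|za] := eqVneq z a.
    move=> e e0; have [d d0 H] := FL _ e0; exists d => // w wd.
    by rewrite [Q a]/Q eqxx; apply: Qa H _ _ wd; exact: ltW.
  apply: cdiff_cont.
  have r0 : 0 < normc (z - a) by rewrite normc_gt0 subr_eq0.
  apply: (cdiff_near (F := fun z => F z * (z - a)^-1) r0) => [w wz|].
    rewrite /Q; have [wa|//] := eqVneq w a; move: wz.
    by rewrite {1}wa normcB ltxx.
  by apply: cdiffM; [exact: dF|exact: cdiff_inv].
- by rewrite addr_ge0// normc_ge0.
- move=> z _ za; rewrite -lerBlDl; apply: le_trans (ler_normcB _ _) _.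
  exact: Qa H1 ler01 _ za.
Qed.

Lemma hardy_pair_lin F f G g (k : R[i]) : hardy_pair F f -> hardy_pair G g ->
  hardy_pair (fun z => F z + k * G z) (fun y => f y + k * g y).
Proof.
move=> [dF [M FM] sf Fb] [dG [N GN] sg Gb]; split.
- move=> z z2; apply: cdiffD; first exact: dF.
  by apply: cdiffM; [exact: cdiff_cst|exact: dG].
- exists ((Num.sqrt M + normc k * Num.sqrt N) ^+ 2) => x x2.
  have [sF FxM] := FM _ x2; have [sG GxN] := GN _ x2.
  have skG := square_integrableZ k sG.
  split; first exact: square_integrableD.
  rewrite -[leLHS]sqr_sqrtr ?sqnorm_ge0// ler_sqr ?nnegrE ?sqrtr_ge0//; last first.
    by rewrite addr_ge0 ?mulr_ge0 ?sqrtr_ge0 ?normc_ge0.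
  apply: le_trans (sqrt_sqnormD sF skG) _; apply: lerD; first exact: ler_wsqrtr.
  rewrite sqnormZ// sqrtrM ?sqr_ge0// sqrtr_sqr ger0_norm ?normc_ge0//.
  by rewrite ler_wpM2l ?normc_ge0//; exact: ler_wsqrtr.
- by apply: square_integrableD => //; exact: square_integrableZ.
- move=> e e0; have k0 : 0 < 1 + normc k by rewrite ltr_pwDl ?normc_ge0.
  have e1 : 0 < e / (1 + normc k) by rewrite divr_gt0.
  have [d1 d10 H1] := Fb _ e1; have [d2 d20 H2] := Gb _ e1.
  exists (Num.min d1 d2); first by rewrite lt_min d10.
  move=> x x2; rewrite lt_min => /andP[x3 x4].
  have [sF _] := FM _ x2; have [sG _] := GN _ x2.
  have s1 := square_integrableB sF sf; have s2 := square_integrableB sG sg.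
  have -> : (fun y => on_line (fun z => F z + k * G z) x y - (f y + k * g y)) =
    (fun y => (on_line F x y - f y) + k * (on_line G x y - g y)).
    by apply/funext => y; rewrite /on_line; ring.
  apply: le_trans (sqrt_sqnormD s1 (square_integrableZ k s2)) _.
  rewrite sqnormZ// sqrtrM ?sqr_ge0// sqrtr_sqr ger0_norm ?normc_ge0//.
  apply: le_trans (lerD (H1 _ x2 x3) (ler_wpM2l (normc_ge0 k) (H2 _ x2 x4))) _.
  by rewrite -[X in X + _]mul1r -mulrDl mulrC divfK ?gt_eqF.
Qed.

Lemma vertical_inv_diff a x x' y : x != complex.Re a -> x' != complex.Re a ->
  ((x +i* y) - a)^-1 - ((x' +i* y) - a)^-1 =
  (x' - x)%:C * (((x +i* y) - a)^-1 * ((x' +i* y) - a)^-1).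
Proof.
move=> xa xa'; have z1 := vertical_neq y xa; have z2 := vertical_neq y xa'.
rewrite (_ : (x' - x)%:C = ((x' +i* y) - a) - ((x +i* y) - a)); last first.
  by apply: complex_ext; rewrite !ReImE/=; ring.
by move: z1 z2; set u := (_ +i* _) - a; set v := (_ +i* _) - a => z1 z2; field; rewrite z1 z2.
Qed.

Lemma normc_vertical_inv_le a x y r : 0 < r -> r <= `|x - complex.Re a| ->
  normc (((x +i* y) - a)^-1) <= r^-1.
Proof.
move=> r0 ra; have xa : x != complex.Re a.
  by apply: contraTneq ra => ->; rewrite subrr normr0 -ltNge.
rewrite normcV lef_pV2 ?posrE ?normc_gt0 ?vertical_neq//.
by apply: le_trans ra _; apply: le_trans (normc_re _); rewrite ReD ReN.
Qed.

Lemma hardy_pair_kernel c : 2^-1 < complex.Re c ->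
  hardy_pair (fun z => (z - c)^-1) (kap c).
Proof.
move=> c2; pose r := complex.Re c - 2^-1.
have r0 : 0 < r by rewrite subr_gt0.
have far x : x <= 2^-1 -> r <= `|x - complex.Re c|.
  by move=> x2; rewrite distrC ler_normr; apply/orP; left; rewrite /r; lra.
have nx x : x <= 2^-1 -> x != complex.Re c.
  by move=> x2; rewrite lt_eqF//; apply: le_lt_trans c2.
have [sk ke] := sqnorm_vertical_inv (nx _ (lexx _)).
split.
- by move=> z z2; apply: cdiff_inv; apply: contraTneq z2 => ->; rewrite -leNgt ltW.
- exists (pi / r) => x /ltW x2; have [sx ->] := sqnorm_vertical_inv (nx _ x2).
  split => //; rewrite ler_wpM2l ?pi_ge0// lef_pV2 ?posrE ?far//.
  exact: lt_le_trans (far _ x2).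
- exact: sk.
- move=> e e0; pose A := N2 (kap c); have A0 : 0 <= A by exact: sqrtr_ge0.
  exists (e * r / (A + 1)); first by rewrite divr_gt0 ?mulr_gt0// ltr_wpDl.
  move=> x x2 xd; have [sx _] := sqnorm_vertical_inv (nx _ (ltW x2)).
  have M0 : 0 <= (2^-1 - x) / r by rewrite divr_ge0 ?subr_ge0 ?ltW.
  have : sqnorm leb (fun y => on_line (fun z => (z - c)^-1) x y - kap c y) <=
      ((2^-1 - x) / r) ^+ 2 * sqnorm leb (kap c).
    apply: le_sqnorm => [||y] //; first exact: square_integrableB.
    rewrite /on_line /kap (vertical_inv_diff y (nx _ (ltW x2)) (nx _ (lexx _))).
    rewrite mulrA normcM ler_wpM2r ?normc_ge0// normcM normc_real.
    rewrite (ger0_norm (_ : 0 <= 2^-1 - x)) ?subr_ge0 ?(ltW x2)// ler_wpM2l ?subr_ge0 ?(ltW x2)//.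
    by apply: normc_vertical_inv_le => //; exact/far/ltW.
  move=> /ler_wsqrtr/le_trans; apply.
  rewrite sqrtrM ?sqr_ge0// sqrtr_sqr ger0_norm// -/A.
  move: xd; rewrite ltr_pdivlMr ?ltr_wpDl// => /ltW xd.
  rewrite mulrAC ler_pdivrMr//; apply: le_trans xd.
  by rewrite ler_wpM2l ?subr_ge0 ?(ltW x2)// lerDl.
Qed.

(** The reflection c of a in the boundary line: (a - c) / (z - c) takes the
    value 1 at a, and its product with 1 / (z - a) is 2 pi times the Poisson
    kernel. *)
Definition mirror a : R[i] := (1 - complex.Re a) +i* complex.Im a.

Lemma kap_mirror a y : complex.Re a < 2^-1 ->
  kap a y - kap (mirror a) y =
  (2 * (2^-1 - complex.Re a) / ((2^-1 - complex.Re a) ^+ 2 + (y - complex.Im a) ^+ 2))%:C.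
Proof.
move=> a2; set dl := 2^-1 - complex.Re a; set u := y - complex.Im a.
have dl0 : 0 < dl by rewrite subr_gt0.
have D0 : 0 < dl ^+ 2 + u ^+ 2 by rewrite ltr_pwDl ?exprn_gt0// sqr_ge0.
have e1 : (2^-1 +i* y) - a = dl +i* u.
  by apply: complex_ext; rewrite !ReImE.
have e2 : (2^-1 +i* y) - mirror a = (- dl) +i* u.
  by apply: complex_ext; rewrite /dl /u /mirror /=; field.
rewrite /kap e1 e2.
have z1 : dl +i* u != 0 by rewrite eq_complex/= gt_eqF.
have z2 : (- dl) +i* u != 0 by rewrite eq_complex/= oppr_eq0 gt_eqF.
have D0' : ((dl ^+ 2 + u ^+ 2)%:C : R[i]) != 0 by rewrite eq_complex/= gt_eqF.
have -> : (dl +i* u)^-1 = (dl +i* (- u)) / (dl ^+ 2 + u ^+ 2)%:C.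
  apply: (mulfI z1); rewrite divff// mulrA; apply: (mulIf D0'); rewrite divfK// mul1r.
  by apply: complex_ext; rewrite !ReImE/=; ring.
have -> : ((- dl) +i* u)^-1 = ((- dl) +i* (- u)) / (dl ^+ 2 + u ^+ 2)%:C.
  apply: (mulfI z2); rewrite divff// mulrA; apply: (mulIf D0'); rewrite divfK// mul1r.
  by apply: complex_ext; rewrite !ReImE/=; ring.
rewrite -mulrBl; apply: (mulIf D0'); rewrite divfK// -rmorphM/= divfK ?gt_eqF//.
by apply: complex_ext; rewrite !ReImE/=; ring.
Qed.

Lemma integral_kap_mirror a : complex.Re a < 2^-1 ->
  Rintegral leb setT (fun y => 2 * (2^-1 - complex.Re a) /
    ((2^-1 - complex.Re a) ^+ 2 + (y - complex.Im a) ^+ 2)) = 2 * pi.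
Proof.
move=> a2; set dl := 2^-1 - complex.Re a.
have dl0 : 0 < dl by rewrite subr_gt0.
have ip : leb.-integrable setT (EFin \o (fun y => (dl ^+ 2 + (y - complex.Im a) ^+ 2)^-1)).
  have a2' : 2^-1 != complex.Re a by rewrite gt_eqF.
  have [sk _] := sqnorm_vertical_inv a2'.
  have := square_integrable_sqr sk; apply: eq_integrable => // y _.
  by rewrite /= normc_vertical_inv.
rewrite (RintegralZl _ measurableT ip) /Rintegral integral_poisson//=.
by field; rewrite gt_eqF.
Qed.

Lemma mirror_right a : complex.Re a < 2^-1 -> 2^-1 < complex.Re (mirror a).
Proof. by rewrite /mirror /= => h; lra. Qed.

Lemma kap_square_integrable a : complex.Re a != 2^-1 -> square_integrable leb (kap a).
Proof. by rewrite eq_sym => /sqnorm_vertical_inv[]. Qed.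

Definition cauchy_transform f a : R[i] :=
  ((2 * pi)^-1)%:C * cintegral leb setT (fun y => f y * kap a y).

(** Subtracting F a times (a - c) / (z - c), with c the reflection of a,
    produces a Hardy function vanishing at a; what is left to compute is the
    integral of the Poisson kernel. *)
Lemma cauchy_formula F f a : hardy_pair F f -> complex.Re a < 2^-1 ->
  F a = cauchy_transform f a.
Proof.
move=> Ff a2; have c2 := mirror_right a2; set c := mirror a in c2.
have ac0 : a - c != 0.
  by rewrite subr_eq0; apply: contraTneq a2 => ->; rewrite -leNgt ltW.
pose k := - (F a * (a - c)).
have P := hardy_pair_lin k Ff (hardy_pair_kernel c2).
have P0 : F a + k * (a - c)^-1 = 0 by rewrite /k mulNr mulfK// subrr.
have := cauchy_left_zero P a2 P0.
have sa : square_integrable leb (kap a) by apply: kap_square_integrable; rewrite lt_eqF.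
have sc : square_integrable leb (kap c) by apply: kap_square_integrable; rewrite gt_eqF.
have [_ _ sf _] := Ff.
have i1 := cintegrableM2 sf sa; have i2 := cintegrableM2 sc sa.
have -> : cintegral leb setT (fun y => (f y + k * kap c y) * kap a y) =
    cintegral leb setT (fun y => f y * kap a y + k * (kap c y * kap a y)).
  by apply: eq_cintegral => y _; ring.
rewrite (cintegralD measurableT i1 (cintegrableZ k measurableT i2)).
rewrite (cintegralZ k measurableT i2) => /eqP; rewrite addr_eq0 => /eqP e.
have pi0 : (2 * pi : R) != 0 by rewrite mulf_neq0// gt_eqF// pi_gt0.
have piC : ((2 * pi : R)%:C : R[i]) != 0 by rewrite eq_complex/= negb_and pi0.
have h : (a - c) * cintegral leb setT (fun y => kap c y * kap a y) = (2 * pi)%:C.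
  rewrite -(cintegralZ _ measurableT i2) -(integral_kap_mirror a2) -cintegral_real.
  apply: eq_cintegral => y _; rewrite -kap_mirror// -/c /kap.
  have a2' : 2^-1 != complex.Re a by rewrite gt_eqF.
  have c2' : 2^-1 != complex.Re c by rewrite lt_eqF.
  have := vertical_neq y a2'; have := vertical_neq y c2'.
  rewrite (_ : a - c = ((2^-1 +i* y) - c) - ((2^-1 +i* y) - a)); last by ring.
  by set u := (_ +i* _) - a; set v := (_ +i* _) - c => v0 u0; field; rewrite v0 u0.
rewrite /cauchy_transform e /k mulNr opprK -mulrA h.
by rewrite mulrC -mulrA -rmorphM/= mulfV// mulr1.
Qed.

End CauchyFormula.

(** * Cauchy transforms *)

Section CauchyTransform.
Variable R : realType.
Local Notation RR := (measurableTypeR R).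
Local Notation leb := (@lebesgue_measure R).
Local Notation N2 f := (Num.sqrt (sqnorm leb f)).
Implicit Types (F G : R[i] -> R[i]) (f g : R -> R[i]) (x y t : R) (a c z w : R[i]).

Lemma kap_resolvent a w y : complex.Re a != 2^-1 -> complex.Re w != 2^-1 ->
  kap w y - kap a y = (w - a) * (kap w y * kap a y).
Proof.
rewrite eq_sym => a2; rewrite eq_sym => w2; rewrite /kap.
have := vertical_neq y a2; have := vertical_neq y w2.
rewrite (_ : w - a = ((2^-1 +i* y) - a) - ((2^-1 +i* y) - w)); last by ring.
by set u := (_ +i* _) - a; set v := (_ +i* _) - w => v0 u0; field; rewrite v0 u0.
Qed.

Lemma cmeas_kap a : complex.Re a != 2^-1 -> cmeas (setT : set RR) (kap a).
Proof. by move=> /kap_square_integrable[]. Qed.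

Lemma normc_kap_le a y r : 0 < r -> r <= `|2^-1 - complex.Re a| ->
  normc (kap a y) <= r^-1.
Proof. exact: normc_vertical_inv_le. Qed.

Lemma square_integrableM_kap f a : square_integrable leb f -> complex.Re a != 2^-1 ->
  square_integrable leb (fun y => f y * kap a y).
Proof.
move=> sf a2; have r0 : 0 < `|2^-1 - complex.Re a|.
  by rewrite normr_gt0 subr_eq0 eq_sym.
have -> : (fun y => f y * kap a y) = (fun y => kap a y * f y).
  by apply/funext => y; rewrite mulrC.
apply: (@square_integrableM_bounded _ _ _ _ _ _ (`|2^-1 - complex.Re a|^-1)) => //.
- exact: cmeas_kap.
- by move=> y; exact: normc_kap_le.
Qed.

Lemma cauchy_integrable f a : square_integrable leb f -> complex.Re a != 2^-1 ->
  cintegrable leb setT (fun y => f y * kap a y).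
Proof. by move=> sf a2; apply: cintegrableM2 => //; exact: kap_square_integrable. Qed.

(** Differentiation under the integral sign; the resolvent identity for the
    kernels reduces the remainder to a Cauchy-Schwarz estimate. *)
Lemma cdiff_cauchy_transform f a : square_integrable leb f ->
  complex.Re a < 2^-1 -> cdiff (cauchy_transform f) a.
Proof.
move=> sf a2; have a2' : complex.Re a != 2^-1 by rewrite lt_eqF.
pose d := 2^-1 - complex.Re a; have d0 : 0 < d by rewrite subr_gt0.
have dE : `|2^-1 - complex.Re a| = d by rewrite gtr0_norm.
have s1 := square_integrableM_kap sf a2'.
have s2 := square_integrableM_kap s1 a2'.
have i2 := cauchy_integrable s1 a2'.
pose C := N2 (fun y => f y * kap a y * kap a y) * N2 (kap a).
pose p : R[i] := ((2 * pi)^-1)%:C.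
have p0 : 0 <= normc p by exact: normc_ge0.
pose K := normc p * (N2 (fun y => f y * kap a y) * (2 / d * N2 (kap a))).
have K0 : 0 <= K by rewrite !mulr_ge0 ?sqrtr_ge0 ?normc_ge0// invr_ge0 ltW.
exists (p * cintegral leb setT (fun y => f y * kap a y * kap a y)) => e e0.
have q0 : 0 < e / (K + 1) by rewrite divr_gt0// ltr_wpDl.
exists (Num.min (d / 2) (e / (K + 1))); first by rewrite lt_min divr_gt0.
move=> w; rewrite lt_min => /andP[wd we].
have w2 : complex.Re w < 2^-1 - d / 2.
  have := normc_re (w - a); rewrite ReD ReN => h.
  have := le_lt_trans (le_trans (ler_norm _) h) wd; rewrite /d; lra.
have w2' : complex.Re w != 2^-1 by rewrite lt_eqF//; lra.
have iw := cauchy_integrable sf w2'; have ia := cauchy_integrable sf a2'.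
have sw := kap_square_integrable w2'; have sa := kap_square_integrable a2'.
have i3 := cintegrableM2 s1 (square_integrableB sw sa).
have -> : cauchy_transform f w - cauchy_transform f a -
    p * cintegral leb setT (fun y => f y * kap a y * kap a y) * (w - a) =
    p * (w - a) * cintegral leb setT (fun y => (f y * kap a y) * (kap w y - kap a y)).
  have -> : cintegral leb setT (fun y => (f y * kap a y) * (kap w y - kap a y)) =
      cintegral leb setT (fun y => f y * kap a y * kap w y) -
      cintegral leb setT (fun y => f y * kap a y * kap a y).
    rewrite -(cintegralB measurableT (cauchy_integrable s1 w2') i2).
    by apply: eq_cintegral => y _; ring.
  have e1 : cintegral leb setT (fun y => f y * kap w y) -
      cintegral leb setT (fun y => f y * kap a y) =
      (w - a) * cintegral leb setT (fun y => f y * kap a y * kap w y).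
    rewrite -(cintegralB measurableT iw ia).
    rewrite -(cintegralZ _ measurableT (cauchy_integrable s1 w2')).
    apply: eq_cintegral => y _; rewrite -mulrBr kap_resolvent//; ring.
  by rewrite /cauchy_transform -/p -[X in X - _ = _]mulrBr e1; ring.
rewrite 2!normcM.
have b : normc (cintegral leb setT (fun y => f y * kap a y * (kap w y - kap a y))) <=
    N2 (fun y => f y * kap a y) * (2 / d * N2 (kap a) * normc (w - a)).
  apply: le_trans (normc_cintegralM s1 (square_integrableB sw sa)) _.
  rewrite ler_wpM2l ?sqrtr_ge0//.
  have M0 : 0 <= 2 / d * normc (w - a) by rewrite !mulr_ge0 ?normc_ge0// invr_ge0 ltW.
  rewrite mulrAC -[X in X * _](ger0_norm M0) -sqrtr_sqr -sqrtrM ?sqr_ge0//.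
  apply: ler_wsqrtr; apply: le_sqnorm => [||y] //; first exact: square_integrableB.
  rewrite kap_resolvent// mulrA normcM ler_wpM2r ?normc_ge0// normcM mulrC.
  rewrite ler_wpM2r ?normc_ge0// -[X in _ <= X]invrK invf_div.
  apply: normc_kap_le; first by rewrite divr_gt0.
  rewrite ler_normr; apply/orP; left; lra.
apply: (@le_trans _ _ (normc (w - a) * (K * normc (w - a)))).
  apply: (@le_trans _ _ (normc p * normc (w - a) *
     (N2 (fun y => f y * kap a y) * (2 / d * N2 (kap a) * normc (w - a))))).
    by rewrite ler_wpM2l// mulr_ge0 ?normc_ge0.
  by rewrite le_eqVlt; apply/orP; left; apply/eqP; rewrite /K; ring.
rewrite mulrC ler_wpM2r ?normc_ge0//.
have := ltW we; rewrite ler_pdivlMr ?ltr_wpDl// => h.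
apply: le_trans h; rewrite mulrC ler_wpM2l ?normc_ge0// lerDl//.
Qed.

Definition poisson (d u : R) : R := d / pi / (d ^+ 2 + u ^+ 2).

Lemma poisson_ge0 d u : 0 < d -> 0 <= poisson d u.
Proof.
move=> d0; apply: mulr_ge0; first by rewrite divr_ge0 ?pi_ge0// ltW.
by rewrite invr_ge0 addr_ge0 ?sqr_ge0.
Qed.

Lemma measurable_poisson d : 0 < d -> measurable_fun (setT : set RR) (poisson d).
Proof.
move=> d0; apply: measurable_funM => //.
under eq_fun do rewrite -powR_inv1 ?addr_ge0 ?sqr_ge0//.
apply: (measurableT_comp (measurable_powR _)).
by apply: measurable_funD => //; exact: measurable_funX.
Qed.

Lemma integral_poisson1 d t : 0 < d ->
  (\int[leb]_y (poisson d (y - t))%:E = 1)%E.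
Proof.
move=> d0; have mp : measurable_fun (setT : set RR) (fun y => ((d ^+ 2 + (y - t) ^+ 2)^-1)%:E).
  apply/measurable_EFinP.
  under eq_fun do rewrite -powR_inv1 ?addr_ge0 ?sqr_ge0//.
  apply: (measurableT_comp (measurable_powR _)).
  by apply: measurable_funD => //; apply: measurable_funX; exact: measurable_funB.
under eq_integral do rewrite /poisson EFinM.
rewrite (ge0_integralZl leb measurableT mp).
- rewrite integral_poisson// -EFinM; congr EFin.
  have d0' : d != 0 by rewrite gt_eqF.
  have pi0 : pi != 0 :> R by rewrite gt_eqF// pi_gt0.
  by rewrite mulrA divfK// divff.
- by move=> y _; rewrite lee_fin invr_ge0 addr_ge0 ?sqr_ge0.
- by rewrite lee_fin divr_ge0 ?pi_ge0// ltW.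
Qed.

(** The conjugates of the kernels kap c span the Hardy space of the right half
    plane, the orthogonal complement of that of the left one. *)
Definition annihilates f := forall c, 2^-1 < complex.Re c ->
  cintegral leb setT (fun y => f y * kap c y) = 0.

(** The kernel at the reflected point contributes 0, and the difference of the
    two kernels is 2 pi times the Poisson kernel. *)
Lemma cauchy_transform_poisson f x t : square_integrable leb f -> annihilates f ->
  x < 2^-1 -> cauchy_transform f (x +i* t) =
  cintegral leb setT (fun y => f y * (poisson (2^-1 - x) (y - t))%:C).
Proof.
move=> sf af x2; set a := x +i* t; have a2 : complex.Re a < 2^-1 by [].
have c2 := mirror_right a2.
have ha : complex.Re a != 2^-1 by rewrite lt_eqF.
have hc : complex.Re (mirror a) != 2^-1 by rewrite gt_eqF.
have ia := cauchy_integrable sf ha; have ic := cauchy_integrable sf hc.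
rewrite /cauchy_transform -[cintegral _ _ _]subr0 -(af _ c2).
rewrite -(cintegralB measurableT ia ic) -(cintegralZ _ measurableT (cintegrableB measurableT ia ic)).
apply: eq_cintegral => y _; rewrite -mulrBr kap_mirror// mulrCA -rmorphM/=.
congr (_ * _%:C); rewrite /poisson /=; set D := _ ^+ 2 + _.
have pi0 : pi != 0 :> R by rewrite gt_eqF// pi_gt0.
have D0 : D != 0.
  by rewrite gt_eqF// ltr_pwDl ?sqr_ge0// exprn_gt0// subr_gt0.
by move: (pi : R) pi0 => p p0; field; rewrite D0 p0.
Qed.

(** By the Cauchy-Schwarz inequality for the probability density given by the
    Poisson kernel, followed by Tonelli's theorem. *)
Lemma poisson_contraction f x : square_integrable leb f -> annihilates f ->
  x < 2^-1 -> square_integrable leb (on_line (cauchy_transform f) x) /\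
  sqnorm leb (on_line (cauchy_transform f) x) <= sqnorm leb f.
Proof.
move=> sf af x2; pose d := 2^-1 - x; have d0 : 0 < d by rewrite subr_gt0.
have mC : cmeas (setT : set RR) (on_line (cauchy_transform f) x).
  by apply: cmeas_on_line => y; apply: cdiff_cont; exact: cdiff_cauchy_transform.
(* the square root splits the Poisson kernel between the two factors of the
   Cauchy-Schwarz inequality *)
pose s t y := Num.sqrt (poisson d (y - t)).
have mp t : measurable_fun (setT : set RR) (fun y => poisson d (y - t)).
  by apply: (measurableT_comp (measurable_poisson d0)); exact: measurable_funB.
have ms t : cmeas (setT : set RR) (fun y => (s t y)%:C).
  apply: cmeas_real; apply: (measurableT_comp _ (mp t)).
  by apply: continuous_measurable_fun; exact: sqrt_continuous.
have sM t y : normc ((s t y)%:C : R[i]) <= Num.sqrt ((d * pi)^-1).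
  rewrite normc_real ger0_norm ?sqrtr_ge0//; apply: ler_wsqrtr.
  rewrite /poisson ler_pdivrMr; last by rewrite ltr_pwDl ?exprn_gt0// sqr_ge0.
  rewrite (_ : d / pi = (d * pi)^-1 * d ^+ 2); last first.
    have d0' : d != 0 by rewrite gt_eqF.
    have pi0 : pi != 0 :> R by rewrite gt_eqF// pi_gt0.
    by move: (pi : R) pi0 => p p0; field; rewrite d0' p0.
  by rewrite ler_wpM2l ?lerDl ?sqr_ge0// invr_ge0 mulr_ge0 ?pi_ge0// ltW.
have ss t : square_integrable leb (fun y => (s t y)%:C).
  apply: (@square_integrable_dom _ _ _ leb _ (fun y : R => poisson d (y - t))) => //.
  - apply/integrableP; split; first by apply/measurable_EFinP; exact: mp.
    under eq_integral do rewrite /= ger0_norm ?poisson_ge0//.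
    by rewrite integral_poisson1// ltry.
  - move=> y; rewrite normc_real ger0_norm ?sqrtr_ge0// sqr_sqrtr//.
    exact: poisson_ge0.
have s1 t : sqnorm leb (fun y => (s t y)%:C) = 1.
  apply: EFin_inj; rewrite -sqnorm_EFin// -(integral_poisson1 t d0).
  apply: eq_integral => y _; rewrite normc_real ger0_norm ?sqrtr_ge0// sqr_sqrtr//.
  exact: poisson_ge0.
have sfs t : square_integrable leb (fun y => (s t y)%:C * f y).
  exact: square_integrableM_bounded (ms t) (sM t) sf.
have ptw t : ((normc (on_line (cauchy_transform f) x t) ^+ 2)%:E <=
    \int[leb]_y (normc (f y) ^+ 2 * poisson d (y - t))%:E)%E.
  rewrite /on_line cauchy_transform_poisson//.
  have -> : (\int[leb]_y (normc (f y) ^+ 2 * poisson d (y - t))%:E =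
      (sqnorm leb (fun y => (s t y)%:C * f y))%:E)%E.
    rewrite -sqnorm_EFin//; apply: eq_integral => y _; congr EFin.
    rewrite normcM exprMn normc_real ger0_norm ?sqrtr_ge0// sqr_sqrtr ?poisson_ge0//.
    by rewrite mulrC.
  rewrite lee_fin -[leRHS]sqr_sqrtr ?sqnorm_ge0// ler_sqr ?nnegrE ?sqrtr_ge0 ?normc_ge0//.
  have := normc_cintegralM (sfs t) (ss t); rewrite s1 sqrtr1 mulr1; apply: le_trans.
  rewrite le_eqVlt; apply/orP; left; apply/eqP; congr normc.
  apply: eq_cintegral => y _; rewrite mulrAC -rmorphM/= -expr2 sqr_sqrtr ?poisson_ge0//.
  by rewrite mulrC.
have mf := sf.1.
pose G (q : RR * RR) : \bar R := (normc (f q.2) ^+ 2 * poisson d (q.2 - q.1))%:E.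
have G0 q : (0 <= G q)%E.
  by rewrite lee_fin mulr_ge0 ?poisson_ge0 ?exprn_ge0 ?normc_ge0.
have mG : measurable_fun setT G.
  apply/measurable_EFinP; apply: measurable_funM.
    apply: measurable_funX.
    exact: (measurableT_comp (cmeas_normc mf) measurable_snd).
  apply: (measurableT_comp (measurable_poisson d0)).
  exact: (measurable_funB measurable_snd measurable_fst).
have ty := @fubini_tonelli _ _ _ _ _ leb leb G mG G0.
have e2 : (\int[leb]_y \int[leb]_t G (t, y) = (sqnorm leb f)%:E)%E.
  clear ty.
  rewrite -sqnorm_EFin//; apply: eq_integral => y _.
  have m1 : measurable_fun (setT : set RR) (fun t => (poisson d (t - y))%:E).
    by apply/measurable_EFinP; exact: mp.
  transitivity (\int[leb]_t ((normc (f y) ^+ 2)%:E * (poisson d (t - y))%:E))%E.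
    apply: eq_integral => t _; rewrite /G /= -EFinM /poisson.
    by rewrite -(sqrrN (t - y)) opprB.
  rewrite (ge0_integralZl leb measurableT m1).
  - by rewrite integral_poisson1// mule1.
  - by move=> t _; rewrite lee_fin poisson_ge0.
  - by rewrite lee_fin exprn_ge0 ?normc_ge0.
have le : (\int[leb]_t (normc (on_line (cauchy_transform f) x t) ^+ 2)%:E <= (sqnorm leb f)%:E)%E.
  rewrite -e2 -ty; apply: (ge0_le_integral leb measurableT).
  - by move=> t _; rewrite lee_fin exprn_ge0 ?normc_ge0.
  - by apply/measurable_EFinP; exact/measurable_funX/cmeas_normc.
  - exact: measurable_fun_fubini_tonelli_F.
  - by move=> t _; exact: ptw.
clear ty e2 ptw.
have sC : square_integrable leb (on_line (cauchy_transform f) x).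
  apply/square_integrableP; split => //; apply/integrableP; split.
    by apply/measurable_EFinP; exact/measurable_funX/cmeas_normc.
  under eq_integral do rewrite gee0_abs ?lee_fin ?exprn_ge0 ?normc_ge0//.
  exact: le_lt_trans le (ltry _).
by split => //; rewrite -lee_fin -sqnorm_EFin.
Qed.

End CauchyTransform.

(** * The Hardy space *)

Lemma ae_mono d (T : measurableType d) (R : realType) (mu : {measure set T -> \bar R})
    (P Q : T -> Prop) : (forall x, P x -> Q x) ->
  {ae mu, forall x, P x} -> {ae mu, forall x, Q x}.
Proof. by move=> PQ; apply: filterS => x; exact: PQ. Qed.

Section HardySpace.
Variable R : realType.
Local Notation RR := (measurableTypeR R).
Local Notation leb := (@lebesgue_measure R).
Local Notation N2 f := (Num.sqrt (sqnorm leb f)).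
Local Notation L2l := (L2 leb).
Implicit Types (F G : R[i] -> R[i]) (f g : R -> R[i]) (x y t : R) (a c z w : R[i]).

(** Membership in the Hardy space without reference to an extension: the
    extension is the Cauchy transform, and the bound on the vertical lines is
    a consequence of the first two conditions. *)
Definition hardy_fun f := [/\ square_integrable leb f, annihilates f &
  forall e : R, 0 < e -> exists2 dl : R, 0 < dl & forall x, x < 2^-1 ->
    2^-1 - x < dl -> N2 (fun y => on_line (cauchy_transform f) x y - f y) <= e].

Lemma hardy_fun_pair f : hardy_fun f -> hardy_pair (cauchy_transform f) f.
Proof.
move=> [sf af bf]; split => //.
- by move=> z; exact: cdiff_cauchy_transform.
- by exists (sqnorm leb f) => x; exact: poisson_contraction.
Qed.

Lemma hardy_pair_fun F f : hardy_pair F f -> hardy_fun f.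
Proof.
move=> Ff; have [_ _ sf bf] := Ff; split => //.
- by move=> c; exact: cauchy_right Ff.
- move=> e /bf[dl dl0 H]; exists dl => // x x2 xd.
  have -> : (fun y => on_line (cauchy_transform f) x y - f y) =
    (fun y => on_line F x y - f y).
    by apply/funext => y; rewrite /on_line (cauchy_formula Ff).
  exact: H.
Qed.

Lemma cauchy_transform_ae f g a : cmeas (setT : set RR) f -> cmeas (setT : set RR) g ->
  {ae leb, forall y, f y = g y} -> complex.Re a != 2^-1 ->
  cintegral leb setT (fun y => f y * kap a y) =
  cintegral leb setT (fun y => g y * kap a y).
Proof.
move=> mf mg fg a2; apply: ae_eq_cintegral => //.
- by apply: cmeasM => //; exact: cmeas_kap.
- by apply: cmeasM => //; exact: cmeas_kap.
- by move: fg; apply: ae_mono => y -> _.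
Qed.

Lemma hardy_fun_ae f g : square_integrable leb g ->
  {ae leb, forall y, f y = g y} -> hardy_fun f -> hardy_fun g.
Proof.
move=> sg fg hf; have [sf af bf] := hf; have mf := sf.1; have mg := sg.1; split => //.
- move=> c c2; rewrite -(cauchy_transform_ae mf mg fg) ?af// gt_eqF//.
- move=> e /bf[dl dl0 H]; exists dl => // x x2 xd.
  have mC : cmeas (setT : set RR) (on_line (cauchy_transform f) x).
    by have [+ _] := poisson_contraction sf af x2; case.
  have <- : sqnorm leb (fun y => on_line (cauchy_transform f) x y - f y) =
    sqnorm leb (fun y => on_line (cauchy_transform g) x y - g y).
    have -> : on_line (cauchy_transform g) x = on_line (cauchy_transform f) x.
      apply/funext => y; rewrite /on_line /cauchy_transform.
      by rewrite -(cauchy_transform_ae mf mg fg)// lt_eqF.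
    apply: ae_eq_sqnorm; [exact: cmeasB|exact: cmeasB|].
    by move: fg; apply: ae_mono => y ->.
  exact: H.
Qed.

Lemma left_limitP (u : R -> \bar R) (v : R -> R) :
  (forall x, x < 2^-1 -> u x = (v x)%:E) -> (forall x, 0 <= v x) ->
  (u x @[x --> (2^-1 : R)^'-] --> 0%E <->
   forall e : R, 0 < e -> exists2 dl : R, 0 < dl &
     forall x, x < 2^-1 -> 2^-1 - x < dl -> v x <= e).
Proof.
move=> uv v0; split.
- move=> /fine_cvgP[_ /cvgrPdist_le h] e e0.
  have [dl dl0 H] := h _ e0; exists dl => // x x2 xd.
  have := H x; rewrite /ball_/= sub0r normrN uv//= ger0_norm ?subr_ge0 ?(ltW x2)//.
  by move=> /(_ xd x2); apply: le_trans; exact: ler_norm.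
- move=> h; apply/fine_cvgP; split.
    by exists 1 => //= x _ x2; rewrite uv.
  apply/cvgrPdist_le => e /h[dl dl0 H]; exists dl => //= x xd x2.
  rewrite sub0r normrN uv//= ger0_norm//; apply: H => //.
  by move: xd; rewrite /ball_/= gtr0_norm// subr_gt0.
Qed.

(** By the Cauchy formula the extension of a Hardy function is the Cauchy
    transform of its boundary values; conversely the Poisson contraction
    bounds the Cauchy transform on the vertical lines. *)
Lemma H2_hardy (f : L2l) : H2 f <-> hardy_fun f.
Proof.
have sf : square_integrable leb f by exact: L2_reprP.
split.
- move=> [F [dF bF vF]].
  have dF' z : complex.Re z < 2^-1 -> cdiff F z by move=> /dF/cderivP.
  pose S x : \bar R := (\int[leb]_y (normc (F (x +i* y)) ^+ 2)%:E)%E.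
  have S0 x : (0 <= S x)%E.
    by apply: integral_ge0 => y _; rewrite lee_fin exprn_ge0 ?normc_ge0.
  have SM x : x < 2^-1 -> (S x <= ereal_sup [set S x | x in [set x : R | (x < 2^-1)%R]])%E.
    by move=> x2; apply: ereal_sup_ubound; exists x.
  pose s := ereal_sup [set S x | x in [set x : R | (x < 2^-1)%R]].
  have sfin : s \is a fin_num.
    rewrite ge0_fin_numE; first exact: bF.
    apply: le_trans (S0 (2^-1 - 1)) _; apply: SM; lra.
  have sF x : x < 2^-1 -> square_integrable leb (on_line F x).
    move=> x2; have mF : cmeas (setT : set RR) (on_line F x).
      by apply: cmeas_on_line => y; apply: cdiff_cont; exact: dF'.
    apply/square_integrableP; split => //; apply/integrableP; split.
      by apply/measurable_EFinP; exact/measurable_funX/cmeas_normc.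
    under eq_integral do rewrite gee0_abs ?lee_fin ?exprn_ge0 ?normc_ge0//.
    apply: le_lt_trans (SM _ x2) _; exact: bF.
  apply: (@hardy_pair_fun F); split => //.
  + exists (fine s) => x x2; split; first exact: sF.
    rewrite -lee_fin (fineK sfin) -(sqnorm_EFin (sF _ x2)); exact: SM.
  + apply: (proj1 (@left_limitP _ (fun x => N2 (fun y => on_line F x y - f y)) _ _) vF).
    * by move=> x x2; apply: cLnorm2_sqrt; apply: square_integrableB => //; exact: sF.
    * by move=> x; exact: sqrtr_ge0.
- move=> hf; have [dC _ _ bC] := hardy_fun_pair hf; have [_ af _] := hf.
  exists (cauchy_transform f); split.
  + by move=> z /dC/cderivP.
  + apply: (@le_lt_trans _ _ (sqnorm leb f)%:E); last exact: ltry.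
    apply: ge_ereal_sup => _ [x x2 <-]; have [sx le] := poisson_contraction sf af x2.
    by rewrite sqnorm_EFin// lee_fin.
  + apply: (proj2 (@left_limitP _ (fun x => N2 (fun y => on_line (cauchy_transform f) x y - f y)) _ _)) => //.
    * move=> x x2; have [sx _] := poisson_contraction sf af x2.
      by apply: cLnorm2_sqrt; apply: square_integrableB.
Qed.

Lemma hardy_fun0 : hardy_fun (fun=> 0).
Proof.
have s0 : square_integrable leb (fun=> 0) by exact: square_integrable0.
have N0 : sqnorm leb (fun=> 0) = 0.
  by rewrite /sqnorm; under eq_Rintegral do rewrite normc0 expr0n; rewrite /Rintegral integral0.
apply: (@hardy_pair_fun (fun=> 0)); split => //.
- by move=> z _; exact: cdiff_cst.
- by exists 0 => x _; rewrite /on_line N0.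
- move=> e e0; exists 1 => // x _ _; rewrite /on_line.
  by under eq_fun do rewrite subr0; rewrite N0 sqrtr0 ltW.
Qed.

Lemma nrm_sub_sqnorm (f g : L2l) : nrm (f - g) = N2 (fun y => f y - g y).
Proof.
rewrite nrmE; congr Num.sqrt; apply: ae_eq_sqnorm; last exact: L2_subE.
- exact: (L2_reprP _).1.
- by apply: cmeasB; exact: (L2_reprP _).1.
Qed.

(** The contraction property makes the convergence to the boundary values
    stable under limits in mean square, by the usual argument with three
    thirds of e. *)
Lemma H2_closed : closed_subspace (@H2 R).
Proof.
split.
- apply/H2_hardy; apply: hardy_fun_ae hardy_fun0; first exact: L2_reprP.
  by move: (L2_zeroE leb); apply: ae_mono => y ->.
- move=> c f g /H2_hardy/hardy_fun_pair hf /H2_hardy/hardy_fun_pair hg.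
  apply/H2_hardy; apply: hardy_fun_ae (hardy_pair_fun (hardy_pair_lin c hg hf)).
    exact: L2_reprP.
  have := ae_and (L2_addE (c *: f) g) (L2_scaleE c f).
  by apply: ae_mono => y /= [-> ->]; exact: addrC.
- move=> f cf; apply/H2_hardy; have sf : square_integrable leb f by exact: L2_reprP.
  have af : annihilates f.
    move=> c c2; have hc : complex.Re c != 2^-1 by rewrite gt_eqF.
    have sc := kap_square_integrable hc.
    have q0 : 0 < N2 (kap c) + 1 by rewrite ltr_wpDl ?sqrtr_ge0.
    apply: eq0_normc; apply/eqP; rewrite eq_le normc_ge0 andbT.
    apply/ler_addgt0Pr => e e0; rewrite add0r.
    have [g /H2_hardy[sg ag _] fg] := cf _ (divr_gt0 e0 q0).
    have sh := square_integrableB sf sg.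
    rewrite -[cintegral _ _ _]subr0 -(ag _ c2).
    rewrite -(cintegralB measurableT (cauchy_integrable sf hc) (cauchy_integrable sg hc)).
    have -> : cintegral leb setT (fun y => f y * kap c y - g y * kap c y) =
        cintegral leb setT (fun y => (f y - g y) * kap c y).
      by apply: eq_cintegral => y _; ring.
    apply: le_trans (normc_cintegralM sh sc) _.
    move: fg; rewrite nrm_sub_sqnorm ltr_pdivlMr// => /ltW; apply: le_trans.
    by rewrite ler_wpM2l ?sqrtr_ge0// lerDl.
  split => // e e0; have e3 : 0 < e / 3 by rewrite divr_gt0.
  have [g /H2_hardy[sg ag bg] fg] := cf _ e3; have [dl dl0 H] := bg _ e3.
  exists dl => // x x2 xd; pose h y := f y - g y.
  have sh : square_integrable leb h by exact: square_integrableB.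
  have ah : annihilates h.
    move=> c c2; have hc : complex.Re c != 2^-1 by rewrite gt_eqF.
    rewrite -(subr0 0) -{1}(af _ c2) -(ag _ c2).
    rewrite -(cintegralB measurableT (cauchy_integrable sf hc) (cauchy_integrable sg hc)).
    by apply: eq_cintegral => y _; rewrite /h; ring.
  have [sCh leh] := poisson_contraction sh ah x2.
  have [sCg _] := poisson_contraction sg ag x2.
  have hE y : on_line (cauchy_transform f) x y - f y =
      on_line (cauchy_transform h) x y +
      ((on_line (cauchy_transform g) x y - g y) + - h y).
    have -> : on_line (cauchy_transform h) x y =
        on_line (cauchy_transform f) x y - on_line (cauchy_transform g) x y.
      have hx : complex.Re (x +i* y) != 2^-1 by rewrite lt_eqF.
      rewrite /on_line /cauchy_transform -mulrBr.
      rewrite -(cintegralB measurableT (cauchy_integrable sf hx) (cauchy_integrable sg hx)).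
      by congr (_ * _); apply: eq_cintegral => s _; rewrite /h; ring.
    by rewrite /h; ring.
  have sD := square_integrableB sCg sg; have sN := square_integrableN sh.
  have -> : (fun y => on_line (cauchy_transform f) x y - f y) =
    (fun y => on_line (cauchy_transform h) x y +
      ((on_line (cauchy_transform g) x y - g y) + - h y)) by apply/funext; exact: hE.
  apply: le_trans (sqrt_sqnormD sCh (square_integrableD sD sN)) _.
  have k1 : N2 (on_line (cauchy_transform h) x) <= e / 3.
    apply: le_trans (ler_wsqrtr leh) _; apply: ltW.
    by rewrite /h -nrm_sub_sqnorm.
  have k2 : N2 (fun y => (on_line (cauchy_transform g) x y - g y) + - h y) <= e / 3 + e / 3.
    apply: le_trans (sqrt_sqnormD sD sN) _; apply: lerD; first exact: H.
    by rewrite sqnormN /h -nrm_sub_sqnorm ltW.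
  apply: le_trans (lerD k1 k2) _; lra.
Qed.

(** The Lipschitz condition on H near the boundary makes the boundary value of
    H F the product of the boundary values. *)
Lemma hardy_pair_multiplier H (M C : R) F f : hardy_pair F f ->
  (forall z, complex.Re z < 2^-1 -> cdiff H z) ->
  cmeas (setT : set RR) (on_line H 2^-1) ->
  (forall x y, x <= 2^-1 -> normc (H (x +i* y)) <= M) ->
  (forall x y, x < 2^-1 ->
     normc (H (x +i* y) - H (2^-1 +i* y)) <= C * (2^-1 - x)) ->
  hardy_pair (fun z => H z * F z) (fun y => on_line H 2^-1 y * f y).
Proof.
move=> [dF [B FB] sf bF] dH mH HM HC.
have M0 : 0 <= M by apply: le_trans (HM 0 0 _); rewrite ?normc_ge0 ?invr_ge0.
have C0 : 0 <= C.
  have := HC (2^-1 - 1) 0; rewrite subKr mulr1 => h; apply: le_trans (h _).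
    exact: normc_ge0.
  by rewrite ltrBlDr ltrDl.
have mHx x : x < 2^-1 -> cmeas (setT : set RR) (on_line H x).
  by move=> x2; apply: cmeas_on_line => y; apply: cdiff_cont; exact: dH.
have sHF x : x < 2^-1 -> square_integrable leb (on_line (fun z => H z * F z) x).
  move=> x2; have [sF _] := FB _ x2.
  apply: (square_integrableM_bounded (mHx _ x2) _ sF) => y; exact/HM/ltW.
have sHf : square_integrable leb (fun y => on_line H 2^-1 y * f y).
  by apply: (square_integrableM_bounded mH _ sf) => y; exact: HM.
split => //.
- by move=> z z2; apply: cdiffM; [exact: dH|exact: dF].
- exists (M ^+ 2 * B) => x x2; split; first exact: sHF.
  have [sF FxB] := FB _ x2.
  apply: (@le_trans _ _ (M ^+ 2 * sqnorm leb (on_line F x))).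
    apply: le_sqnorm => // [|y]; first exact: sHF.
    by rewrite /on_line normcM ler_wpM2r ?normc_ge0//; exact/HM/ltW.
  by rewrite ler_wpM2l// sqr_ge0.
- move=> e e0; have e2 : 0 < e / 2 by rewrite divr_gt0.
  have M1 : 0 < M + 1 by rewrite ltr_wpDl.
  have [d1 d10 H1] := bF _ (divr_gt0 e2 M1).
  have A0 : 0 <= N2 f by exact: sqrtr_ge0.
  have q0 : 0 < C * N2 f + 1 by rewrite ltr_wpDl// mulr_ge0.
  exists (Num.min d1 (e / 2 / (C * N2 f + 1))).
    by rewrite lt_min d10 divr_gt0.
  move=> x x2; rewrite lt_min => /andP[xd1 xd2].
  have [sF _] := FB _ x2; have sD := square_integrableB sF sf.
  have mD : cmeas (setT : set RR) (fun y => on_line H x y - on_line H 2^-1 y).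
    by apply: cmeasB => //; exact: mHx.
  have DC y : normc (on_line H x y - on_line H 2^-1 y) <= C * (2^-1 - x).
    exact: HC.
  have s1 : square_integrable leb (fun y => on_line H x y * (on_line F x y - f y)).
    by apply: (square_integrableM_bounded (mHx _ x2) _ sD) => y; exact/HM/ltW.
  have s2 := square_integrableM_bounded mD DC sf.
  have -> : (fun y => on_line (fun z => H z * F z) x y - on_line H 2^-1 y * f y) =
    (fun y => on_line H x y * (on_line F x y - f y) +
       (on_line H x y - on_line H 2^-1 y) * f y).
    by apply/funext => y; rewrite /on_line; ring.
  apply: le_trans (sqrt_sqnormD s1 s2) _.
  have k1 : N2 (fun y => on_line H x y * (on_line F x y - f y)) <= e / 2.
    apply: (@le_trans _ _ (M * N2 (fun y => on_line F x y - f y))).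
      rewrite -[X in X * _](ger0_norm M0) -sqrtr_sqr -sqrtrM ?sqr_ge0//.
      apply: ler_wsqrtr; apply: le_sqnorm => // y.
      by rewrite normcM ler_wpM2r ?normc_ge0//; exact/HM/ltW.
    apply: (@le_trans _ _ (M * (e / 2 / (M + 1)))); first by rewrite ler_wpM2l// H1.
    rewrite mulrA ler_pdivrMr// mulrC; apply: ler_wpM2l; first exact: ltW.
    by rewrite lerDl.
  have k2 : N2 (fun y => (on_line H x y - on_line H 2^-1 y) * f y) <= e / 2.
    have D0 : 0 <= C * (2^-1 - x) by rewrite mulr_ge0// subr_ge0 ltW.
    apply: (@le_trans _ _ (C * (2^-1 - x) * N2 f)).
      rewrite -[X in X * _](ger0_norm D0) -sqrtr_sqr -sqrtrM ?sqr_ge0//.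
      apply: ler_wsqrtr; apply: le_sqnorm => // y.
      by rewrite normcM ler_wpM2r ?normc_ge0.
    move: xd2; rewrite ltr_pdivlMr// => /ltW; apply: le_trans.
    rewrite mulrAC mulrC; apply: ler_wpM2l; first by rewrite subr_ge0 ltW.
    by rewrite lerDl.
  by apply: le_trans (lerD k1 k2) _; rewrite -splitr.
Qed.

(** The Cauchy transform of f / (z - a) is (F - F a) / (z - a), where F is the
    Cauchy transform of f. *)
Lemma hardy_fun_division f a : hardy_fun f -> complex.Re a < 2^-1 ->
  cauchy_transform f a = 0 -> hardy_fun (fun y => f y * kap a y).
Proof.
move=> hf a2 Ca0; have [dF [B FB] sf bF] := hardy_fun_pair hf; have [_ af _] := hf.
have ha : complex.Re a != 2^-1 by rewrite lt_eqF.
have pi0 : (2 * pi : R) != 0 by rewrite mulf_neq0// gt_eqF// pi_gt0.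
have C0 : cintegral leb setT (fun y => f y * kap a y) = 0.
  move/eqP: Ca0; rewrite /cauchy_transform mulf_eq0 => /orP[|/eqP//].
  by rewrite eq_complex/= invr_eq0 (negbTE pi0).
have sfa := square_integrableM_kap sf ha.
(* the resolvent identity for the kernels at a and c, where the integral at a
   vanishes *)
have E c : complex.Re c != 2^-1 -> c != a ->
    cintegral leb setT (fun y => f y * kap a y * kap c y) =
    (c - a)^-1 * cintegral leb setT (fun y => f y * kap c y).
  move=> hc ca; have ca0 : c - a != 0 by rewrite subr_eq0.
  have ic := cauchy_integrable sf hc; have ia := cauchy_integrable sf ha.
  have -> : cintegral leb setT (fun y => f y * kap c y) =
      cintegral leb setT (fun y => f y * kap c y - f y * kap a y).
    by rewrite (cintegralB measurableT ic ia) C0 subr0.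
  rewrite -(cintegralZ _ measurableT (cintegrableB measurableT ic ia)).
  apply: eq_cintegral => y _; rewrite -mulrBr kap_resolvent//.
  by move: (c - a) ca0 (kap a y) (kap c y) (f y) => k k0 p q u; field.
split => //.
- move=> c c2; have ca : c != a.
    by apply: contraTneq c2 => ->; rewrite -leNgt ltW.
  have hc : complex.Re c != 2^-1 by rewrite gt_eqF.
  rewrite (E _ hc ca) [X in _ * X](_ : _ = 0) ?mulr0//; exact: af.
- pose r := (2^-1 - complex.Re a) / 2.
  have r0 : 0 < r by rewrite divr_gt0// subr_gt0.
  have kr y : normc (kap a y) <= r^-1.
    apply: normc_kap_le => //; rewrite ler_normr; apply/orP; left; rewrite /r.
    lra.
  move=> e e0; have e2 : 0 < e / 2 by rewrite divr_gt0.
  have [d1 d10 H1] := bF _ (mulr_gt0 e2 r0).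
  have A0 : 0 <= N2 f by exact: sqrtr_ge0.
  pose K := r^-1 * r^-1 * N2 f.
  have K0 : 0 <= K by rewrite /K !mulr_ge0 ?invr_ge0 ?(ltW r0).
  exists (Num.min r (Num.min d1 (e / 2 / (K + 1)))).
    by rewrite !lt_min r0 d10 divr_gt0// ltr_wpDl.
  move=> x x2; rewrite !lt_min => /and3P[xr xd1 xd2].
  have xa : r <= `|x - complex.Re a|.
    by rewrite ler_normr; apply/orP; left; move: xr; rewrite /r; lra.
  have xna : x != complex.Re a.
    by apply: contraTneq xa => ->; rewrite subrr normr0 -ltNge.
  pose k y := ((x +i* y) - a)^-1.
  have kxr y : normc (k y) <= r^-1 by exact: normc_vertical_inv_le.
  have [skx _] := sqnorm_vertical_inv xna; have sk := kap_square_integrable ha.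
  have [sF _] := FB _ x2; have sD := square_integrableB sF sf.
  have -> : (fun y => on_line (cauchy_transform (fun y => f y * kap a y)) x y - f y * kap a y) =
    (fun y => k y * (on_line (cauchy_transform f) x y - f y) + (k y - kap a y) * f y).
    apply/funext => y; have hx : complex.Re (x +i* y) != 2^-1 by rewrite lt_eqF.
    have xa' : x +i* y != a by rewrite -subr_eq0 vertical_neq.
    rewrite /on_line /cauchy_transform (E _ hx xa').
    by rewrite /k; ring.
  have s1 : square_integrable leb (fun y => k y * (on_line (cauchy_transform f) x y - f y)).
    exact: (square_integrableM_bounded skx.1 kxr sD).
  have kD y : normc (k y - kap a y) <= r^-1 * r^-1 * (2^-1 - x).
    rewrite /k /kap vertical_inv_diff//; last by rewrite eq_sym.
    rewrite normcM normc_real mulrC gtr0_norm ?subr_gt0// ler_wpM2r//.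
      by rewrite subr_ge0 ltW.
    by rewrite normcM; apply: ler_pM; rewrite ?normc_ge0//; [exact: kxr|exact: kr].
  have s2 : square_integrable leb (fun y => (k y - kap a y) * f y).
    exact: (square_integrableM_bounded (cmeasB skx.1 sk.1) kD sf).
  apply: le_trans (sqrt_sqnormD s1 s2) _.
  have k1 : N2 (fun y => k y * (on_line (cauchy_transform f) x y - f y)) <= e / 2.
    apply: (@le_trans _ _ (r^-1 * N2 (fun y => on_line (cauchy_transform f) x y - f y))).
      have ir : 0 <= r^-1 by rewrite invr_ge0 ltW.
      rewrite -[X in X * _](ger0_norm ir) -sqrtr_sqr -sqrtrM ?sqr_ge0//.
      apply: ler_wsqrtr; apply: le_sqnorm => // y.
      by rewrite normcM ler_wpM2r ?normc_ge0.
    by rewrite mulrC ler_pdivrMr//; exact: H1.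
  have k2 : N2 (fun y => (k y - kap a y) * f y) <= e / 2.
    have D0 : 0 <= r^-1 * r^-1 * (2^-1 - x).
      by rewrite !mulr_ge0 ?invr_ge0 ?(ltW r0)// subr_ge0 ltW.
    apply: (@le_trans _ _ (r^-1 * r^-1 * (2^-1 - x) * N2 f)).
      rewrite -[X in X * _](ger0_norm D0) -sqrtr_sqr -sqrtrM ?sqr_ge0//.
      apply: ler_wsqrtr; apply: le_sqnorm => // y.
      by rewrite normcM ler_wpM2r ?normc_ge0.
    move: xd2; rewrite ltr_pdivlMr ?ltr_wpDl// => /ltW; apply: le_trans.
    rewrite mulrAC -/K mulrC; apply: ler_wpM2l; first by rewrite subr_ge0 ltW.
    by rewrite lerDl.
  by apply: le_trans (lerD k1 k2) _; rewrite -splitr.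
Qed.

End HardySpace.

(** * Hankel operators *)

Lemma scale_add_sub (K : pzRingType) (V : lmodType K) (c : K) (x y x' y' : V) :
  c *: x + y - (c *: x' + y') = c *: (x - x') + (y - y').
Proof. by rewrite opprD scalerBr addrACA. Qed.

Lemma addr_subr_l (V : zmodType) (x y : V) : y + x - y = x.
Proof. by rewrite addrC addKr. Qed.

Section HankelOperators.
Variable R : realType.
Local Notation RR := (measurableTypeR R).
Local Notation leb := (@lebesgue_measure R).
Local Notation L2l := (L2 leb).
Local Notation P := (@Hardy_proj R).
Implicit Types (f g : L2l) (u v w : RR -> R[i]) (a c : R[i]).

Definition hankel v f : L2l := mult_op v (P f) - P (mult_op v (P f)).

Definition bounded_symbol v (M : R) :=
  [/\ cmeas (setT : set RR) v, 0 <= M & forall y, normc (v y) <= M].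

Lemma Hardy_proj_linear : linear P.
Proof. exact: orth_proj_linear (@H2_closed R). Qed.

Lemma hankel_linear v M : bounded_symbol v M -> linear (hankel v).
Proof.
move=> [mv M0 vM] c f g; rewrite /hankel.
rewrite Hardy_proj_linear (mult_op_linear mv vM).
rewrite Hardy_proj_linear; exact: scale_add_sub.
Qed.

Lemma nrm_hankel v M f : bounded_symbol v M -> nrm (hankel v f) <= M * nrm f.
Proof.
move=> [mv M0 vM]; apply: le_trans (nrm_coproj_le (@H2_closed R) _) _.
apply: le_trans (nrm_mult_op mv M0 vM _) _; rewrite ler_wpM2l//.
exact: (nrm_proj_le (@H2_closed R)).
Qed.

Lemma hankel_comb v w w' (M M1 M2 : R) c f : bounded_symbol v M ->
  bounded_symbol w M1 -> bounded_symbol w' M2 ->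
  (forall y, v y = c * w y + w' y) ->
  hankel v f = c *: hankel w f + hankel w' f.
Proof.
move=> [mv M0 vM] [mw M10 wM] [mw' M20 wM'] vE; rewrite /hankel.
have -> : mult_op v (P f) = c *: mult_op w (P f) + mult_op w' (P f).
  apply: L2_eqP; have := ae_and (ae_and (mult_opE mv vM (P f))
     (ae_and (mult_opE mw wM (P f)) (mult_opE mw' wM' (P f))))
   (ae_and (L2_addE (c *: mult_op w (P f)) (mult_op w' (P f)))
     (L2_scaleE c (mult_op w (P f)))).
  apply: ae_mono => y /= [[-> [e1 e2]] [-> ->]].
  by rewrite e1 e2 vE mulrDl mulrA.
by rewrite Hardy_proj_linear; exact: scale_add_sub.
Qed.

Lemma hardy_fun_proj f : hardy_fun (P f).
Proof. by apply/H2_hardy; have [] := orth_projP (@H2_closed R) f. Qed.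

Lemma hankel_eq0 v M f : bounded_symbol v M -> hardy_fun (fun y => v y * P f y) ->
  hankel v f = 0.
Proof.
move=> [mv M0 vM] hv; rewrite /hankel.
have Hv : H2 (mult_op v (P f)).
  apply/H2_hardy; apply: hardy_fun_ae hv; first exact: L2_reprP.
  by have := mult_opE mv vM (P f); apply: ae_mono => y ->.
rewrite {2}/Hardy_proj (orth_proj_id (@H2_closed R) Hv); exact: subrr.
Qed.

Lemma kap_bounded_symbol a : complex.Re a != 2^-1 ->
  bounded_symbol (kap a) (`|2^-1 - complex.Re a|^-1).
Proof.
move=> a2; split; [exact: cmeas_kap|by rewrite invr_ge0|].
by move=> y; apply: normc_kap_le => //; rewrite normr_gt0 subr_eq0 eq_sym.
Qed.

(** Evaluation at a of the extension of the projection of f. *)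
Definition hardy_point a f := cauchy_transform (P f) a.

Lemma hardy_point_linear a : complex.Re a != 2^-1 ->
  forall c f g, hardy_point a (c *: f + g) = c * hardy_point a f + hardy_point a g.
Proof.
move=> a2 c f g; rewrite /hardy_point Hardy_proj_linear.
move: (P f) (P g) => p q.
have sp : square_integrable leb p by exact: L2_reprP.
have sq : square_integrable leb q by exact: L2_reprP.
have ip := cauchy_integrable sp a2; have iq := cauchy_integrable sq a2.
rewrite /cauchy_transform (@cauchy_transform_ae _ _ (fun y => c * p y + q y)) //.
- rewrite [in RHS]mulrCA -mulrDr -(cintegralZ c measurableT ip).
  rewrite -(cintegralD measurableT (cintegrableZ c measurableT ip) iq).
  by congr (_ * _); apply: eq_cintegral => y _; ring.
- exact: (L2_reprP _).1.
- by apply: cmeasD; [apply: cmeasM; [exact: cmeas_cst|exact: sp.1]|exact: sq.1].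
- have := ae_and (L2_addE (c *: p) q) (L2_scaleE c p).
  by apply: ae_mono => y /= [-> ->].
Qed.

(** The division property: the Hankel operator with symbol 1 / (z - a) has at
    most rank one, since its kernel contains that of a linear form. *)
Lemma hankel_kap_eq0 a f : complex.Re a < 2^-1 -> hardy_point a f = 0 ->
  hankel (kap a) f = 0.
Proof.
move=> a2 fa; apply: (hankel_eq0 (kap_bounded_symbol _)); first by rewrite lt_eqF.
have := hardy_fun_division (hardy_fun_proj f) a2 fa.
by under eq_fun do rewrite mulrC.
Qed.

Section PartialFractions.
Variables (u h : RR -> R[i]) (r a : nat -> R[i]) (eps : nat -> R) (Mu Mh : R).

Definition pole_remainder n y := u y - h y - \sum_(k < n) r k * kap (a k) y.

Hypotheses (bu : bounded_symbol u Mu) (bh : bounded_symbol h Mh)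
  (hH : forall f, hardy_fun f -> hardy_fun (fun y => h y * f y))
  (a2 : forall k, complex.Re (a k) < 2^-1)
  (er : forall n y, normc (pole_remainder n y) <= eps n).

Let a2' k : complex.Re (a k) != 2^-1. Proof. by rewrite lt_eqF. Qed.

Let eps0 n : 0 <= eps n. Proof. exact: le_trans (normc_ge0 _) (er n 0). Qed.

Let ber n : bounded_symbol (pole_remainder n) (eps n).
Proof.
split=> //; have [mu _ _] := bu; have [mh _ _] := bh.
apply: cmeasB; first exact: cmeasB.
elim: n => [|n IH].
  by under eq_fun do rewrite big_ord0; exact: cmeas_cst.
under eq_fun do rewrite big_ord_recr/=.
apply: cmeasD => //; apply: cmeasM; [exact: cmeas_cst|exact: cmeas_kap].
Qed.

(* The symbol h contributes nothing since it preserves the Hardy space. *)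
Let hankel_sum n f : hankel u f =
  \sum_(k < n) r k *: hankel (kap (a k)) f + hankel (pole_remainder n) f.
Proof.
elim: n => [|n ->].
  rewrite big_ord0 add0r (hankel_comb (c := 1) f bu bh (ber 0)).
    by rewrite (hankel_eq0 bh (hH (hardy_fun_proj f))) scaler0 add0r.
  by move=> y; rewrite /pole_remainder big_ord0 subr0 mul1r addrC subrK.
rewrite big_ord_recr/= -addrA; congr (_ + _).
apply: (hankel_comb f (ber n) (kap_bounded_symbol (a2' n)) (ber n.+1)) => y.
by rewrite /pole_remainder big_ord_recr/=; ring.
Qed.

(** On the common kernel of the n evaluations at the poles the Hankel operator
    coincides with that of the remainder. *)
Lemma partial_fraction_singular_value n : 0 <= singular_value (hankel u) n <= eps n.
Proof.
apply: (@singular_value_le _ _ _ _ _ n (fun k => hardy_point (a k))) => //.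
- exact: hankel_linear bu.
- by move=> k c f g; exact: hardy_point_linear.
- move=> f f0; rewrite (hankel_sum n f) big1 ?add0r; first exact: nrm_hankel (ber n).
  by move=> k _; rewrite hankel_kap_eq0 ?scaler0.
Qed.

(** The operator is a limit of finite sums of operators of rank one. *)
Lemma partial_fraction_compact : (forall e : R, 0 < e -> exists n, eps n <= e) ->
  compact_op (hankel u).
Proof.
move=> eps_small; apply: compact_op_approx; first exact: hankel_linear bu.
move=> e e0; have [n en] := eps_small _ e0.
pose t (k : 'I_n) f := r k *: hankel (kap (a k)) f.
exists (fun f => \sum_(k < n) t k f); split; last first.
  move=> f; rewrite (hankel_sum n f) addr_subr_l.
  apply: le_trans (nrm_hankel f (ber n)) _.
  by rewrite ler_wpM2r ?nrm_ge0.
pose B k := normc (r k) * `|2^-1 - complex.Re (a k)|^-1.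
have B0 k : 0 <= B k by rewrite mulr_ge0 ?normc_ge0 ?invr_ge0.
apply: (@totally_bounded_rank _ _ _ _ n t (fun k => hardy_point (a k)) (\sum_(k < n) B k)).
- by apply: sumr_ge0 => k _.
- move=> k c f g; rewrite /t (hankel_linear (kap_bounded_symbol (a2' k))).
  by rewrite scalerDr !scalerA mulrC.
- by move=> k c f g; exact: hardy_point_linear.
- move=> k f; rewrite nrmZ; apply: (@le_trans _ _ (B k * nrm f)).
    rewrite -mulrA ler_wpM2l ?normc_ge0//.
    exact: nrm_hankel (kap_bounded_symbol (a2' k)).
  rewrite ler_wpM2r ?nrm_ge0// (bigD1 k)//= lerDl.
  by apply: sumr_ge0 => j _.
- by move=> k f fk; rewrite /t hankel_kap_eq0// scaler0.
Qed.

End PartialFractions.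
End HankelOperators.

(** * The complex exponential *)

Section ComplexExponential.
Variable R : realType.
Implicit Types (z w s : R[i]) (a b x y : R) (F G : R[i] -> R[i]).

Lemma normc_pairE a b : normc (a +i* b) = Num.sqrt (a ^+ 2 + b ^+ 2).
Proof. by []. Qed.

Lemma cexpE a b : cexp (a +i* b) = (expR a * cos b) +i* (expR a * sin b) :> R[i].
Proof. by apply: complex_ext; rewrite /cexp /=; ring. Qed.

Lemma cexp_real x : cexp (x%:C : R[i]) = (expR x)%:C.
Proof. by rewrite cexpE cos0 sin0 mulr1 mulr0. Qed.

Lemma cexp0 : cexp (0 : R[i]) = 1.
Proof. by rewrite (cexp_real 0) expR0. Qed.

Lemma cexpD z w : cexp (z + w) = cexp z * cexp w.
Proof.
case: z w => [a b] [c d]; rewrite !cexpE; apply: complex_ext => /=.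
  by rewrite expRD cosD; ring.
by rewrite expRD sinD; ring.
Qed.

Lemma normc_cexp z : normc (cexp z) = expR (complex.Re z).
Proof.
case: z => a b; rewrite cexpE normc_pairE /= !exprMn -mulrDr cos2Dsin2 mulr1 sqrtr_sqr.
by rewrite ger0_norm ?expR_ge0.
Qed.

Lemma cexp_conj z : conjc (cexp z) = cexp (conjc z).
Proof.
by case: z => a b; rewrite [conjc (a +i* b)]/= !cexpE cosN sinN mulrN.
Qed.

Lemma cexp_neq0 z : cexp z != 0.
Proof. by rewrite -normc_eq0 normc_cexp gt_eqF// expR_gt0. Qed.

Lemma sin_le_norm b : `|sin b| <= `|b|.
Proof.
wlog b0 : b / 0 <= b.
  move=> h; have [/h//|/ltW b0] := leP 0 b.
  by rewrite -normrN -sinN -(normrN b); apply: h; rewrite oppr_ge0.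
rewrite (ger0_norm b0); move: b0; rewrite le_eqVlt => /orP[/eqP <-|b0].
  by rewrite sin0 normr0.
have [c _] := MVT_segment (ltW b0) (fun x _ => is_derive_sin x)
  (continuous_subspaceT (@continuous_sin R)).
rewrite sin0 !subr0 => ->; rewrite normrM (gtr0_norm b0) ler_piMl ?(ltW b0)//.
by rewrite ler_norml cos_geN1 cos_le1.
Qed.

Lemma oneB_cos b : 1 - cos b = 2 * sin (b / 2) ^+ 2.
Proof.
rewrite {1}[b]splitr cosD -!expr2; have := cos2Dsin2 (b / 2).
by set c := cos _; set s := sin _ => h; lra.
Qed.

Lemma oneB_cos_ge0 b : 0 <= 1 - cos b.
Proof. by rewrite subr_ge0 cos_le1. Qed.

Lemma oneB_cos_le b : 1 - cos b <= b ^+ 2 / 2.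
Proof.
rewrite oneB_cos; have := sin_le_norm (b / 2).
rewrite -ler_sqr ?nnegrE ?normr_ge0// !real_normK ?num_real// exprMn exprVn; lra.
Qed.

Lemma sinB_le b : `|sin b - b| <= b ^+ 2.
Proof.
wlog b0 : b / 0 <= b.
  move=> h; have [/h//|/ltW b0] := leP 0 b.
  by have := h (- b); rewrite oppr_ge0 => /(_ b0); rewrite sinN opprK sqrrN addrC distrC.
move: b0; rewrite le_eqVlt => /orP[/eqP <-|b0].
  by rewrite sin0 subr0 normr0 expr0n.
have [c] := MVT_segment (ltW b0) (fun x _ => is_derive_sin x)
  (continuous_subspaceT (@continuous_sin R)).
rewrite in_itv/= => /andP[c0 cb]; rewrite sin0 !subr0 => ->.
rewrite -{2}[b]mul1r -mulrBl normrM (gtr0_norm b0) expr2 ler_wpM2r ?(ltW b0)//.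
rewrite distrC (ger0_norm (oneB_cos_ge0 c)) oneB_cos.
have := sin_le_norm (c / 2); have sle1 : `|sin (c / 2)| <= 1.
  by rewrite ler_norml sin_geN1 sin_le1.
rewrite (ger0_norm (_ : 0 <= c / 2)) ?divr_ge0// => h.
rewrite -[X in 2 * X](real_normK (num_real _)) expr2.
have := ler_wpM2l (normr_ge0 (sin (c / 2))) sle1; lra.
Qed.

Lemma one_le_expR x : 0 <= x -> 1 <= expR x.
Proof. by move=> x0; rewrite -(@expR0 R) ler_expR. Qed.

Lemma expR_subr1 x : `|expR x - 1| <= `|x| * expR `|x|.
Proof.
have [x0|x0] := leP 0 x.
  rewrite (ger0_norm x0) ger0_norm ?subr_ge0 ?one_le_expR//.
  have := expR_ge1Dx (- x) => h; have := ler_wpM2l (expR_ge0 x) h.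
  by rewrite -expRD subrr expR0; lra.
rewrite (ltr0_norm x0) ler0_norm; last by rewrite subr_le0 expR_le1 ltW.
apply: (@le_trans _ _ (- x)); first by have := expR_ge1Dx x; lra.
by rewrite ler_peMr ?oppr_ge0 ?(ltW x0)// one_le_expR// oppr_ge0 ltW.
Qed.

Lemma expR_second x : `|expR x - 1 - x| <= x ^+ 2 * expR `|x|.
Proof.
rewrite ger0_norm; last by have := expR_ge1Dx x; lra.
have := expR_ge1Dx (- x) => h; have := ler_wpM2l (expR_ge0 x) h.
rewrite -expRD subrr expR0 => h1.
have h2 : expR x - 1 <= x * expR x by lra.
apply: (@le_trans _ _ (x * (expR x - 1))); first by lra.
apply: le_trans (ler_norm _) _; rewrite normrM -[x ^+ 2](real_normK (num_real x)).
by rewrite expr2 -mulrA ler_wpM2l// expR_subr1.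
Qed.

Lemma normc_cexp_sub1 z : complex.Re z <= 0 -> normc (cexp z - 1) <= 2 * normc z.
Proof.
case: z => a b /= a0; rewrite cexpE.
have -> : (expR a * cos b) +i* (expR a * sin b) - 1 =
    (expR a - 1)%:C * (cos b +i* sin b) + ((cos b - 1) +i* sin b).
  by apply: complex_ext; rewrite !ReImE /=; ring.
apply: le_trans (le_normcD _ _) _; rewrite normcM normc_real.
have -> : normc (cos b +i* sin b) = 1 by rewrite normc_pairE cos2Dsin2 sqrtr1.
have -> : normc ((cos b - 1) +i* sin b) = 2 * `|sin (b / 2)|.
  have -> : 2 * `|sin (b / 2)| = `|2 * sin (b / 2)| by rewrite normrM ger0_norm.
  rewrite normc_pairE -sqrtr_sqr; congr Num.sqrt.
  have := oneB_cos b; have := cos2Dsin2 b; rewrite exprMn sqrrB1.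
  by set c := cos b; set s := sin b; lra.
have ea : `|expR a - 1| <= `|a|.
  rewrite (ler0_norm a0) ler0_norm ?subr_le0 ?expR_le1//.
  by have := expR_ge1Dx a; lra.
have sb := sin_le_norm (b / 2); rewrite normrM (@ger0_norm _ 2^-1)// in sb.
have := normc_re (a +i* b); have := normc_im (a +i* b) => /=; lra.
Qed.

(** Lipschitz bound on the left half plane: up to the factor exp w of modulus
    at most 1 the difference is exp (z - w) - 1, where z has the smaller real
    part. *)
Lemma normc_cexp_sub z w : complex.Re z <= 0 -> complex.Re w <= 0 ->
  normc (cexp z - cexp w) <= 2 * normc (z - w).
Proof.
wlog zw : z w / complex.Re z <= complex.Re w.
  move=> h z0 w0; have [/h|/ltW/h] := leP (complex.Re z) (complex.Re w); first exact.
  by rewrite normcB (normcB w); apply.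
move=> z0 w0; rewrite (_ : cexp z - cexp w = cexp w * (cexp (z - w) - 1)); last first.
  by rewrite mulrBr mulr1 -cexpD [w + _]addrC subrK.
rewrite normcM normc_cexp; apply: (@le_trans _ _ (normc (cexp (z - w) - 1))).
  by rewrite ler_piMl ?normc_ge0// expR_le1.
by apply: normc_cexp_sub1; rewrite ReD ReN subr_le0.
Qed.

Lemma normc_cexp_second z :
  normc (cexp z - 1 - z) <= 4 * normc z ^+ 2 * expR (normc z).
Proof.
have := normc_re z; have := normc_im z; case: z => a b; set r := normc _ => /= br ar.
have r0 : 0 <= r by exact: normc_ge0.
rewrite cexpE.
have -> : (expR a * cos b) +i* (expR a * sin b) - 1 - (a +i* b) =
    (expR a)%:C * ((cos b - 1) +i* (sin b - b)) + ((expR a - 1)%:C * (0 +i* b)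
      + (expR a - 1 - a)%:C).
  by apply: complex_ext; rewrite !ReImE /=; ring.
have er : expR `|a| <= expR r by rewrite ler_expR.
have er' : expR a <= expR r by rewrite ler_expR; apply: le_trans (ler_norm _) ar.
have e0 := expR_ge0 r.
have b2 : b ^+ 2 <= r ^+ 2 by rewrite -[b ^+ 2](real_normK (num_real _)) ler_sqr ?nnegrE.
have a2 : a ^+ 2 <= r ^+ 2 by rewrite -[a ^+ 2](real_normK (num_real _)) ler_sqr ?nnegrE.
have k1 : normc ((expR a)%:C * ((cos b - 1) +i* (sin b - b))) <= 2 * r ^+ 2 * expR r.
  rewrite normcM normc_real (ger0_norm (expR_ge0 _)) mulrC.
  apply: ler_pM; rewrite ?normc_ge0 ?expR_ge0//.
  apply: le_trans (normc_le_reim _) _; rewrite /= distrC (ger0_norm (oneB_cos_ge0 b)).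
  by have := oneB_cos_le b; have := sinB_le b; have := sqr_ge0 b; lra.
have k2 : normc ((expR a - 1)%:C * (0 +i* b)) <= r ^+ 2 * expR r.
  rewrite normcM normc_real; have -> : normc (0 +i* b) = `|b|.
    by rewrite normc_pairE expr0n/= add0r sqrtr_sqr.
  apply: (@le_trans _ _ (`|a| * expR `|a| * `|b|)); first by rewrite ler_wpM2r// expR_subr1.
  rewrite mulrAC; apply: ler_pM => //; rewrite ?mulr_ge0 ?expR_ge0// expr2.
  by apply: ler_pM.
have k3 : normc ((expR a - 1 - a)%:C : R[i]) <= r ^+ 2 * expR r.
  rewrite normc_real; apply: le_trans (expR_second a) _.
  by apply: ler_pM; rewrite ?sqr_ge0 ?expR_ge0.
apply: le_trans (le_normcD _ _) _; have := le_normcD ((expR a - 1)%:C * (0 +i* b)) (expR a - 1 - a)%:C.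
lra.
Qed.

Lemma cdiff_cexp z : cdiff (@cexp R) z.
Proof.
exists (cexp z) => e e0; pose K := 4 * normc (cexp z) * expR 1.
have K0 : 0 <= K by rewrite !mulr_ge0 ?normc_ge0 ?expR_ge0.
exists (Num.min 1 (e / (K + 1))); first by rewrite lt_min ltr01 divr_gt0// ltr_wpDl.
move=> w; rewrite lt_min => /andP[w1 we]; set d := w - z in w1 we *.
have -> : cexp w - cexp z - cexp z * d = cexp z * (cexp d - 1 - d).
  by rewrite !mulrBr mulr1 -cexpD /d [z + _]addrC subrK.
rewrite normcM.
have h1 := ler_wpM2l (normc_ge0 (cexp z)) (normc_cexp_second d).
apply: le_trans h1 _.
apply: (@le_trans _ _ (K * normc d * normc d)).
  have : expR (normc d) <= expR 1 by rewrite ler_expR ltW.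
  have p : 0 <= normc (cexp z) * (4 * normc d ^+ 2) by rewrite !mulr_ge0 ?normc_ge0 ?sqr_ge0.
  by move=> /(ler_wpM2l p); rewrite /K; lra.
rewrite ler_wpM2r ?normc_ge0//; move: we; rewrite ltr_pdivlMr ?ltr_wpDl// => /ltW.
by apply: le_trans; rewrite mulrC ler_wpM2l ?normc_ge0// lerDl.
Qed.

Lemma cdiff_comp F G z : cdiff G z -> cdiff F (G z) -> cdiff (fun w => F (G w)) z.
Proof.
move=> dG [L FL]; have cG := cdiff_cont dG; have [M GM] := dG.
exists (L * M) => e e0; have e2 : 0 < e / 2 by rewrite divr_gt0.
have M1 : 0 < normc M + 1 by rewrite ltr_wpDl ?normc_ge0.
have L1 : 0 < normc L + 1 by rewrite ltr_wpDl ?normc_ge0.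
have [d1 d10 H1] := FL _ (divr_gt0 e2 M1).
have [d2 d20 H2] := GM _ (divr_gt0 e2 L1).
have [d3 d30 H3] := GM _ ltr01.
have d12 : 0 < d1 / 2 by rewrite divr_gt0.
have [d4 d40 H4] := cG _ d12.
exists (Num.min d2 (Num.min d3 d4)); first by rewrite !lt_min d20 d30.
move=> w; rewrite !lt_min => /and3P[w2 w3 w4].
have n0 := normc_ge0 (w - z).
have k0 : normc (G w - G z) <= (normc M + 1) * normc (w - z).
  rewrite -(subrK (M * (w - z)) (G w - G z)); apply: le_trans (le_normcD _ _) _.
  by have := H3 _ w3; rewrite normcM; lra.
have k1 : normc (F (G w) - F (G z) - L * (G w - G z)) <= e / 2 * normc (w - z).
  apply: le_trans (H1 _ _) _.
    by apply: le_lt_trans (H4 _ w4) _; rewrite ltr_pdivrMr// ltr_pMr// ltr1n.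
  apply: le_trans (ler_wpM2l _ k0) _; first by rewrite divr_ge0// ltW.
  by rewrite mulrA divfK ?gt_eqF.
have k2 : normc (L * (G w - G z - M * (w - z))) <= e / 2 * normc (w - z).
  rewrite normcM; apply: le_trans (ler_wpM2l (normc_ge0 _) (H2 _ w2)) _.
  rewrite mulrA ler_wpM2r// mulrA ler_pdivrMr// mulrC ler_wpM2l ?(ltW e2)//.
  by rewrite lerDl.
have -> : F (G w) - F (G z) - L * M * (w - z) =
  (F (G w) - F (G z) - L * (G w - G z)) + L * (G w - G z - M * (w - z)) by ring.
by apply: le_trans (le_normcD _ _) _; lra.
Qed.

End ComplexExponential.

(** * Integrals over the real line *)

Section IntegralsOnTheLine.
Variable R : realType.
Local Notation RR := (measurableTypeR R).
Local Notation leb := (@lebesgue_measure R).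
Implicit Types (f : R -> R[i]) (g h : R -> R) (s z : R[i]) (u v x y C l : R).

(** The weight 1 / (1 + u^2) serves as the one integrable majorant throughout.
    *)
Definition decays C f := forall u, normc (f u) <= C * (1 + u ^+ 2)^-1.

Lemma oneDsqr_gt0 u : 0 < 1 + u ^+ 2.
Proof. by rewrite ltr_pwDl// sqr_ge0. Qed.

Lemma integrable_oneDsqr C : leb.-integrable setT (EFin \o (fun u : RR => C * (1 + u ^+ 2)^-1)).
Proof.
have m1 : measurable_fun (setT : set RR) (fun u : RR => ((1 + u ^+ 2)^-1)%:E).
  apply/measurable_EFinP; apply: continuous_measurable_fun.
  exact: continuous_oneDsqrV.
have i1 : leb.-integrable setT (EFin \o (fun u : RR => (1 + u ^+ 2)^-1)).
  apply/integrableP; split => //.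
  under eq_integral do rewrite /= ger0_norm ?invr_ge0 ?(ltW (oneDsqr_gt0 _))//.
  by rewrite integral_oneDsqr ltry.
exact: (integrableZl measurableT C i1).
Qed.

Lemma Rintegral_oneDsqr C : Rintegral leb setT (fun u : RR => C * (1 + u ^+ 2)^-1) = C * pi.
Proof.
have i1 := integrable_oneDsqr 1.
have i2 : leb.-integrable setT (EFin \o (fun u : RR => (1 + u ^+ 2)^-1)).
  by have := i1; apply: eq_integrable => // u _; rewrite /= mul1r.
by rewrite (RintegralZl _ measurableT i2) /Rintegral integral_oneDsqr.
Qed.

Lemma cintegrable_decays C f : cmeas (setT : set RR) f -> decays C f ->
  cintegrable leb setT f.
Proof. by move=> mf fC; apply: (dom_cintegrable measurableT mf (integrable_oneDsqr C)). Qed.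

Lemma le_cintegral_decays C f : cmeas (setT : set RR) f -> decays C f ->
  normc (cintegral leb setT f) <= C * pi.
Proof.
move=> mf fC; rewrite -Rintegral_oneDsqr.
exact: (le_normc_cintegral_dom measurableT mf (integrable_oneDsqr C)).
Qed.

Lemma expR_decay l u : 0 < l ->
  expR (- (l * `|u|)) <= (1 + 4 / l ^+ 2) * (1 + u ^+ 2)^-1.
Proof.
move=> l0; rewrite expRN ler_pdivlMr ?oneDsqr_gt0// mulrC ler_pdivrMr ?expR_gt0//.
have u2 : u ^+ 2 = `|u| ^+ 2 by rewrite real_normK ?num_real.
rewrite u2; set t := `|u|; have t0 : 0 <= t by exact: normr_ge0.
have e1 : 1 + l * t / 2 <= expR (l * t / 2) := expR_ge1Dx _.
have e2 : 1 + (l * t) ^+ 2 / 4 <= expR (l * t).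
  have -> : l * t = l * t / 2 + l * t / 2 by rewrite -splitr.
  rewrite expRD; have p : 0 <= l * t / 2 by rewrite divr_ge0 ?mulr_ge0 ?(ltW l0).
  have p1 : 0 <= 1 + l * t / 2 by rewrite addr_ge0.
  have := ler_pM p1 p1 e1 e1; rewrite -splitr; apply: le_trans.
  have := sqr_ge0 (l * t); nra.
have c0 : 0 <= 1 + 4 / l ^+ 2 by rewrite addr_ge0// divr_ge0// sqr_ge0.
apply: le_trans (ler_wpM2l c0 e2).
rewrite (_ : (1 + 4 / l ^+ 2) * (1 + (l * t) ^+ 2 / 4) =
   1 + t ^+ 2 + (4 / l ^+ 2 + (l * t) ^+ 2 / 4)); last by field; rewrite gt_eqF.
by rewrite lerDl addr_ge0 ?divr_ge0 ?sqr_ge0.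
Qed.

Lemma norm_expR_decay l u : 0 < l ->
  `|u| * expR (- (l * `|u|)) <= 2 / l * expR (- (l / 2 * `|u|)).
Proof.
move=> l0; have -> : - (l * `|u|) = - (l / 2 * `|u|) + - (l / 2 * `|u|).
  by rewrite -opprD -mulrDl -splitr.
rewrite expRD mulrA ler_wpM2r ?expR_ge0//.
rewrite expRN ler_pdivrMr ?expR_gt0//.
have := expR_ge1Dx (l / 2 * `|u|); have l2 : 0 <= 2 / l by rewrite divr_ge0// ltW.
move=> /(ler_wpM2l l2); apply: le_trans.
rewrite (_ : 2 / l * (1 + l / 2 * `|u|) = 2 / l + `|u|) ?lerDr//.
by field; rewrite gt_eqF.
Qed.

Lemma ae_neq0 : {ae leb, forall u : RR, u <> 0}.
Proof.
exists [set 0]; split; first exact: measurable_set1.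
- exact: lebesgue_measure_set1.
- by move=> u /= /contrapT.
Qed.

Lemma cintegral_off0 f f' (D : set RR) : measurable D -> cmeas D f -> cmeas D f' ->
  (forall u, D u -> u <> 0 -> f u = f' u) -> cintegral leb D f = cintegral leb D f'.
Proof.
move=> mD mf mf' ff; apply: ae_eq_cintegral => //.
by apply: ae_mono ae_neq0 => u u0 Du; exact: ff.
Qed.

Definition heaviside u : R := (0 <= u)%R%:R.

Lemma measurable_heaviside : measurable_fun (setT : set RR) heaviside.
Proof.
rewrite (_ : heaviside = \1_(`[0, +oo[%classic : set RR)).
  by apply: measurable_indic; exact: measurable_itv.
apply/funext => u; rewrite /heaviside indicE; congr (_%:R).
by rewrite mem_setE in_itv/= andbT.
Qed.

Lemma heaviside_nneg u : 0 <= u -> heaviside u = 1.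
Proof. by rewrite /heaviside => ->. Qed.

Lemma heaviside_neg u : u < 0 -> heaviside u = 0.
Proof. by rewrite /heaviside ltNge => /negbTE ->. Qed.

Lemma continuous_FTC2_Rintegral (F f : R -> R) a b : a <= b ->
  (forall x, is_derive x 1 F (f x)) -> continuous f ->
  Rintegral leb `[a, b] f = F b - F a.
Proof.
rewrite le_eqVlt => /orP[/eqP <-|ab] dF cf.
  by rewrite set_itv1 Rintegral_set1 subrr.
have cF : continuous F.
  by move=> x; apply: differentiable_continuous; apply/derivable1_diffP; case: (dF x).
rewrite /Rintegral (continuous_FTC2 (F := F)) //.
- exact: continuous_subspaceT.
- split=> [x _| |]; first by case: (dF x).
  + by apply: cvg_at_right_filter; exact: cF.
  + by apply: cvg_at_left_filter; exact: cF.
- by move=> x _; rewrite derive1E; case: (dF x).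
Qed.

Section ExponentialPrimitive.
Variables (g g' : R -> R) (s : R[i]).
Hypotheses (dg : forall u, is_derive u 1 g (g' u)) (cg' : continuous g').

(** The functions g (u) exp (u s), with their derivatives: every integration
    by parts below is the fundamental theorem of calculus for one of them. *)
Definition exp_prim u : R[i] := (g u)%:C * cexp (u%:C * s).
Definition exp_deriv u : R[i] := ((g' u)%:C + s * (g u)%:C) * cexp (u%:C * s).

Let cg : continuous g.
Proof. by move=> x; apply: differentiable_continuous; apply/derivable1_diffP; case: (dg x). Qed.

Let a := complex.Re s.
Let b := complex.Im s.

Let sE u : cexp (u%:C * s) = (expR (u * a) * cos (u * b)) +i* (expR (u * a) * sin (u * b)).
Proof.
rewrite (_ : u%:C * s = (u * a) +i* (u * b)) ?cexpE//.
by apply: complex_ext; rewrite !ReImE /= /a /b; ring.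
Qed.

Let primE u : exp_prim u = (g u * (expR (u * a) * cos (u * b))) +i*
  (g u * (expR (u * a) * sin (u * b))).
Proof. by rewrite /exp_prim sE; apply: complex_ext; rewrite !ReImE /=; ring. Qed.

Let dRe u := g' u * (expR (u * a) * cos (u * b)) +
  g u * (a * (expR (u * a) * cos (u * b)) - b * (expR (u * a) * sin (u * b))).
Let dIm u := g' u * (expR (u * a) * sin (u * b)) +
  g u * (a * (expR (u * a) * sin (u * b)) + b * (expR (u * a) * cos (u * b))).

Let derivE u : exp_deriv u = dRe u +i* dIm u.
Proof.
rewrite /exp_deriv sE /dRe /dIm (_ : s = a +i* b); last by rewrite /a /b; case: (s).
by apply: complex_ext; rewrite !ReImE /=; ring.
Qed.

Let primRe u : is_derive u 1 (fun u => g u * (expR (u * a) * cos (u * b))) (dRe u).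
Proof. by apply: is_derive_eq; rewrite /dRe /GRing.scale /=; ring. Qed.

Let primIm u : is_derive u 1 (fun u => g u * (expR (u * a) * sin (u * b))) (dIm u).
Proof. by apply: is_derive_eq; rewrite /dIm /GRing.scale /=; ring. Qed.

Let cexpa (c : R) : continuous (fun u : R => expR (u * c)).
Proof.
move=> u; apply: continuous_comp; last exact: continuous_expR.
by apply: cvgM; [exact: cvg_id|exact: cvg_cst].
Qed.
Let ccosb : continuous (fun u : R => cos (u * b)).
Proof.
move=> u; apply: continuous_comp; last exact: continuous_cos.
by apply: cvgM; [exact: cvg_id|exact: cvg_cst].
Qed.
Let csinb : continuous (fun u : R => sin (u * b)).
Proof.
move=> u; apply: continuous_comp; last exact: continuous_sin.
by apply: cvgM; [exact: cvg_id|exact: cvg_cst].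
Qed.

Let cdRe : continuous dRe.
Proof.
move=> u; apply: cvgD; apply: cvgM; [exact: cg'| |exact: cg|].
  by apply: cvgM; [exact: cexpa|exact: ccosb].
apply: cvgB; (apply: cvgM; first exact: cvg_cst).
  by apply: cvgM; [exact: cexpa|exact: ccosb].
by apply: cvgM; [exact: cexpa|exact: csinb].
Qed.

Let cdIm : continuous dIm.
Proof.
move=> u; apply: cvgD; apply: cvgM; [exact: cg'| |exact: cg|].
  by apply: cvgM; [exact: cexpa|exact: csinb].
apply: cvgD; (apply: cvgM; first exact: cvg_cst).
  by apply: cvgM; [exact: cexpa|exact: csinb].
by apply: cvgM; [exact: cexpa|exact: ccosb].
Qed.

Lemma cmeas_exp_deriv : cmeas (setT : set RR) exp_deriv.
Proof.
split; apply: continuous_measurable_fun.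
  by rewrite (_ : (fun u => _) = dRe)//; apply/funext => u; rewrite derivE.
by rewrite (_ : (fun u => _) = dIm)//; apply/funext => u; rewrite derivE.
Qed.

Lemma exp_FTC_segment x y : x <= y ->
  cintegral leb `[x, y] exp_deriv = exp_prim y - exp_prim x.
Proof.
move=> xy; rewrite /cintegral.
under eq_Rintegral do rewrite derivE /=.
rewrite (continuous_FTC2_Rintegral xy primRe cdRe).
under eq_Rintegral do rewrite derivE /=.
rewrite (continuous_FTC2_Rintegral xy primIm cdIm).
by rewrite !primE; apply: complex_ext; rewrite !ReImE.
Qed.

Let decay_small C e : 0 < e -> exists2 n : nat, C * (1 + n%:R ^+ 2)^-1 <= e &
  forall m : nat, (n <= m)%N -> C * (1 + m%:R ^+ 2)^-1 <= e.
Proof.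
move=> e0; have k0 : 0 <= `|C| / e by rewrite divr_ge0// ltW.
pose n := (Num.truncn (`|C| / e)).+1.
have H m : (n <= m)%N -> C * (1 + m%:R ^+ 2)^-1 <= e.
  move=> nm; rewrite ler_pdivrMr ?oneDsqr_gt0// mulrC -ler_pdivrMr//.
  apply: (@le_trans _ _ (`|C| / e)); first by rewrite ler_wpM2r ?invr_ge0 ?(ltW e0)// ler_norm.
  apply: (@le_trans _ _ n%:R); first exact/ltW/truncnS_gt.
  apply: (@le_trans _ _ m%:R); first by rewrite ler_nat.
  have := sqr_ge0 (m%:R - 1 : R); have := sqr_ge0 (m%:R : R); nra.
by exists n => //; exact: H.
Qed.

Lemma exp_FTC_line C : decays C exp_prim -> decays C exp_deriv ->
  cintegral leb setT exp_deriv = 0.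
Proof.
move=> dP dD; have iD := cintegrable_decays cmeas_exp_deriv dD.
apply: eq0_normc; apply/eqP; rewrite eq_le normc_ge0 andbT.
apply/ler_addgt0Pr => e e0; rewrite add0r; have e3 : 0 < e / 3 by rewrite divr_gt0.
have [n Hn] := cintegral_tail iD e3; have [p _ Hp] := decay_small C e3.
pose m := maxn n p; have mE : - m%:R <= - n%:R :> R by rewrite lerN2 ler_nat leq_maxl.
have mE' : n%:R <= m%:R :> R by rewrite ler_nat leq_maxl.
have := Hn _ _ mE mE'; rewrite exp_FTC_segment ?ge0_cp// => h.
have h1 := le_trans (dP m%:R) (Hp m (leq_maxr _ _)).
have := dP (- m%:R); rewrite sqrrN => /le_trans/(_ (Hp m (leq_maxr _ _))) h2.
set I := cintegral _ _ _ in h *; rewrite -(subrK (exp_prim m%:R - exp_prim (- m%:R)) I).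
apply: le_trans (le_normcD _ _) _.
have := le_normcD (exp_prim m%:R) (- exp_prim (- m%:R)); rewrite normcN; lra.
Qed.

(** On the left half line only the value at 0 survives. *)
Lemma exp_FTC_half C : (forall u, u <= 0 -> normc (exp_prim u) <= C * (1 + u ^+ 2)^-1) ->
  (forall u, u <= 0 -> normc (exp_deriv u) <= C * (1 + u ^+ 2)^-1) ->
  cintegral leb setT (fun u => (1 - heaviside u)%:C * exp_deriv u) = (g 0)%:C.
Proof.
move=> dP dD; set D := fun u => _; have mD : cmeas (setT : set RR) D.
  apply: cmeasM; last exact: cmeas_exp_deriv.
  by apply: cmeas_real; apply: measurable_funB => //; exact: measurable_heaviside.
have DC : decays C D.
  move=> u; rewrite /D normcM normc_real; have [u0|u0] := leP 0 u.
    rewrite heaviside_nneg// subrr normr0 mul0r.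
    have := le_trans (normc_ge0 _) (dP 0 (lexx _)); rewrite expr0n/= addr0 invr1 mulr1 => C0.
    by rewrite divr_ge0// ltW// oneDsqr_gt0.
  by rewrite heaviside_neg// subr0 normr1 mul1r; exact/dD/ltW.
have iD := cintegrable_decays mD DC.
have P0 : exp_prim 0 = (g 0)%:C by rewrite /exp_prim mul0r cexp0 mulr1.
apply/eqP; rewrite -subr_eq0 -normc_eq0 eq_le normc_ge0 andbT.
apply/ler_addgt0Pr => e e0; rewrite add0r; have e3 : 0 < e / 2 by rewrite divr_gt0.
have [n Hn] := cintegral_tail iD e3; have [p _ Hp] := decay_small C e3.
pose m := maxn n p; have mE : - m%:R <= - n%:R :> R by rewrite lerN2 ler_nat leq_maxl.
have mE' : n%:R <= m%:R :> R by rewrite ler_nat leq_maxl.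
have m0 : - m%:R <= 0 :> R by rewrite oppr_le0.
have := Hn _ _ mE mE'.
have iS : cintegrable leb `[- m%:R, m%:R] D.
  by apply: (cintegrableS measurableT _ _ iD) => //; exact: measurable_itv.
rewrite (cintegral_split m0 (ler0n _ m) iS).
have -> : cintegral leb `[0, m%:R] D = 0.
  rewrite -(cintegral0 leb `[0, m%:R]); apply: eq_cintegral => u.
  rewrite mem_setE in_itv/= => /andP[u0 _].
  by rewrite /D heaviside_nneg// subrr mul0r.
have -> : cintegral leb `[- m%:R, 0] D = cintegral leb `[- m%:R, 0] exp_deriv.
  have mI : measurable (`[- m%:R, 0]%classic : set RR) by exact: measurable_itv.
  apply: cintegral_off0 => //; [exact: cmeasS mD|exact: cmeasS cmeas_exp_deriv|].
  move=> u; rewrite /= in_itv/= => /andP[_ u0] /eqP un0.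
  by rewrite /D heaviside_neg ?subr0 ?mul1r// lt_neqAle un0.
rewrite addr0 exp_FTC_segment// P0 => h.
have := dP _ m0; rewrite sqrrN => /le_trans/(_ (Hp m (leq_maxr _ _))) h2.
set I := cintegral _ _ _ in h *.
rewrite (_ : I - (g 0)%:C = (I - ((g 0)%:C - exp_prim (- m%:R))) + - exp_prim (- m%:R)); last by ring.
apply: le_trans (le_normcD _ _) _; rewrite normcN; lra.
Qed.

End ExponentialPrimitive.
End IntegralsOnTheLine.

(** * Changes of variables *)

Section ChangeOfVariables.
Variable R : realType.
Local Notation RR := (measurableTypeR R).
Local Notation leb := (@lebesgue_measure R).
Local Notation Pos := (`]0, +oo[%classic : set RR).
Implicit Types (f : R -> R[i]) (g h G : R -> R) (u v x y : R).

(* The hypothesis ge0H is the change of variables for nonnegative integrands;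
   it extends to integrable ones. *)
Section Transfer.
Variables (D : set RR) (phi om : R -> R).
Hypotheses (oD : open (D : set R)) (phiD : forall x, D (phi x))
  (cphi : continuous phi) (com : continuous om) (om0 : forall x, 0 <= om x)
  (ge0H : forall G, (forall x, D x -> {for x, continuous G}) -> (forall x, 0 <= G x) ->
    (\int[leb]_(x in D) (G x)%:E = \int[leb]_x (G (phi x) * om x)%:E)%E).

Let mD : measurable D. Proof. exact: open_measurable. Qed.

Let ch h x : (forall x, D x -> {for x, continuous h}) ->
  {for x, continuous (fun x => h (phi x) * om x)}.
Proof.
move=> hc; apply: cvgM; last exact: com.
by apply: continuous_comp; [exact: cphi|exact/hc/phiD].
Qed.

Let mh h : (forall x, D x -> {for x, continuous h}) -> measurable_fun D h.
Proof.
move=> hc; apply: open_continuous_measurable_fun => // x; rewrite inE; exact: hc.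
Qed.

Let cnorm h : (forall x, D x -> {for x, continuous h}) ->
  forall x, D x -> {for x, continuous (fun x => `|h x|)}.
Proof. by move=> hc x Dx; apply: cvg_norm; exact: hc. Qed.

Lemma transfer_integrable h : (forall x, D x -> {for x, continuous h}) ->
  leb.-integrable D (EFin \o h) <->
  leb.-integrable setT (EFin \o (fun x => h (phi x) * om x)).
Proof.
move=> hc; have m1 : measurable_fun D (EFin \o h) by apply/measurable_EFinP; exact: mh.
have m2 : measurable_fun (setT : set RR) (EFin \o (fun x => h (phi x) * om x)).
  by apply/measurable_EFinP; apply: continuous_measurable_fun => x; exact: ch.
have e : (\int[leb]_(x in D) `|(h x)%:E| = \int[leb]_x `|(h (phi x) * om x)%:E|)%E.
  under eq_integral do rewrite abse_EFin.
  rewrite (ge0H (cnorm hc)) => [|x]; last exact: normr_ge0.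
  by apply: eq_integral => x _; rewrite abse_EFin normrM (ger0_norm (om0 x)).
split=> /integrableP[_ fi]; apply/integrableP; split => //.
  by rewrite /= -e.
by rewrite /= e.
Qed.

(** A real integrand is the difference of the nonnegative functions |h| + h
    and |h|. *)
Lemma transfer_Rintegral h : (forall x, D x -> {for x, continuous h}) ->
  leb.-integrable D (EFin \o h) ->
  Rintegral leb D h = Rintegral leb setT (fun x => h (phi x) * om x).
Proof.
move=> hc ih; have ih' := (transfer_integrable hc).1 ih.
have nc := cnorm hc.
have inh : leb.-integrable D (EFin \o (fun x => `|h x|)) by exact: integrable_norm.
have inh' := (transfer_integrable nc).1 inh.
have sc x : D x -> {for x, continuous (fun x => `|h x| + h x)}.
  by move=> Dx; apply: cvgD; [exact: nc|exact: hc].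
have is_ : leb.-integrable D (EFin \o (fun x => `|h x| + h x)).
  by have := integrableD mD inh ih; apply: eq_integrable => // x _; rewrite /= EFinD.
have is' := (transfer_integrable sc).1 is_.
have R1 : Rintegral leb D h =
    Rintegral leb D (fun x => `|h x| + h x) - Rintegral leb D (fun x => `|h x|).
  by rewrite -(RintegralB mD is_ inh); apply: eq_Rintegral => x _; rewrite addrC addKr.
have R2 : Rintegral leb setT (fun x => h (phi x) * om x) =
    Rintegral leb setT (fun x => (`|h (phi x)| + h (phi x)) * om x) -
    Rintegral leb setT (fun x => `|h (phi x)| * om x).
  by rewrite -(RintegralB measurableT is' inh'); apply: eq_Rintegral => x _; ring.
rewrite R1 R2 /Rintegral (ge0H nc) => [|x]; last exact: normr_ge0.
rewrite (ge0H sc)// => x.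
by have := ler_norm (- h x); rewrite normrN -subr_ge0 opprK.
Qed.

Variable f : R -> R[i].
Hypothesis cf : forall x, D x -> rcont f x.

Let cre x : D x -> {for x, continuous (fun x => complex.Re (f x))}.
Proof. by move=> /cf; exact: rcont_re. Qed.
Let cim x : D x -> {for x, continuous (fun x => complex.Im (f x))}.
Proof. by move=> /cf; exact: rcont_im. Qed.

Let transE : (fun x => f (phi x) * (om x)%:C) =
  (fun x => (complex.Re (f (phi x)) * om x) +i* (complex.Im (f (phi x)) * om x)).
Proof. by apply/funext => x; apply: complex_ext; rewrite !ReImE /=; ring. Qed.

Lemma transfer_cintegrable : cintegrable leb D f <->
  cintegrable leb setT (fun x => f (phi x) * (om x)%:C).
Proof.
by rewrite transE; split=> -[fr fi]; split;
  first [exact/(transfer_integrable cre)|exact/(transfer_integrable cim)].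
Qed.

Lemma transfer_cintegral : cintegrable leb D f ->
  cintegral leb D f = cintegral leb setT (fun x => f (phi x) * (om x)%:C).
Proof.
move=> [fr fi]; rewrite transE /cintegral.
by rewrite (transfer_Rintegral cre fr) (transfer_Rintegral cim fi).
Qed.

End Transfer.

Lemma cintegrable_affine f al be : 0 < al -> (forall x, rcont f x) ->
  cintegrable leb setT f ->
  cintegrable leb setT (fun x => f (al * x + be) * al%:C) /\
  cintegral leb setT f = cintegral leb setT (fun x => f (al * x + be) * al%:C).
Proof.
move=> al0 cf fi.
have cphi : continuous (fun x : R => al * x + be).
  by move=> x; apply: cvgD; [apply: cvgM; [exact: cvg_cst|exact: cvg_id]|exact: cvg_cst].
have com : continuous (fun x : R => al) by move=> x; exact: cvg_cst.
have H G : (forall x, (setT : set RR) x -> {for x, continuous G}) -> (forall x, 0 <= G x) ->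
    (\int[leb]_(x in setT) (G x)%:E = \int[leb]_x (G (al * x + be) * al)%:E)%E.
  by move=> cG G0; apply: ge0_integral_affine => // x; exact: cG.
split; first by apply: (transfer_cintegrable openT _ cphi com _ H _).1 => //; rewrite ltW.
by apply: (transfer_cintegral openT _ cphi com _ H) => //; rewrite ltW.
Qed.

(** The substitution t = exp x, obtained from the segments [-n, n] by monotone
    convergence. *)
Lemma ge0_integral_exp_subst G : (forall t, 0 < t -> {for t, continuous G}) ->
  (forall t, 0 <= G t) ->
  (\int[leb]_(t in Pos) (G t)%:E = \int[leb]_x (G (expR x) * expR x)%:E)%E.
Proof.
move=> cG G0; pose S (n : nat) : set RR := `[- n%:R, n%:R]%classic.
pose E (n : nat) : set RR := `[expR (- n%:R), expR n%:R]%classic.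
have SE n : (\int[leb]_(t in E n) (G t)%:E = \int[leb]_(x in S n) (G (expR x) * expR x)%:E)%E.
  have n0 : - n%:R <= n%:R :> R by rewrite ge0_cp.
  have dE : derive1 (@expR R) = @expR R by apply/funext => x; rewrite derive1E derive_val.
  rewrite /E /S (integration_by_substitution_increasing (F := expR)) ?dE//.
  - by move=> x y _ _ xy; rewrite ltr_expR.
  - by move=> x _; exact: continuous_expR.
  - by apply/cvg_ex; exists (expR (- n%:R)); apply: cvg_at_right_filter; exact: continuous_expR.
  - by apply/cvg_ex; exists (expR n%:R); apply: cvg_at_left_filter; exact: continuous_expR.
  - split=> [x _| |]; first exact: derivable_expR.
    + by apply: cvg_at_right_filter; exact: continuous_expR.
    + by apply: cvg_at_left_filter; exact: continuous_expR.
  - apply: continuous_in_subspaceT => t; rewrite mem_setE in_itv/= => /andP[t0 _].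
    by apply: cG; apply: lt_le_trans t0; exact: expR_gt0.
have US : \bigcup_n S n = setT.
  rewrite -subTset => x _; exists (Num.truncn `|x|).+1 => //; rewrite /S/= in_itv/=.
  by rewrite -ler_norml ltW// truncnS_gt.
have UE : \bigcup_n E n = `]0, +oo[%classic.
  apply/seteqP; split=> t.
    move=> [n _]; rewrite /E/= !in_itv/= andbT => /andP[h _].
    exact: lt_le_trans (expR_gt0 _) h.
  rewrite /= in_itv/= andbT => t0; have : (setT : set R) (ln t) by [].
  rewrite -US => -[n _]; rewrite /S /E/= in_itv/= => /andP[h1 h2]; exists n => //=.
  by rewrite in_itv/= -[t]lnK ?posrE// !ler_expR h1.
have ndS : nondecreasing_seq S.
  move=> m n mn; apply/subsetPset => x; rewrite /S/= !in_itv/= => /andP[h1 h2].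
  have mn' : m%:R <= n%:R :> R by rewrite ler_nat.
  by apply/andP; split; lra.
have ndE : nondecreasing_seq E.
  move=> m n mn; apply/subsetPset => x; rewrite /E/= !in_itv/= => /andP[h1 h2].
  have mn' : m%:R <= n%:R :> R by rewrite ler_nat.
  apply/andP; split; first by apply: le_trans h1; rewrite ler_expR lerN2.
  by apply: le_trans h2 _; rewrite ler_expR.
have cR : continuous (fun x => G (expR x) * expR x).
  move=> x; apply: cvgM; last exact: continuous_expR.
  by apply: continuous_comp; [exact: continuous_expR|exact/cG/expR_gt0].
have cS := @ge0_nondecreasing_set_cvg_integral _ _ _ S (fun x => (G (expR x) * expR x)%:E) leb
  ndS (fun n => measurable_itv _).
have cE := @ge0_nondecreasing_set_cvg_integral _ _ _ E (fun x => (G x)%:E) leb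
  ndE (fun n => measurable_itv _).
have {}cS := cS ltac:(by move=> n; apply/measurable_EFinP; apply: measurable_funTS;
   exact: continuous_measurable_fun).
have mG : measurable_fun (`]0, +oo[%classic : set RR) G.
  apply: open_continuous_measurable_fun; first exact: interval_open.
  by move=> t; rewrite inE/= in_itv/= andbT; exact: cG.
have {}cE := cE ltac:(by move=> n; apply/measurable_EFinP;
   apply: (measurable_funS (measurable_itv _) _ mG); rewrite -UE; exact: bigcup_sup).
have {}cS := cS ltac:(by move=> n x _; rewrite lee_fin mulr_ge0 ?expR_ge0).
have {}cE := cE ltac:(by move=> n x _; rewrite lee_fin).
rewrite US in cS; rewrite UE in cE.
apply: (cvg_unique _ cE) => //.
have -> : (fun n => \int[leb]_(t in E n) (G t)%:E)%E =
  (fun n => \int[leb]_(x in S n) (G (expR x) * expR x)%:E)%E.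
  by apply/funext => n; exact: SE.
exact: cS.
Qed.

Lemma exp_subst f : (forall t, 0 < t -> rcont f t) ->
  (cintegrable leb `]0, +oo[ f <-> cintegrable leb setT (fun x => f (expR x) * (expR x)%:C)) /\
  (cintegrable leb `]0, +oo[ f ->
   cintegral leb `]0, +oo[ f = cintegral leb setT (fun x => f (expR x) * (expR x)%:C)).
Proof.
move=> cf; have D0 t : (`]0, +oo[%classic : set RR) t -> 0 < t.
  by rewrite /= in_itv/= andbT.
have phiD x : (`]0, +oo[%classic : set RR) (expR x) by rewrite /= in_itv/= andbT expR_gt0.
have cf' t : (`]0, +oo[%classic : set RR) t -> rcont f t by move=> /D0; exact: cf.
have H G : (forall t, (`]0, +oo[%classic : set RR) t -> {for t, continuous G}) ->
    (forall t, 0 <= G t) ->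
    (\int[leb]_(t in Pos) (G t)%:E = \int[leb]_x (G (expR x) * expR x)%:E)%E.
  move=> cG G0; apply: ge0_integral_exp_subst => // t t0; apply: cG.
  by rewrite /= in_itv/= andbT.
have oD : open (`]0, +oo[%classic : set R) by exact: interval_open.
split.
  apply: (transfer_cintegrable oD phiD (@continuous_expR R) (@continuous_expR R) _ H cf').
  by move=> x; exact: expR_ge0.
apply: (transfer_cintegral oD phiD (@continuous_expR R) (@continuous_expR R) _ H cf').
by move=> x; exact: expR_ge0.
Qed.

End ChangeOfVariables.

(** * The Fourier transform of the Gaussian *)

Section GaussianFourier.
Variable R : realType.
Local Notation RR := (measurableTypeR R).
Local Notation leb := (@lebesgue_measure R).
Local Notation Pos := (`]0, +oo[%classic : set RR).
Implicit Types (s t u v x y : R) (z : R[i]) (f h : R -> R).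

Definition gauss s : R := expR (- (pi * s ^+ 2)).

Lemma gauss_gt0 s : 0 < gauss s. Proof. exact: expR_gt0. Qed.

Lemma gaussN s : gauss (- s) = gauss s. Proof. by rewrite /gauss sqrrN. Qed.

Lemma is_derive_gauss s : is_derive s 1 gauss (- (2 * pi * s) * gauss s).
Proof. by apply: is_derive_eq; rewrite /gauss /GRing.scale /=; ring. Qed.

Lemma continuous_gauss : continuous gauss.
Proof.
move=> s; apply: differentiable_continuous; apply/derivable1_diffP.
by case: (is_derive_gauss s).
Qed.

(** The square of the weight leaves room for one factor s. *)
Lemma gauss_le s : gauss s <= (1 + s ^+ 2)^-1 ^+ 2.
Proof.
rewrite /gauss expRN exprVn lef_pV2 ?posrE ?expR_gt0 ?exprn_gt0 ?oneDsqr_gt0//.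
have -> : pi * s ^+ 2 = pi * s ^+ 2 / 2 + pi * s ^+ 2 / 2 by rewrite -splitr.
rewrite expRD -expr2; have h : 1 + s ^+ 2 <= expR (pi * s ^+ 2 / 2).
  apply: le_trans (expR_ge1Dx _); rewrite lerD2l mulrAC ler_peMl ?sqr_ge0//.
  by rewrite ler_pdivlMr// mul1r pi_ge2.
by rewrite !expr2; apply: ler_pM => //; exact/ltW/oneDsqr_gt0.
Qed.

Lemma oneDsqrV_le1 s : (1 + s ^+ 2)^-1 <= 1.
Proof. by rewrite invf_le1 ?oneDsqr_gt0// lerDl sqr_ge0. Qed.

Lemma gauss_decay s : gauss s <= (1 + s ^+ 2)^-1.
Proof.
apply: le_trans (gauss_le s) _; rewrite expr2 ler_piMr ?oneDsqrV_le1//.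
by rewrite invr_ge0 ltW// oneDsqr_gt0.
Qed.

Lemma norm_gauss_decay s : `|s| * gauss s <= (1 + s ^+ 2)^-1.
Proof.
apply: le_trans (ler_wpM2l (normr_ge0 s) (gauss_le s)) _.
have p := oneDsqr_gt0 s; rewrite expr2 mulrA ler_piMl ?invr_ge0 ?(ltW p)//.
rewrite ler_pdivrMr// mul1r -[s ^+ 2](real_normK (num_real _)).
by have := sqr_ge0 (`|s| - 1); have := sqr_ge0 `|s|; nra.
Qed.

Lemma integral_gauss : (\int[leb]_s (gauss s)%:E = 1)%E.
Proof.
have p0 : 0 < Num.sqrt pi :> R by rewrite sqrtr_gt0 pi_gt0.
have mg : measurable_fun (setT : set RR) (fun s => (gauss s)%:E).
  by apply/measurable_EFinP; apply: continuous_measurable_fun; exact: continuous_gauss.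
have := @ge0_integral_affine R (Num.sqrt pi) 0 gauss_fun p0 (@continuous_gauss_fun R).
move=> /(_ ltac:(by move=> x; exact: expR_ge0)); rewrite integralT_gauss.
have -> : (\int[leb]_x (gauss_fun (Num.sqrt pi * x + 0) * Num.sqrt pi)%:E =
    (Num.sqrt pi)%:E * \int[leb]_s (gauss s)%:E)%E.
  rewrite -(ge0_integralZl leb measurableT mg).
  - apply: eq_integral => x _; rewrite -EFinM mulrC; congr (_ * _)%:E.
    by rewrite /gauss_fun /gauss addr0 exprMn sqr_sqrtr ?pi_ge0.
  - by move=> s _; rewrite lee_fin ltW// gauss_gt0.
  - by rewrite lee_fin ltW.
move=> e; have : ((Num.sqrt pi)^-1%:E * (Num.sqrt pi)%:E =
    (Num.sqrt pi)^-1%:E * ((Num.sqrt pi)%:E * \int[leb]_s (gauss s)%:E))%E by rewrite {1}e.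
by rewrite muleA -EFinM mulVf ?gt_eqF// mul1e => <-.
Qed.

Let q t : R[i] := 0 +i* (2 * pi * t).

Let Re_q t s : complex.Re (s%:C * q t) = 0. Proof. by rewrite ReImE /=; ring. Qed.

Let normc_q t s : normc (cexp (s%:C * q t)) = 1.
Proof. by rewrite normc_cexp Re_q expR0. Qed.

Let cg' : continuous (fun s => - (2 * pi * s) * gauss s).
Proof.
move=> s; apply: cvgM; last exact: continuous_gauss.
by apply: cvgN; apply: cvgM; [exact: cvg_cst|exact: cvg_id].
Qed.

Let mcexp t : cmeas (setT : set RR) (fun s => cexp (s%:C * q t)).
Proof.
apply: rcont_cmeas => s e e0; have := @cdiff_cexp R (s%:C * q t).
move=> /cdiff_cont/(_ e e0)[d d0 H].
have k0 : 0 < normc (q t) + 1 by rewrite ltr_wpDl ?normc_ge0.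
exists (d / (normc (q t) + 1)); first by rewrite divr_gt0.
move=> v vs; apply: H; rewrite -mulrBl -rmorphB normcM normc_real.
move: vs; rewrite ltr_pdivlMr//; apply: le_lt_trans.
by rewrite ler_wpM2l// lerDl.
Qed.

Let mgauss : measurable_fun (setT : set RR) gauss.
Proof. by apply: continuous_measurable_fun; exact: continuous_gauss. Qed.

Let igq t : cintegrable leb setT (fun s => (gauss s)%:C * cexp (s%:C * q t)).
Proof.
apply: (@cintegrable_decays _ 1).
  by apply: cmeasM; [exact: cmeas_real mgauss|exact: mcexp].
move=> s; rewrite normcM normc_q normc_real gtr0_norm ?gauss_gt0// mulr1 mul1r.
exact: gauss_decay.
Qed.

Let H z := cexp (pi%:C * (z * z)).

Let HE t y : H (t +i* y) = (expR (pi * t ^+ 2))%:C * ((gauss y)%:C * cexp (y%:C * q t)).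
Proof.
rewrite /H /gauss -!cexp_real -!cexpD; congr cexp.
by apply: complex_ext; rewrite !ReImE /=; ring.
Qed.

(** The integral of exp (pi z^2) over the vertical line of abscissa t does not
    depend on t; on that line pi z^2 is pi t^2 - pi y^2 + 2 pi i t y, and for
    t = 0 the integral is 1. *)
Lemma gauss_fourier t : 0 < t ->
  cintegral leb setT (fun s => (gauss s)%:C * cexp (s%:C * (0 +i* (2 * pi * t)))) = (gauss t)%:C.
Proof.
move=> t0; rewrite -/(q t).
have dH z : cdiff H z.
  apply: (@cdiff_comp _ (@cexp R) (fun w => pi%:C * (w * w))); last exact: cdiff_cexp.
  have di w : cdiff id w by apply/cderivP; exact: cderiv_id.
  by apply: cdiffM; [exact: cdiff_cst|apply: cdiffM; exact: di].
have nH x y : normc (H (x +i* y)) = expR (pi * x ^+ 2) * gauss y.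
  rewrite HE 2!normcM normc_q mulr1 !normc_real ger0_norm ?expR_ge0//.
  by rewrite gtr0_norm// gauss_gt0.
have e : cintegral leb setT (fun y => H (t +i* y)) = cintegral leb setT (fun y => H (0 +i* y)).
  apply: (@strip_integral_eq _ _ _ _ 0 (expR (pi * t ^+ 2))) => //.
  - by move=> x y _; exact/cdiff_cont/dH.
  - move=> c d; rewrite oppr0 => c0 d0; apply: goursat; first exact: ltW.
      exact: le_trans d0.
    by move=> x y _ _; exact: dH.
  - move=> x /andP[x0 xt]; under eq_integral do rewrite nH EFinM.
    rewrite (ge0_integralZl leb measurableT).
    + rewrite integral_gauss mule1 lee_fin ler_expR ler_wpM2l ?pi_ge0//.
      by rewrite ler_sqr ?nnegrE// ltW.
    + exact/measurable_EFinP.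
    + by move=> y _; rewrite lee_fin ltW// gauss_gt0.
    + by rewrite lee_fin expR_ge0.
have e0 : cintegral leb setT (fun y => H (0 +i* y)) = 1.
  rewrite (_ : (fun y => _) = (fun y => (gauss y)%:C)); last first.
    apply/funext => y; rewrite HE expr0n mulr0 expR0 mul1r.
    by rewrite (_ : y%:C * q 0 = 0) ?cexp0 ?mulr1// /q mulr0; exact: mulr0.
  by rewrite cintegral_real /Rintegral integral_gauss.
have e1 : cintegral leb setT (fun y => H (t +i* y)) =
    (expR (pi * t ^+ 2))%:C * cintegral leb setT (fun s => (gauss s)%:C * cexp (s%:C * q t)).
  by rewrite -(cintegralZ _ measurableT (igq t)); apply: eq_cintegral => y _; exact: HE.
have k0 : ((expR (pi * t ^+ 2))%:C : R[i]) != 0.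
  by rewrite eq_complex/= gt_eqF// expR_gt0.
apply: (mulfI k0); apply: etrans (esym e1) _.
by rewrite e e0 -rmorphM/= /gauss -expRD subrr expR0.
Qed.

Let igsq t : cintegrable leb setT (fun s => (s * gauss s)%:C * cexp (s%:C * q t)).
Proof.
apply: (@cintegrable_decays _ 1).
  by apply: cmeasM; [apply: cmeas_real; exact: measurable_funM|exact: mcexp].
move=> s; rewrite normcM normc_q normc_real mulr1 mul1r normrM (gtr0_norm (gauss_gt0 s)).
exact: norm_gauss_decay.
Qed.

(** The integral of the derivative of exp (- pi s^2) exp (2 pi i t s) is 0;
    the imaginary part relates the sine transform of s exp (- pi s^2) to the
    Fourier transform of the Gaussian. *)
Lemma gauss_sine t : 0 < t ->
  leb.-integrable setT (EFin \o (fun s => s * gauss s * sin (2 * pi * s * t))) /\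
  Rintegral leb setT (fun s => s * gauss s * sin (2 * pi * s * t)) = t * gauss t.
Proof.
move=> t0; pose C := 2 * pi + 2 * pi * t.
have C0 : 0 <= C by rewrite addr_ge0 ?mulr_ge0 ?pi_ge0 ?(ltW t0).
have C1 : 1 <= C.
  have := @pi_ge2 R; have : 0 <= 2 * pi * t by rewrite !mulr_ge0 ?pi_ge0 ?(ltW t0).
  rewrite /C; lra.
have nq : normc (q t) = 2 * pi * t.
  rewrite /q normc_pairE expr0n/= add0r sqrtr_sqr ger0_norm//.
  by rewrite !mulr_ge0 ?pi_ge0 ?(ltW t0).
have := @exp_FTC_line _ gauss _ (q t) is_derive_gauss cg' C.
have dP : decays C (exp_prim gauss (q t)).
  move=> s; rewrite /exp_prim normcM normc_q normc_real gtr0_norm ?gauss_gt0// mulr1.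
  apply: le_trans (gauss_decay s) _; rewrite ler_peMl// invr_ge0.
  exact/ltW/oneDsqr_gt0.
have dD : decays C (exp_deriv gauss (fun s => - (2 * pi * s) * gauss s) (q t)).
  move=> s; rewrite /exp_deriv normcM normc_q mulr1.
  apply: le_trans (le_normcD _ _) _; rewrite normcM !normc_real nq /C [leRHS]mulrDl.
  apply: lerD.
    have tp0 : 0 <= 2 * pi :> R by rewrite mulr_ge0// pi_ge0.
    rewrite normrM normrN normrM (gtr0_norm (gauss_gt0 s)) (ger0_norm tp0).
    by rewrite -mulrA ler_wpM2l// norm_gauss_decay.
  rewrite gtr0_norm ?gauss_gt0// ler_wpM2l ?gauss_decay//.
  by rewrite !mulr_ge0 ?pi_ge0 ?(ltW t0).
move=> /(_ dP dD) e.
have E : cintegral leb setT (fun s => (s * gauss s)%:C * cexp (s%:C * q t)) =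
    0 +i* (t * gauss t).
  have e2 : cintegral leb setT (exp_deriv gauss (fun s => - (2 * pi * s) * gauss s) (q t)) =
      (- (2 * pi))%:C * cintegral leb setT (fun s => (s * gauss s)%:C * cexp (s%:C * q t))
      + q t * (gauss t)%:C.
    rewrite -(gauss_fourier t0) -/(q t).
    rewrite -(cintegralZ _ measurableT (igsq t)) -(cintegralZ _ measurableT (igq t)).
    rewrite -(cintegralD measurableT (cintegrableZ _ measurableT (igsq t))
      (cintegrableZ _ measurableT (igq t))).
    apply: eq_cintegral => s _; rewrite /exp_deriv !rmorphM !rmorphN !rmorphM/=.
    by set c := cexp _; ring.
  move: e; rewrite e2; set I := cintegral _ _ _.
  have pi0 : (2 * pi : R) != 0 by rewrite mulf_neq0// gt_eqF// pi_gt0.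
  case: I => p r; rewrite /q => /eqP; rewrite eq_complex !ReImE /= => /andP[/eqP h1 /eqP h2].
  apply: complex_ext => /=; apply: (mulfI pi0); last by move: h2; lra.
  by move: h1; lra.
have imE s : complex.Im ((s * gauss s)%:C * cexp (s%:C * q t)) =
    s * gauss s * sin (2 * pi * s * t).
  have -> : s%:C * q t = 0 +i* (2 * pi * s * t) by apply: complex_ext; rewrite !ReImE /=; ring.
  by rewrite cexpE expR0 !ReImE /=; ring.
split.
  have [_] := igsq t; apply: eq_integrable => // s _.
  by rewrite /= -imE.
have : complex.Im (cintegral leb setT (fun s => (s * gauss s)%:C * cexp (s%:C * q t))) = t * gauss t.
  by rewrite E.
by move=> <-; rewrite /cintegral /=; apply: eq_Rintegral => s _; rewrite -imE.
Qed.

Lemma Rintegral_even f : continuous f -> (forall x, f (- x) = f x) ->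
  leb.-integrable setT (EFin \o f) ->
  Rintegral leb setT f = 2 * Rintegral leb Pos f.
Proof.
move=> cf fN fi.
have mPos : measurable Pos by exact: measurable_itv.
have P (h : R -> R) : continuous h -> (forall x, 0 <= h x) -> (forall x, h (- x) = h x) ->
    leb.-integrable setT (EFin \o h) ->
    Rintegral leb setT h = 2 * Rintegral leb Pos h.
  move=> ch h0 hN hi; rewrite /Rintegral ge0_symfun_integralT//; last first.
    by move=> x /=; rewrite hN.
  rewrite -set_itvcy fineM//; last first.
    have mC : measurable (`[0, +oo[%classic : set RR) by exact: measurable_itv.
    by apply: (integrable_fin_num mC); exact: integrableS measurableT mC (@subsetT _ _) hi.
  rewrite -integral_itv_obnd_cbnd//; apply/measurable_EFinP; apply: measurable_funTS.
  exact: continuous_measurable_fun.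
have cn : continuous (fun x => `|f x|) by move=> x; apply: cvg_norm; exact: cf.
have ni : leb.-integrable setT (EFin \o (fun x => `|f x|)) by exact: integrable_norm.
have cs : continuous (fun x => `|f x| + f x) by move=> x; apply: cvgD; [exact: cn|exact: cf].
have si : leb.-integrable setT (EFin \o (fun x => `|f x| + f x)).
  by have := integrableD measurableT ni fi; apply: eq_integrable => // x _; rewrite /= EFinD.
have split_ (D : set RR) : measurable D -> Rintegral leb D f =
    Rintegral leb D (fun x => `|f x| + f x) - Rintegral leb D (fun x => `|f x|).
  move=> mD; rewrite -(RintegralB mD).
  - by apply: eq_Rintegral => x _; rewrite addrC addKr.
  - exact: integrableS measurableT mD (@subsetT _ _) si.
  - exact: integrableS measurableT mD (@subsetT _ _) ni.
rewrite (split_ _ measurableT) (split_ _ mPos) (P _ cs)//.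
- by rewrite (P _ cn)// => [|x]; rewrite ?mulrBr// fN.
- by move=> x; have := ler_norm (- f x); rewrite normrN -subr_ge0 opprK.
- by move=> x; rewrite fN.
Qed.

(** The density of 2 s exp (- pi s^2) ds in the variable v = ln s. *)
Definition gauss_weight v : R := 2 * expR v ^+ 2 * gauss (expR v).

(** The sine identity in the variables s = e^v and t = e^u, the even integrand
    being folded onto s > 0. *)
Lemma gauss_sine_log u :
  leb.-integrable setT
    (EFin \o (fun v => gauss_weight v * sin (2 * pi * expR (u + v)))) /\
  Rintegral leb setT (fun v => gauss_weight v * sin (2 * pi * expR (u + v))) =
  expR u * gauss (expR u).
Proof.
pose t := expR u; have t0 : 0 < t by exact: expR_gt0.
have [fi <-] := gauss_sine t0; set f := fun s => _ in fi *.
have cf : continuous f.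
  move=> s; apply: cvgM.
    by apply: cvgM; [exact: cvg_id|exact: continuous_gauss].
  apply: continuous_comp; last exact: continuous_sin.
  by apply: cvgM; [apply: cvgM; [exact: cvg_cst|exact: cvg_id]|exact: cvg_cst].
have fN s : f (- s) = f s.
  have e : 2 * pi * - s * t = - (2 * pi * s * t) by ring.
  by rewrite /f gaussN e sinN; ring.
rewrite (Rintegral_even cf fN fi).
have cfC s : 0 < s -> rcont (fun s => (f s)%:C) s.
  move=> _ e e0; have /cvgrPdist_le/(_ e e0)[d d0 H0] := cf s; exists d => // v vs.
  by rewrite -rmorphB normc_real distrC; apply: H0 => /=; rewrite /ball_/= distrC.
have [sI sE] := exp_subst cfC.
have fP : cintegrable leb Pos (fun s => (f s)%:C).
  apply: cintegrable_real; last exact: measurable_itv.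
  exact: integrableS measurableT (measurable_itv _ : measurable Pos) (@subsetT _ _) fi.
have wE v : gauss_weight v * sin (2 * pi * expR (u + v)) = 2 * (f (expR v) * expR v).
  by rewrite /gauss_weight /f expRD /t (_ : 2 * pi * (expR u * expR v) = 2 * pi * expR v * expR u); ring.
have [fi' _] := sI.1 fP.
have fi2 : leb.-integrable setT (EFin \o (fun v => f (expR v) * expR v)).
  by move: fi'; apply: eq_integrable => // v _; rewrite /= !mulr0 !subr0.
split.
  have := integrableZl measurableT 2 fi2; apply: eq_integrable => // v _.
  by rewrite /= wE.
have -> : Rintegral leb setT (fun v => gauss_weight v * sin (2 * pi * expR (u + v))) =
    Rintegral leb setT (fun v => 2 * (f (expR v) * expR v)).
  by apply: eq_Rintegral => v _; exact: wE.
rewrite (RintegralZl _ measurableT fi2); congr (2 * _).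
have := sE fP; rewrite cintegral_real => /(congr1 (@complex.Re R)) /= ->.
by apply: eq_Rintegral => v _ /=; rewrite mulr0 subr0.
Qed.

End GaussianFourier.

(** * Euler's integral *)

Section EulerIntegral.
Variable R : realType.
Local Notation RR := (measurableTypeR R).
Local Notation leb := (@lebesgue_measure R).
Local Notation Pos := (`]0, +oo[%classic : set RR).
Implicit Types (t u v x y sg eta : R) (s z : R[i]) (f h : R -> R).

Lemma rcont_reim (f : R -> R[i]) x : {for x, continuous (fun y => complex.Re (f y))} ->
  {for x, continuous (fun y => complex.Im (f y))} -> rcont f x.
Proof.
move=> /cvgrPdist_le cr /cvgrPdist_le ci e e0; have e2 : 0 < e / 2 by rewrite divr_gt0.
have [d1 d10 H1] := cr _ e2; have [d2 d20 H2] := ci _ e2.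
exists (Num.min d1 d2); first by rewrite lt_min d10.
move=> y; rewrite lt_min distrC => /andP[y1 y2].
have := H1 y y1; have := H2 y y2; rewrite distrC => h2; rewrite distrC => h1.
by apply: le_trans (normc_le_reim _) _; rewrite !ReImE; lra.
Qed.

Lemma rcont_real (h : R -> R) x : {for x, continuous h} -> rcont (fun y => (h y)%:C) x.
Proof. by move=> ch; apply: rcont_reim => //=; exact: cvg_cst. Qed.

Lemma rcontM (f g : R -> R[i]) x : rcont f x -> rcont g x -> rcont (fun y => f y * g y) x.
Proof.
move=> cf cg; have fr := rcont_re cf; have fi := rcont_im cf.
have gr := rcont_re cg; have gi := rcont_im cg.
apply: rcont_reim.
  have -> : (fun y => complex.Re (f y * g y)) = (fun y =>
    complex.Re (f y) * complex.Re (g y) - complex.Im (f y) * complex.Im (g y)).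
    by apply/funext => y; rewrite ReImE.
  by apply: cvgB; exact: cvgM.
have -> : (fun y => complex.Im (f y * g y)) = (fun y =>
  complex.Re (f y) * complex.Im (g y) + complex.Im (f y) * complex.Re (g y)).
  by apply/funext => y; rewrite ReImE.
by apply: cvgD; exact: cvgM.
Qed.

Lemma rcont_cexp (h : R -> R) s x : {for x, continuous h} ->
  rcont (fun y => cexp ((h y)%:C * s)) x.
Proof.
move=> /rcont_real ch e e0; have /cdiff_cont/(_ e e0)[d d0 H] := @cdiff_cexp R ((h x)%:C * s).
have k0 : 0 < normc s + 1 by rewrite ltr_wpDl ?normc_ge0.
have dk : 0 < d / (normc s + 1) / 2 by rewrite !divr_gt0.
have [d1 d10 H1] := ch _ dk; exists d1 => // y /H1 h1; apply: H.
rewrite -mulrBl normcM; apply: (@le_lt_trans _ _ (d / (normc s + 1) / 2 * (normc s + 1))).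
  by apply: ler_pM; rewrite ?normc_ge0// lerDl.
by rewrite mulrAC divfK ?gt_eqF// ltr_pdivrMr// ltr_pMr// ltr1n.
Qed.

Lemma measurable_expR_line : measurable_fun (setT : set RR) (@expR R).
Proof. by apply: continuous_measurable_fun; exact: continuous_expR. Qed.

Lemma cmeas_cexp s : cmeas (setT : set RR) (fun x => cexp (x%:C * s)).
Proof. by apply: rcont_cmeas => x; apply: rcont_cexp; exact: cvg_id. Qed.

Lemma normc_cexp_real s x : normc (cexp (x%:C * s)) = expR (x * complex.Re s).
Proof. by rewrite normc_cexp !ReImE /= mul0r subr0. Qed.

(** Euler's integral is taken over the real line in the variable x = ln t,
    where exp (- t) becomes exp (- e^x). *)
Definition damp x : R := expR (- expR x).

Lemma damp_gt0 x : 0 < damp x. Proof. exact: expR_gt0. Qed.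

Lemma continuous_damp : continuous damp.
Proof.
move=> x; apply: continuous_comp; last exact: continuous_expR.
by apply: cvgN; exact: continuous_expR.
Qed.

Lemma measurable_damp : measurable_fun (setT : set RR) damp.
Proof. by apply: continuous_measurable_fun; exact: continuous_damp. Qed.

Lemma damp_decay sg : 0 < sg -> exists2 C, 0 <= C &
  forall x, damp x * expR (x * sg) <= C * (1 + x ^+ 2)^-1.
Proof.
move=> sg0; pose n := (Num.truncn sg).+1; pose l := Num.min sg 1.
have l0 : 0 < l by rewrite lt_min sg0 ltr01.
have : l <= l by []. rewrite {2}/l le_min => /andP[lsg l1].
have f1 : 1 <= (n.+1)`!%:R :> R by rewrite ler1n fact_gt0.
exists ((n.+1)`!%:R * (1 + 4 / l ^+ 2)).
  by rewrite mulr_ge0 ?ler0n// addr_ge0// divr_ge0// sqr_ge0.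
move=> x; rewrite -mulrA; apply: le_trans (ler_wpM2l (ler0n _ _) (expR_decay x l0)).
have [x0|x0] := leP x 0.
  rewrite (ler0_norm x0); apply: (@le_trans _ _ (1 * expR (x * sg))).
    by rewrite ler_wpM2r ?expR_ge0// /damp expR_le1 oppr_le0 expR_ge0.
  apply: ler_pM => //; rewrite ?expR_ge0// ler_expR; nra.
rewrite (gtr0_norm x0) /damp.
(* the term of degree n + 1 of the exponential series at e^x *)
have h : expR (- expR x) <= (n.+1)`!%:R * expR (- (x *+ n.+1)).
  rewrite !expRN ler_pdivlMr; last by rewrite expR_gt0.
  rewrite mulrC ler_pdivrMr ?expR_gt0//.
  rewrite (_ : expR (x *+ n.+1) = expR x ^+ n.+1); last by rewrite -expRM_natl mulr_natl.
  have := @expR_ge1Dxn R (expR x) n (expR_ge0 _) => h1.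
  have h2 : expR x ^+ n.+1 / (n.+1)`!%:R <= expR (expR x) by lra.
  by move: h2; rewrite ler_pdivrMr ?ltr0n ?fact_gt0// mulrC.
apply: le_trans (ler_wpM2r (expR_ge0 _) h) _.
rewrite -mulrA -expRD ler_wpM2l ?ler0n// ler_expR.
have sn : sg <= n%:R by apply/ltW/truncnS_gt.
rewrite -[x *+ _]mulr_natr -natr1; nra.
Qed.

Definition euler_integrand s x : R[i] := (damp x)%:C * cexp (x%:C * s).
Definition euler s : R[i] := cintegral leb setT (euler_integrand s).

Lemma cmeas_euler s : cmeas (setT : set RR) (euler_integrand s).
Proof. by apply: cmeasM; [apply: cmeas_real; exact: measurable_damp|exact: cmeas_cexp]. Qed.

Lemma euler_decays s : 0 < complex.Re s -> exists C, decays C (euler_integrand s).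
Proof.
move=> /damp_decay[C _ H]; exists C => x.
by rewrite /euler_integrand normcM normc_real gtr0_norm ?damp_gt0// normc_cexp_real.
Qed.

Lemma euler_integrable s : 0 < complex.Re s -> cintegrable leb setT (euler_integrand s).
Proof. by move=> /euler_decays[C]; exact/cintegrable_decays/cmeas_euler. Qed.

Lemma euler_Gamma s : 0 < complex.Re s -> Gamma_integral s = euler s.
Proof.
move=> s0; rewrite /Gamma_integral; set f := fun t : R => _.
have cf t : 0 < t -> rcont f t.
  move=> t0; apply: rcontM.
    rewrite /cpow; under eq_fun do rewrite mulrC.
    by apply: rcont_cexp; exact: continuous_ln.
  apply: rcont_real; apply: continuous_comp; last exact: continuous_expR.
  by apply: cvgN; exact: cvg_id.
have e : (fun x => f (expR x) * (expR x)%:C) = euler_integrand s.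
  apply/funext => x; rewrite /f /cpow expRK /euler_integrand /damp.
  rewrite -!cexp_real -!cexpD; congr cexp.
  by apply: complex_ext; rewrite !ReImE /=; ring.
have [sI sE] := exp_subst cf; rewrite e in sI sE.
by apply: sE; apply/sI; exact: euler_integrable.
Qed.

Let dd x : is_derive x 1 damp (- expR x * damp x).
Proof. by apply: is_derive_eq; rewrite /damp /GRing.scale /=; ring. Qed.

(** Integration by parts. *)
Lemma euler_rec s : 0 < complex.Re s -> euler (s + 1) = s * euler s.
Proof.
move=> s0; have s1 : 0 < complex.Re (s + 1) by rewrite ReImE /= ltr_wpDr.
have cg' : continuous (fun x => - expR x * damp x).
  move=> x; apply: cvgM; last exact: continuous_damp.
  by apply: cvgN; exact: continuous_expR.
have [C HC] := euler_decays s0; have [C1 HC1] := euler_decays s1.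
have C10 : 0 <= C1.
  by have := le_trans (normc_ge0 _) (HC1 0); rewrite expr0n/= addr0 invr1 mulr1.
have C0 : 0 <= C.
  by have := le_trans (normc_ge0 _) (HC 0); rewrite expr0n/= addr0 invr1 mulr1.
have dE x : exp_deriv damp (fun x => - expR x * damp x) s x =
    s * euler_integrand s x - euler_integrand (s + 1) x.
  rewrite /exp_deriv /euler_integrand mulrDr mulr1 cexpD cexp_real rmorphM rmorphN/=.
  by set c := cexp _; ring.
have dP : decays (C + (normc s * C + C1)) (exp_prim damp s).
  move=> x; apply: le_trans (HC x) _; rewrite ler_wpM2r ?invr_ge0 ?(ltW (oneDsqr_gt0 _))//.
  by rewrite lerDl addr_ge0// mulr_ge0// normc_ge0.
have dD : decays (C + (normc s * C + C1)) (exp_deriv damp (fun x => - expR x * damp x) s).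
  move=> x; rewrite dE; apply: le_trans (le_normcD _ _) _; rewrite normcN normcM.
  have p : 0 <= (1 + x ^+ 2)^-1 by rewrite invr_ge0 (ltW (oneDsqr_gt0 _)).
  have := ler_wpM2l (normc_ge0 s) (HC x); have := HC1 x; have := mulr_ge0 C0 p; lra.
have := exp_FTC_line dd cg' dP dD.
have i0 := euler_integrable s0; have i1 := euler_integrable s1.
have -> : cintegral leb setT (exp_deriv damp (fun x => - expR x * damp x) s) =
    cintegral leb setT (fun x => s * euler_integrand s x - euler_integrand (s + 1) x).
  by apply: eq_cintegral => x _; exact: dE.
rewrite (cintegralB measurableT (cintegrableZ s measurableT i0) i1).
by rewrite (cintegralZ _ measurableT i0) => /eqP; rewrite subr_eq0 => /eqP.
Qed.

Definition reuler sg : R := Rintegral leb setT (fun x => damp x * expR (x * sg)).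

Lemma euler_real sg : euler (sg%:C) = (reuler sg)%:C.
Proof.
rewrite -cintegral_real; apply: eq_cintegral => x _.
by rewrite /euler_integrand -rmorphM/= cexp_real rmorphM.
Qed.

Lemma reuler_integrable sg : 0 < sg ->
  leb.-integrable setT (EFin \o (fun x => damp x * expR (x * sg))).
Proof.
move=> sg0; have [ir _] := @euler_integrable sg%:C sg0.
move: ir; apply: eq_integrable => // x _; congr EFin.
transitivity (complex.Re ((damp x * expR (x * sg))%:C : R[i])) => //.
by congr complex.Re; rewrite /euler_integrand -rmorphM/= cexp_real rmorphM.
Qed.

Lemma reuler_rec sg : 0 < sg -> reuler (sg + 1) = sg * reuler sg.
Proof.
move=> sg0; apply: complexI; rewrite -euler_real rmorphD/= euler_rec//.
by rewrite euler_real rmorphM.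
Qed.

Lemma reuler_gt0 sg : 0 < sg -> 0 < reuler sg.
Proof.
move=> sg0; have ir := reuler_integrable sg0; pose b : R := expR (- expR 1).
pose I01 : set RR := `[0, 1]%classic.
have mI : measurable I01 by exact: measurable_itv.
have b0 : 0 < b by exact: expR_gt0.
apply: (lt_le_trans b0); rewrite -lee_fin /reuler /Rintegral fineK; last first.
  exact: integrable_fin_num.
apply: (@le_trans _ _ (\int[leb]_(x in I01) (cst b%:E x))%E).
  have e1 : leb I01 = 1%E.
    by apply: etrans (lebesgue_measure_itv `[0, 1]) _; rewrite /= lte01 oppr0 adde0.
  rewrite integral_cst// [X in (_ * X)%E](_ : _ = 1%E) ?mule1//; exact: e1.
apply: (@le_trans _ _ (\int[leb]_(x in I01) (damp x * expR (x * sg))%:E)%E).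
  apply: (ge0_le_integral leb mI) => //.
  - by move=> x _; rewrite lee_fin ltW.
  - apply/measurable_EFinP; apply: measurable_funTS; apply/measurable_EFinP.
    exact: measurable_int ir.
  - move=> x; rewrite /I01/= in_itv/= => /andP[x0 x1]; rewrite lee_fin -[b]mulr1.
    apply: ler_pM; rewrite ?(ltW b0)//; first by rewrite /b /damp ler_expR lerN2 ler_expR.
    by apply: one_le_expR; rewrite mulr_ge0// ltW.
apply: ge0_subset_integral => //; first exact: measurable_int ir.
by move=> x _; rewrite lee_fin mulr_ge0 ?expR_ge0// ltW// damp_gt0.
Qed.

(** Since e^x + e^(-x) - 2 is the square of e^(x/2) - e^(-x/2). *)
Lemma sqr_le_exp x : x ^+ 2 <= 4 * (expR x + expR (- x) - 2).
Proof.
have e1 : expR x = expR (x / 2) ^+ 2 by rewrite expr2 -expRD -splitr.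
have e2 : expR (- x) = expR (- (x / 2)) ^+ 2 by rewrite expr2 -expRD -opprD -splitr.
have e3 : expR (x / 2) * expR (- (x / 2)) = 1 by rewrite -expRD subrr expR0.
rewrite e1 e2; set p := expR _ in e3 *; set q := expR _ in e3 *.
have -> : p ^+ 2 + q ^+ 2 - 2 = (p - q) ^+ 2 by rewrite sqrrB e3; ring.
have : (x / 2) ^+ 2 <= (p - q) ^+ 2; last by rewrite exprMn exprVn; lra.
rewrite -[X in X <= _](real_normK (num_real _)) -[X in _ <= X](real_normK (num_real _)).
rewrite ler_sqr ?nnegrE//.
have hp : 1 + x / 2 <= p by exact: expR_ge1Dx.
have hq : 1 - x / 2 <= q by exact: expR_ge1Dx.
have [x0|x0] := leP 0 x.
  rewrite ger0_norm ?divr_ge0//; apply: le_trans (ler_norm _).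
  have : q <= 1 by rewrite /q expR_le1 oppr_le0 divr_ge0.
  lra.
rewrite ltr0_norm ?ltr_pdivrMr ?mul0r// -normrN opprB; apply: le_trans (ler_norm _).
have : p <= 1 by rewrite /p expR_le1 ler_pdivrMr// mul0r ltW.
lra.
Qed.

(** Far to the right the mass of the integrand concentrates near x = ln (Re s
    - 1), too much for the oscillation of exp (i x Im s) to produce a
    cancellation. *)
Lemma euler_neq0_far s : 1 < complex.Re s ->
  2 * complex.Im s ^+ 2 < complex.Re s - 1 -> euler s != 0.
Proof.
set sg := complex.Re s; set eta := complex.Im s => sg1 hc.
pose c := sg - 1; have c0 : 0 < c by rewrite subr_gt0.
pose L := ln c; have s0 : 0 < complex.Re s by exact: lt_trans ltr01 sg1.
have is_ := euler_integrable s0.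
have sgc : sg = c + 1 by rewrite /c subrK.
have ic := reuler_integrable c0; have isg := reuler_integrable s0.
have sg10 : 0 < sg + 1 by rewrite addr_gt0.
have is1 := reuler_integrable sg10.
(* the phase of the integrand at x = L is rotated to 0 *)
pose w : R[i] := cexp (0 +i* (- (eta * L))).
suff : 0 < complex.Re (euler s * w).
  by apply: contraTneq => ->; rewrite mul0r ltxx.
rewrite /euler -(cintegralZr _ measurableT is_) /cintegral /=.
(* the cosine of eta (x - L) is at least 1 - eta^2 (x - L)^2 / 2, and the
   square is bounded by exponentials whose integrals are values of Gamma *)
pose lo x : R := damp x * expR (x * sg) * (1 + 4 * eta ^+ 2)
   - 2 * eta ^+ 2 / c * (damp x * expR (x * (sg + 1)))
   - 2 * eta ^+ 2 * c * (damp x * expR (x * c)).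
have loE x : lo x = damp x * expR (x * sg) *
    (1 - 2 * eta ^+ 2 * (expR (x - L) + expR (- (x - L)) - 2)).
  have e1 : expR (x * (sg + 1)) = expR (x * sg) * expR x by rewrite -expRD; congr expR; ring.
  have e2 : expR (x * c) = expR (x * sg) * expR (- x).
    by rewrite -expRD; congr expR; rewrite /c; ring.
  have e3 : expR (x - L) = expR x / c by rewrite expRB /L lnK// posrE.
  have e4 : expR (- (x - L)) = expR (- x) * c by rewrite opprB addrC expRD /L lnK// posrE.
  by rewrite /lo e1 e2 e3 e4; field; rewrite gt_eqF.
have ireal x : complex.Re (euler_integrand s x * w) =
    damp x * expR (x * sg) * cos (eta * (x - L)).
  rewrite /euler_integrand /w -mulrA -cexpD.
  have -> : x%:C * s + 0 +i* (- (eta * L)) = (x * sg) +i* (eta * (x - L)).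
    by apply: complex_ext; rewrite !ReImE /= -/sg -/eta; ring.
  by rewrite cexpE !ReImE /=; ring.
have il : leb.-integrable setT (EFin \o lo).
  have j1 := integrableZl measurableT (1 + 4 * eta ^+ 2) isg.
  have j2 := integrableZl measurableT (2 * eta ^+ 2 / c) is1.
  have j3 := integrableZl measurableT (2 * eta ^+ 2 * c) ic.
  have := integrableB measurableT (integrableB measurableT j1 j2) j3.
  apply: eq_integrable => // x _; rewrite /= -!EFinM -!EFinB; congr EFin.
  by rewrite /lo; ring.
have iw : leb.-integrable setT (EFin \o (fun x => complex.Re (euler_integrand s x * w))).
  have m1 : cmeas (setT : set RR) (fun x => euler_integrand s x * w).
    by apply: cmeasM; [exact: cmeas_euler|exact: cmeas_cst].
  have := cintegrableZ w measurableT is_; case=> + _.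
  by apply: eq_integrable => // x _; congr EFin; congr complex.Re; exact: mulrC.
have ge : Rintegral leb setT lo <=
    Rintegral leb setT (fun x => complex.Re (euler_integrand s x * w)).
  apply: le_Rintegral => // x _; rewrite [leLHS](loE x) [leRHS](ireal x).
  rewrite ler_wpM2l ?mulr_ge0 ?expR_ge0 ?(ltW (damp_gt0 _))//.
  have := oneB_cos_le (eta * (x - L)); rewrite exprMn => h1.
  have := ler_wpM2l (sqr_ge0 eta) (sqr_le_exp (x - L)); lra.
apply: lt_le_trans ge.
have -> : Rintegral leb setT lo = reuler sg * (1 - 2 * eta ^+ 2 / c).
  have j1 := integrableZl measurableT (1 + 4 * eta ^+ 2) isg.
  have j2 := integrableZl measurableT (2 * eta ^+ 2 / c) is1.
  have j3 := integrableZl measurableT (2 * eta ^+ 2 * c) ic.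
  have R1 : Rintegral leb setT lo = (1 + 4 * eta ^+ 2) * reuler sg -
      2 * eta ^+ 2 / c * reuler (sg + 1) - 2 * eta ^+ 2 * c * reuler c.
    rewrite /reuler -!(RintegralZl _ measurableT)//.
    rewrite -(RintegralB measurableT j1 j2).
    have j12 : leb.-integrable setT (EFin \o (fun x => (1 + 4 * eta ^+ 2) * (damp x * expR (x * sg)) -
        2 * eta ^+ 2 / c * (damp x * expR (x * (sg + 1))))).
      by have := integrableB measurableT j1 j2; apply: eq_integrable => // x _; rewrite /= EFinB.
    rewrite -(RintegralB measurableT j12 j3); apply: eq_Rintegral => x _.
    by rewrite /lo; ring.
  have e1 : reuler (sg + 1) = sg * reuler sg by exact: reuler_rec.
  have e2 : reuler sg = c * reuler c by rewrite {1}sgc reuler_rec.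
  have e3 : reuler (sg + 1) = (c + 1) * reuler sg by rewrite e1 -sgc.
  have c0' : c != 0 by rewrite gt_eqF.
  rewrite R1 e3 -[2 * eta ^+ 2 * c * _]mulrA -e2.
  by move: (reuler sg) (c) c0' => r k k0; field.
rewrite mulr_gt0 ?reuler_gt0// subr_gt0 ltr_pdivrMr// mul1r.
exact: hc.
Qed.

(** The recursion moves a zero to the right with its imaginary part unchanged.
    *)
Lemma euler_neq0 s : 0 < complex.Re s -> euler s != 0.
Proof.
move=> s0; have shift n : euler s = 0 -> euler (s + n%:R) = 0.
  move=> e0; elim: n => [|n IH]; first by rewrite addr0.
  rewrite -natr1 addrA euler_rec ?IH ?mulr0//.
  rewrite ReImE -(rmorph_nat (real_complex R)) /=; apply: ltr_wpDr => //.
pose n := (Num.truncn (2 * complex.Im s ^+ 2 + 1)).+1.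
have hn : 2 * complex.Im s ^+ 2 + 1 < n%:R by exact: truncnS_gt.
apply/negP => /eqP/(shift n) e0.
have nR : n%:R = (n%:R)%:C :> R[i] by rewrite rmorph_nat.
have := @euler_neq0_far (s + n%:R); rewrite e0 eqxx => h; suff : false by [].
have i2 := sqr_ge0 (complex.Im s).
by apply: h; rewrite nR !ReImE /= ?addr0; lra.
Qed.

End EulerIntegral.

(** * The Fubini theorem for complex-valued functions *)

Section ComplexFubini.
Variable R : realType.
Local Notation RR := (measurableTypeR R).
Local Notation leb := (@lebesgue_measure R).

Lemma real_Fubini (k : RR -> RR -> R) :
  measurable_fun setT (fun p : RR * RR => k p.1 p.2) ->
  (forall u, leb.-integrable setT (EFin \o k u)) ->
  (forall v, leb.-integrable setT (EFin \o k^~ v)) ->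
  (\int[leb]_v \int[leb]_u `|(k u v)%:E| < +oo)%E ->
  Rintegral leb setT (fun u => Rintegral leb setT (k u)) =
  Rintegral leb setT (fun v => Rintegral leb setT (k^~ v)).
Proof.
move=> mk iu iv fin.
pose f (p : RR * RR) := (k p.1 p.2)%:E.
have mf : measurable_fun setT f by exact/measurable_EFinP.
have fi : (leb \x leb)%E.-integrable setT f by apply/(integrable21ltyP leb leb mf).
have e := Fubini fi.
have e1 u : (\int[leb]_y f (u, y) = (Rintegral leb setT (k u))%:E)%E.
  by rewrite /Rintegral fineK//; exact: (integrable_fin_num measurableT (iu u)).
have e2 v : (\int[leb]_x f (x, v) = (Rintegral leb setT (k^~ v))%:E)%E.
  by rewrite /Rintegral fineK//; exact: (integrable_fin_num measurableT (iv v)).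
rewrite [LHS]/Rintegral [RHS]/Rintegral; congr fine.
transitivity (\int[leb]_x \int[leb]_y f (x, y))%E.
  by apply: eq_integral => u _; rewrite e1.
by rewrite e; apply: eq_integral => v _; rewrite e2.
Qed.

Lemma complex_Fubini (k : RR -> RR -> R[i]) :
  cmeas setT (fun p : RR * RR => k p.1 p.2) ->
  (forall u, cintegrable leb setT (k u)) ->
  (forall v, cintegrable leb setT (k^~ v)) ->
  (\int[leb]_v \int[leb]_u (normc (k u v))%:E < +oo)%E ->
  cintegral leb setT (fun u => cintegral leb setT (k u)) =
  cintegral leb setT (fun v => cintegral leb setT (k^~ v)).
Proof.
move=> [mr mi] iu iv fin.
have mn : measurable_fun setT (fun p : RR * RR => (normc (k p.1 p.2))%:E).
  by apply/measurable_EFinP; exact: (@cmeas_normc _ _ _ setT (fun p : RR * RR => k p.1 p.2)).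
have fin' (h : R[i] -> R) : (forall z, `|h z| <= normc z) ->
    measurable_fun setT (fun p : RR * RR => h (k p.1 p.2)) ->
    (\int[leb]_v \int[leb]_u `|(h (k u v))%:E| < +oo)%E.
  move=> hz mh; apply: le_lt_trans fin.
  have mha : measurable_fun setT (fun p : RR * RR => `|(h (k p.1 p.2))%:E|%E).
    by apply: measurableT_comp => //; exact/measurable_EFinP.
  apply: (ge0_le_integral leb measurableT).
  - by move=> v _; apply: integral_ge0.
  - by apply: (@measurable_fun_fubini_tonelli_G _ _ _ _ _ leb (fun p : RR * RR => `|(h (k p.1 p.2))%:E|%E)).
  - apply: (@measurable_fun_fubini_tonelli_G _ _ _ _ _ leb (fun p : RR * RR => (normc (k p.1 p.2))%:E)) => //.
    by move=> p; rewrite lee_fin normc_ge0.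
  - move=> v _; apply: (ge0_le_integral leb measurableT) => //.
    + exact: (measurableT_comp mha (pair2_measurable v)).
    + exact: (measurableT_comp mn (pair2_measurable v)).
    + by move=> u _; rewrite /= lee_fin hz.
rewrite /cintegral /=; congr (_ +i* _).
  apply: (real_Fubini (k := fun u v => complex.Re (k u v))); first exact: mr.
  - by move=> u; case: (iu u).
  - by move=> v; case: (iv v).
  - by apply: (fin' (@complex.Re R) (@normc_re R) mr).
apply: (real_Fubini (k := fun u v => complex.Im (k u v))); first exact: mi.
- by move=> u; case: (iu u).
- by move=> v; case: (iv v).
- by apply: (fin' (@complex.Im R) (@normc_im R) mi).
Qed.

End ComplexFubini.

(** * The Mellin transform of the Gaussian *)

Section FunctionalEquation.
Variable R : realType.
Local Notation RR := (measurableTypeR R).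
Local Notation leb := (@lebesgue_measure R).
Implicit Types (t u v x y sg : R) (s z : R[i]).

(** The Mellin integrand of exp (- pi t^2) in the variable x = ln t. *)
Definition mellin_integrand s x : R[i] := (gauss (expR x))%:C * cexp (x%:C * s).
Definition mellin s : R[i] := cintegral leb setT (mellin_integrand s).

(** For x > 0 the Gaussian is at most e^(-4 x), which the exponent sg <= 3
    does not spoil. *)
Lemma gauss_exp_decay sg x : 0 < sg -> sg <= 3 ->
  gauss (expR x) * expR (x * sg) <= (1 + 4 / Num.min sg 1 ^+ 2) * (1 + x ^+ 2)^-1.
Proof.
move=> sg0 sg3; set l := Num.min sg 1; have l0 : 0 < l by rewrite lt_min sg0 ltr01.
have : l <= l by []. rewrite {2}/l le_min => /andP[lsg l1].
apply: le_trans (expR_decay x l0); have [x0|x0] := leP x 0.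
  rewrite (ler0_norm x0); apply: (@le_trans _ _ (1 * expR (x * sg))).
    rewrite ler_wpM2r ?expR_ge0//; apply: le_trans (gauss_decay _) _; exact: oneDsqrV_le1.
  rewrite mul1r ler_expR; nra.
rewrite (gtr0_norm x0); apply: (@le_trans _ _ (expR (- (4 * x)) * expR (x * sg))).
  rewrite ler_wpM2r ?expR_ge0//; apply: le_trans (gauss_le _) _.
  have -> : expR (- (4 * x)) = (expR x ^+ 2)^-1 ^+ 2.
    by rewrite expRN exprVn -exprM -expRM_natl.
  have e2 : 0 < expR x ^+ 2 by rewrite exprn_gt0// expR_gt0.
  rewrite ler_sqr ?nnegrE ?invr_ge0 ?(ltW e2) ?(ltW (oneDsqr_gt0 _))//.
  by rewrite lef_pV2 ?posrE ?oneDsqr_gt0// lerDr.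
rewrite -expRD ler_expR; nra.
Qed.

Lemma measurable_gauss_exp : measurable_fun (setT : set RR) (fun x => gauss (expR x)).
Proof.
apply: continuous_measurable_fun => x; apply: continuous_comp.
  exact: continuous_expR.
exact: continuous_gauss.
Qed.

Lemma cmeas_mellin s : cmeas (setT : set RR) (mellin_integrand s).
Proof. by apply: cmeasM; [apply: cmeas_real; exact: measurable_gauss_exp|exact: cmeas_cexp]. Qed.

Lemma mellin_decays s : 0 < complex.Re s <= 3 -> exists2 C, 0 <= C & decays C (mellin_integrand s).
Proof.
move=> /andP[s0 s3]; exists (1 + 4 / Num.min (complex.Re s) 1 ^+ 2).
  by rewrite addr_ge0// divr_ge0// sqr_ge0.
move=> x; rewrite /mellin_integrand normcM normc_real gtr0_norm ?gauss_gt0// normc_cexp_real.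
exact: gauss_exp_decay.
Qed.

Lemma mellin_integrable s : 0 < complex.Re s <= 3 -> cintegrable leb setT (mellin_integrand s).
Proof. by move=> /mellin_decays[C _]; exact/cintegrable_decays/cmeas_mellin. Qed.

Lemma halfC : (2^-1 : R[i]) = (2^-1 : R)%:C.
Proof. by rewrite fmorphV/= rmorph_nat. Qed.

(** The substitution of pi e^(2x) for t in Euler's integral. *)
Lemma Gamma_mellin s : 0 < complex.Re s ->
  cpow pi (- s / 2) * Gamma (s / 2) = 2 * mellin s.
Proof.
move=> s0; have Rh : complex.Re (s / 2) = complex.Re s / 2.
  by rewrite halfC !ReImE /= mulr0 subr0.
have h0 : 0 < complex.Re (s / 2) by rewrite Rh divr_gt0.
rewrite /Gamma /Gamma_shift h0 addr0 big_ord0 divr1 euler_Gamma// /euler.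
have ce x : rcont (euler_integrand (s / 2)) x.
  apply: rcontM; first by apply: rcont_real; exact: continuous_damp.
  by apply: rcont_cexp; exact: cvg_id.
have [ia ->] := cintegrable_affine (ln pi) (ltr0n _ 2) ce (euler_integrable h0).
have e x : euler_integrand (s / 2) (2 * x + ln pi) * 2%:C =
    (2 * cexp ((ln pi)%:C * (s / 2))) * mellin_integrand s x.
  rewrite /euler_integrand; have -> : damp (2 * x + ln pi) = gauss (expR x).
    rewrite /damp /gauss expRD lnK ?posrE ?pi_gt0// mulrC.
    by rewrite -expRM_natl.
  rewrite (_ : (2 * x + ln pi)%:C * (s / 2) = x%:C * s + (ln pi)%:C * (s / 2)); last first.
    by rewrite rmorphD rmorphM/= rmorph_nat; field.
  by rewrite cexpD rmorph_nat /mellin_integrand; ring.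
set c := 2 * cexp _ in e; have c0 : c != 0 by rewrite mulf_neq0// cexp_neq0.
have im : cintegrable leb setT (mellin_integrand s).
  have := cintegrableZ c^-1 measurableT ia; apply: eq_cintegrable => // x _.
  by rewrite e mulKf.
have -> : cintegral leb setT (fun x => euler_integrand (s / 2) (2 * x + ln pi) * 2%:C) =
    c * mellin s.
  rewrite -(cintegralZ c measurableT im); apply: eq_cintegral => x _; exact: e.
rewrite mulrA; congr (_ * _); rewrite /c /cpow mulrCA -cexpD mulrC.
by rewrite (_ : _ + _ = 0) ?cexp0 ?mul1r//; ring.
Qed.

End FunctionalEquation.

(** * The archimedean factor as a sine transform *)

Section ArchimedeanFactor.
Variable R : realType.
Local Notation RR := (measurableTypeR R).
Local Notation leb := (@lebesgue_measure R).
Implicit Types (t u v x y sg : R) (s z : R[i]).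

Lemma two_neq0 : (2 : R[i]) != 0.
Proof. by rewrite pnatr_eq0. Qed.

Lemma mellin_neq0 s : 0 < complex.Re s -> mellin s != 0.
Proof.
move=> s0; have Rh : complex.Re (s / 2) = complex.Re s / 2.
  by rewrite halfC !ReImE /= mulr0 subr0.
have h0 : 0 < complex.Re (s / 2) by rewrite Rh divr_gt0.
have : 2 * mellin s != 0; last by rewrite mulf_eq0 negb_or => /andP[].
rewrite -Gamma_mellin// mulf_neq0 ?cexp_neq0//.
by rewrite /Gamma /Gamma_shift h0 addr0 big_ord0 divr1 euler_Gamma// euler_neq0.
Qed.

Lemma mellin_conj s : 0 < complex.Re s <= 3 -> mellin (conjc s) = conjc (mellin s).
Proof.
move=> s03; rewrite /mellin -(cintegral_conj measurableT (mellin_integrable s03)).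
apply: eq_cintegral => x _; rewrite /mellin_integrand conjcM cexp_conj conjcM.
by rewrite !conjc_real.
Qed.

Lemma rho_mellin z : 0 < complex.Re z < 1 -> rho_infty z = mellin z / mellin (1 - z).
Proof.
move=> /andP[z0 z1]; have z1' : 0 < complex.Re (1 - z) by rewrite !ReImE /= subr_gt0.
by rewrite /rho_infty !Gamma_mellin// invfM mulrACA divff ?two_neq0// mul1r.
Qed.

Lemma critical_sub y : 1 - critical_line y = conjc (critical_line y).
Proof. by rewrite /critical_line /vertical_line; apply: complex_ext; rewrite !ReImE /=; field. Qed.

Lemma critical_re y : complex.Re (critical_line y) = 2^-1. Proof. by []. Qed.

Lemma half_strip : 0 < (2^-1 : R) < 1.
Proof. by rewrite invr_gt0 ltr0n invf_lt1// ltr1n. Qed.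

(** On the critical line 1 - z is the complex conjugate of z, and the Mellin
    transform commutes with conjugation. *)
Lemma normc_rho y : normc (rho_infty (critical_line y)) = 1.
Proof.
have [h0 h1] := andP half_strip.
have c3 : 0 < complex.Re (critical_line y) <= 3.
  by rewrite critical_re h0/= (le_trans (ltW h1))// ler1n.
rewrite rho_mellin ?half_strip// critical_sub mellin_conj// normc_div normc_conj.
by rewrite divff// normc_eq0 mellin_neq0.
Qed.

(** Integration by parts: the derivative of exp (- pi e^(2v)) is - pi times
    the weight. *)
Lemma gauss_weight_mellin s : 0 < complex.Re s <= 1 ->
  cintegrable leb setT (fun v => (gauss_weight v)%:C * cexp (v%:C * s)) /\
  pi%:C * cintegral leb setT (fun v => (gauss_weight v)%:C * cexp (v%:C * s)) = s * mellin s.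
Proof.
move=> /andP[s0 s1]; set w := fun v : R => (gauss_weight v)%:C * _.
have s3 : 0 < complex.Re s <= 3 by rewrite s0 (le_trans s1)// ler1n.
have s2 : 0 < complex.Re (s + 2%:C) <= 3 by rewrite ReImE /=; lra.
have wE v : w v = 2 * mellin_integrand (s + 2%:C) v.
  rewrite /w /gauss_weight /mellin_integrand mulrDr cexpD -rmorphM/= cexp_real.
  rewrite (_ : expR (v * 2) = expR v ^+ 2); last by rewrite mulrC -expRM_natl.
  by rewrite !rmorphM rmorph_nat; ring.
have i2 := mellin_integrable s2; have im := mellin_integrable s3.
have iw : cintegrable leb setT w.
  by have := cintegrableZ 2 measurableT i2; apply: eq_cintegrable => // v _; rewrite wE.
split => //; pose g v := gauss (expR v); pose g' v := - pi * gauss_weight v.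
have dg v : is_derive v 1 g (g' v).
  rewrite /g /gauss; apply: is_derive_eq.
  by rewrite /g' /gauss_weight /gauss /GRing.scale /=; ring.
have cg' : continuous g'.
  have ce : continuous (fun v : R => expR v) by exact: continuous_expR.
  move=> v; apply: cvgM; first exact: cvg_cst.
  apply: cvgM; first apply: cvgM; first exact: cvg_cst.
    by rewrite expr2; under eq_fun do rewrite expr2; apply: cvgM; exact: ce.
  by apply: continuous_comp; [exact: ce|exact: continuous_gauss].
have dE v : exp_deriv g g' s v = s * mellin_integrand s v - pi%:C * w v.
  rewrite /exp_deriv /g' /w /mellin_integrand rmorphM rmorphN/= -/(g v).
  by set c := cexp _; ring.
have [C C0 HC] := mellin_decays s3; have [C2 C20 HC2] := mellin_decays s2.
pose K := C + (normc s * C + pi * (2 * C2)).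
have K0 : 0 <= normc s * C + pi * (2 * C2) by rewrite addr_ge0 ?mulr_ge0 ?normc_ge0 ?pi_ge0.
have dP : decays K (exp_prim g s).
  move=> x; apply: le_trans (HC x) _; rewrite ler_wpM2r ?invr_ge0 ?(ltW (oneDsqr_gt0 _))//.
  by rewrite lerDl.
have dD : decays K (exp_deriv g g' s).
  move=> x; rewrite dE; apply: le_trans (le_normcD _ _) _; rewrite normcN normcM.
  have p : 0 <= (1 + x ^+ 2)^-1 by rewrite invr_ge0 (ltW (oneDsqr_gt0 _)).
  have h1 := ler_wpM2l (normc_ge0 s) (HC x).
  have h2 : normc (pi%:C * w x) <= pi * (2 * C2) * (1 + x ^+ 2)^-1.
    rewrite wE normcM normc_real (ger0_norm (pi_ge0 _)) normcM normc_nat -!mulrA.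
    by rewrite ler_wpM2l ?pi_ge0// ler_wpM2l.
  have := mulr_ge0 C0 p; rewrite /K; lra.
have := exp_FTC_line dg cg' dP dD.
have -> : cintegral leb setT (exp_deriv g g' s) =
    cintegral leb setT (fun x => s * mellin_integrand s x - pi%:C * w x).
  by apply: eq_cintegral => x _; exact: dE.
rewrite (cintegralB measurableT (cintegrableZ s measurableT im) (cintegrableZ pi%:C measurableT iw)).
rewrite (cintegralZ _ measurableT im) (cintegralZ _ measurableT iw) => /eqP.
by rewrite subr_eq0 => /eqP <-.
Qed.

Definition osc u : R := sin (2 * pi * expR u).

Lemma continuous_osc : continuous osc.
Proof.
move=> u; apply: continuous_comp; last exact: continuous_sin.
by apply: cvgM; [exact: cvg_cst|exact: continuous_expR].
Qed.

Lemma measurable_osc : measurable_fun (setT : set RR) osc.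
Proof. by apply: continuous_measurable_fun; exact: continuous_osc. Qed.

Lemma osc_le1 u : `|osc u| <= 1.
Proof. by rewrite /osc ler_norml sin_geN1 sin_le1. Qed.

Lemma osc_le u : `|osc u| <= 2 * pi * expR u.
Proof.
apply: le_trans (sin_le_norm _) _.
by rewrite ger0_norm// !mulr_ge0 ?pi_ge0 ?expR_ge0.
Qed.

Definition osc_integrand z u : R[i] := (osc u)%:C * cexp (u%:C * (z - 1)).
Definition sine_transform z : R[i] := cintegral leb setT (osc_integrand z).

Lemma cmeas_osc z : cmeas (setT : set RR) (osc_integrand z).
Proof. by apply: cmeasM; [apply: cmeas_real; exact: measurable_osc|exact: cmeas_cexp]. Qed.

(* 17 = 1 + 4 / (1/2)^2 comes from the decay of exp (- |u| / 2) *)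
Definition osc_bound : R := 2 * pi * 17.

Lemma osc_decays z : complex.Re z = 2^-1 -> decays osc_bound (osc_integrand z).
Proof.
move=> z2 u; rewrite /osc_integrand normcM normc_real normc_cexp_real !ReImE z2 /=.
have h12 : 0 < 2^-1 :> R by rewrite invr_gt0.
have e17 : 1 + 4 / 2^-1 ^+ 2 = 17 :> R by field.
have := expR_decay u h12; rewrite e17 => h.
have p2 : 0 <= 2 * pi :> R by rewrite mulr_ge0// pi_ge0.
have p1 : 1 <= 2 * pi :> R by have := @pi_ge2 R; lra.
rewrite /osc_bound -mulrA; apply: le_trans (ler_wpM2l p2 h).
have [u0|u0] := leP 0 u.
  rewrite (ger0_norm u0); apply: ler_pM; rewrite ?expR_ge0 ?normr_ge0//.
    by apply: le_trans (osc_le1 u) p1.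
  by rewrite ler_expR; lra.
apply: le_trans (ler_wpM2r (expR_ge0 _) (osc_le u)) _.
rewrite -[X in X <= _]mulrA -expRD; apply: ler_wpM2l => //; rewrite ler_expR (ltr0_norm u0); lra.
Qed.

Lemma osc_integrable z : complex.Re z = 2^-1 -> cintegrable leb setT (osc_integrand z).
Proof. by move=> /osc_decays; exact/cintegrable_decays/cmeas_osc. Qed.

Lemma continuous_gauss_weight : continuous (@gauss_weight R).
Proof.
have ce : continuous (fun v : R => expR v) by exact: continuous_expR.
move=> v; apply: cvgM; first apply: cvgM; first exact: cvg_cst.
  by rewrite expr2; under eq_fun do rewrite expr2; apply: cvgM; exact: ce.
by apply: continuous_comp; [exact: ce|exact: continuous_gauss].
Qed.

Lemma gauss_weight_ge0 v : 0 <= gauss_weight v.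
Proof. by rewrite /gauss_weight !mulr_ge0 ?exprn_ge0 ?expR_ge0 ?(ltW (gauss_gt0 _)). Qed.

(** With t = e^u, the factor t exp (- pi t^2) is replaced by its sine
    transform and the integrals are exchanged; as the kernel is a function of
    u + v, a translation separates the two variables. The double integral
    converges absolutely since sin (2 pi t) is O(t) at 0. *)
Lemma mellin_sine z : complex.Re z = 2^-1 -> mellin z =
  sine_transform z * cintegral leb setT (fun v => (gauss_weight v)%:C * cexp (v%:C * (1 - z))).
Proof.
move=> z2; have [h0 h1] := andP half_strip.
have z1 : 0 < complex.Re (1 - z) <= 1 by rewrite !ReImE z2 /=; lra.
have [iw _] := gauss_weight_mellin z1.
have mw : measurable_fun (setT : set RR) (@gauss_weight R).
  by apply: continuous_measurable_fun; exact: continuous_gauss_weight.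
pose k (u v : RR) : R[i] := cexp (u%:C * (z - 1)) * (gauss_weight v * osc (u + v))%:C.
have nk u v : normc (k u v) = expR (- u / 2) * (gauss_weight v * `|osc (u + v)|).
  rewrite /k normcM normc_cexp_real normc_real normrM ger0_norm ?gauss_weight_ge0//.
  by congr (expR _ * _); rewrite !ReImE z2 /=; field.
have mk : cmeas setT (fun p : RR * RR => k p.1 p.2).
  apply: cmeasM.
    have [m1 m2] := cmeas_cexp (z - 1).
    by split; [exact: (measurableT_comp m1 measurable_fst)|exact: (measurableT_comp m2 measurable_fst)].
  apply: cmeas_real; apply: measurable_funM; first exact: (measurableT_comp mw measurable_snd).
  apply: (measurableT_comp measurable_osc).
  exact: (measurable_funD measurable_fst measurable_snd).
have mosc u : measurable_fun (setT : set RR) (fun v : RR => osc (u + v)).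
  by apply: (measurableT_comp measurable_osc); exact: measurable_funD.
have i0 : leb.-integrable setT (EFin \o @gauss_weight R).
  have s2 : 0 < complex.Re (2%:C : R[i]) <= 3 by rewrite /=; lra.
  have [ir _] := mellin_integrable s2; have := integrableZl measurableT 2 ir.
  apply: eq_integrable => // v _.
  have e : mellin_integrand 2%:C v = (gauss (expR v) * expR v ^+ 2)%:C.
    rewrite /mellin_integrand -rmorphM/= cexp_real rmorphM.
    by rewrite (_ : expR (v * 2) = expR v ^+ 2)// mulrC -expRM_natl.
  transitivity ((2 * complex.Re (mellin_integrand 2%:C v))%:E) => //.
  by rewrite e /gauss_weight /=; congr EFin; ring.
have iku u : cintegrable leb setT (k u).
  have ig : leb.-integrable setT (EFin \o (fun v : RR => expR (- u / 2) * gauss_weight v)).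
    exact: (integrableZl measurableT _ i0).
  apply: (dom_cintegrable measurableT _ ig).
  - apply: cmeasM; first exact: cmeas_cst.
    by apply: cmeas_real; apply: measurable_funM.
  - move=> v _; rewrite nk ler_wpM2l ?expR_ge0// ler_piMr ?gauss_weight_ge0//.
    exact: osc_le1.
have co u : rcont (osc_integrand z) u.
  apply: rcontM; first by apply: rcont_real; exact: continuous_osc.
  by apply: rcont_cexp; exact: cvg_id.
have kE v : k^~ v = fun u => ((gauss_weight v)%:C * cexp (v%:C * (1 - z))) *
    (osc_integrand z (1 * u + v) * 1%:C).
  apply/funext => u; rewrite /k /osc_integrand mul1r mulr1.
  have -> : (u + v)%:C * (z - 1) = u%:C * (z - 1) + - (v%:C * (1 - z)).
    by rewrite rmorphD/=; ring.
  rewrite cexpD rmorphM/=; have : cexp (v%:C * (1 - z)) * cexp (- (v%:C * (1 - z))) = 1.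
    by rewrite -cexpD subrr cexp0.
  set a := cexp (v%:C * _); set b := cexp (- _) => ab.
  have -> : (gauss_weight v)%:C * a * ((osc (u + v))%:C * (cexp (u%:C * (z - 1)) * b)) =
    (a * b) * (cexp (u%:C * (z - 1)) * ((gauss_weight v)%:C * (osc (u + v))%:C)) by ring.
  by rewrite ab mul1r.
have aff v := cintegrable_affine v ltr01 co (osc_integrable z2).
have ikv v : cintegrable leb setT (k^~ v).
  by rewrite kE; exact: cintegrableZ measurableT (aff v).1.
have fin : (\int[leb]_v \int[leb]_u (normc (k u v))%:E < +oo)%E.
  have cD : continuous (fun p : R => osc_bound * (1 + p ^+ 2)^-1).
    by move=> p; apply: cvgM; [exact: cvg_cst|exact: continuous_oneDsqrV].
  have ob0 : 0 <= osc_bound by rewrite /osc_bound !mulr_ge0// pi_ge0.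
  have D0 (p : R) : 0 <= osc_bound * (1 + p ^+ 2)^-1.
    by rewrite mulr_ge0// invr_ge0 ltW// oneDsqr_gt0.
  have Dfin : (\int[leb]_p (osc_bound * (1 + p ^+ 2)^-1)%:E = (osc_bound * pi)%:E)%E.
    rewrite -Rintegral_oneDsqr /Rintegral fineK//.
    exact: (integrable_fin_num measurableT (integrable_oneDsqr _)).
  have inner v : (\int[leb]_u (normc (k u v))%:E <=
      (osc_bound * pi)%:E * (normc ((gauss_weight v)%:C * cexp (v%:C * (1 - z))))%:E)%E.
    rewrite -Dfin (ge0_integral_affine v ltr01 cD D0) muleC.
    have mD : measurable_fun (setT : set RR) (fun u => (osc_bound * (1 + (1 * u + v) ^+ 2)^-1 * 1)%:E).
      apply/measurable_EFinP; apply: continuous_measurable_fun => u.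
      apply: cvgM; last exact: cvg_cst.
      apply: (continuous_comp (f := fun u => 1 * u + v) (g := fun p : R => osc_bound * (1 + p ^+ 2)^-1)).
        by apply: cvgD; [apply: cvgM; [exact: cvg_cst|exact: cvg_id]|exact: cvg_cst].
      exact: cD.
    rewrite -(ge0_integralZl leb measurableT mD).
    - apply: (ge0_le_integral leb measurableT).
      + by move=> u _; rewrite lee_fin normc_ge0.
      + by apply/measurable_EFinP; apply: cmeas_normc; exact: (cintegrable_cmeas (ikv v)).
      + by apply: measurable_funeM.
      + move=> u _; rewrite -EFinM lee_fin.
        have -> : k u v = ((gauss_weight v)%:C * cexp (v%:C * (1 - z))) *
            (osc_integrand z (1 * u + v) * 1%:C) by exact: (congr1 (fun f => f u) (kE v)).
        rewrite !mulr1 normcM ler_wpM2l ?normc_ge0//.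
        exact: osc_decays.
    - by move=> u _; rewrite lee_fin mulr_ge0.
    - by rewrite lee_fin normc_ge0.
  have in_ := cintegrable_normc measurableT iw.
  have mn : measurable_fun (setT : set RR)
      (fun v => (normc ((gauss_weight v)%:C * cexp (v%:C * (1 - z))))%:E).
    by apply/measurable_EFinP; exact/cmeas_normc/cintegrable_cmeas/iw.
  have mk2 : measurable_fun setT (fun p : RR * RR => (normc (k p.1 p.2))%:E).
    by apply/measurable_EFinP; exact: (@cmeas_normc _ _ _ setT (fun p : RR * RR => k p.1 p.2)).
  apply: (@le_lt_trans _ _ (\int[leb]_v ((osc_bound * pi)%:E *
     (normc ((gauss_weight v)%:C * cexp (v%:C * (1 - z))))%:E))%E).
    apply: (ge0_le_integral leb measurableT).
    - by move=> v _; apply: integral_ge0 => u _; rewrite lee_fin normc_ge0.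
    - apply: (@measurable_fun_fubini_tonelli_G _ _ _ _ _ leb (fun p : RR * RR => (normc (k p.1 p.2))%:E)) => //.
      by move=> p; rewrite lee_fin normc_ge0.
    - exact: measurable_funeM.
    - by move=> v _; exact: inner.
  rewrite (ge0_integralZl leb measurableT mn).
  - have [_] := integrableP _ _ _ in_.
    under eq_integral do rewrite gee0_abs ?lee_fin ?normc_ge0//.
    by move=> h; rewrite lte_mul_pinfty// lee_fin mulr_ge0// pi_ge0.
  - by move=> v _; rewrite lee_fin normc_ge0.
  - by rewrite lee_fin mulr_ge0// pi_ge0.
have F := complex_Fubini mk iku ikv fin.
have LE : mellin z = cintegral leb setT (fun u => cintegral leb setT (k u)).
  apply: eq_cintegral => u _; have [iu eu] := gauss_sine_log u.
  have iu' : cintegrable leb setT (fun v => (gauss_weight v * osc (u + v))%:C).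
    exact: cintegrable_real.
  have eI : cintegral leb setT (fun v => (gauss_weight v * osc (u + v))%:C) =
      (expR u)%:C * (gauss (expR u))%:C.
    by apply: etrans (cintegral_real _ _ _) _; rewrite -rmorphM; congr (_%:C).
  apply: esym; apply: etrans (cintegralZ _ measurableT iu') _.
  apply: etrans (congr1 (fun X => cexp (u%:C * (z - 1)) * X) eI) _.
  rewrite -(cexp_real u) mulrA -cexpD /mellin_integrand mulrC; congr (_ * cexp _).
  by ring.
rewrite LE F mulrC -(cintegralZr _ measurableT iw); apply: eq_cintegral => v _.
rewrite kE (cintegralZ _ measurableT (aff v).1); congr (_ * _).
exact: esym (aff v).2.
Qed.

(** The second factor of the Mellin transform at z is (1 - z) / pi times the
    Mellin transform at 1 - z. *)
Lemma rho_sine z : complex.Re z = 2^-1 ->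
  rho_infty z = (1 - z) / pi%:C * sine_transform z.
Proof.
move=> z2; have [h0 h1] := andP half_strip.
have z1 : 0 < complex.Re (1 - z) <= 1 by rewrite !ReImE z2 /=; lra.
have [_ e] := gauss_weight_mellin z1.
rewrite rho_mellin ?z2 ?half_strip// mellin_sine//.
have m0 : mellin (1 - z) != 0 by apply: mellin_neq0; have /andP[] := z1.
have pi0 : (pi%:C : R[i]) != 0 by rewrite eq_complex/= negb_and gt_eqF// pi_gt0.
move: (pi%:C) pi0 (mellin _) m0 (cintegral _ _ _) e (sine_transform z) => p p0 m m0 I e S.
have -> : I = (1 - z) * m / p by rewrite -e mulrAC divff// mul1r.
by field; rewrite p0 m0.
Qed.

End ArchimedeanFactor.

(** * Laplace transforms *)

Section LaplaceTransform.
Variable R : realType.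
Local Notation RR := (measurableTypeR R).
Local Notation leb := (@lebesgue_measure R).
Implicit Types (c : R -> R) (u v x y M : R) (s z w : R[i]).

Definition laplace c s : R[i] := cintegral leb setT (fun u => (c u)%:C * cexp (u%:C * s)).

Lemma half_decay_subproof : {C : R | 0 <= C & forall u,
  [/\ expR (- (2^-1 * `|u|)) <= C * (1 + u ^+ 2)^-1,
      `|u| * expR (- (2^-1 * `|u|)) <= C * (1 + u ^+ 2)^-1 &
      u ^+ 2 * expR (- (2^-1 * `|u|)) <= C * (1 + u ^+ 2)^-1]}.
Proof.
pose l1 : R := 2^-1; pose l2 := l1 / 2; pose l3 := l2 / 2.
have l10 : 0 < l1 by rewrite invr_gt0.
have l20 : 0 < l2 by rewrite divr_gt0.
have l30 : 0 < l3 by rewrite divr_gt0.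
pose D (l : R) : R := 1 + 4 / l ^+ 2.
have D0 l : 0 <= D l by rewrite addr_ge0// divr_ge0// sqr_ge0.
have q0 (l : R) : 0 < l -> 0 <= 2 / l by move=> l0; rewrite divr_ge0// ltW.
pose C1 := 2 / l1 * D l2; pose C2 := 2 / l1 * (2 / l2 * D l3).
have C10 : 0 <= C1 by rewrite mulr_ge0// q0.
have C20 : 0 <= C2 by apply: mulr_ge0; [exact: q0|apply: mulr_ge0 => //; exact: q0].
exists (D l1 + C1 + C2); first exact: addr_ge0 (addr_ge0 (D0 _) C10) C20.
move=> u; set k := (1 + u ^+ 2)^-1.
have k0 : 0 <= k by rewrite invr_ge0 ltW// oneDsqr_gt0.
have b0 : expR (- (l1 * `|u|)) <= D l1 * k by exact: expR_decay.
have b1 : `|u| * expR (- (l1 * `|u|)) <= C1 * k.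
  apply: le_trans (norm_expR_decay u l10) _; rewrite /C1 -[leRHS]mulrA.
  by apply: ler_wpM2l; [exact: q0|exact: expR_decay].
have b2 : u ^+ 2 * expR (- (l1 * `|u|)) <= C2 * k.
  rewrite -[u ^+ 2](real_normK (num_real u)) expr2 -mulrA.
  apply: le_trans (ler_wpM2l (normr_ge0 u) (norm_expR_decay u l10)) _.
  rewrite [leLHS]mulrCA /C2 -[leRHS]mulrA; apply: ler_wpM2l; first exact: q0.
  apply: le_trans (norm_expR_decay u l20) _; rewrite -[leRHS]mulrA.
  by apply: ler_wpM2l; [exact: q0|exact: expR_decay].
have p1 := mulr_ge0 (D0 l1) k0; have p2 := mulr_ge0 C10 k0; have p3 := mulr_ge0 C20 k0.
have -> : (D l1 + C1 + C2) * k = D l1 * k + C1 * k + C2 * k by rewrite 2!mulrDl.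
move: (D l1 * k) (C1 * k) (C2 * k) b0 b1 b2 p1 p2 p3 => X Y Z b0 b1 b2 p1 p2 p3.
by split; [apply: le_trans b0 _|apply: le_trans b1 _|apply: le_trans b2 _]; lra.
Qed.

(** One constant serves the three estimates below. *)
Definition half_decay_cst : R := s2val half_decay_subproof.
Local Notation B := half_decay_cst.

Lemma half_decay_ge0 : 0 <= B. Proof. exact: (s2valP half_decay_subproof). Qed.

Lemma half_decay u : expR (- (2^-1 * `|u|)) <= B * (1 + u ^+ 2)^-1.
Proof. by have [] := s2valP' half_decay_subproof u. Qed.

Lemma half_decay1 u : `|u| * expR (- (2^-1 * `|u|)) <= B * (1 + u ^+ 2)^-1.
Proof. by have [] := s2valP' half_decay_subproof u. Qed.

Lemma half_decay2 u : u ^+ 2 * expR (- (2^-1 * `|u|)) <= B * (1 + u ^+ 2)^-1.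
Proof. by have [] := s2valP' half_decay_subproof u. Qed.

Let kge0 u : 0 <= (1 + u ^+ 2)^-1.
Proof. by rewrite invr_ge0 ltW// oneDsqr_gt0. Qed.

Lemma mul3_ge0 (a b c : R) : 0 <= a -> 0 <= b -> 0 <= c -> 0 <= a * b * c.
Proof. by move=> a0 b0 c0; apply: mulr_ge0 => //; exact: mulr_ge0. Qed.

Section Bounds.
Variables (c : R -> R) (M : R).
Hypotheses (mc : measurable_fun (setT : set RR) c) (M0 : 0 <= M)
  (cM : forall u, `|c u| <= M * expR (- (2^-1 * `|u|))).

(** Where c does not vanish, the exponential factor has modulus at most 1. *)
Definition damped s := forall u, c u = 0 \/ u * complex.Re s <= 0.

Lemma cmeas_laplace s : cmeas (setT : set RR) (fun u => (c u)%:C * cexp (u%:C * s)).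
Proof. by apply: cmeasM; [exact: cmeas_real|exact: cmeas_cexp]. Qed.

Lemma laplace_decays s : damped s -> decays (M * B) (fun u => (c u)%:C * cexp (u%:C * s)).
Proof.
move=> ds u; rewrite normcM normc_real normc_cexp_real.
have k0 : 0 <= M * B * (1 + u ^+ 2)^-1.
  exact: mul3_ge0 M0 half_decay_ge0 (kge0 u).
have [->|us] := ds u; first by rewrite normr0 mul0r.
apply: (@le_trans _ _ `|c u|); first by rewrite ler_piMr// expR_le1.
apply: le_trans (cM u) _; rewrite -mulrA ler_wpM2l//; exact: half_decay.
Qed.

Lemma laplace_integrable s : damped s ->
  cintegrable leb setT (fun u => (c u)%:C * cexp (u%:C * s)).
Proof. by move=> /laplace_decays; exact/cintegrable_decays/cmeas_laplace. Qed.

Lemma normc_laplace s : damped s -> normc (laplace c s) <= M * B * pi.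
Proof. by move=> /laplace_decays; exact/le_cintegral_decays/cmeas_laplace. Qed.

Lemma laplace_lipschitz s z : damped s -> damped z ->
  normc (laplace c s - laplace c z) <= M * (2 * B) * pi * normc (s - z).
Proof.
move=> ds dz; rewrite /laplace.
rewrite -(cintegralB measurableT (laplace_integrable ds) (laplace_integrable dz)).
rewrite mulrAC; apply: le_cintegral_decays.
  by apply: cmeasB; exact: cmeas_laplace.
move=> u; rewrite -mulrBr normcM normc_real.
have n0 := normc_ge0 (s - z).
have k0 : 0 <= M * (2 * B) * normc (s - z) * (1 + u ^+ 2)^-1.
  apply: mulr_ge0 (kge0 u); apply: mulr_ge0 n0; apply: mulr_ge0 => //.
  by apply: mulr_ge0 => //; exact: half_decay_ge0.
have [->|us] := ds u; first by rewrite normr0 mul0r.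
have [->|uz] := dz u; first by rewrite normr0 mul0r.
have h : normc (cexp (u%:C * s) - cexp (u%:C * z)) <= 2 * (`|u| * normc (s - z)).
  rewrite -(normc_real u) -normcM mulrBr; apply: normc_cexp_sub.
    by rewrite !ReImE /= mul0r subr0.
  by rewrite !ReImE /= mul0r subr0.
apply: le_trans (ler_pM (normr_ge0 _) (normc_ge0 _) (cM u) h) _.
have := ler_wpM2l (mulr_ge0 M0 n0) (half_decay1 u).
set e := expR _; set k := (1 + _)^-1; lra.
Qed.

(** Differentiation under the integral sign: the integrand of the derivative
    carries an additional factor u and that of the remainder a factor u^2,
    both absorbed by exp (- |u| / 2). *)
Lemma laplace_cdiff s : (forall u, u < 0 -> c u = 0) -> complex.Re s < 0 ->
  cdiff (laplace c) s.
Proof.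
move=> c0 s0; have damp_s w : complex.Re w <= 0 -> damped w.
  move=> w0 u; have [u0|u0] := ltP u 0; first by left; exact: c0.
  by right; rewrite mulr_ge0_le0.
have ds := damp_s _ (ltW s0).
have md : cmeas (setT : set RR) (fun u => (u * c u)%:C * cexp (u%:C * s)).
  by apply: cmeasM; [apply: cmeas_real; exact: measurable_funM|exact: cmeas_cexp].
have dd : decays (M * B) (fun u => (u * c u)%:C * cexp (u%:C * s)).
  move=> u; rewrite normcM normc_real normc_cexp_real normrM.
  have k0 : 0 <= M * B * (1 + u ^+ 2)^-1.
    exact: mul3_ge0 M0 half_decay_ge0 (kge0 u).
  have [->|us] := ds u; first by rewrite normr0 mulr0 mul0r.
  apply: (@le_trans _ _ (`|u| * `|c u|)); first by rewrite ler_piMr ?mulr_ge0// expR_le1.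
  have := ler_wpM2l (normr_ge0 u) (cM u); have := ler_wpM2l M0 (half_decay1 u).
  set e := expR _; set k := (1 + _)^-1; lra.
have id_ := cintegrable_decays md dd.
pose L := cintegral leb setT (fun u => (u * c u)%:C * cexp (u%:C * s)).
exists L => e e0; pose K := M * (4 * B) * pi.
have K0 : 0 <= K.
  apply: mulr_ge0 (pi_ge0 _); apply: mulr_ge0 => //; apply: mulr_ge0 => //.
  exact: half_decay_ge0.
exists (Num.min (- complex.Re s) (e / (K + 1))).
  by rewrite lt_min oppr_gt0 s0 divr_gt0// ltr_wpDl.
move=> w; rewrite lt_min; set d := w - s => /andP[wd we].
have w0 : complex.Re w <= 0.
  have := le_trans (ler_norm _) (normc_re d); rewrite /d !ReImE -/d; move: wd; lra.
have dw := damp_s _ w0; have iw := laplace_integrable dw; have is_ := laplace_integrable ds.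
have -> : laplace c w - laplace c s - L * d =
    cintegral leb setT (fun u => (c u)%:C * cexp (u%:C * s) * (cexp (u%:C * d) - 1 - u%:C * d)).
  rewrite mulrC /L -(cintegralZ d measurableT id_) /laplace.
  rewrite -(cintegralB measurableT iw is_).
  rewrite -(cintegralB measurableT (cintegrableB measurableT iw is_) (cintegrableZ d measurableT id_)).
  apply: eq_cintegral => u _; rewrite (_ : u%:C * w = u%:C * s + u%:C * d); last first.
    by rewrite -mulrDr /d addrC subrK.
  by rewrite cexpD rmorphM/=; set a := cexp _; set b := cexp _; ring.
apply: (@le_trans _ _ (K * normc d ^+ 2)).
  rewrite /K mulrAC; apply: le_cintegral_decays.
    apply: cmeasM; first exact: cmeas_laplace.
    apply: cmeasB; first by apply: cmeasB; [exact: cmeas_cexp|exact: cmeas_cst].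
    by apply: cmeasM; [apply: cmeas_real|exact: cmeas_cst].
  move=> u; have [u0|u0] := ltP u 0.
    rewrite c0// mul0r mul0r normc0; apply: mulr_ge0 (kge0 u).
    apply: mulr_ge0 (sqr_ge0 _); apply: mulr_ge0 => //; apply: mulr_ge0 => //.
    exact: half_decay_ge0.
  have := normc_cexp_second (u%:C * d); rewrite normcM normc_real => h.
  rewrite 2!normcM normc_real normc_cexp_real.
  have h1 : expR (u * complex.Re s) * expR (`|u| * normc d) <= 1.
    rewrite -expRD expR_le1 (ger0_norm u0) -mulrDr mulr_ge0_le0//.
    by move: wd; lra.
  have p1 := mulr_ge0 (normr_ge0 (c u)) (expR_ge0 (u * complex.Re s)).
  apply: le_trans (ler_wpM2l p1 h) _.
  rewrite exprMn real_normK ?num_real//.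
  have q0 : 0 <= 4 * (u ^+ 2 * normc d ^+ 2).
    by apply: mulr_ge0 => //; apply: mulr_ge0; exact: sqr_ge0.
  apply: (@le_trans _ _ (`|c u| * (4 * (u ^+ 2 * normc d ^+ 2)))).
    have := ler_piMr (mulr_ge0 (normr_ge0 (c u)) q0) h1.
    by set E1 := expR _; set E2 := expR _; lra.
  apply: le_trans (ler_wpM2r q0 (cM u)) _.
  have := ler_wpM2l (mulr_ge0 M0 (sqr_ge0 (normc d))) (half_decay2 u).
  set e2 := expR _; set k := (1 + _)^-1; lra.
rewrite expr2 mulrA ler_wpM2r ?normc_ge0//; move: we.
rewrite ltr_pdivlMr ?ltr_wpDl// => /ltW; apply: le_trans.
by rewrite mulrC ler_wpM2l ?normc_ge0// lerDl.
Qed.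

End Bounds.
End LaplaceTransform.

(** * Partial fractions *)

Section CosineRemainder.
Variable R : realType.
Implicit Types (x : R) (n : nat).

Definition cos_remainder n x : R := cos x - \sum_(k < n) cos_coeff' x k.

Lemma expR_ge_coeff (y : R) m : 0 <= y -> y ^+ m / m`!%:R <= expR y.
Proof.
case: m => [|m] y0; first by rewrite expr0 fact0 divr1 one_le_expR.
by have := expR_ge1Dxn m y0; lra.
Qed.

(** Comparing x^(2k) / (2k)! = 4^-k (2x)^(2k) / (2k)! with the exponential
    series at 2x. *)
Lemma cos_coeff'_le x k : 0 <= x -> `|cos_coeff' x k| <= expR (2 * x) / 4 ^+ k.
Proof.
move=> x0; rewrite cos_coeff'E /cos_coeff /= odd_double /= mul1r.
rewrite !normrM normrX normrN normr1 expr1n mul1r normrX (ger0_norm x0).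
rewrite ger0_norm ?invr_ge0 ?ler0n// ler_pdivlMr ?exprn_gt0//.
apply: le_trans (expR_ge_coeff k.*2 (_ : 0 <= 2 * x)); last by rewrite mulr_ge0.
have e4 : 2 ^+ k.*2 = 4 ^+ k :> R by rewrite -mul2n exprM -natrX.
by rewrite exprMn e4 mulrC mulrA.
Qed.

(** The tail of a geometric series of ratio 1/4, with 2 in place of 4/3. *)
Lemma cos_remainder_le n x : 0 <= x ->
  `|cos_remainder n x| <= 2 * expR (2 * x) / 4 ^+ n.
Proof.
move=> x0; set E := expR (2 * x); have E0 : 0 <= E by exact: expR_ge0.
have q0 m : 0 <= E / 4 ^+ m by rewrite divr_ge0// exprn_ge0.
have S j : `|\sum_(n <= k < n + j) cos_coeff' x k| <= 2 * (E / 4 ^+ n - E / 4 ^+ (n + j)).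
  elim: j => [|j IH]; first by rewrite addn0 big_geq// normr0 subrr mulr0.
  rewrite addnS big_nat_recr ?leq_addr//=; apply: le_trans (ler_normD _ _) _.
  have := cos_coeff'_le (n + j) x0; rewrite -/E => h.
  have e4 : E / 4 ^+ (n + j).+1 = E / 4 ^+ (n + j) / 4 by rewrite exprSr invfM mulrA.
  rewrite e4; have := q0 (n + j)%N; lra.
apply/ler_addgt0Pr => e e0; have /cvgrPdist_le/(_ e e0)[N _ HN] := @cvg_cos_coeff' R x.
have := HN (n + N)%N (leq_addl _ _); rewrite /series /= => h.
rewrite /cos_remainder -(big_mkord xpredT (cos_coeff' x)).
have cat := @big_cat_nat _ _ _ n 0 (n + N) xpredT (cos_coeff' x) (leq0n _) (leq_addr _ _).
rewrite cat /= in h.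
set A := \sum_(0 <= k < n) _ in h *; set T := \sum_(n <= k < _) _ in h.
have hT : `|T| <= 2 * E / 4 ^+ n.
  by apply: le_trans (S N) _; have := q0 (n + N)%N; rewrite -mulrA; lra.
rewrite (_ : cos x - A = (cos x - (A + T)) + T); last by ring.
by apply: le_trans (ler_normD _ _) _; rewrite addrC lerD.
Qed.

End CosineRemainder.

Section PartialFractionExpansion.
Variable R : realType.
Local Notation RR := (measurableTypeR R).
Local Notation leb := (@lebesgue_measure R).
Local Notation B := (half_decay_cst R).
Implicit Types (u v x y M : R) (s z w : R[i]) (b : R -> R).

Local Notation half := ((2^-1 : R)%:C : R[i]).

(** The decay e^(-u/2) on the critical line is put into the coefficient, which
    leaves z - 1/2 in the exponent. *)
Definition osc_right u : R := heaviside u * osc u * expR (- (u / 2)).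

(** Restricted to u < 0, with e^(u/2) taken out of the exponential e^(u z). *)
Definition cut_left b u : R := (1 - heaviside u) * b u * expR (u / 2).

Lemma measurable_osc_right : measurable_fun (setT : set RR) osc_right.
Proof.
apply: measurable_funM.
  by apply: measurable_funM; [exact: measurable_heaviside|exact: measurable_osc].
apply: (measurableT_comp (@measurable_expR_line R)).
by apply: measurableT_comp => //; exact: measurable_funM.
Qed.

Lemma measurable_cut_left b : measurable_fun (setT : set RR) b ->
  measurable_fun (setT : set RR) (cut_left b).
Proof.
move=> mb; apply: measurable_funM.
  by apply: measurable_funM => //; apply: measurable_funB => //; exact: measurable_heaviside.
by apply: (measurableT_comp (@measurable_expR_line R)); exact: measurable_funM.
Qed.

Lemma osc_right_le u : `|osc_right u| <= 1 * expR (- (2^-1 * `|u|)).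
Proof.
rewrite /osc_right mul1r; have [u0|u0] := leP 0 u.
  rewrite heaviside_nneg// mul1r normrM (ger0_norm (expR_ge0 _)) (ger0_norm u0).
  by rewrite [u / 2]mulrC ler_piMl ?expR_ge0// osc_le1.
by rewrite heaviside_neg// !mul0r normr0 expR_ge0.
Qed.

Lemma cut_left_le b M : 0 <= M -> (forall u, u <= 0 -> `|b u| <= M) ->
  forall u, `|cut_left b u| <= M * expR (- (2^-1 * `|u|)).
Proof.
move=> M0 bM u; rewrite /cut_left; have [u0|u0] := leP 0 u.
  by rewrite heaviside_nneg// subrr !mul0r normr0 mulr_ge0// expR_ge0.
rewrite heaviside_neg// subr0 mul1r normrM (ger0_norm (expR_ge0 _)) (ltr0_norm u0).
by rewrite mulrN opprK [u / 2]mulrC ler_wpM2r ?expR_ge0// bM// ltW.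
Qed.

Lemma damped_right s : complex.Re s <= 0 -> damped osc_right s.
Proof.
move=> s0 u; have [u0|u0] := leP 0 u; first by right; rewrite mulr_ge0_le0.
by left; rewrite /osc_right heaviside_neg// !mul0r.
Qed.

Lemma damped_line c s : complex.Re s = 0 -> damped c s.
Proof. by move=> s0 u; right; rewrite s0 mulr0. Qed.

Lemma cexp_half u z : cexp (u%:C * z) = (expR (u / 2))%:C * cexp (u%:C * (z - half)).
Proof.
rewrite -cexp_real -cexpD; congr cexp.
by rewrite mulrBr -rmorphM addrC subrK.
Qed.

Lemma osc_rightE u z : (osc_right u)%:C * cexp (u%:C * (z - half)) =
  (heaviside u)%:C * osc_integrand z u.
Proof.
rewrite /osc_right /osc_integrand !rmorphM/= -!mulrA; congr (_ * (_ * _)).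
rewrite -cexp_real -cexpD; congr cexp.
by apply: complex_ext; rewrite !ReImE /=; field.
Qed.

Lemma cut_leftE b u z : (cut_left b u)%:C * cexp (u%:C * (z - half)) =
  (1 - heaviside u)%:C * ((b u)%:C * cexp (u%:C * z)).
Proof. by rewrite (cexp_half u z) /cut_left !rmorphM/= !mulrA. Qed.

Lemma Re_sub_half z : complex.Re (z - half) = complex.Re z - 2^-1.
Proof. by rewrite !ReImE. Qed.

Definition cos_exp u : R := 2 * cos (2 * pi * expR u).

Lemma continuous_cos_exp : continuous cos_exp.
Proof.
move=> u; apply: cvgM; first exact: cvg_cst.
apply: continuous_comp; last exact: continuous_cos.
by apply: cvgM; [exact: cvg_cst|exact: continuous_expR].
Qed.

(** Integration by parts on the negative half line; the boundary term
    vanishes because sin (2 pi) = 0. *)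
Lemma sine_left z : complex.Re z = 2^-1 ->
  cintegrable leb setT (fun u => (1 - heaviside u)%:C * osc_integrand z u) /\
  (1 - z) / pi%:C * cintegral leb setT (fun u => (1 - heaviside u)%:C * osc_integrand z u) =
  laplace (cut_left cos_exp) (z - half).
Proof.
move=> z2; pose g' u := pi * expR u * cos_exp u.
have mc : measurable_fun (setT : set RR) cos_exp.
  by apply: continuous_measurable_fun; exact: continuous_cos_exp.
have dg u : is_derive u 1 (@osc R) (g' u).
  rewrite /osc; apply: is_derive_eq.
  by rewrite /g' /cos_exp /GRing.scale /=; ring.
have cg' : continuous g'.
  move=> u; apply: cvgM; last exact: continuous_cos_exp.
  by apply: cvgM; [exact: cvg_cst|exact: continuous_expR].
have dE u : exp_deriv (@osc R) g' (z - 1) u =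
    pi%:C * ((cos_exp u)%:C * cexp (u%:C * z)) - (1 - z) * osc_integrand z u.
  rewrite (_ : u%:C * z = u%:C * (z - 1) + u%:C); last by ring.
  rewrite cexpD cexp_real /exp_deriv /osc_integrand /g' !rmorphM/=.
  by set c := cexp _; ring.
have cM u : u <= 0 -> `|cos_exp u| <= 2.
  by move=> _; rewrite /cos_exp normrM ger0_norm// ler_piMr// ler_norml cos_geN1 cos_le1.
have od := osc_decays z2.
have zh : complex.Re (z - half) = 0 by rewrite Re_sub_half z2 subrr.
have il := laplace_integrable (measurable_cut_left mc) (ler0n _ 2)
  (cut_left_le (ler0n _ 2) cM) (damped_line (cut_left cos_exp) zh).
have ob0 : 0 <= osc_bound R by rewrite /osc_bound !mulr_ge0// pi_ge0.
pose n1 := normc (1 - z); have n10 : 0 <= n1 by exact: normc_ge0.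
have B0 := half_decay_ge0 R.
pose K := osc_bound R + (n1 * osc_bound R + pi * (2 * B)).
have K0 : 0 <= n1 * osc_bound R + pi * (2 * B).
  by apply: addr_ge0; apply: mulr_ge0; rewrite ?pi_ge0// mulr_ge0.
have k0 u : 0 <= (1 + u ^+ 2)^-1 by rewrite invr_ge0 ltW// oneDsqr_gt0.
have := @exp_FTC_half _ (@osc R) g' (z - 1) dg cg' K.
have dP u : u <= 0 -> normc (exp_prim (@osc R) (z - 1) u) <= K * (1 + u ^+ 2)^-1.
  by move=> _; apply: le_trans (od u) _; rewrite ler_wpM2r// lerDl.
have dD u : u <= 0 -> normc (exp_deriv (@osc R) g' (z - 1) u) <= K * (1 + u ^+ 2)^-1.
  move=> u0; rewrite dE; apply: le_trans (le_normcD _ _) _; rewrite normcN.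
  have -> : normc (pi%:C * ((cos_exp u)%:C * cexp (u%:C * z))) =
      pi * (`|cos_exp u| * expR (u / 2)).
    by rewrite 2!normcM !normc_real normc_cexp_real z2 (ger0_norm (pi_ge0 R)).
  have -> : normc ((1 - z) * osc_integrand z u) = n1 * normc (osc_integrand z u) by rewrite normcM.
  have h1 : `|cos_exp u| * expR (u / 2) <= 2 * (B * (1 + u ^+ 2)^-1).
    apply: ler_pM; rewrite ?expR_ge0 ?normr_ge0 ?cM//.
    by have := half_decay u; rewrite (ler0_norm u0) mulrN opprK [2^-1 * u]mulrC.
  have h2 := ler_wpM2l n10 (od u); have h3 := ler_wpM2l (pi_ge0 R) h1.
  have := mulr_ge0 ob0 (k0 u); rewrite /K; lra.
have o0 : osc 0 = 0 :> R by rewrite /osc expR0 mulr1 mulrC mulr_natr sin2pi.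
move=> /(_ dP dD); rewrite o0 => e.
have mh : cmeas (setT : set RR) (fun u => (1 - heaviside u)%:C : R[i]).
  by apply: cmeas_real; apply: measurable_funB => //; exact: measurable_heaviside.
have io : cintegrable leb setT (fun u => (1 - heaviside u)%:C * osc_integrand z u).
  apply: (@cintegrable_decays _ (osc_bound R)); first by apply: cmeasM => //; exact: cmeas_osc.
  move=> u; apply: le_trans (od u); rewrite normcM normc_real ler_piMl ?normc_ge0//.
  have [u0|u0] := leP 0 u; first by rewrite heaviside_nneg// subrr normr0.
  by rewrite heaviside_neg// subr0 normr1.
split => //.
have E : cintegral leb setT (fun u => (1 - heaviside u)%:C * exp_deriv (@osc R) g' (z - 1) u) =
   pi%:C * laplace (cut_left cos_exp) (z - half) -
   (1 - z) * cintegral leb setT (fun u => (1 - heaviside u)%:C * osc_integrand z u).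
  rewrite /laplace -(cintegralZ _ measurableT il) -(cintegralZ _ measurableT io).
  rewrite -(cintegralB measurableT (cintegrableZ _ measurableT il) (cintegrableZ _ measurableT io)).
  by apply: eq_cintegral => u _; rewrite dE cut_leftE; ring.
have pi0 : (pi%:C : R[i]) != 0 by rewrite eq_complex/= negb_and gt_eqF// pi_gt0.
move: e; rewrite E => /eqP; rewrite subr_eq0 => /eqP e.
by rewrite mulrAC -e mulrAC divff// mul1r.
Qed.

(** The sine transform split at u = 0. *)
Lemma rho_decomposition z : complex.Re z = 2^-1 -> rho_infty z =
  (1 - z) / pi%:C * laplace osc_right (z - half) + laplace (cut_left cos_exp) (z - half).
Proof.
move=> z2; have [io <-] := sine_left z2; rewrite rho_sine// -mulrDr; congr (_ * _).
have zh : complex.Re (z - half) <= 0 by rewrite Re_sub_half z2 subrr.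
have ir := laplace_integrable measurable_osc_right ler01 osc_right_le (damped_right zh).
rewrite /laplace -(cintegralD measurableT ir io).
apply: eq_cintegral => u _; rewrite osc_rightE -mulrDl -rmorphD/=.
by rewrite addrC subrK mul1r.
Qed.

(** The integrand is e^(s u) with s = z + 2 k, whose primitive e^(s u) / s
    vanishes at minus infinity. *)
Lemma simple_pole (k : nat) z : complex.Re z = 2^-1 ->
  cintegrable leb setT
    (fun u => (1 - heaviside u)%:C * ((expR u ^+ k.*2)%:C * cexp (u%:C * z))) /\
  cintegral leb setT (fun u => (1 - heaviside u)%:C * ((expR u ^+ k.*2)%:C * cexp (u%:C * z))) =
  (z + k.*2%:R)^-1.
Proof.
move=> z2; pose s := z + (k.*2%:R)%:C; have Rs : complex.Re s = 2^-1 + k.*2%:R.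
  by rewrite /s !ReImE z2.
have s0 : s != 0.
  apply: contraTneq (lexx (0 : R)) => s0; move: Rs; rewrite s0 /= => e.
  by have : 0 < 2^-1 + k.*2%:R :> R; [rewrite ltr_pwDl ?invr_gt0|rewrite -e ltxx].
have sE : z + k.*2%:R = s by rewrite /s rmorph_nat.
have dg u : is_derive u 1 (cst (1 : R)) (cst 0 u) by exact: is_derive_cst.
have cg : continuous (cst (0 : R) : R -> R) by exact: cst_continuous.
pose K := B + normc s * B; have B0 := half_decay_ge0 R.
have k0 u : 0 <= (1 + u ^+ 2)^-1 by rewrite invr_ge0 ltW// oneDsqr_gt0.
have ns := normc_ge0 s.
have eB u : u <= 0 -> expR (u * complex.Re s) <= B * (1 + u ^+ 2)^-1.
  move=> u0; apply: le_trans (half_decay u); rewrite ler_expR Rs (ler0_norm u0).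
  have : u * k.*2%:R <= 0 by rewrite mulr_le0_ge0// ler0n.
  lra.
have := @exp_FTC_half _ (cst 1) (cst 0) s dg cg K.
have dP u : u <= 0 -> normc (exp_prim (cst 1) s u) <= K * (1 + u ^+ 2)^-1.
  move=> /eB h; rewrite /exp_prim /cst mul1r normc_cexp_real; apply: le_trans h _.
  by rewrite ler_wpM2r// lerDl mulr_ge0.
have dD u : u <= 0 -> normc (exp_deriv (cst 1) (cst 0) s u) <= K * (1 + u ^+ 2)^-1.
  move=> /eB h; rewrite /exp_deriv /cst add0r mulr1 normcM normc_cexp_real.
  have := ler_wpM2l ns h; have := mulr_ge0 B0 (k0 u); rewrite /K; lra.
move=> /(_ dP dD); rewrite /cst => e.
have ig : cintegrable leb setT (fun u => (1 - heaviside u)%:C * cexp (u%:C * s)).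
  apply: (@cintegrable_decays _ B).
    apply: cmeasM; last exact: cmeas_cexp.
    by apply: cmeas_real; apply: measurable_funB => //; exact: measurable_heaviside.
  move=> u; rewrite normcM normc_real normc_cexp_real; have [u0|u0] := leP 0 u.
    by rewrite heaviside_nneg// subrr normr0 mul0r mulr_ge0.
  by rewrite heaviside_neg// subr0 normr1 mul1r eB// ltW.
have E u : (1 - heaviside u)%:C * ((expR u ^+ k.*2)%:C * cexp (u%:C * z)) =
    (1 - heaviside u)%:C * cexp (u%:C * s).
  rewrite -expRM_natl -cexp_real -cexpD; congr (_ * cexp _).
  by rewrite /s rmorphM/=; ring.
split; first by apply: eq_cintegrable ig => // u _; rewrite E.
apply: (mulfI s0); rewrite sE divff// -[RHS]e.
have -> : cintegral leb setT
      (fun u => (1 - heaviside u)%:C * ((expR u ^+ k.*2)%:C * cexp (u%:C * z))) =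
    cintegral leb setT (fun u => (1 - heaviside u)%:C * cexp (u%:C * s)).
  by apply: eq_cintegral => u _; exact: E.
rewrite -(cintegralZ _ measurableT ig); apply: eq_cintegral => u _.
by rewrite /exp_deriv; ring.
Qed.

End PartialFractionExpansion.

Section PoleRemainder.
Variable R : realType.
Local Notation RR := (measurableTypeR R).
Local Notation leb := (@lebesgue_measure R).
Local Notation B := (half_decay_cst R).
Implicit Types (u v x y M : R) (s z w : R[i]) (b : R -> R).
Local Notation half := ((2^-1 : R)%:C : R[i]).

Definition rho_line y : R[i] := rho_infty (critical_line y).

Definition holo_part z : R[i] := (1 - z) / pi%:C * laplace (@osc_right R) (z - half).

Definition holo_line y : R[i] := holo_part (critical_line y).

(** The poles of Gamma (z / 2). The residues of rho_infty there are the Taylor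
    coefficients of 2 cos (2 pi t). *)
Definition rho_pole (k : nat) : R[i] := - k.*2%:R.
Definition rho_residue (k : nat) : R[i] := (2 * cos_coeff' (2 * pi) k)%:C.

Definition cos_exp_remainder n u : R := 2 * cos_remainder n (2 * pi * expR u).

Definition remainder_bound n : R := 4 * expR (4 * pi) / 4 ^+ n.

Lemma rho_pole_left k : complex.Re (rho_pole k) < 2^-1.
Proof.
rewrite /rho_pole -(rmorph_nat (real_complex R)) !ReImE /=.
by apply: (@le_lt_trans _ _ 0); rewrite ?invr_gt0// oppr_le0.
Qed.

Lemma kap_rho_pole k y : kap (rho_pole k) y = (critical_line y + k.*2%:R)^-1.
Proof. by rewrite /kap /rho_pole opprK. Qed.

Lemma cos_coeff'_exp u k :
  cos_coeff' (2 * pi * expR u) k = cos_coeff' (2 * pi) k * expR u ^+ k.*2.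
Proof. by rewrite /cos_coeff' exprMn mulrA [in RHS]mulrAC. Qed.

Lemma cos_exp_remainderS n u : cos_exp_remainder n.+1 u =
  cos_exp_remainder n u - 2 * cos_coeff' (2 * pi) n * expR u ^+ n.*2.
Proof.
by rewrite /cos_exp_remainder /cos_remainder big_ord_recr/= cos_coeff'_exp; ring.
Qed.

Lemma measurable_cos_exp_remainder n :
  measurable_fun (setT : set RR) (cos_exp_remainder n).
Proof.
elim: n => [|n IH].
  apply: continuous_measurable_fun.
  have -> : cos_exp_remainder 0 = @cos_exp R.
    by apply/funext => u; rewrite /cos_exp_remainder /cos_remainder big_ord0 subr0.
  exact: continuous_cos_exp.
have -> : cos_exp_remainder n.+1 = (fun u =>
    cos_exp_remainder n u - 2 * cos_coeff' (2 * pi) n * expR u ^+ n.*2).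
  by apply/funext => u; exact: cos_exp_remainderS.
apply: measurable_funB => //; apply: measurable_funM => //.
by apply: measurable_funX; exact: measurable_expR_line.
Qed.

Lemma remainder_bound_ge0 n : 0 <= remainder_bound n.
Proof. by rewrite /remainder_bound divr_ge0 ?exprn_ge0// mulr_ge0// expR_ge0. Qed.

Lemma cos_exp_remainder_le n u : u <= 0 -> `|cos_exp_remainder n u| <= remainder_bound n.
Proof.
move=> u0; have p0 : 0 <= 2 * pi * expR u by rewrite !mulr_ge0 ?pi_ge0 ?expR_ge0.
rewrite /cos_exp_remainder normrM (@ger0_norm _ 2)//.
apply: le_trans (ler_wpM2l (ler0n _ 2) (cos_remainder_le n p0)) _.
have i4 : 0 <= (4 ^+ n)^-1 :> R by rewrite invr_ge0 exprn_ge0.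
have : expR (2 * (2 * pi * expR u)) <= expR (4 * pi).
  rewrite ler_expR; have : expR u <= 1 by rewrite expR_le1.
  by move=> /(ler_wpM2l (pi_ge0 R)); lra.
by move=> /(ler_wpM2r i4); rewrite /remainder_bound; lra.
Qed.

(** Removing a term of the Taylor polynomial of the cosine removes a simple
    fraction. *)
Lemma pole_remainder_laplace n y :
  pole_remainder rho_line holo_line rho_residue rho_pole n y =
  laplace (cut_left (cos_exp_remainder n)) (critical_line y - half).
Proof.
set z := critical_line y; have z2 : complex.Re z = 2^-1 by [].
have zh : complex.Re (z - half) = 0 by rewrite Re_sub_half z2 subrr.
have il m := laplace_integrable (measurable_cut_left (measurable_cos_exp_remainder m))
  (remainder_bound_ge0 m) (cut_left_le (remainder_bound_ge0 m) (@cos_exp_remainder_le m))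
  (damped_line (cut_left (cos_exp_remainder m)) zh).
elim: n => [|n IH].
  rewrite /pole_remainder big_ord0 subr0 /rho_line rho_decomposition//.
  rewrite /holo_line /holo_part -/z addrC addKr; congr (laplace (cut_left _) _).
  by apply/funext => u; rewrite /cos_exp_remainder /cos_remainder big_ord0 subr0.
have -> : pole_remainder rho_line holo_line rho_residue rho_pole n.+1 y =
    pole_remainder rho_line holo_line rho_residue rho_pole n y -
    rho_residue n * kap (rho_pole n) y.
  by rewrite /pole_remainder big_ord_recr/=; ring.
have [ip ep] := simple_pole n z2; rewrite IH kap_rho_pole -/z -ep /rho_residue.
have e u : (cut_left (cos_exp_remainder n.+1) u)%:C * cexp (u%:C * (z - half)) =
    (cut_left (cos_exp_remainder n) u)%:C * cexp (u%:C * (z - half)) -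
    (2 * cos_coeff' (2 * pi) n)%:C *
      ((1 - heaviside u)%:C * ((expR u ^+ n.*2)%:C * cexp (u%:C * z))).
  have eb : (cos_exp_remainder n.+1 u)%:C = (cos_exp_remainder n u)%:C -
      (2 * cos_coeff' (2 * pi) n)%:C * (expR u ^+ n.*2)%:C :> R[i].
    by rewrite cos_exp_remainderS rmorphB; congr (_ - _); exact: rmorphM.
  by rewrite !cut_leftE eb; ring.
rewrite /laplace -(cintegralZ _ measurableT ip).
rewrite -(cintegralB measurableT (il n) (cintegrableZ _ measurableT ip)).
by apply: eq_cintegral => u _; rewrite e.
Qed.

Lemma pole_remainder_le n y :
  normc (pole_remainder rho_line holo_line rho_residue rho_pole n y) <=
  remainder_bound n * B * pi.
Proof.
rewrite pole_remainder_laplace; apply: normc_laplace.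
- by apply: measurable_cut_left; exact: measurable_cos_exp_remainder.
- exact: remainder_bound_ge0.
- apply: cut_left_le; first exact: remainder_bound_ge0.
  exact: cos_exp_remainder_le.
- by apply: damped_line; rewrite Re_sub_half subrr.
Qed.

End PoleRemainder.

(** * The holomorphic part *)

Section HolomorphicPart.
Variable R : realType.
Local Notation RR := (measurableTypeR R).
Local Notation leb := (@lebesgue_measure R).
Local Notation N2 f := (Num.sqrt (sqnorm leb f)).
Local Notation B := (half_decay_cst R).
Implicit Types (u v x y M : R) (s z w : R[i]) (f g : R -> R[i]).
Local Notation half := ((2^-1 : R)%:C : R[i]).

Lemma hardy_fun_closed f : square_integrable leb f ->
  (forall e : R, 0 < e -> exists2 g, hardy_fun g & N2 (fun y => f y - g y) < e) ->
  hardy_fun f.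
Proof.
move=> sf H; have [_ _ cl] := @H2_closed R.
have cF := L2_classK sf.
suff : H2 (L2_class leb f).
  by move=> /H2_hardy; apply: hardy_fun_ae => //.
apply: cl => e /H[g hg fg]; have [sg _ _] := hg; have cG := L2_classK sg.
exists (L2_class leb g).
  apply/H2_hardy; apply: hardy_fun_ae hg; first exact: L2_reprP.
  by apply: ae_mono cG => y ->.
rewrite nrm_sub_sqnorm; move: fg; congr (Num.sqrt _ < e); apply: ae_eq_sqnorm.
- by apply: cmeasB; [exact: sf.1|exact: sg.1].
- by apply: cmeasB; exact: (L2_reprP _).1.
- by apply: ae_mono (ae_and cF cG) => y /= [-> ->].
Qed.

(** Dominated convergence. The weight is the squared modulus of (z - 1/2) / (z
    - c), c = n + 3/2, on the critical line. *)
Lemma vanishing_weight f (e : R) : square_integrable leb f -> 0 < e ->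
  exists n : nat, Rintegral leb setT
    (fun y => normc (f y) ^+ 2 * (y ^+ 2 / (n.+1%:R ^+ 2 + y ^+ 2))) <= e.
Proof.
move=> sf e0; have iF := square_integrable_sqr sf.
pose w n y : R := y ^+ 2 / (n.+1%:R ^+ 2 + y ^+ 2).
have D0 n y : 0 < n.+1%:R ^+ 2 + y ^+ 2 :> R by rewrite ltr_pwDl ?sqr_ge0// exprn_gt0.
have w0 n y : 0 <= w n y by rewrite divr_ge0 ?sqr_ge0// ltW.
have w1 n y : w n y <= 1 by rewrite ler_pdivrMr// mul1r lerDr sqr_ge0.
have wn n y : w n y <= y ^+ 2 / n.+1%:R.
  rewrite ler_wpM2l ?sqr_ge0// lef_pV2 ?posrE//; apply: (@le_trans _ _ (n.+1%:R ^+ 2)).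
    by rewrite expr2 ler_peMr// ler1n.
  by rewrite lerDl sqr_ge0.
have cw n : continuous (w n).
  move=> y; apply: cvgM; first exact: exprn_continuous.
  apply: cvgV; first by rewrite gt_eqF.
  by apply: cvgD; [exact: cvg_cst|exact: exprn_continuous].
have mF : measurable_fun (setT : set RR) (fun y => normc (f y) ^+ 2).
  by apply: measurable_funX; apply: cmeas_normc; exact: sf.1.
pose f_ n (y : RR) := (normc (f y) ^+ 2 * w n y)%:E.
have F0 y : 0 <= normc (f y) ^+ 2 by rewrite exprn_ge0// normc_ge0.
have mf_ n : measurable_fun (setT : set RR) (f_ n).
  apply/measurable_EFinP; apply: measurable_funM => //.
  exact: continuous_measurable_fun.
have cv (y : RR) : (setT : set RR) y -> f_ ^~ y @ \oo --> (cst 0%E : RR -> \bar R) y.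
  move=> _; apply/fine_cvgP; split; first by apply: nearW => n.
  apply/cvgrPdist_le => d d0 /=.
  pose A := normc (f y) ^+ 2 * y ^+ 2; have A0 : 0 <= A by exact: mulr_ge0 (F0 y) (sqr_ge0 y).
  exists (Num.truncn (A / d)).+1 => // n /= nN.
  rewrite sub0r normrN (ger0_norm (mulr_ge0 (F0 y) (w0 n y))).
  apply: (@le_trans _ _ (A / n.+1%:R)).
    by rewrite /A -mulrA ler_wpM2l.
  rewrite ler_pdivrMr// mulrC -ler_pdivrMr//.
  apply: ltW; apply: lt_le_trans (truncnS_gt _) _; rewrite ler_nat; exact: leqW.
have dom : forall (y : RR) n, (setT : set RR) y -> (`|f_ n y| <= (normc (f y) ^+ 2)%:E)%E.
  move=> y n _; rewrite /f_ abse_EFin lee_fin (ger0_norm (mulr_ge0 (F0 y) (w0 n y))).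
  by rewrite ler_piMr.
have [_ _] := dominated_convergence measurableT mf_ (measurable_cst _) (aeW _ cv) iF (aeW _ dom).
rewrite integral0 => /fine_cvgP[_ /cvgrPdist_le/(_ e e0)[N _ HN]].
exists N; have := HN N (leqnn _); rewrite sub0r normrN /=.
exact: le_trans (ler_norm _).
Qed.

Let I z := laplace (@osc_right R) (z - half).

Let I_le x y : x <= 2^-1 -> normc (I (x +i* y)) <= 1 * B * pi.
Proof.
move=> x2; apply: (normc_laplace (@measurable_osc_right R) ler01 (@osc_right_le R)).
by apply: damped_right; rewrite Re_sub_half subr_le0.
Qed.

Let I_lip x y : x < 2^-1 ->
  normc (I (x +i* y) - I (2^-1 +i* y)) <= 1 * (2 * B) * pi * (2^-1 - x).
Proof.
move=> x2; have d1 : damped (@osc_right R) ((x +i* y) - half).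
  by apply: damped_right; rewrite Re_sub_half subr_le0 ltW.
have d2 : damped (@osc_right R) ((2^-1 +i* y) - half).
  by apply: damped_right; rewrite Re_sub_half subrr.
apply: le_trans (laplace_lipschitz (@measurable_osc_right R) ler01 (@osc_right_le R) d1 d2) _.
rewrite (_ : (x +i* y) - half - ((2^-1 +i* y) - half) = (x - 2^-1)%:C); last first.
  by apply: complex_ext; rewrite !ReImE /=; ring.
by rewrite normc_real distrC ger0_norm// subr_ge0 ltW.
Qed.

Let I_cdiff z : complex.Re z < 2^-1 -> cdiff I z.
Proof.
move=> z2; apply: (@cdiff_comp _ (laplace (@osc_right R)) (fun w => w - half)).
  by apply: cdiffB; [apply/cderivP; exact: cderiv_id|exact: cdiff_cst].
apply: (laplace_cdiff (@measurable_osc_right R) ler01 (@osc_right_le R)).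
  by move=> u u0; rewrite /osc_right heaviside_neg// !mul0r.
by rewrite Re_sub_half subr_lt0.
Qed.

Lemma rcont_laplace_line (c : R -> R) M : measurable_fun (setT : set RR) c -> 0 <= M ->
  (forall u, `|c u| <= M * expR (- (2^-1 * `|u|))) ->
  forall y, rcont (fun y => laplace c (critical_line y - half)) y.
Proof.
move=> mc M0 cM y e e0; pose K := M * (2 * B) * pi.
have K0 : 0 <= K.
  by apply: mulr_ge0 (pi_ge0 _); apply: mulr_ge0 => //; apply: mulr_ge0 => //; exact: half_decay_ge0.
have dl t : damped c (critical_line t - half) by apply: damped_line; rewrite Re_sub_half subrr.
exists (e / (K + 1)); first by rewrite divr_gt0// ltr_wpDl.
move=> t; rewrite ltr_pdivlMr ?ltr_wpDl// => /ltW ty.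
apply: le_trans (laplace_lipschitz mc M0 cM (dl t) (dl y)) _.
have -> : critical_line t - half - (critical_line y - half) = 'i%C * (t - y)%:C.
  by apply: complex_ext; rewrite !ReImE /=; ring.
rewrite normcM normc_real normc_i mul1r -/K; apply: le_trans ty.
by rewrite mulrC ler_wpM2l// lerDl.
Qed.

Let cmeas_I : cmeas (setT : set RR) (on_line I 2^-1).
Proof.
apply: rcont_cmeas => y.
exact: (rcont_laplace_line (@measurable_osc_right R) ler01 (@osc_right_le R)).
Qed.

Lemma cmeas_critical_line : cmeas (setT : set RR) (@critical_line R).
Proof. by split => //=; exact: measurable_cst. Qed.

Lemma cmeas_holo_line : cmeas (setT : set RR) (@holo_line R).
Proof.
apply: cmeasM; last exact: cmeas_I.
apply: cmeasM; last exact: cmeas_cst.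
by apply: cmeasB; [exact: cmeas_cst|exact: cmeas_critical_line].
Qed.

Lemma rho_line_eq y : rho_line y = holo_line y +
  laplace (cut_left (@cos_exp R)) (critical_line y - half).
Proof. exact: rho_decomposition. Qed.

Let cos_exp_le u : u <= 0 -> `|cos_exp u| <= 2.
Proof.
by move=> _; rewrite /cos_exp normrM ger0_norm// ler_piMr// ler_norml cos_geN1 cos_le1.
Qed.

Let mcos : measurable_fun (setT : set RR) (@cos_exp R).
Proof. by apply: continuous_measurable_fun; exact: continuous_cos_exp. Qed.

Lemma cmeas_rho_line : cmeas (setT : set RR) (@rho_line R).
Proof.
have -> : @rho_line R = fun y => holo_line y +
    laplace (cut_left (@cos_exp R)) (critical_line y - half).
  by apply/funext => y; exact: rho_line_eq.
apply: cmeasD; first exact: cmeas_holo_line.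
apply: rcont_cmeas => y; apply: (rcont_laplace_line (measurable_cut_left mcos) (ler0n _ 2)).
exact: cut_left_le (ler0n _ 2) cos_exp_le.
Qed.

Lemma holo_line_bounded : bounded_symbol (@holo_line R) (1 + 2 * B * pi).
Proof.
have b0 : 0 <= 2 * B * pi.
  by apply: mulr_ge0 (pi_ge0 _); apply: mulr_ge0 => //; exact: half_decay_ge0.
split; [exact: cmeas_holo_line|exact: addr_ge0|].
move=> y; have -> : holo_line y = rho_line y -
    laplace (cut_left (@cos_exp R)) (critical_line y - half) by rewrite rho_line_eq addrK.
apply: le_trans (le_normcD _ _) _; rewrite normcN /rho_line normc_rho lerD2l.
apply: (normc_laplace (measurable_cut_left mcos) (ler0n _ 2) (cut_left_le (ler0n _ 2) cos_exp_le)).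
by apply: damped_line; rewrite Re_sub_half subrr.
Qed.

(** The functions r h f / (c - z) with r = c - 1/2 belong to the Hardy space,
    because (1 - z) / (c - z) is bounded in the half plane, and they converge
    to h f as r tends to infinity: on the line they differ from h f by the
    product of h f and (z - 1/2) / (z - c). *)
Lemma holo_line_hardy f : hardy_fun f -> hardy_fun (fun y => holo_line y * f y).
Proof.
move=> hf; have [sf _ _] := hf; have [mh M0 hM] := holo_line_bounded.
set Mh := 1 + _ in M0 hM.
have shf : square_integrable leb (fun y => holo_line y * f y).
  exact: (square_integrableM_bounded mh hM sf).
apply: hardy_fun_closed => // e e0.
have M1 : 0 < Mh + 1 by rewrite ltr_wpDl.
have e2 : 0 < (e / (Mh + 1)) ^+ 2 by rewrite exprn_gt0// divr_gt0.
have [n Hn] := vanishing_weight sf e2.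
pose r : R := n.+1%:R; have r0 : 0 < r by [].
pose c : R[i] := (r + 2^-1)%:C.
have c2 : 2^-1 < complex.Re c by rewrite /= ltrDr.
have hc : complex.Re c != 2^-1 by rewrite gt_eqF.
have far x : x <= 2^-1 -> r <= `|x - complex.Re c|.
  by move=> x2; rewrite distrC ler_normr; apply/orP; left; rewrite /=; lra.
have nx x : x <= 2^-1 -> x != complex.Re c.
  by move=> x2; rewrite lt_eqF//; apply: le_lt_trans c2.
(* (1 - z) / (c - z) is 1 + (c - 1) / (z - c): the two terms are multipliers
   *)
have P1 := hardy_pair_multiplier (hardy_fun_pair hf) I_cdiff cmeas_I I_le I_lip.
pose H z : R[i] := (z - c)^-1.
have dH z : complex.Re z < 2^-1 -> cdiff H z.
  by move=> z2; apply: cdiff_inv; apply: contraTneq z2 => ->; rewrite -leNgt ltW.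
have mH : cmeas (setT : set RR) (on_line H 2^-1) by exact: cmeas_kap.
have HM x y : x <= 2^-1 -> normc (H (x +i* y)) <= r^-1.
  by move=> x2; apply: normc_vertical_inv_le => //; exact: far.
have HL x y : x < 2^-1 -> normc (H (x +i* y) - H (2^-1 +i* y)) <= r^-1 * r^-1 * (2^-1 - x).
  move=> x2; rewrite /H (vertical_inv_diff y (nx _ (ltW x2)) (nx _ (lexx _))) normcM normc_real.
  rewrite gtr0_norm ?subr_gt0// mulrC ler_wpM2r ?subr_ge0 ?(ltW x2)//.
  by rewrite normcM; apply: ler_pM; rewrite ?normc_ge0//; apply: HM => //; exact: ltW.
have P2 := hardy_pair_multiplier P1 dH mH HM HL.
have P3 := hardy_pair_lin (c - 1) P1 P2.
have P4 := hardy_pair_lin ((r / pi)%:C) (hardy_fun_pair (@hardy_fun0 R)) P3.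
have hg := hardy_pair_fun P4; set g := fun y => _ in hg.
exists g => //.
have pi0 : (pi%:C : R[i]) != 0 by rewrite eq_complex/= negb_and gt_eqF// pi_gt0.
have gE y : holo_line y * f y - g y =
    holo_line y * ((0 +i* y) * kap c y * f y).
  rewrite /g /holo_line /holo_part -/(I (critical_line y)) /on_line -/(kap c y).
  set i := I _; rewrite add0r rmorphM fmorphV/=.
  have zc : (2^-1 +i* y) - c != 0 by apply: vertical_neq; rewrite eq_sym.
  have kz : kap c y * ((2^-1 +i* y) - c) = 1 by rewrite /kap mulVf.
  have z1 : 1 - critical_line y = (1 - c) - ((2^-1 +i* y) - c).
    by apply: complex_ext; rewrite !ReImE /=; ring.
  have yE : 0 +i* y = ((2^-1 +i* y) - c) + r%:C.
    by apply: complex_ext; rewrite !ReImE /=; field.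
  rewrite z1 yE /kap /H; move: (_ - c) zc => D D0 {kz z1 yE}.
  by move: (pi%:C) pi0 (f y) (r%:C) i (c) => p p0 a q i k; field; rewrite D0 p0.
have k0 : 0 <= Mh * (e / (Mh + 1)) by rewrite mulr_ge0// divr_ge0// ltW.
have skf := square_integrableM_kap sf hc.
pose q y : R[i] := (0 +i* y) * kap c y.
have q1 y : normc (q y) ^+ 2 = y ^+ 2 / (r ^+ 2 + y ^+ 2).
  rewrite /q normcM exprMn normc_vertical_inv normc_sqr /= expr0n add0r subr0.
  by rewrite (_ : (2^-1 - (r + 2^-1)) ^+ 2 = r ^+ 2)//; ring.
have q2 y : normc (q y) <= 1.
  rewrite -ler_sqr ?nnegrE ?normc_ge0// q1 expr1n.
  by rewrite ler_pdivrMr ?ltr_pwDl ?exprn_gt0 ?sqr_ge0// mul1r lerDr sqr_ge0.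
have mq : cmeas (setT : set RR) q.
  apply: cmeasM; last exact: cmeas_kap.
  by split => //=; exact: measurable_cst.
have sq := square_integrableM_bounded mq q2 sf.
have shq := square_integrableM_bounded mh hM sq.
have -> : (fun y => holo_line y * f y - g y) = (fun y => holo_line y * (q y * f y)).
  by apply/funext => y; exact: gE.
have le1 : sqnorm leb (fun y => holo_line y * (q y * f y)) <=
    Mh ^+ 2 * sqnorm leb (fun y => q y * f y).
  by apply: le_sqnorm => // y; rewrite normcM ler_wpM2r ?normc_ge0.
have le2 : sqnorm leb (fun y => q y * f y) <= (e / (Mh + 1)) ^+ 2.
  apply: le_trans Hn; rewrite /sqnorm le_eqVlt; apply/orP; left; apply/eqP.
  by apply: eq_Rintegral => y _; rewrite normcM exprMn q1 mulrC.
apply: (@le_lt_trans _ _ (Mh * (e / (Mh + 1)))).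
  rewrite -[leRHS](ger0_norm k0) -sqrtr_sqr; apply: ler_wsqrtr; apply: le_trans le1 _.
  by rewrite exprMn ler_wpM2l// sqr_ge0.
rewrite mulrA ltr_pdivrMr// mulrC ltr_pM2l// ltrDl.
exact: ltr01.
Qed.

End HolomorphicPart.

(** * Conclusion *)

Section InfiniteOrder.
Variable R : realType.
Local Notation B := (half_decay_cst R).

Definition rho_eps n : R := remainder_bound R n * B * pi.

Lemma rho_epsE n : rho_eps n = rho_eps 0 / 4 ^+ n.
Proof. by rewrite /rho_eps /remainder_bound expr0 divr1; ring. Qed.

Lemma rho_eps_ge0 n : 0 <= rho_eps n.
Proof.
apply: mulr_ge0 (pi_ge0 _); apply: mulr_ge0; last exact: half_decay_ge0.
exact: remainder_bound_ge0.
Qed.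

(** One term of the exponential series at n ln 4. *)
Lemma exprn_le_geometric (m : nat) : exists2 C : R, 0 < C &
  forall n : nat, n%:R ^+ m <= C * 4 ^+ n.
Proof.
have l0 : 0 < ln 4 :> R by rewrite ln_gt0// ltr1n.
exists (m`!%:R / ln 4 ^+ m); first by rewrite divr_gt0 ?exprn_gt0// ltr0n fact_gt0.
move=> n; have p0 : 0 <= n%:R * ln 4 :> R by rewrite mulr_ge0// ltW.
have := expR_ge_coeff m p0; rewrite expRM_natl lnK ?posrE// => h.
rewrite mulrAC ler_pdivlMr ?exprn_gt0// -exprMn.
by move: h; rewrite ler_pdivrMr ?ltr0n ?fact_gt0// [_ * m`!%:R]mulrC.
Qed.

Lemma rho_eps_small (e : R) : 0 < e -> exists n, rho_eps n <= e.
Proof.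
move=> e0; have [C C0 H] := exprn_le_geometric 1.
pose n := (Num.truncn (rho_eps 0 * C / e)).+1; exists n.
rewrite rho_epsE ler_pdivrMr ?exprn_gt0//.
have nN : rho_eps 0 * C / e <= n%:R by apply/ltW/truncnS_gt.
have := le_trans nN (H n); rewrite ler_pdivrMr// => h.
rewrite -(ler_pM2r C0); apply: le_trans h _.
by rewrite [_ * e]mulrC [C * _]mulrC mulrA.
Qed.

Lemma geometric_bigO (s : nat -> R) : (forall n, 0 <= s n <= rho_eps n) ->
  forall N : R, 0 < N -> (s : nat -> R^o) =O_\oo (fun n => (n%:R : R) `^ (- N) : R^o).
Proof.
move=> hs N N0; pose m := (Num.truncn N).+1.
have Nm : N <= m%:R by apply/ltW/truncnS_gt.
have [C C0 H] := exprn_le_geometric m.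
apply/eqO_exP; exists (rho_eps 0 * C + 1); first by rewrite ltr_wpDl// mulr_ge0 ?rho_eps_ge0// ltW.
exists 1%N => // n /= n1; have [s0 sn] := andP (hs n).
have n1' : 1 <= n%:R :> R by rewrite ler1n.
rewrite (ger0_norm s0) (ger0_norm (powR_ge0 _ _)); apply: le_trans sn _.
rewrite rho_epsE powRN -/(_ / _) ler_pdivlMr ?powR_gt0 ?(lt_le_trans ltr01)//.
rewrite mulrAC ler_pdivrMr ?exprn_gt0//.
have h : n%:R `^ N <= C * 4 ^+ n.
  by apply: le_trans (H n); rewrite -powR_mulrn// ler_powR.
apply: le_trans (ler_wpM2l (rho_eps_ge0 0) h) _; rewrite mulrA ler_wpM2r ?exprn_ge0//.
by rewrite lerDl.
Qed.

End InfiniteOrder.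

Theorem theorem2p1 (R : realType) :
  quasi_inner (@rho_infty R) /\
  infinitesimal_infinite_order (Hankel_op (@rho_infty R)).
Proof.
have bu : bounded_symbol (@rho_line R) 1.
  by split; [exact: cmeas_rho_line|exact: ler01|move=> y; rewrite /rho_line normc_rho].
have bh := holo_line_bounded R; have hh := @holo_line_hardy R.
have ha := @rho_pole_left R; have er := @pole_remainder_le R.
have K : compact_op (Hankel_op (@rho_infty R)).
  exact: (partial_fraction_compact bu bh hh ha er (@rho_eps_small R)).
split; split => //.
- split; first exact: cmeas_rho_line.
  by apply: aeW => y; exact: normc_rho.
- apply: geometric_bigO => n.
  exact: (partial_fraction_singular_value bu bh hh ha er n).
Qed.
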